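(* Let $T$ be a Fourier integral operator of type I with a tame phase $\Phi$ and a symbol $\sigma\in S^s_w=M^{\infty,\infty}_{1\otimes v_s}(\mathbb{R}^{2d})$, with $s>2d$. If $T$ is invertible on $L^2(\mathbb{R}^d)$, then $T^{-1}$ is a Fourier integral operator of type II with the same phase $\Phi$ and a symbol $\tau\in S^s_w$.
   Context: Notation: $\langle z\rangle=(1+|z|^2)^{1/2}$. On $\mathbb{R}^n$, for $z=(x,\eta)\in\mathbb{R}^{2n}$, $\pi(z)f(t)=e^{2\pi i t\cdot\eta}f(t-x)$; $\langle f,g\rangle$ extends the $L^2$ inner product $\int f\overline{g}$ to $\mathcal{S}'\times\mathcal{S}$; $V_gf(z)=\langle f,\pi(z)g\rangle$. Fourier transform: $\hat f(\eta)=\int f(t)e^{-2\pi i t\cdot\eta}dt$. Symbol class: for fixed $\Psi\in\mathcal{S}(\mathbb{R}^{2d})\setminus\{0\}$, $S^s_w=M^{\infty,\infty}_{1\otimes v_s}(\mathbb{R}^{2d})$ consists of all $\sigma\in\mathcal{S}'(\mathbb{R}^{2d})$ with $\sup_{z,\zeta\in\mathbb{R}^{2d}}|V_\Psi\sigma(z,\zeta)|\langle\zeta\rangle^s<\infty$ (independent of $\Psi$). Tame phase: a real function $\Phi$ on $\mathbb{R}^{2d}$ such that (A1) $\Phi\in C^\infty(\mathbb{R}^{2d})$; (A2) $|\partial_z^\alpha\Phi(z)|\le C_\alpha$ for all $z\in\mathbb{R}^{2d}$ and $|\alpha|\ge2$; (A3) there is $\delta>0$ with $|\det\partial^2_{x,\eta}\Phi(x,\eta)|\ge\delta$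 for all $(x,\eta)\in\mathbb{R}^{2d}$. FIO of type I with phase $\Phi$ and symbol $\sigma$: $T_{I,\Phi,\sigma}f(x)=\int_{\mathbb{R}^d}e^{2\pi i\Phi(x,\eta)}\sigma(x,\eta)\hat f(\eta)\,d\eta$, understood weakly: $\langle T_{I,\Phi,\sigma}f,h\rangle=\langle\sigma,e^{-2\pi i\Phi(x,\eta)}h(x)\overline{\hat f(\eta)}\rangle$ for $f,h\in\mathcal{S}(\mathbb{R}^d)$. FIO of type II with phase $\Phi$ and symbol $\tau$: $T_{II,\Phi,\tau}f(x)=\int_{\mathbb{R}^{2d}}e^{-2\pi i[\Phi(y,\eta)-x\cdot\eta]}\tau(y,\eta)f(y)\,dy\,d\eta$, understood weakly: $\langle T_{II,\Phi,\tau}f,h\rangle=\langle\tau,e^{2\pi i\Phi(y,\eta)}\overline{f(y)}\hat h(\eta)\rangle$ for $f,h\in\mathcal{S}(\mathbb{R}^d)$. For $s>2d$ a FIO of type I with tame phase and symbol in $S^s_w$ extends to a bounded operator on $L^2(\mathbb{R}^d)$; invertibility refers to this extension. *)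

(* Defs.v *)
From HB Require Import structures.
From mathcomp Require Import all_boot all_order all_algebra.
From mathcomp Require Import complex.
From mathcomp Require Import all_classical all_reals all_analysis.

Set Implicit Arguments.
Unset Strict Implicit.
Unset Printing Implicit Defensive.

Import Order.TTheory GRing.Theory Num.Theory.
Import numFieldNormedType.Exports.

Local Open Scope classical_set_scope.
Local Open Scope ring_scope.

Definition rV_display : measure_display. Proof. exact. Qed.

Section rV_measurable.
Variables (R : realType) (n : nat).

Definition rV_coord (i : 'I_n) (x : 'rV[R]_n) : R := x ord0 i.

Let rV_set0 : g_sigma_preimage rV_coord set0.
Proof. exact: sigma_algebra0. Qed.

Let rV_setC A : g_sigma_preimage rV_coord A -> g_sigma_preimage rV_coord (~` A).
Proof. exact: sigma_algebraC. Qed.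

Let rV_bigcup (F : _^nat) : (forall i, g_sigma_preimage rV_coord (F i)) ->
  g_sigma_preimage rV_coord (\bigcup_i (F i)).
Proof. exact: sigma_algebra_bigcup. Qed.

(* The Borel sigma-algebra of R^n, as the one generated by the coordinates. *)
HB.instance Definition _ := @isMeasurable.Build rV_display 'rV[R]_n
  (g_sigma_preimage rV_coord) rV_set0 rV_setC rV_bigcup.

End rV_measurable.

Section rV_measurable_theory.
Variable R : realType.

Lemma measurable_rV_coord n (i : 'I_n) :
  measurable_fun [set: 'rV[R]_n] (rV_coord i).
Proof.
move=> _ Y mY; rewrite setTI; apply: sub_sigma_algebra => /=.
rewrite -bigcup_seq/=; exists i => /=; first by rewrite mem_index_enum.
by exists Y => //; rewrite setTI.
Qed.

Lemma measurable_fun_rVP d (T : measurableType d) n (f : T -> 'rV[R]_n) :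
  (forall i, measurable_fun [set: T] (rV_coord i \o f)) ->
  measurable_fun [set: T] f.
Proof.
move=> mf; have sub : g_sigma_preimage (fun i => rV_coord i \o f) `<=` measurable.
  apply: smallest_sub; first exact: sigma_algebra_measurable.
  rewrite -bigcup_seq/=; apply: bigcup_sub => i _ A [B mB <-].
  exact: mf.
move: sub; rewrite g_sigma_preimage_comp => sub _ A mA.
by apply: sub; exists A.
Qed.

Definition rV_cons n (p : R * 'rV[R]_n) : 'rV[R]_n.+1 :=
  row_mx (const_mx p.1 : 'rV_1) p.2.

Definition rV_uncons n (x : 'rV[R]_n.+1) : R * 'rV[R]_n :=
  (x ord0 ord0, rsubmx (x : 'rV_(1 + n))).

Lemma rV_consK n : cancel (@rV_cons n) (@rV_uncons n).
Proof.
move=> [a v]; rewrite /rV_uncons /rV_cons row_mxKr; congr pair => /=.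
have -> : (ord0 : 'I_n.+1) = lshift n (ord0 : 'I_1) by exact/val_inj.
transitivity ((const_mx a : 'rV[R]_1) ord0 ord0); last by rewrite mxE.
exact: row_mxEl.
Qed.

Lemma measurable_rV_cons n : measurable_fun setT (@rV_cons n).
Proof.
apply: measurable_fun_rVP => i.
case: (split_ordP (i : 'I_(1 + n))) => j ->.
  rewrite (_ : _ \o _ = fst)//; apply/funext => -[a v] /=.
  transitivity ((const_mx a : 'rV[R]_1) ord0 j); last by rewrite mxE.
  exact: row_mxEl.
rewrite (_ : _ \o _ = rV_coord j \o snd).
  by apply: measurableT_comp => //; exact: measurable_rV_coord.
by apply/funext => -[a v]; exact: row_mxEr.
Qed.

Lemma measurable_rV_uncons n : measurable_fun setT (@rV_uncons n).
Proof.
apply: (@measurable_fun_pair _ _ _ _ _ _ (fun x : 'rV[R]_n.+1 => x ord0 ord0)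
  (fun x : 'rV[R]_n.+1 => rsubmx (x : 'rV_(1 + n)))).
  exact: (@measurable_rV_coord n.+1 ord0).
apply: measurable_fun_rVP => i.
rewrite (_ : _ \o _ = @rV_coord R n.+1 (rshift 1 i)).
  exact: measurable_rV_coord.
by apply/funext => x /=; rewrite /rV_coord mxE.
Qed.

End rV_measurable_theory.

Section leb_step.
Variables (R : realType) (n : nat).
Variable m : {sigma_finite_measure set 'rV[R]_n -> \bar R}.

Definition leb_step : set 'rV[R]_n.+1 -> \bar R :=
  pushforward (@lebesgue_measure R \x m)%E (@rV_cons R n).

Let leb_step0 : leb_step set0 = 0%E.
Proof. by rewrite /leb_step /pushforward preimage_set0 measure0. Qed.

Let leb_step_ge0 A : (0 <= leb_step A)%E.
Proof. exact: (measure_ge0 (@lebesgue_measure R \x m)%E). Qed.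

Let leb_step_sigma_additive : semi_sigma_additive leb_step.
Proof.
move=> F mF tF mUF; rewrite /leb_step /pushforward preimage_bigcup.
apply: measure_semi_sigma_additive.
- by move=> k; rewrite -[X in measurable X]setTI; exact: measurable_rV_cons.
- apply/trivIsetP => /= i j _ _ ij; rewrite -preimage_setI.
  by move/trivIsetP : tF => /(_ _ _ _ _ ij) ->//; rewrite preimage_set0.
- by rewrite -preimage_bigcup -[X in measurable X]setTI;
    exact: measurable_rV_cons.
Qed.

HB.instance Definition _ := isMeasure.Build _ _ _ leb_step
  leb_step0 leb_step_ge0 leb_step_sigma_additive.

Let leb_step_sigma_finite : sigma_finite setT leb_step.
Proof.
have /sigma_finiteP[F [TF ndF Foo]] := sigma_finiteT (@lebesgue_measure R).
have /sigma_finiteP[G [TG ndG Goo]] := sigma_finiteT m.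
exists (fun k => @rV_uncons R n @^-1` (F k `*` G k)).
  rewrite -preimage_bigcup (_ : \bigcup_i _ = setT) ?preimage_setT//.
  rewrite -setXTT TF TG predeqE => -[x y]; split.
    by move=> [k _ []/= ? ?]; split; exists k.
  move=> [/= [i _ Fx] [j _ Gy]]; exists (maxn i j) => //; split.
    by move: x Fx; exact/subsetPset/ndF/leq_maxl.
  by move: y Gy; exact/subsetPset/ndG/leq_maxr.
move=> k; have [mF Fk] := Foo k; have [mG Gk] := Goo k; split.
  by rewrite -[X in measurable X]setTI; apply: measurable_rV_uncons => //;
    exact: measurableX.
rewrite /leb_step /pushforward -comp_preimage.
rewrite (_ : _ \o _ = id); last by apply/funext => x; exact: rV_consK.
by rewrite preimage_id product_measure1E// lte_mul_pinfty// ge0_fin_numE.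
Qed.

HB.instance Definition _ :=
  Measure_isSigmaFinite.Build _ _ _ leb_step leb_step_sigma_finite.

End leb_step.

(* Lebesgue measure on R^n, as the n-fold product of Lebesgue measure on R
   transported to row vectors. *)
Fixpoint leb (R : realType) (n : nat) :
    {sigma_finite_measure set 'rV[R]_n -> \bar R} :=
  match n with
  | 0 => dirac (0 : 'rV[R]_0)
  | n'.+1 => leb_step (leb R n')
  end.

Section complex_functions.
Variables (R : realType) (n : nat).
Local Notation C := R[i].
Local Notation V := 'rV[R]_n.
Implicit Types (f g h : V -> C) (x eta : V).

Definition cabs : C -> R := @ComplexField.Normc.normc R.

Definition expi2pi (t : R) : C := Complex (cos (2 * pi * t)) (sin (2 * pi * t)).

Definition dot (x y : V) : R := \sum_(i < n) x ord0 i * y ord0 i.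

Definition japanese (x : V) : R := Num.sqrt (1 + dot x x).

Definition cintegral f : C :=
  Complex (\int[leb R n]_x complex.Re (f x)) (\int[leb R n]_x complex.Im (f x)).

Definition fourier f : V -> C :=
  fun eta => cintegral (fun t => f t * expi2pi (- dot t eta)).

Definition tf_shift x eta g : V -> C :=
  fun t => expi2pi (dot t eta) * g (t - x).

(* A multi-index is given by the list of the directions of differentiation:
   [pderiv [:: i; j] p] is d_i (d_j p).  Its order |alpha| is the length of the
   list; on smooth functions the order of the list is immaterial. *)
Definition pderiv (a : seq 'I_n) (p : V -> R) : V -> R :=
  foldr (fun i q => 'D_(delta_mx ord0 i) q) p a.

Definition smooth (p : V -> R) : Prop := forall a : seq 'I_n,
  continuous (pderiv a p) /\
  forall i x, derivable (pderiv a p) x (delta_mx ord0 i).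

Definition csmooth f : Prop :=
  smooth (fun x => complex.Re (f x)) /\ smooth (fun x => complex.Im (f x)).

Definition cpderiv (a : seq 'I_n) f : V -> C := fun x =>
  Complex (pderiv a (fun y => complex.Re (f y)) x)
          (pderiv a (fun y => complex.Im (f y)) x).

(* The N-th Schwartz seminorm, sup of <x>^N |d^a f(x)| over x and |a| <= N, is
   at most M. *)
Definition schwartz_le (N : nat) (M : R) f : Prop :=
  forall (a : seq 'I_n) x, (size a <= N)%N ->
    japanese x ^+ N * cabs (cpderiv a f x) <= M.

Definition schwartz f : Prop :=
  csmooth f /\ forall N, exists M, schwartz_le N M f.

(* A tempered distribution is represented by a total functional, of which only
   the values on Schwartz functions are meaningful. *)
Definition tempered (u : (V -> C) -> C) : Prop :=
  (forall (a : C) f g, schwartz f -> schwartz g ->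
     u (fun x => a * f x + g x) = a * u f + u g) /\
  (exists (K : R) (N : nat), forall f (M : R),
     schwartz f -> schwartz_le N M f -> cabs (u f) <= K * M).

(* The sesquilinear pairing <u, g>, extending the L^2 inner product: the
   functional u itself is linear. *)
Definition pairing (u : (V -> C) -> C) g : C := u (fun x => conjc (g x)).

Definition stft g (u : (V -> C) -> C) x eta : C := pairing u (tf_shift x eta g).

Definition L2norm f : \bar R :=
  Lnorm (leb R n) 2%:E (fun x => (cabs (f x))%:E).

Definition L2 f : Prop :=
  [/\ measurable_fun setT (fun x => complex.Re (f x)),
      measurable_fun setT (fun x => complex.Im (f x)) &
      (L2norm f < +oo)%E].

Definition ae_equal f g : Prop := {ae leb R n, forall x, f x = g x}.

Definition inner f g : C := cintegral (fun x => f x * conjc (g x)).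

(* Operators act on representatives; by linearity and boundedness they respect
   equality almost everywhere. *)
Definition L2_bounded (T : (V -> C) -> (V -> C)) : Prop :=
  [/\ forall f, L2 f -> L2 (T f),
      forall (a : C) f g, L2 f -> L2 g ->
        ae_equal (T (fun x => a * f x + g x)) (fun x => a * T f x + T g x) &
      exists K : R, forall f, L2 f -> (L2norm (T f) <= K%:E * L2norm f)%E].

Definition L2_inverse (T S : (V -> C) -> (V -> C)) : Prop :=
  L2_bounded S /\
  forall f, L2 f -> ae_equal (S (T f)) f /\ ae_equal (T (S f)) f.

(* T is a bounded operator on L^2 extending an operator A : S -> S' given
   weakly, A f h being the value of <A f, h>. *)
Definition L2_extension (A : (V -> C) -> (V -> C) -> C)
    (T : (V -> C) -> (V -> C)) : Prop :=
  L2_bounded T /\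
  forall f h, schwartz f -> schwartz h -> inner (T f) h = A f h.

(* M^{oo,oo}_{1 (x) v_s}(R^n), with window Psi. *)
Definition modulation_class (Psi : V -> C) (s : R) (u : (V -> C) -> C) : Prop :=
  tempered u /\
  exists K : R, forall z zeta,
    cabs (stft Psi u z zeta) * (japanese zeta `^ s) <= K.

End complex_functions.

(* A point z of R^(2d) is (x, eta) with x = lsubmx z and eta = rsubmx z. *)
Section FIO.
Variables (R : realType) (d : nat).
Local Notation C := R[i].
Local Notation V := 'rV[R]_d.
Local Notation W := 'rV[R]_(d + d).

Definition mixed_hessian (Phi : W -> R) (z : W) : 'M[R]_d :=
  \matrix_(i < d, j < d) pderiv [:: lshift d i; rshift d j] Phi z.

Definition tame_phase (Phi : W -> R) : Prop :=
  [/\ smooth Phi,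
      forall a : seq 'I_(d + d), (2 <= size a)%N ->
        exists K : R, forall z, `|pderiv a Phi z| <= K &
      exists2 delta : R, 0 < delta &
        forall z, delta <= `|\det (mixed_hessian Phi z)|].

Definition FIO_I (Phi : W -> R) (sigma : (W -> C) -> C) (f h : V -> C) : C :=
  pairing sigma (fun z =>
    expi2pi (- Phi z) * h (lsubmx z) * conjc (fourier f (rsubmx z))).

Definition FIO_II (Phi : W -> R) (tau : (W -> C) -> C) (f h : V -> C) : C :=
  pairing tau (fun z =>
    expi2pi (Phi z) * conjc (f (lsubmx z)) * fourier h (rsubmx z)).

End FIO.

(* Main.v *)
(* Idea.  Test [T] against the time-frequency shifts [pi(z) g] of a Gaussian [g].  The matrix
   coefficient [<T pi(z) g, pi(u) g>] pairs [sigma] with a Gaussian wave packet: for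
   [u = (x', eta')] and [z = (x, eta)] it sits at the point [(x', eta)] and oscillates with
   frequency [F(u, z) = grad Phi (x', eta) - (eta', x)].  By (A2) the packets are uniformly
   Schwartz after translation and modulation, so [sigma] in the symbol class gives
   [|<T pi(z) g, pi(u) g>| <= C <F(u, z)>^(-s)].

   By (A3) and Hadamard's inversion theorem [F] is expansive in [u] and in [z], hence
   [<T pi(z) g, T pi(w) g>] is [O(<z - w>^(-s))], and so are the coefficients of the iterates of
   the strict contraction [A = 1 - c T^* T].  Interpolating this decay with the exponential
   bound [||A||^n] (Brandenburg's trick) makes the decay constants of [A^n] summable, and
   the Neumann series transfers the decay to the inverse:
   [|<T^-1 pi(u) g, pi(z) g>| <= C <F(u, z)>^(-s)].

   The symbol of [T^-1] is the superposition, over [u] and [z], of the packets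
   weighted by these coefficients; the packet estimates put it in the symbol class, and the
   inversion formula of the short-time Fourier transform identifies the operator. *)

Require Import Defs.
From HB Require Import structures.
From mathcomp Require Import all_boot all_order all_algebra.
From mathcomp Require Import complex.
From mathcomp Require Import all_classical all_reals all_analysis.
From mathcomp Require Import perm measurable_realfun ring lra.

Set Implicit Arguments.
Unset Strict Implicit.
Unset Printing Implicit Defensive.

Import Order.TTheory GRing.Theory Num.Theory.
Import numFieldNormedType.Exports.

Local Open Scope classical_set_scope.
Local Open Scope ring_scope.


(** * Complex-valued integrals *)

(** [T] and its inverse are only maps on representatives, and [sigma] is only known by its values on
    Schwartz functions. Every step is therefore an identity or an estimate between phase-space
    coefficients [inner (B (tfa a g)) h]. Two tools recur: [stft_exchange] takes an integral of
    time-frequency shifts out of a tempered functional by Riemann sums, and [stft_conv] bounds a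
    coefficient by a convolution of two weights of exponent [- s]. The condition [s > 2d] enters
    there, as integrability over phase space. The Neumann series cannot be estimated term by term,
    as the decay constants of [A^n] given by convolution may grow geometrically. In
    [A^(2n) = A^n A^n] one factor carries the whole weight while the other is interpolated between
    its weight and [rho^n], at an exponent strictly between [2d] and [s]. Along powers of two the
    constants obey [a_(k+1) = C a_k^(2 - th) q^(2^k)]. Since [2 - th < 2], the last factor wins
    whatever [C] is, and some power of [A] halves the decay constant. *)

Section ComplexModulus.
Variable R : realType.
Local Notation C := R[i].
Implicit Types z w : C.

Lemma cabsE z : cabs z = Num.sqrt (complex.Re z ^+ 2 + complex.Im z ^+ 2).
Proof. by case: z. Qed.

Lemma cabs_ge0 z : 0 <= cabs z.
Proof. by rewrite cabsE sqrtr_ge0. Qed.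

Lemma cabs_sq z : cabs z ^+ 2 = complex.Re z ^+ 2 + complex.Im z ^+ 2.
Proof. by rewrite cabsE sqr_sqrtr// addr_ge0 ?sqr_ge0. Qed.

Lemma cabsM z w : cabs (z * w) = cabs z * cabs w.
Proof. exact: ComplexField.Normc.normcM. Qed.

Lemma cabsD z w : cabs (z + w) <= cabs z + cabs w.
Proof. exact: le_normcD. Qed.

Lemma cabsN z : cabs (- z) = cabs z.
Proof. exact: normcN. Qed.

Lemma cabsB z w : cabs (z - w) <= cabs z + cabs w.
Proof. by rewrite (le_trans (cabsD _ _))// cabsN. Qed.

Lemma cabs_distC z w : cabs (z - w) = cabs (w - z).
Proof. by rewrite -cabsN opprB. Qed.

Lemma cabs0 : cabs (0 : C) = 0.
Proof. exact: ComplexField.Normc.normc0. Qed.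

Lemma cabs_eq0 z : cabs z = 0 -> z = 0.
Proof. exact: ComplexField.Normc.eq0_normc. Qed.

Lemma cabsJ z : cabs (conjc z) = cabs z.
Proof. by rewrite !cabsE; case: z => a b /=; rewrite sqrrN. Qed.

Lemma cabs_real (x : R) : cabs (x%:C)%C = `|x|.
Proof. by rewrite cabsE/= expr0n/= addr0 sqrtr_sqr. Qed.

Lemma Re_le_cabs z : `|complex.Re z| <= cabs z.
Proof. by rewrite cabsE -sqrtr_sqr ler_wsqrtr// lerDl sqr_ge0. Qed.

Lemma Im_le_cabs z : `|complex.Im z| <= cabs z.
Proof. by rewrite cabsE -sqrtr_sqr ler_wsqrtr// lerDr sqr_ge0. Qed.

Lemma cabs_le_ReIm z : cabs z <= `|complex.Re z| + `|complex.Im z|.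
Proof.
rewrite -(@ler_pXn2r _ 2%N) ?nnegrE ?cabs_ge0 ?addr_ge0// cabs_sq sqrrD.
rewrite !real_normK ?num_real// -addrA lerD2l lerDr.
by rewrite mulrn_wge0 ?mulr_ge0.
Qed.

Lemma ReD z w : complex.Re (z + w) = complex.Re z + complex.Re w.
Proof. by case: z w => ? ? []. Qed.
Lemma ImD z w : complex.Im (z + w) = complex.Im z + complex.Im w.
Proof. by case: z w => ? ? []. Qed.
Lemma ReN z : complex.Re (- z) = - complex.Re z. Proof. by case: z. Qed.
Lemma ImN z : complex.Im (- z) = - complex.Im z. Proof. by case: z. Qed.
Lemma ReB z w : complex.Re (z - w) = complex.Re z - complex.Re w.
Proof. by rewrite ReD ReN. Qed.
Lemma ImB z w : complex.Im (z - w) = complex.Im z - complex.Im w.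
Proof. by rewrite ImD ImN. Qed.
Lemma ReM z w : complex.Re (z * w) =
  complex.Re z * complex.Re w - complex.Im z * complex.Im w.
Proof. by case: z w => ? ? []. Qed.
Lemma ImM z w : complex.Im (z * w) =
  complex.Re z * complex.Im w + complex.Im z * complex.Re w.
Proof. by case: z w => ? ? []. Qed.
Lemma ReJ z : complex.Re (conjc z) = complex.Re z. Proof. by case: z. Qed.
Lemma ImJ z : complex.Im (conjc z) = - complex.Im z. Proof. by case: z. Qed.

Lemma complex_ext z w : complex.Re z = complex.Re w ->
  complex.Im z = complex.Im w -> z = w.
Proof. by case: z w => a b [c e] /= -> ->. Qed.

Lemma conjcD z w : conjc (z + w) = conjc z + conjc w.
Proof. exact: rmorphD. Qed.
Lemma conjcM z w : conjc (z * w) = conjc z * conjc w.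
Proof. exact: rmorphM. Qed.
Lemma conjcN z : conjc (- z) = - conjc z.
Proof. exact: rmorphN. Qed.

Lemma mulcJ z : z * conjc z = ((cabs z ^+ 2)%:C)%C.
Proof.
rewrite cabs_sq; apply: complex_ext; rewrite ?ReM ?ImM ReJ ImJ/=.
  by rewrite mulrN opprK -!expr2.
by rewrite mulrN mulrC addNr.
Qed.

End ComplexModulus.

Definition ReImE := (ReD, ImD, ReB, ImB, ReN, ImN, ReM, ImM, ReJ, ImJ).

Section ComplexIntegral.
Context (R : realType) (d : measure_display) (T : measurableType d).
Variable mu : {measure set T -> \bar R}.
Local Notation C := R[i].
Implicit Types f g : T -> C.

Definition cI f : C :=
  Complex (\int[mu]_x complex.Re (f x)) (\int[mu]_x complex.Im (f x)).

Definition cmf f := measurable_fun setT (fun x => complex.Re (f x)) /\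
  measurable_fun setT (fun x => complex.Im (f x)).

Definition rint (b : T -> R) := mu.-integrable setT (EFin \o b).

Definition cint f := rint (fun x => complex.Re (f x)) /\
  rint (fun x => complex.Im (f x)).

Lemma rint_mf (b : T -> R) : rint b -> measurable_fun setT b.
Proof. by move=> /measurable_int/measurable_EFinP. Qed.

Lemma cint_cmf f : cint f -> cmf f.
Proof. by move=> [? ?]; split; exact: rint_mf. Qed.

Lemma cmf_add f g : cmf f -> cmf g -> cmf (fun x => f x + g x).
Proof.
move=> [? ?] [? ?]; split.
  under eq_fun do rewrite ReD; exact: measurable_funD.
under eq_fun do rewrite ImD; exact: measurable_funD.
Qed.

Lemma mf_opp (b : T -> R) : measurable_fun setT b ->
  measurable_fun setT (fun x => - b x).
Proof. exact: measurableT_comp. Qed.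

Lemma cmf_opp f : cmf f -> cmf (fun x => - f x).
Proof.
by move=> [? ?]; split; under eq_fun do rewrite ?ReN ?ImN; exact: mf_opp.
Qed.

Lemma cmf_mul f g : cmf f -> cmf g -> cmf (fun x => f x * g x).
Proof.
move=> [? ?] [? ?]; split.
  under eq_fun do rewrite ReM.
  by apply: measurable_funB; exact: measurable_funM.
under eq_fun do rewrite ImM.
by apply: measurable_funD; exact: measurable_funM.
Qed.

Lemma cmf_conj f : cmf f -> cmf (fun x => conjc (f x)).
Proof.
move=> [? ?]; split; first by under eq_fun do rewrite ReJ.
by under eq_fun do rewrite ImJ; exact: mf_opp.
Qed.

Lemma cmf_cst (c : C) : cmf (fun _ => c).
Proof. by split; exact: measurable_cst. Qed.

Lemma cmf_real (b : T -> R) : measurable_fun setT b ->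
  cmf (fun x => ((b x)%:C)%C).
Proof. by move=> ?; split => //=; exact: measurable_cst. Qed.

Lemma cmf_cabs f : cmf f -> measurable_fun setT (fun x => cabs (f x)).
Proof.
move=> [mr mi]; under eq_fun do rewrite cabsE.
apply: (@measurableT_comp _ _ _ _ _ _ (@Num.sqrt R)).
  apply: continuous_measurable_fun; exact: sqrt_continuous.
by apply: measurable_funD; exact: measurable_funX.
Qed.

Lemma rint_dom (b c : T -> R) : measurable_fun setT b ->
  (forall x, `|b x| <= c x) -> rint c -> rint b.
Proof.
move=> mb bc ic; apply: (le_integrable measurableT _ _ ic).
  exact/measurable_EFinP.
move=> x _ /=; rewrite lee_fin (le_trans (bc x))//.
exact: ler_norm.
Qed.

Lemma cint_dom f (b : T -> R) : cmf f -> (forall x, cabs (f x) <= b x) ->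
  rint b -> cint f.
Proof.
move=> [mr mi] fb ib; split; apply: rint_dom ib => // x.
- exact: le_trans (Re_le_cabs _) (fb x).
- exact: le_trans (Im_le_cabs _) (fb x).
Qed.

Lemma rintD (b c : T -> R) : rint b -> rint c -> rint (fun x => b x + c x).
Proof. by move=> ib ic; exact: integrableD ib ic. Qed.

Lemma rintZ (k : R) (b : T -> R) : rint b -> rint (fun x => k * b x).
Proof. by move=> ib; exact: integrableZl ib. Qed.

Lemma rintN (b : T -> R) : rint b -> rint (fun x => - b x).
Proof. by move=> /(rintZ (-1)); under eq_fun do rewrite mulN1r. Qed.

Lemma rint_abs (b : T -> R) : rint b -> rint (fun x => `|b x|).
Proof. by move=> ib; exact: integrable_abse ib. Qed.

Lemma cint_cabs f : cint f -> rint (fun x => cabs (f x)).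
Proof.
move=> [ir ii]; apply: (@rint_dom _ (fun x => `|complex.Re (f x)| + `|complex.Im (f x)|)).
- by apply: cmf_cabs; exact: cint_cmf.
- by move=> x; rewrite ger0_norm ?cabs_ge0// cabs_le_ReIm.
- by apply: rintD; exact: rint_abs.
Qed.

Lemma cintD f g : cint f -> cint g -> cint (fun x => f x + g x).
Proof.
move=> [? ?] [? ?]; split.
  by under eq_fun do rewrite ReD; exact: rintD.
by under eq_fun do rewrite ImD; exact: rintD.
Qed.

Lemma cintZ (k : C) f : cint f -> cint (fun x => k * f x).
Proof.
move=> [ir ii]; split.
  under eq_fun do rewrite ReM.
  by apply: rintD; [exact: rintZ|apply: rintN; exact: rintZ].
under eq_fun do rewrite ImM.
by apply: rintD; exact: rintZ.
Qed.

Lemma cintN f : cint f -> cint (fun x => - f x).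
Proof. by move=> /(cintZ (-1)); under eq_fun do rewrite mulN1r. Qed.

Lemma cint_real (b : T -> R) : rint b -> cint (fun x => ((b x)%:C)%C).
Proof.
by move=> ?; split => //=; rewrite /rint; exact: integrable0.
Qed.

Lemma rID (b c : T -> R) : rint b -> rint c ->
  \int[mu]_x (b x + c x) = \int[mu]_x b x + \int[mu]_x c x.
Proof. by move=> ? ?; rewrite RintegralD. Qed.

Lemma rIZ (k : R) (b : T -> R) : rint b ->
  \int[mu]_x (k * b x) = k * \int[mu]_x b x.
Proof. by move=> ?; rewrite RintegralZl. Qed.

Lemma rIN (b : T -> R) : rint b -> \int[mu]_x (- b x) = - \int[mu]_x b x.
Proof.
by move=> ?; rewrite -mulN1r -rIZ//; apply: eq_Rintegral => x _; rewrite mulN1r.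
Qed.

Lemma rIle (b c : T -> R) : rint b -> rint c -> (forall x, b x <= c x) ->
  \int[mu]_x b x <= \int[mu]_x c x.
Proof. by move=> ? ? bc; apply: le_Rintegral. Qed.

Lemma cI_ext f g : f =1 g -> cI f = cI g.
Proof. by move=> /funext ->. Qed.

Lemma cID f g : cint f -> cint g -> cI (fun x => f x + g x) = cI f + cI g.
Proof.
move=> [? ?] [? ?]; apply: complex_ext => /=.
  by under eq_Rintegral do rewrite ReD; rewrite rID.
by under eq_Rintegral do rewrite ImD; rewrite rID.
Qed.

Lemma cIZ (k : C) f : cint f -> cI (fun x => k * f x) = k * cI f.
Proof.
move=> [ir ii]; apply: complex_ext => /=.
  under eq_Rintegral do rewrite ReM.
  rewrite rID ?rIN ?ReM ?rIZ//; [exact: rintZ|exact: rintZ|].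
  by apply: rintN; exact: rintZ.
under eq_Rintegral do rewrite ImM.
rewrite rID ?ImM ?rIZ//; exact: rintZ.
Qed.

Lemma cIN f : cint f -> cI (fun x => - f x) = - cI f.
Proof.
by move=> ?; rewrite -mulN1r -cIZ//; apply: cI_ext => x; rewrite mulN1r.
Qed.

Lemma cIB f g : cint f -> cint g -> cI (fun x => f x - g x) = cI f - cI g.
Proof. by move=> ? ?; rewrite cID ?cIN//; exact: cintN. Qed.

Lemma cI_conj f : cint f -> cI (fun x => conjc (f x)) = conjc (cI f).
Proof.
move=> [? ?]; apply: complex_ext; rewrite ?ReJ ?ImJ/=.
  by apply: eq_Rintegral => x _; rewrite ReJ.
by under eq_Rintegral do rewrite ImJ; rewrite rIN.
Qed.

Lemma cI_real (b : T -> R) : cI (fun x => ((b x)%:C)%C) = ((\int[mu]_x b x)%:C)%C.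
Proof.
apply: complex_ext => //=; rewrite /Rintegral.
by under eq_integral do rewrite /=; rewrite integral0.
Qed.

Lemma cI0 : cI (fun _ => 0) = 0.
Proof. by rewrite (cI_real (fun=> 0)) /Rintegral integral0. Qed.

Lemma cint_sum (I : Type) (s : seq I) (f : I -> T -> C) :
  (forall i, cint (f i)) -> cint (fun x => \sum_(i <- s) f i x).
Proof.
move=> fi; elim: s => [|i s IH].
  under eq_fun do rewrite big_nil; apply: (@cint_real (fun=> 0)).
  exact: integrable0.
by under eq_fun do rewrite big_cons; exact: cintD.
Qed.

Lemma cI_sum (I : Type) (s : seq I) (f : I -> T -> C) :
  (forall i, cint (f i)) ->
  cI (fun x => \sum_(i <- s) f i x) = \sum_(i <- s) cI (f i).
Proof.
move=> fi; elim: s => [|i s IH].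
  by rewrite big_nil -[RHS]cI0; apply: cI_ext => x; rewrite big_nil.
rewrite big_cons -IH -cID//; last exact: cint_sum.
by apply: cI_ext => x; rewrite big_cons.
Qed.

(* Rotating the integral to the positive real axis gives the sharp constant. *)
Lemma cI_le f : cint f -> cabs (cI f) <= \int[mu]_x cabs (f x).
Proof.
move=> fi; have [->|c0] := eqVneq (cI f) 0.
  by rewrite cabs0; apply: Rintegral_ge0 => x _; exact: cabs_ge0.
have c0' : 0 < cabs (cI f).
  rewrite lt_neqAle cabs_ge0 andbT eq_sym; apply: contra c0.
  by move/eqP/cabs_eq0 ->.
rewrite -(ler_pM2l c0') -expr2.
have -> : cabs (cI f) ^+ 2 = complex.Re (cI (fun x => conjc (cI f) * f x)).
  by rewrite cIZ// mulrC mulcJ.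
rewrite -rIZ; last exact: cint_cabs.
apply: rIle; [by have [] := cintZ (conjc (cI f)) fi|by apply: rintZ; exact: cint_cabs|].
move=> x; rewrite (le_trans (ler_norm _))// (le_trans (Re_le_cabs _))//.
by rewrite cabsM cabsJ.
Qed.

Lemma cI_le_dom f (b : T -> R) : cmf f -> (forall x, cabs (f x) <= b x) ->
  rint b -> cabs (cI f) <= \int[mu]_x b x.
Proof.
move=> mf fb ib; have fi := cint_dom mf fb ib.
by apply: le_trans (cI_le fi) _; apply: rIle => //; exact: cint_cabs.
Qed.

Lemma dominated_rint (u : nat -> T -> R) (v b : T -> R) :
  (forall n, measurable_fun setT (u n)) -> measurable_fun setT v ->
  (forall x, u n x @[n --> \oo] --> v x) ->
  (forall n x, `|u n x| <= b x) -> rint b ->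
  rint v /\ (\int[mu]_x u n x @[n --> \oo] --> \int[mu]_x v x).
Proof.
move=> mu_ mv uv ub ib.
have [|||||] := @dominated_convergence _ _ _ mu setT measurableT
  (fun n => EFin \o u n) (EFin \o v) (EFin \o b).
- by move=> n; exact/measurable_EFinP.
- exact/measurable_EFinP.
- by apply: aeW => x _ /=; apply: cvg_comp (uv x) _; exact: cvg_refl.
- exact: ib.
- by apply: aeW => x n _ /=; rewrite lee_fin.
move=> iv _ cv; split=> //.
by rewrite /Rintegral; apply: fine_cvg; rewrite fineK//; exact: integrable_fin_num.
Qed.

Lemma dominated_cI (u : nat -> T -> C) (v : T -> C) (b : T -> R) :
  (forall n, cmf (u n)) -> cmf v ->
  (forall x, complex.Re (u n x) @[n --> \oo] --> complex.Re (v x)) ->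
  (forall x, complex.Im (u n x) @[n --> \oo] --> complex.Im (v x)) ->
  (forall n x, cabs (u n x) <= b x) -> rint b ->
  [/\ cint v, complex.Re (cI (u n)) @[n --> \oo] --> complex.Re (cI v)
    & complex.Im (cI (u n)) @[n --> \oo] --> complex.Im (cI v)].
Proof.
move=> mu_ [mvr mvi] cr ci ub ib.
have [ir cvr] := @dominated_rint (fun n x => complex.Re (u n x)) _ b
  (fun n => (mu_ n).1) mvr cr (fun n x => le_trans (Re_le_cabs _) (ub n x)) ib.
have [ii cvi] := @dominated_rint (fun n x => complex.Im (u n x)) _ b
  (fun n => (mu_ n).2) mvi ci (fun n x => le_trans (Im_le_cabs _) (ub n x)) ib.
by split.
Qed.

Lemma is_derive_rI (f g : R -> T -> R) (b : T -> R) (a : R) :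
  (forall x, rint (f x)) ->
  (forall x y, is_derive (x : R) (1 : R) (fun x' => f x' y) (g x y)) ->
  (forall x y, `|x - a| < 1 -> `|g x y| <= b y) -> rint b ->
  is_derive a (1 : R) (fun x => \int[mu]_y f x y) (\int[mu]_y g a y).
Proof.
move=> fi fg gb ib.
have Ia : `](a - 1), (a + 1)[%classic a by rewrite /= in_itv/=; apply/andP; split; lra.
have b0 y : 0 <= `|b y| by [].
have der x y : `](a - 1), (a + 1)[%classic x -> setT y -> derivable (f^~ y) x 1.
  by move=> _ _; exact: ex_derive.
have ub x y : `](a - 1), (a + 1)[%classic x -> setT y -> `|partial1of2 f x y| <= `|b y|.
  rewrite /= in_itv/= => /andP[ax xa] _; rewrite partial1of2E derive_val.
  by apply: le_trans (gb _ _ _) (ler_norm _); rewrite ltr_norml; apply/andP; split; lra.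
have ib' := rint_abs ib.
have h1 := @derivable_under_integral _ _ _ mu f setT measurableT a _ _ Ia
  (fun x _ => fi x) der (fun y => `|b y|) b0 ib' ub.
have h2 := @differentiation_under_integral _ _ _ mu f setT measurableT a _ _ Ia
  (fun x _ => fi x) der (fun y => `|b y|) b0 ib' ub.
apply: DeriveDef => //; rewrite -derive1E h2.
by apply: eq_Rintegral => y _ /=; rewrite partial1of2E derive_val.
Qed.

End ComplexIntegral.

Section RealFubini1.
Context (R : realType) (d1 d2 : measure_display).
Context (T1 : measurableType d1) (T2 : measurableType d2).
Variables (m1 : {sigma_finite_measure set T1 -> \bar R}).
Variables (m2 : {sigma_finite_measure set T2 -> \bar R}).
Local Notation C := R[i].
Let m12 : {measure set (T1 * T2) -> \bar R} := (m1 \x m2)%E.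

Lemma rI_prod1 (f : T1 * T2 -> R) : rint m12 f ->
  rint m1 (fun x => \int[m2]_y f (x, y)) /\
  \int[m1]_x (\int[m2]_y f (x, y)) = \int[m12]_z f z.
Proof.
move=> fi.
have iF := integrable_fubini_F fi.
(* The inner extended integral is finite only almost everywhere; where it is infinite [fine] returns
   0, so the two functions agree off a null set. *)
have aeF : ae_eq m1 setT (fubini_F m2 (EFin \o f))
    (EFin \o (fun x => \int[m2]_y f (x, y))).
  have := integrable_ae measurableT iF.
  by apply: filterS => x /(_ Logic.I) ? _ /=; rewrite /Rintegral fineK.
have mF : measurable_fun setT (EFin \o (fun x => \int[m2]_y f (x, y))).
  apply/measurable_EFinP.
  apply: (@measurableT_comp _ _ _ _ _ _ (@fine R)); first exact: fine_measurable.
  exact: measurable_int iF.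
split.
  have /integrableP[mF' Foo] := iF.
  apply/integrableP; split => //; apply: le_lt_trans Foo.
  rewrite le_eqVlt; apply/orP; left; apply/eqP/ae_eq_integral => //.
  - exact: measurableT_comp.
  - exact: measurableT_comp.
  - by apply: filterS aeF => x /= + xT => /(_ xT) ->.
rewrite /Rintegral; congr fine.
rewrite -integral12_prod_meas1//; apply/esym/ae_eq_integral => //.
exact: measurable_int iF.
Qed.

End RealFubini1.

Section ComplexFubini.
Context (R : realType) (d1 d2 : measure_display).
Context (T1 : measurableType d1) (T2 : measurableType d2).
Variables (m1 : {sigma_finite_measure set T1 -> \bar R}).
Variables (m2 : {sigma_finite_measure set T2 -> \bar R}).
Local Notation C := R[i].
Let m12 : {measure set (T1 * T2) -> \bar R} := (m1 \x m2)%E.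

Lemma rI_prod2 (f : T1 * T2 -> R) : rint m12 f ->
  rint m2 (fun y => \int[m1]_x f (x, y)) /\
  \int[m2]_y (\int[m1]_x f (x, y)) = \int[m12]_z f z.
Proof.
move=> fi.
have mf := measurable_int _ fi.
have fi' : rint (m2 \x m1)%E (fun p => f (p.2, p.1)).
  apply/(integrable12ltyP m2 m1 _).2.
    by apply: (measurableT_comp mf); apply: measurable_fun_pair; [exact: measurable_snd|exact: measurable_fst].
  exact/(integrable21ltyP m1 m2 mf).1.
have [i1 e1] := rI_prod1 fi'; split => //.
rewrite e1 /Rintegral; congr fine.
by rewrite -integral12_prod_meas1// -integral21_prod_meas1.
Qed.

Lemma cI_prod1 (f : T1 * T2 -> C) : cint m12 f ->
  cint m1 (fun x => cI m2 (fun y => f (x, y))) /\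
  cI m1 (fun x => cI m2 (fun y => f (x, y))) = cI m12 f.
Proof.
move=> [/rI_prod1[? er] /rI_prod1[? ei]]; split; first by split.
by rewrite /cI /= er ei.
Qed.

Lemma cI_prod2 (f : T1 * T2 -> C) : cint m12 f ->
  cint m2 (fun y => cI m1 (fun x => f (x, y))) /\
  cI m2 (fun y => cI m1 (fun x => f (x, y))) = cI m12 f.
Proof.
move=> [/rI_prod2[? er] /rI_prod2[? ei]]; split; first by split.
by rewrite /cI /= er ei.
Qed.

Lemma cI_swap (f : T1 -> T2 -> C) : cint m12 (fun z => f z.1 z.2) ->
  cI m1 (fun x => cI m2 (f x)) = cI m2 (fun y => cI m1 (fun x => f x y)).
Proof.
by move=> fi; have [_ e1] := cI_prod1 fi; have [_ e2] := cI_prod2 fi; rewrite e1 e2.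
Qed.

(** Tonelli for the modulus. Later uses of Fubini are justified through a majorant [b] whose inner
    integrals are themselves majorized by [B]. *)
Lemma rint_prod (f : T1 * T2 -> R) (b : T1 -> T2 -> R) (B : T1 -> R) :
  measurable_fun setT f -> (forall x y, `|f (x, y)| <= b x y) ->
  (forall x, rint m2 (b x)) -> (forall x, \int[m2]_y b x y <= B x) ->
  rint m1 B -> rint m12 f.
Proof.
move=> mf fb bi bB Bi; apply/(integrable12ltyP m1 m2 _).2; first exact/measurable_EFinP.
have /integrableP[mB Boo] := Bi.
apply: le_lt_trans Boo; apply: ge0_le_integral => //.
- by move=> x _; exact: integral_ge0.
- apply: (measurable_fun_fubini_tonelli_F (abse \o (EFin \o f))) => //=.
  by apply: measurableT_comp => //; exact/measurable_EFinP.
- by apply: measurableT_comp.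
move=> x _; apply: (@le_trans _ _ (\int[m2]_y (b x y)%:E)%E).
  apply: ge0_le_integral => //.
  - apply: measurableT_comp => //; apply/measurable_EFinP.
    by apply: (measurableT_comp mf); exact: measurable_pair1.
  - by apply/measurable_EFinP; exact: rint_mf (bi x).
  by move=> y _ /=; rewrite lee_fin.
have : (\int[m2]_y (b x y)%:E)%E \is a fin_num by exact: integrable_fin_num (bi x).
move=> /fineK <-; rewrite lee_fin (le_trans (bB x))//; exact: ler_norm.
Qed.

Lemma cint_prod (f : T1 * T2 -> C) (b : T1 -> T2 -> R) (B : T1 -> R) :
  cmf f -> (forall x y, cabs (f (x, y)) <= b x y) ->
  (forall x, rint m2 (b x)) -> (forall x, \int[m2]_y b x y <= B x) ->
  rint m1 B -> cint m12 f.
Proof.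
move=> [mr mi] fb bi bB Bi; split; apply: (@rint_prod _ b B) => // x y.
- exact: le_trans (Re_le_cabs _) (fb x y).
- exact: le_trans (Im_le_cabs _) (fb x y).
Qed.

(** Each component is [fine] of a difference of two Tonelli integrals, those of the positive and the
    negative part, and all these operations preserve measurability. *)
Lemma cmf_cI_param (f : T1 * T2 -> C) : cmf f ->
  cmf (fun x => cI m2 (fun y => f (x, y))).
Proof.
have key (g : T1 * T2 -> R) : measurable_fun setT g ->
    measurable_fun setT (fun x => \int[m2]_y g (x, y)).
  move=> mg.
  apply: (@measurableT_comp _ _ _ _ _ _ (@fine R)); first exact: fine_measurable.
  under eq_fun do rewrite integralE.
  have mge : measurable_fun setT (EFin \o g) by exact/measurable_EFinP.
  apply: emeasurable_funB.
    have h : measurable_fun setT ((EFin \o g)^\+)%E by exact: measurable_funepos.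
    have := measurable_fun_fubini_tonelli_F (m2:=m2) _ h (fun x => funepos_ge0 _ x).
    by apply: eq_measurable_fun => x _; apply: eq_integral => y _; rewrite !funeposE.
  have h : measurable_fun setT ((EFin \o g)^\-)%E by exact: measurable_funeneg.
  have := measurable_fun_fubini_tonelli_F (m2:=m2) _ h (fun x => funeneg_ge0 _ x).
  by apply: eq_measurable_fun => x _; apply: eq_integral => y _; rewrite !funenegE.
by move=> [mr mi]; split; [exact: (key _ mr)|exact: (key _ mi)].
Qed.

End ComplexFubini.

(** * Lebesgue measure on row vectors *)

Section SupNorm.
Variables (R : realType).

Lemma rV_coord_le n (x : 'rV[R]_n) i : `|x ord0 i| <= `|x|.
Proof.
rewrite {2}/Num.norm/= mx_normrE; exact: (le_bigmax _ (fun ij : 'I_1 * 'I_n => `|x ij.1 ij.2|) (ord0, i)).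
Qed.

Lemma rV_norm_le n (x : 'rV[R]_n) e : 0 <= e ->
  (forall i, `|x ord0 i| <= e) -> `|x| <= e.
Proof.
move=> e0 xe; rewrite /Num.norm/= mx_normrE; apply: bigmax_le => // -[i j] _ /=.
by rewrite (ord1 i).
Qed.

(** The polynomial weight of all estimates. It is equivalent to [japanese] but submultiplicative
    ([jwD]), so that Peetre's inequality holds without a constant. *)
Definition jw n (x : 'rV[R]_n) : R := 1 + `|x|.

Lemma jw_ge1 n (x : 'rV[R]_n) : 1 <= jw x. Proof. by rewrite lerDl. Qed.
Lemma jw_gt0 n (x : 'rV[R]_n) : 0 < jw x. Proof. exact: lt_le_trans (jw_ge1 x). Qed.
Lemma jw_ge0 n (x : 'rV[R]_n) : 0 <= jw x. Proof. exact: ltW (jw_gt0 x). Qed.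
Lemma jwN n (x : 'rV[R]_n) : jw (- x) = jw x. Proof. by rewrite /jw normrN. Qed.
Lemma jw_distC n (x y : 'rV[R]_n) : jw (x - y) = jw (y - x).
Proof. by rewrite -jwN opprB. Qed.

Lemma jwD n (x y : 'rV[R]_n) : jw (x + y) <= jw x * jw y.
Proof.
have h := ler_normD x y; rewrite /jw.
have h1 := normr_ge0 x; have h2 := normr_ge0 y.
nra.
Qed.

Lemma jw_powR_gt0 n (x : 'rV[R]_n) r : 0 < jw x `^ r.
Proof. by rewrite powR_gt0 ?jw_gt0. Qed.

Lemma peetre n (x y : 'rV[R]_n) r : 0 <= r ->
  jw (x + y) `^ r <= jw x `^ r * jw y `^ r.
Proof.
move=> r0; rewrite -powRM ?jw_ge0//; apply: ge0_ler_powR => //.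
- by rewrite nnegrE jw_ge0.
- by rewrite nnegrE mulr_ge0 ?jw_ge0.
- exact: jwD.
Qed.

(** Peetre's inequality for negative powers comes from the positive case applied to
    [x = (x + y) - y]. *)
Lemma peetreN n (x y : 'rV[R]_n) r : 0 <= r ->
  jw (x + y) `^ (- r) <= jw x `^ (- r) * jw y `^ r.
Proof.
move=> r0; rewrite !powRN -[leLHS]mul1r ler_pdivrMr ?jw_powR_gt0//.
rewrite -mulrA mulrC -ler_pdivrMr ?invr_gt0 ?jw_powR_gt0// invrK mul1r.
rewrite -{1}(addrK y x) [leLHS](_ : _ = jw (- y + (x + y)) `^ r); last by rewrite addrC.
by rewrite (le_trans (peetre _ _ r0))// jwN.
Qed.

Lemma jw_powR_le n (x : 'rV[R]_n) r q : r <= q -> jw x `^ r <= jw x `^ q.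
Proof. by move=> rq; rewrite ler_powR// jw_ge1. Qed.

Lemma jw_powRN_le1 n (x : 'rV[R]_n) r : 0 <= r -> jw x `^ (- r) <= 1.
Proof. by move=> r0; rewrite -(powRr0 (jw x)) jw_powR_le// oppr_le0. Qed.

Lemma jw_powRD n (x : 'rV[R]_n) r q : jw x `^ (r + q) = jw x `^ r * jw x `^ q.
Proof. by rewrite powRD//; apply/implyP => _; rewrite gt_eqF// jw_gt0. Qed.

Lemma jw_powR_mono n m (x : 'rV[R]_n) (y : 'rV[R]_m) (c r : R) : 0 < c -> 0 <= r ->
  jw x <= c * jw y -> jw y `^ (- r) <= c `^ r * jw x `^ (- r).
Proof.
move=> c0 r0 xy; rewrite !powRN ler_pdivlMr ?jw_powR_gt0// mulrC.
rewrite ler_pdivrMr ?jw_powR_gt0// -powRM ?jw_ge0//; last exact: ltW.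
by apply: ge0_ler_powR => //; rewrite nnegrE ?mulr_ge0 ?jw_ge0// ltW.
Qed.

End SupNorm.

(** * Approximation of points by a finite grid *)

Section Grid.
Variables (R : realType) (N : nat).
Local Notation K := (N.+1%:R : R).

(** Points of step [1/K] starting at [- K]. The [2 K^2] half-open cells between them cover
    [[- K, K)], and [None] stands for the outside. *)
Definition grid (i : nat) : R := i%:R / K - K.

Definition cell1 (x : R) : option 'I_(2 * N.+1 * N.+1) :=
  [pick i : 'I_(2 * N.+1 * N.+1) | grid i <= x < grid i.+1].

(** The default 0 outside the grid keeps [cval1 (cell1 x)] within [|x| + 1] for every [x], uniformly
    in [N]; dominated convergence of the Riemann sums rests on this. *)
Definition cval1 (o : option 'I_(2 * N.+1 * N.+1)) : R :=
  if o is Some i then grid i else 0.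

Let K0 : 0 < K. Proof. by []. Qed.

Let gridE i x : (grid i <= x < grid i.+1) = (i%:R <= (x + K) * K < i.+1%:R).
Proof. by rewrite /grid lerBlDr ltrBrDr ler_pdivrMr// ltr_pdivlMr. Qed.

Let gridS i : grid i.+1 = grid i + K^-1.
Proof. by rewrite /grid -natr1 mulrDl mul1r addrAC. Qed.

Lemma cval1_close x : `|x| < K -> `|cval1 (cell1 x) - x| <= K^-1.
Proof.
rewrite ltr_norml => /andP[x1 x2].
rewrite /cell1; case: pickP => [i /andP[i1 i2]|/=].
  rewrite ler0_norm ?subr_le0// opprB /= lerBlDr (le_trans (ltW i2))//.
  by rewrite gridS addrC.
have y0 : 0 <= (x + K) * K by rewrite mulr_ge0 ?ltW//; lra.
have hi : (Num.truncn ((x + K) * K) < 2 * N.+1 * N.+1)%N.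
  rewrite truncn_lt_nat// natrM natrM ltr_pM2r//; lra.
move/(_ (Ordinal hi)); rewrite gridE/= truncn_itv//.
Qed.

Lemma cval1_bound x : `|cval1 (cell1 x)| <= `|x| + 1.
Proof.
rewrite /cell1; case: pickP => [i /andP[i1 i2]|_] /=; last by rewrite normr0 addr_ge0.
have : grid i.+1 <= grid i + 1.
  by rewrite gridS lerD2l invf_le1// ler1n.
move=> h; have := ler_norm x; have := ler_norm (- x); rewrite normrN ler_norml => ? ?.
by apply/andP; split; lra.
Qed.

Let cell1_Some i : [set x | cell1 x = Some i] = `[grid i, grid i.+1[%classic.
Proof.
rewrite predeqE => x /=; rewrite in_itv/= /cell1; split.
  by case: pickP => // j h [<-].
rewrite gridE => hi; case: pickP => [j|/(_ i)]; last by rewrite gridE hi.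
rewrite gridE => hj; congr Some; apply/val_inj => /=.
by rewrite -(truncn_def hi) (truncn_def hj).
Qed.

Lemma measurable_cell1 o : measurable [set x | cell1 x = o].
Proof.
case: o => [i|]; first by rewrite cell1_Some.
rewrite (_ : [set x | _] =
    ~` \big[setU/set0]_(i : 'I_(2 * N.+1 * N.+1)) [set x | cell1 x = Some i]).
  by apply: measurableC; apply: bigsetU_measurable => i _; rewrite cell1_Some.
rewrite predeqE => x /=; rewrite -bigcup_seq /bigcup/=; split.
  by move=> -> [].
by case E : (cell1 x) => [i|//] []; exists i => //=; rewrite mem_index_enum.
Qed.

Definition cell_type n : finType := {ffun 'I_n -> option 'I_(2 * N.+1 * N.+1)}.

Definition cell n (x : 'rV[R]_n) : cell_type n := [ffun k => cell1 (x ord0 k)].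

Definition cval n (f : cell_type n) : 'rV[R]_n := \row_k cval1 (f k).

Lemma cval_close n (x : 'rV[R]_n) : `|x| < K -> `|cval (cell x) - x| <= K^-1.
Proof.
move=> xK; apply: rV_norm_le => [|k]; first by rewrite invr_ge0.
rewrite !mxE ffunE; apply: cval1_close; exact: le_lt_trans (rV_coord_le _ _) xK.
Qed.

Lemma cval_bound n (x : 'rV[R]_n) : `|cval (cell x)| <= `|x| + 1.
Proof.
apply: rV_norm_le => [|k]; first by rewrite addr_ge0.
rewrite !mxE ffunE (le_trans (cval1_bound _))// lerD2r; exact: rV_coord_le.
Qed.

Lemma measurable_cell n (f : cell_type n) :
  measurable [set x : 'rV[R]_n | cell x = f].
Proof.
rewrite (_ : [set x | _] = \bigcap_(k in [set: 'I_n])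
    (@rV_coord R n k @^-1` [set y | cell1 y = f k])).
  apply: fin_bigcap_measurable => [|k _]; first exact: finite_finset.
  by rewrite -[X in measurable X]setTI; apply: measurable_rV_coord => //;
    exact: measurable_cell1.
rewrite predeqE => x /=; split => [<- k _ /=|h]; first by rewrite ffunE.
by apply/ffunP => k; rewrite ffunE; exact: h.
Qed.

End Grid.

Arguments cell {R} N {n} x.
Arguments cval {R N n} f.

Section FiniteValued.
Context (R : realType) (d : measure_display) (T : measurableType d).

Lemma measurable_fin_comp (I : finType) (k : T -> I) (v : I -> R) :
  (forall i, measurable [set x | k x = i]) -> measurable_fun setT (fun x => v (k x)).
Proof.
move=> mk _ Y mY; rewrite setTI.
rewrite (_ : _ @^-1` _ = \big[setU/set0]_(i : I | `[< Y (v i) >]) [set x | k x = i]).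
  by apply: bigsetU_measurable => i _.
rewrite predeqE => x /=; rewrite -bigcup_seq_cond; split.
  by move=> Yx; exists (k x) => //=; rewrite mem_index_enum; exact/asboolP.
by move=> [i /= /andP[_ /asboolP Yi] ->].
Qed.

End FiniteValued.

Section ContinuousMeasurable.
Variables (R : realType).

Lemma cvg_cval n (x : 'rV[R]_n) :
  (cval (cell N x) : 'rV[R]_n) @[N --> \oo] --> x.
Proof.
apply/cvgrPdist_lt => /= e e0.
near=> N.
rewrite distrC (le_lt_trans (cval_close _))//.
  by rewrite (@lt_le_trans _ _ N%:R)// ?ler_nat//; near: N; exact: nbhs_infty_gtr.
near: N; exact: (near_infty_natSinv_lt (PosNum e0)).
Unshelve. all: by end_near. Qed.

(** [f] is the pointwise limit of [f (cval (cell N x))], which takes finitely many values on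
    measurable cells. This links the topology of row vectors to the coordinate sigma-algebra. *)
Lemma continuous_mf n (f : 'rV[R]_n -> R) : continuous f -> measurable_fun setT f.
Proof.
move=> cf.
refine (@measurable_fun_cvg _ _ _ setT (fun N x => f (cval (cell N x))) f _ _).
  move=> N; apply: (measurable_fin_comp (k := fun x => cell N x) (fun c => f (cval c))).
  exact: measurable_cell.
by move=> x _; apply: continuous_cvg; [exact: cf|exact: cvg_cval].
Qed.

End ContinuousMeasurable.

(** * Transport of integrals along a measure-preserving map *)

Section Transport.
Context (R : realType) (d1 d2 : measure_display).
Context (X : measurableType d1) (Y : measurableType d2).
Variables (phi : X -> Y) (mphi : measurable_fun setT phi).
Variables (mu : {measure set X -> \bar R}) (nu : {measure set Y -> \bar R}).
Hypothesis nuE : forall A, measurable A -> nu A = mu (phi @^-1` A).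

Lemma transport_ge0 (f : Y -> \bar R) : measurable_fun setT f ->
  (forall y, (0 <= f y)%E) -> (\int[nu]_y f y = \int[mu]_x f (phi x))%E.
Proof.
move=> mf f0.
transitivity (\int[pushforward mu phi]_y f y)%E.
  by apply: eq_measure_integral => A mA _; exact: nuE.
by rewrite ge0_integral_pushforward// preimage_setT.
Qed.

Lemma transport_rint (f : Y -> R) : measurable_fun setT f ->
  rint mu (f \o phi) <-> rint nu f.
Proof.
move=> mf; have mf' : measurable_fun setT (EFin \o f) by exact/measurable_EFinP.
have e : (\int[nu]_y `|(f y)%:E| = \int[mu]_x `|(f (phi x))%:E|)%E.
  by rewrite transport_ge0//; exact: measurableT_comp.
split=> /integrableP[mg h]; apply/integrableP; split => //.
- by rewrite e.
- by apply/measurable_EFinP; exact: measurableT_comp.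
- by rewrite -e.
Qed.

Lemma transport_rI (f : Y -> R) : measurable_fun setT f ->
  \int[nu]_y f y = \int[mu]_x f (phi x).
Proof.
move=> mf; have mf' : measurable_fun setT (EFin \o f) by exact/measurable_EFinP.
rewrite /Rintegral; congr fine.
rewrite integralE [RHS]integralE; congr (_ - _)%E.
  rewrite transport_ge0//; last exact: measurable_funepos.
  by apply: eq_integral => x _; rewrite !funeposE.
rewrite transport_ge0//; last exact: measurable_funeneg.
by apply: eq_integral => x _; rewrite !funenegE.
Qed.

Lemma transport_cint (f : Y -> R[i]) : cmf f -> cint mu (f \o phi) <-> cint nu f.
Proof.
by move=> [mr mi]; split=> -[h1 h2]; split;
  (apply/(transport_rint mr) || apply/(transport_rint mi)).
Qed.

Lemma transport_cI (f : Y -> R[i]) : cmf f -> cI nu f = cI mu (fun x => f (phi x)).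
Proof.
by move=> [mr mi]; rewrite /cI (transport_rI mr) (transport_rI mi).
Qed.

End Transport.

Section LebesgueProduct.
Variable R : realType.

Lemma leb_consE n A : measurable A ->
  leb R n.+1 A = (@lebesgue_measure R \x leb R n)%E (@rV_cons R n @^-1` A).
Proof. by []. Qed.

(** The push-forward of Lebesgue measure under a translation has the right value on half-open
    intervals, hence on all measurable sets by uniqueness. *)
Lemma leb_shift1 (a : R) (f : R -> \bar R) : measurable_fun setT f ->
  (forall y, (0 <= f y)%E) ->
  (\int[lebesgue_measure]_y f (y + a)%R = \int[lebesgue_measure]_y f y)%E.
Proof.
move=> mf f0.
pose phi : measurableTypeR R -> measurableTypeR R := fun y => y + a.
have ms : measurable_fun setT phi by exact: measurable_funD.
pose m : {measure set (measurableTypeR R) -> \bar R} := pushforward lebesgue_measure phi.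
apply/esym; apply: (@transport_ge0 R _ _ (measurableTypeR R) (measurableTypeR R)
  phi) => // A mA.
apply: (lebesgue_measure_unique (mu := m ms)) => // _ [[b c] _ <-] /=.
rewrite /m/= /pushforward (_ : _ @^-1` _ = `](b - a), (c - a)]%classic); last first.
  by rewrite predeqE => x /=; rewrite !in_itv/= ltrBlDr lerBrDr.
by rewrite !lebesgue_measure_itv/= !lte_fin ltrD2r -!EFinD opprB addrA subrK.
Qed.

Lemma measurable_rV_shift n (a : 'rV[R]_n) : measurable_fun setT (fun x : 'rV[R]_n => x + a).
Proof.
apply: measurable_fun_rVP => i.
rewrite (_ : _ \o _ = fun x => rV_coord i x + a ord0 i); last first.
  by apply/funext => x /=; rewrite /rV_coord mxE.
by apply: measurable_funD => //; exact: measurable_rV_coord.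
Qed.

Lemma rV_unconsK n : cancel (@rV_uncons R n) (@rV_cons R n).
Proof.
move=> x; apply/rowP => i; case: (split_ordP (i : 'I_(1 + n))) => j ->.
  transitivity ((const_mx (x ord0 ord0) : 'rV[R]_1) ord0 j); first exact: row_mxEl.
  by rewrite mxE; congr (x _ _); apply/val_inj; case: j => [[]].
transitivity (rsubmx (x : 'rV_(1 + n)) ord0 j); first exact: row_mxEr.
by rewrite mxE.
Qed.

Lemma rV_consD n (p q : R * 'rV[R]_n) :
  rV_cons p + rV_cons q = rV_cons (p.1 + q.1, p.2 + q.2).
Proof.
rewrite /rV_cons [LHS](@add_row_mx R 1 1 n (const_mx p.1) p.2 (const_mx q.1) q.2).
have -> // : const_mx p.1 + const_mx q.1 = const_mx (p.1 + q.1) :> 'rV[R]_1.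
by apply/rowP => j; rewrite !mxE.
Qed.

Lemma ge0_leb_cons n (f : 'rV[R]_n.+1 -> \bar R) : measurable_fun setT f ->
  (forall y, (0 <= f y)%E) ->
  (\int[leb R n.+1]_y f y =
   \int[lebesgue_measure]_t \int[leb R n]_v f (rV_cons (t, v)))%E.
Proof.
move=> mf f0.
rewrite (@transport_ge0 R _ _ (measurableTypeR R * 'rV[R]_n)%type _
  (@rV_cons R n) (@measurable_rV_cons R n) (@lebesgue_measure R \x leb R n)%E)//.
rewrite fubini_tonelli1//.
exact: measurableT_comp mf (@measurable_rV_cons R n).
Qed.

Lemma measurable_cons_section n (f : 'rV[R]_n.+1 -> \bar R) t :
  measurable_fun setT f -> measurable_fun setT (fun v => f (rV_cons (t, v))).
Proof.
move=> mf; apply: (measurableT_comp mf).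
apply: (measurableT_comp (@measurable_rV_cons R n)).
exact: measurable_pair1.
Qed.

Lemma measurable_cons_int n (f : 'rV[R]_n.+1 -> \bar R) :
  measurable_fun setT f -> (forall y, (0 <= f y)%E) ->
  measurable_fun setT (fun t => \int[leb R n]_v f (rV_cons (t, v)))%E.
Proof.
move=> mf f0; apply: (measurable_fun_fubini_tonelli_F (m2 := leb R n)
  (fun p : measurableTypeR R * 'rV[R]_n => f (rV_cons p))) => //.
exact: measurableT_comp mf (@measurable_rV_cons R n).
Qed.

Lemma ge0_leb_shift n (a : 'rV[R]_n) (f : 'rV[R]_n -> \bar R) :
  measurable_fun setT f -> (forall y, (0 <= f y)%E) ->
  (\int[leb R n]_y f (y + a)%R = \int[leb R n]_y f y)%E.
Proof.
elim: n a f => [|n IH] a f mf f0.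
  by apply: eq_integral => x _; rewrite (thinmx0 (x + a)) (thinmx0 x).
have mfa : measurable_fun setT (fun y : 'rV[R]_n.+1 => f (y + a)).
  exact: measurableT_comp mf (@measurable_rV_shift _ a).
rewrite (ge0_leb_cons mfa (fun y => f0 _)) (ge0_leb_cons mf f0).
rewrite -[RHS](leb_shift1 (rV_uncons a).1) => [||t]; last exact: integral_ge0.
- apply: eq_integral => t _.
  rewrite -[RHS](IH (rV_uncons a).2)//; last exact: measurable_cons_section.
  by apply: eq_integral => v _; rewrite -{1}(rV_unconsK a) rV_consD.
- exact: measurable_cons_int.
Qed.

Lemma leb_shift n (a : 'rV[R]_n) A : measurable A ->
  leb R n A = leb R n ((fun x : 'rV[R]_n => x + a) @^-1` A).
Proof.
move=> mA.
have mA' : measurable ((fun x : 'rV[R]_n => x + a) @^-1` A).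
  by rewrite -[X in measurable X]setTI; exact: measurable_rV_shift.
have m1A : measurable_fun setT (fun x => (\1_A x)%:E : \bar R).
  exact/measurable_EFinP/measurable_indic.
have i0 y : (0 <= (\1_A y)%:E :> \bar R)%E by rewrite lee_fin.
have H := @ge0_leb_shift n a _ m1A i0.
transitivity (\int[leb R n]_y (\1_A y)%:E)%E; first by rewrite integral_indic// setIT.
rewrite -H.
transitivity (\int[leb R n]_y (\1_((fun x : 'rV[R]_n => x + a) @^-1` A) y)%:E)%E; first by [].
by rewrite integral_indic// setIT.
Qed.

Definition rV_app n m (p : 'rV[R]_n * 'rV[R]_m) : 'rV[R]_(n + m) := row_mx p.1 p.2.

Lemma measurable_rV_app n m : measurable_fun setT (@rV_app n m).
Proof.
apply: measurable_fun_rVP => i; case: (split_ordP i) => j ->.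
  rewrite (_ : _ \o _ = rV_coord j \o fst).
    by apply: measurableT_comp => //; exact: measurable_rV_coord.
  by apply/funext => -[x y] /=; rewrite /rV_coord /rV_app row_mxEl.
rewrite (_ : _ \o _ = rV_coord j \o snd).
  by apply: measurableT_comp => //; exact: measurable_rV_coord.
by apply/funext => -[x y] /=; rewrite /rV_coord /rV_app row_mxEr.
Qed.

(** Both sides list the same coordinates; the case analysis matches positions in [n.+1 + m] with
    positions in [1 + (n + m)] through their values. *)
Lemma rV_app_cons n m t (x : 'rV[R]_n) (y : 'rV[R]_m) :
  rV_app (rV_cons (t, x), y) = rV_cons (t, rV_app (x, y)).
Proof.
rewrite /rV_app /rV_cons /=; apply/rowP => i; rewrite !mxE.
case: (splitP (i : 'I_(n.+1 + m))) => j /= ij.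
  rewrite !mxE; case: (splitP (j : 'I_(1 + n))) => k jk; case: (splitP (i : 'I_(1 + (n + m)))) => l /= il.
  - by rewrite !mxE.
  - by case: k jk => k /= k1 jk; exfalso; move: k1; rewrite -jk -ij il.
  - by case: l il => l /= l1 il; exfalso; move: l1; rewrite -il ij jk.
  rewrite mxE; case: (splitP l) => q lq.
    congr (x _ _); apply/val_inj => /=; rewrite -lq; apply/eqP.
    by rewrite -(eqn_add2l 1) -jk -il ij.
  exfalso; have := ltn_ord k; rewrite -(ltn_add2l 1) -jk -ij il lq.
  by rewrite ltn_add2l ltnNge leq_addr.
case: (splitP (i : 'I_(1 + (n + m)))) => l /= il.
  by case: l il => l /= l1 il; exfalso; move: l1; rewrite -il ij.
rewrite mxE; case: (splitP l) => q lq.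
  exfalso; have := ltn_ord q; rewrite -lq -(ltn_add2l 1) -il ij.
  by rewrite ltnNge leq_addr.
congr (y _ _); apply/val_inj => /=; apply/eqP.
by rewrite -(eqn_add2l n.+1) -ij il lq.
Qed.

Lemma ge0_leb_app n m (f : 'rV[R]_(n + m) -> \bar R) : measurable_fun setT f ->
  (forall y, (0 <= f y)%E) ->
  (\int[leb R (n + m)]_y f y = \int[leb R n]_x \int[leb R m]_y f (rV_app (x, y)))%E.
Proof.
elim: n f => [|n IH] f mf f0.
  rewrite [RHS](_ : _ = \int[\d_ (const_mx 0%R : 'rV[R]_0)]_x \int[leb R m]_y f (rV_app (x, y)))%E//.
  have mff : measurable_fun setT (f \o @rV_app 0 m).
    exact: measurableT_comp mf (@measurable_rV_app _ _).
  rewrite integral_dirac//; last first.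
    apply: (measurable_fun_fubini_tonelli_F (m2 := leb R m) (f \o @rV_app 0 m)) => //.
    by move=> p; exact: f0.
  rewrite diracE mem_set// mul1e; apply: eq_integral => y _; congr f.
  rewrite /rV_app/=; apply/rowP => i; rewrite mxE; case: splitP => [[]//|j ij].
  by congr (y _ _); apply/val_inj.
have mff : measurable_fun setT (f \o @rV_app n.+1 m).
  exact: measurableT_comp mf (@measurable_rV_app _ _).
have mF : measurable_fun setT (fun x => \int[leb R m]_y f (rV_app (x, y)))%E.
  apply: (measurable_fun_fubini_tonelli_F (m2 := leb R m) (f \o @rV_app n.+1 m)) => //.
  by move=> p; exact: f0.
rewrite (@ge0_leb_cons (n + m) f)// [RHS]ge0_leb_cons//; last first.
  by move=> x; exact: integral_ge0.
apply: eq_integral => t _; rewrite IH//; last exact: measurable_cons_section.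
by apply: eq_integral => x _; apply: eq_integral => y _; rewrite -rV_app_cons.
Qed.

Lemma leb_app n m A : measurable A ->
  leb R (n + m) A = (leb R n \x leb R m)%E (@rV_app n m @^-1` A).
Proof.
move=> mA.
have mA' : measurable (@rV_app n m @^-1` A).
  by rewrite -[X in measurable X]setTI; exact: measurable_rV_app.
have m1A : measurable_fun setT (fun x => (\1_A x)%:E : \bar R).
  exact/measurable_EFinP/measurable_indic.
have := @ge0_leb_app n m (fun x => (\1_A x)%:E) m1A _.
rewrite integral_indic// setIT => -> //.
have e : (fun p => \1_(@rV_app n m @^-1` A) p)%:E = (fun p => \1_A (rV_app p))%:E.
  by [].
rewrite -(fubini_tonelli1 (m1 := leb R n) (m2 := leb R m) (fun p => (\1_A (@rV_app n m p))%:E))//.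
  under eq_integral do rewrite -[\1_A _]/(\1_(@rV_app n m @^-1` A) _).
  by rewrite integral_indic// setIT.
exact: measurableT_comp m1A (@measurable_rV_app _ _).
Qed.

Definition pint n m : {measure set ('rV[R]_n * 'rV[R]_m) -> \bar R} :=
  (leb R n \x leb R m)%E.

Lemma cI_app n m (f : 'rV[R]_(n + m) -> R[i]) : cmf f ->
  cI (leb R (n + m)) f = cI (@pint n m) (fun p => f (rV_app p)).
Proof. by apply: transport_cI; [exact: measurable_rV_app|exact: leb_app]. Qed.

Lemma cint_app n m (f : 'rV[R]_(n + m) -> R[i]) : cmf f ->
  cint (@pint n m) (f \o @rV_app n m) <-> cint (leb R (n + m)) f.
Proof. by apply: transport_cint; [exact: measurable_rV_app|exact: leb_app]. Qed.

Lemma cI_shift n (a : 'rV[R]_n) (f : 'rV[R]_n -> R[i]) : cmf f ->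
  cI (leb R n) (fun x => f (x + a)) = cI (leb R n) f.
Proof.
move=> mf; apply/esym; apply: (transport_cI (phi := fun x : 'rV[R]_n => x + a)) => //.
  exact: measurable_rV_shift.
exact: leb_shift.
Qed.

Lemma rI_shift n (a : 'rV[R]_n) (f : 'rV[R]_n -> R) : measurable_fun setT f ->
  \int[leb R n]_x f (x + a) = \int[leb R n]_x f x.
Proof.
move=> mf; apply/esym; apply: (transport_rI (phi := fun x : 'rV[R]_n => x + a)) => //.
  exact: measurable_rV_shift.
exact: leb_shift.
Qed.

Lemma rint_shift n (a : 'rV[R]_n) (f : 'rV[R]_n -> R) :
  rint (leb R n) f -> rint (leb R n) (fun x => f (x + a)).
Proof.
move=> fi; exact: (iffRL (transport_rint (@measurable_rV_shift n a)
  (@leb_shift n a) (rint_mf fi)) fi).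
Qed.

Lemma cint_shift n (a : 'rV[R]_n) (f : 'rV[R]_n -> R[i]) :
  cint (leb R n) f -> cint (leb R n) (fun x => f (x + a)).
Proof.
by move=> [? ?]; split;
  [exact: (@rint_shift n a (fun x => complex.Re (f x)))
  |exact: (@rint_shift n a (fun x => complex.Im (f x)))].
Qed.

End LebesgueProduct.

(** * Integrability of polynomial weights *)

Section DecayIntegrable.
Variable R : realType.

Lemma rint_decay1 (q : R) : 1 < q ->
  rint (@lebesgue_measure R) (fun t : R => (1 + `|t|) `^ (- q)).
Proof.
move=> q1; pose f (t : R) := (1 + `|t|) `^ (- q).
have cf : continuous f.
  move=> t; apply: (@continuous_comp _ _ _ (fun t : R => 1 + `|t|) (fun y => y `^ (- q))).
    by apply: continuousD; [exact: cst_continuous|exact: norm_continuous].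
  have h : 0 < 1 + `|t| by rewrite ltr_wpDr.
  apply: differentiable_continuous; apply/derivable1_diffP.
  by apply: derivable_powR; rewrite in_itv/= andbT.
have mf : measurable_fun setT f by exact: continuous_measurable_fun.
have f0 x : 0 <= f x by exact: powR_ge0.
apply/integrableP; split; first exact/measurable_EFinP.
under eq_integral do rewrite /= ger0_norm ?f0//.
have ef : f =1 f \o -%R by move=> x; rewrite /= /f normrN.
rewrite (ge0_symfun_integralT f0 cf ef).
(* An antiderivative of the weight on the half-line, vanishing at infinity because [q > 1]; evenness
   has reduced the integral to that half-line. *)
pose F (x : R) := (1 - q)^-1 * (1 + x) `^ (1 - q).
have dF (x : R) : 0 < 1 + x -> is_derive x (1 : R) F ((1 + x) `^ (- q)).
  move=> x0; have h1 := is_derive1_powR (1 - q) x0.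
  have h2 : is_derive x (1 : R) (fun y : R => 1 + y) 1.
    by rewrite -[X in is_derive _ _ _ X]add0r; apply: (@is_deriveD _ _ _ (cst (1 : R)) id).
  have h3 := @is_derive1_comp _ _ (fun y : R => 1 + y) _ _ _ h1 h2.
  rewrite /F; apply: is_derive_eq.
  rewrite mulr1 addrAC subrr add0r scalerA.
  by rewrite /GRing.scale/= mulVf ?mul1r// subr_eq0 lt_eqF.
have -> : [set x : R | 0 <= x] = `[0, +oo[%classic by rewrite set_itvcy.
rewrite (@ge0_continuous_FTC2y _ f F 0 0)//.
- by rewrite -EFinB -EFinM ltry.
- exact: continuous_subspaceT.
- have q0 : 0 < q - 1 by rewrite subr_gt0.
  apply/cvgrPdist_le => /= e e0; near=> x.
  have x0 : 0 < 1 + x by rewrite addr_gt0//; near: x; exact: nbhs_pinfty_gt.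
  (* The threshold is the solution of [(1 + x) ^ (1 - q) / (q - 1) = e] in [1 + x]. *)
  have hx : (e * (q - 1))^-1 `^ (q - 1)^-1 <= 1 + x.
    by rewrite -lerBlDl; near: x; exact: nbhs_pinfty_ge.
  rewrite sub0r normrN /F normrM (ger0_norm (powR_ge0 _ _)) -(opprB q 1) invrN normrN.
  rewrite gtr0_norm ?invr_gt0// powRN ler_pdivrMl// -[leRHS]invrK mulrC.
  rewrite lef_pV2 ?posrE ?powR_gt0 ?invr_gt0 ?mulr_gt0//.
  have -> : (e * (q - 1))^-1 = ((e * (q - 1))^-1 `^ (q - 1)^-1) `^ (q - 1).
    by rewrite -powRrM mulVf ?powRr1 ?gt_eqF// invr_ge0 mulr_ge0// ltW.
  by apply: ge0_ler_powR; rewrite ?nnegrE ?powR_ge0// ltW.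
- by move=> x x0; apply: ex_derive; apply: dF; rewrite addr_gt0.
- apply: cvg_at_right_filter; apply: differentiable_continuous; apply/derivable1_diffP.
  by apply: ex_derive; apply: dF; rewrite addr0.
- move=> x; rewrite in_itv/= andbT => x0; rewrite derive1E.
  have := dF x; rewrite /f ger0_norm ?ltW// => h.
  by have /(@derive_val _ _ _ _ _ _ _) := h (addr_gt0 ltr01 x0).
Unshelve. all: by end_near. Qed.

Definition pdecay n (q : R) (x : 'rV[R]_n) : R := \prod_(i < n) (1 + `|x ord0 i|) `^ (- q).

Lemma rint_leb0 (b : 'rV[R]_0 -> R) : measurable_fun setT b -> rint (leb R 0) b.
Proof.
move=> mb; apply/integrableP; split; first exact/measurable_EFinP.
rewrite [X in (X < _)%E](_ : _ = \int[\d_ (const_mx 0%R : 'rV[R]_0)]_x `|(b x)%:E|)%E//.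
rewrite integral_dirac//; last by apply: measurableT_comp => //; exact/measurable_EFinP.
by rewrite diracT mul1e ltry.
Qed.

Lemma rint_cons n (a : R -> R) (b : 'rV[R]_n -> R) (f : 'rV[R]_n.+1 -> R) :
  (forall t v, f (rV_cons (t, v)) = a t * b v) ->
  rint (@lebesgue_measure R) a -> rint (leb R n) b -> measurable_fun setT f ->
  rint (leb R n.+1) f.
Proof.
move=> fab ia ib mf.
apply: (iffLR (@transport_rint R _ _ (measurableTypeR R * 'rV[R]_n)%type _
  (@rV_cons R n) (@measurable_rV_cons R n) (@lebesgue_measure R \x leb R n)%E
  (leb R n.+1) (fun A mA => erefl) f mf)).
apply: (@rint_prod R _ _ (measurableTypeR R) _ lebesgue_measure (leb R n) _
  (fun t v => `|a t| * `|b v|) (fun t => `|a t| * \int[leb R n]_v `|b v|)).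
- exact: measurableT_comp mf (@measurable_rV_cons R n).
- by move=> t v /=; rewrite fab normrM.
- by move=> t; apply: rintZ; exact: rint_abs.
- by move=> t; rewrite rIZ//; exact: rint_abs.
have := rintZ (\int[leb R n]_v `|b v|) (rint_abs ia).
by under eq_fun do rewrite mulrC.
Qed.

Lemma measurable_pdecay n q : measurable_fun setT (@pdecay n q).
Proof.
apply: measurable_prod => i _.
apply: (@measurableT_comp _ _ _ _ _ _ (fun y : R => (1 + `|y|) `^ (- q)) _ (@rV_coord R n i)).
  apply: (@measurableT_comp _ _ _ _ _ _ (fun y : R => y `^ (- q))).
    exact: measurable_powR.
  exact: measurable_funD.
exact: measurable_rV_coord.
Qed.

Lemma rint_pdecay n q : 1 < q -> rint (leb R n) (@pdecay n q).
Proof.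
move=> q1; elim: n => [|n IH]; first by apply: rint_leb0; exact: measurable_pdecay.
apply: (@rint_cons n (fun t => (1 + `|t|) `^ (- q)) (@pdecay n q)) => //.
- move=> t v; rewrite /pdecay big_ord_recl; congr (_ * _).
    rewrite (_ : rV_cons _ _ _ = t)//.
    by have := congr1 fst (@rV_consK R n (t, v)).
  apply: eq_bigr => i _; congr ((1 + `|_|) `^ _).
  rewrite -[RHS](congr1 (fun p : R * 'rV[R]_n => p.2 ord0 i) (@rV_consK R n (t, v))).
  by rewrite [RHS]mxE; congr (rV_cons _ _ _); apply/val_inj.
- exact: rint_decay1.
- exact: measurable_pdecay.
Qed.

Lemma measurable_jw_powR n r : measurable_fun setT (fun x : 'rV[R]_n => jw x `^ r).
Proof.
apply: (@measurableT_comp _ _ _ _ _ _ (fun y => y `^ r)); first exact: measurable_powR.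
by apply: continuous_mf => x; apply: continuousD; [exact: cst_continuous|exact: norm_continuous].
Qed.

(** Each [1 + |x_i|] is at most [jw x], so the weight lies below the product of the one-dimensional
    weights of exponent [s / n > 1]. *)
Lemma rint_decay n (s : R) : n%:R < s ->
  rint (leb R n) (fun x => jw x `^ (- s)).
Proof.
(* In dimension 0 the quotient [s / n] has no meaning, but there the measure is a point mass. *)
case: n => [|n] ns; first by apply: rint_leb0; exact: measurable_jw_powR.
pose q := s / n.+1%:R.
have q1 : 1 < q by rewrite ltr_pdivlMr// mul1r.
apply: rint_dom (rint_pdecay n.+1 q1); first exact: measurable_jw_powR.
move=> x; rewrite ger0_norm ?powR_ge0//.
have -> : jw x `^ (- s) = \prod_(i < n.+1) jw x `^ (- q).
  rewrite prodr_const card_ord -powR_mulrn ?powR_ge0// -powRrM mulNr; congr (_ `^ (- _)).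
  by rewrite /q divfK// pnatr_eq0.
apply: ler_prod => i _; rewrite powR_ge0/= !powRN lef_pV2 ?posrE ?jw_powR_gt0 ?powR_gt0 ?ltr_wpDr//.
apply: ge0_ler_powR; rewrite ?nnegrE ?jw_ge0 ?addr_ge0//; first lra.
by rewrite lerD2l rV_coord_le.
Qed.

End DecayIntegrable.

(** * Derivative bounds and Schwartz functions *)

Section RealDerivativeRules.
Variables (R : realType) (V : normedModType R).

Lemma is_derive_mulR (p q : V -> R) x v a b : is_derive x v p a -> is_derive x v q b ->
  is_derive x v (fun y => p y * q y) (a * q x + p x * b).
Proof.
move=> hp hq.
have h : is_derive x v (fun y => p y * q y) (p x *: b + q x *: a) := is_deriveM hp hq.
rewrite (_ : _ + _ = p x *: b + q x *: a)//.
by rewrite addrC /GRing.scale/= [a * _]mulrC.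
Qed.

Lemma is_derive_addR (p q : V -> R) x v a b : is_derive x v p a -> is_derive x v q b ->
  is_derive x v (fun y => p y + q y) (a + b).
Proof. exact: is_deriveD. Qed.

Lemma is_derive_subR (p q : V -> R) x v a b : is_derive x v p a -> is_derive x v q b ->
  is_derive x v (fun y => p y - q y) (a - b).
Proof. exact: is_deriveB. Qed.

End RealDerivativeRules.

Section DirectionalDerivative.
Variables (R : realType) (V : normedModType R).
Local Notation C := R[i].
Implicit Types (f g : V -> C) (x v : V).

Definition isD f x v (c : C) :=
  is_derive x v (fun y => complex.Re (f y)) (complex.Re c) /\
  is_derive x v (fun y => complex.Im (f y)) (complex.Im c).

Definition ccont f := continuous (fun y => complex.Re (f y)) /\
  continuous (fun y => complex.Im (f y)).

Lemma is_derive_line (p : V -> R) x v (a : R) :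
  is_derive x v p a <-> is_derive (0 : R) (1 : R) (fun t : R => p (t *: v + x)) a.
Proof.
have e : (fun h : R => h^-1 *: (((fun t : R => p (t *: v + x)) \o shift (0 : R)) (h *: (1 : R)) -
     p ((0 : R) *: v + x))) = (fun h : R => h^-1 *: ((p \o shift x) (h *: v) - p x)).
  by apply/funext => h /=; rewrite scale0r add0r addr0 /GRing.scale/= mulr1.
by split=> -[]; rewrite /derivable /derive => h1 h2; split;
  rewrite /derivable /derive ?e // -e.
Qed.

Lemma isD_line f x v c : isD f x v c <->
  is_derive (0 : R) (1 : R) (fun t : R => complex.Re (f (t *: v + x))) (complex.Re c) /\
  is_derive (0 : R) (1 : R) (fun t : R => complex.Im (f (t *: v + x))) (complex.Im c).
Proof. by rewrite /isD !is_derive_line. Qed.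

Lemma isD_cst (k : C) x v : isD (fun _ => k) x v 0.
Proof. by split; exact: is_derive_cst. Qed.

Lemma isDD f g x v a b : isD f x v a -> isD g x v b ->
  isD (fun y => f y + g y) x v (a + b).
Proof.
move=> [fr fi] [gr gi]; split; rewrite ?ReD ?ImD.
  by under eq_fun do rewrite ReD; exact: is_deriveD.
by under eq_fun do rewrite ImD; exact: is_deriveD.
Qed.

Lemma isDM f g x v a b : isD f x v a -> isD g x v b ->
  isD (fun y => f y * g y) x v (a * g x + f x * b).
Proof.
move=> [fr fi] [gr gi]; split.
  under eq_fun do rewrite ReM.
  have := is_derive_subR (is_derive_mulR fr gr) (is_derive_mulR fi gi).
  by congr is_derive; rewrite !ReImE; ring.
under eq_fun do rewrite ImM.
have := is_derive_addR (is_derive_mulR fr gi) (is_derive_mulR fi gr).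
by congr is_derive; rewrite !ReImE; ring.
Qed.

Lemma isD_conj f x v a : isD f x v a -> isD (fun y => conjc (f y)) x v (conjc a).
Proof.
move=> [fr fi]; split; rewrite ?ReJ ?ImJ.
  by under eq_fun do rewrite ReJ.
by under eq_fun do rewrite ImJ; exact: is_deriveN.
Qed.

Lemma isDZ (k : C) f x v a : isD f x v a -> isD (fun y => k * f y) x v (k * a).
Proof.
move=> h; have := isDM (isD_cst k x v) h.
by rewrite mul0r add0r.
Qed.

Lemma isDN f x v a : isD f x v a -> isD (fun y => - f y) x v (- a).
Proof.
by move=> /(isDZ (-1)); under eq_fun do rewrite mulN1r; rewrite mulN1r.
Qed.

Lemma isDB f g x v a b : isD f x v a -> isD g x v b ->
  isD (fun y => f y - g y) x v (a - b).
Proof. by move=> hf hg; apply: isDD => //; exact: isDN. Qed.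

Lemma isD_real (p : V -> R) x v a : is_derive x v p a ->
  isD (fun y => ((p y)%:C)%C) x v (a%:C)%C.
Proof. by move=> h; split => //=; exact: is_derive_cst. Qed.

Lemma isD_shift f (a : V) x v c : isD f (x + a) v c ->
  isD (fun y => f (y + a)) x v c.
Proof.
move=> /isD_line[h1 h2]; apply/isD_line; split.
  by under eq_fun do rewrite -addrA.
by under eq_fun do rewrite -addrA.
Qed.

Lemma isD_unique f x v a b : isD f x v a -> isD f x v b -> a = b.
Proof.
by move=> [[_ h1] [_ h2]] [[_ h3] [_ h4]]; apply: complex_ext; rewrite -?h1 -?h2.
Qed.

Definition cexp (z : C) : C := Complex
  (expR (complex.Re z) * cos (complex.Im z)) (expR (complex.Re z) * sin (complex.Im z)).

Lemma cabs_cexp z : cabs (cexp z) = expR (complex.Re z).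
Proof.
rewrite cabsE /= !exprMn -mulrDr cos2Dsin2 mulr1 sqrtr_sqr ger0_norm// expR_ge0.
Qed.

Lemma cexpD z w : cexp (z + w) = cexp z * cexp w.
Proof.
by apply: complex_ext; rewrite ?ReM ?ImM /= ReD ImD expRD ?cosD ?sinD; ring.
Qed.

Lemma cexpJ z : conjc (cexp z) = cexp (conjc z).
Proof. by apply: complex_ext; rewrite ReImE /= ReJ ImJ ?cosN ?sinN ?mulrN. Qed.

Lemma cexp0 : cexp 0 = 1.
Proof. by apply: complex_ext; rewrite /= expR0 ?cos0 ?sin0 ?mulr1 ?mulr0. Qed.

Lemma expi2pi_cexp (t : R) : expi2pi t = cexp (Complex 0 (2 * pi * t)).
Proof. by rewrite /cexp/= expR0 !mul1r. Qed.

Lemma isD_cexp f x v a : isD f x v a -> isD (fun y => cexp (f y)) x v (a * cexp (f x)).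
Proof.
move=> /isD_line[h1 h2]; apply/isD_line.
have h3 := is_derive1_comp (is_derive_expR (complex.Re (f ((0 : R) *: v + x)))) h1.
have h4 := is_derive1_comp (is_derive_cos (complex.Im (f ((0 : R) *: v + x)))) h2.
have h5 := is_derive1_comp (is_derive_sin (complex.Im (f ((0 : R) *: v + x)))) h2.
split.
  have := is_derive_mulR h3 h4.
  by congr is_derive; rewrite /= scale0r add0r ReM/=; ring.
have := is_derive_mulR h3 h5.
by congr is_derive; rewrite /= scale0r add0r ImM/=; ring.
Qed.

Lemma ccont_cst (k : C) : ccont (fun _ : V => k).
Proof. by split=> x; exact: cvg_cst. Qed.

Lemma ccontD f g : ccont f -> ccont g -> ccont (fun y => f y + g y).
Proof.
move=> [fr fi] [gr gi]; split => x.
  under eq_fun do rewrite ReD; exact: continuousD (fr x) (gr x).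
under eq_fun do rewrite ImD; exact: continuousD (fi x) (gi x).
Qed.

Lemma ccontM f g : ccont f -> ccont g -> ccont (fun y => f y * g y).
Proof.
move=> [fr fi] [gr gi]; split => x.
  under eq_fun do rewrite ReM.
  exact: continuousB (continuousM (fr x) (gr x)) (continuousM (fi x) (gi x)).
under eq_fun do rewrite ImM.
exact: continuousD (continuousM (fr x) (gi x)) (continuousM (fi x) (gr x)).
Qed.

Lemma ccont_conj f : ccont f -> ccont (fun y => conjc (f y)).
Proof.
move=> [fr fi]; split => x; first by under eq_fun do rewrite ReJ; exact: fr.
by under eq_fun do rewrite ImJ; exact: continuousN (fi x).
Qed.

Lemma ccont_shift f (a : V) : ccont f -> ccont (fun y => f (y + a)).
Proof.
have ca : continuous (fun y : V => y + a).
  by move=> x; apply: continuousD; [exact: (fun _ => id)|exact: cst_continuous].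
by move=> [fr fi]; split => x;
  [exact: (continuous_comp (ca x) (fr _))|exact: (continuous_comp (ca x) (fi _))].
Qed.

Lemma ccont_cexp f : ccont f -> ccont (fun y => cexp (f y)).
Proof.
move=> [fr fi]; split => x /=.
  exact: continuousM (continuous_comp (fr x) (@continuous_expR R _))
    (continuous_comp (fi x) (@continuous_cos R _)).
exact: continuousM (continuous_comp (fr x) (@continuous_expR R _))
  (continuous_comp (fi x) (@continuous_sin R _)).
Qed.

Lemma ccont_real (p : V -> R) : continuous p -> ccont (fun y => ((p y)%:C)%C).
Proof. by move=> cp; split => // x; exact: cvg_cst. Qed.

End DirectionalDerivative.

Section SmoothBounds.
Variables (R : realType) (n : nat).
Local Notation V := 'rV[R]_n.
Local Notation C := R[i].
Implicit Types (f g : V -> C) (B P : V -> R).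

Definition ee (i : 'I_n) : V := delta_mx ord0 i.

(** All derivatives of order at most [N] share the majorant [B]. The recursion supplies each
    derivative as a witness, so that products, exponentials and integrals are treated by induction
    on [N] rather than by multi-index formulas. *)
Fixpoint SB (N : nat) f B : Prop :=
  [/\ ccont f, forall x, cabs (f x) <= B x &
    if N is N'.+1 then
      forall i, exists g, (forall x, isD f x (ee i) (g x)) /\ SB N' g B
    else True].

Lemma SB_cont N f B : SB N f B -> ccont f. Proof. by case: N => [|N] []. Qed.

Lemma SB_bound N f B x : SB N f B -> cabs (f x) <= B x.
Proof. by case: N => [|N] []. Qed.

Lemma SB_ge0 N f B x : SB N f B -> 0 <= B x.
Proof. by move=> /SB_bound h; exact: le_trans (cabs_ge0 _) (h x). Qed.

Lemma SB_le N f B B' : (forall x, B x <= B' x) -> SB N f B -> SB N f B'.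
Proof.
move=> BB; elim: N f => [|N IH] f [cf fb h]; split => //.
- by move=> x; exact: le_trans (fb x) (BB x).
- by move=> x; exact: le_trans (fb x) (BB x).
by move=> i; have [g [dg sg]] := h i; exists g; split => //; exact: IH.
Qed.

Lemma SB_pred N f B : SB N.+1 f B -> SB N f B.
Proof.
elim: N f => [|N IH] f [cf fb h]; split => // i.
by have [g [dg sg]] := h i; exists g; split => //; exact: IH.
Qed.

Lemma SB_sub N M f B : (N <= M)%N -> SB M f B -> SB N f B.
Proof.
move=> /subnK <-; elim: (M - N)%N => // k IH; rewrite addSn => /SB_pred; exact: IH.
Qed.

Lemma SB_deriv N f g B i : SB N.+1 f B -> (forall x, isD f x (ee i) (g x)) -> SB N g B.
Proof.
move=> [_ _ h] dg; have [g' [dg' sg']] := h i.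
by rewrite (_ : g = g')//; apply/funext => x; exact: isD_unique (dg x) (dg' x).
Qed.

Lemma SB_cst N (k : C) : SB N (fun _ => k) (fun _ => cabs k).
Proof.
elim: N k => [|N IH] k; split => //; try exact: ccont_cst.
move=> i; exists (fun _ => 0); split => [x|]; first exact: isD_cst.
by apply: SB_le (IH 0) => x; rewrite cabs0 cabs_ge0.
Qed.

Lemma SB_add N f g B B' : SB N f B -> SB N g B' ->
  SB N (fun x => f x + g x) (fun x => B x + B' x).
Proof.
elim: N f g => [|N IH] f g [cf fb hf] [cg gb hg]; split => //.
- exact: ccontD.
- by move=> x; rewrite (le_trans (cabsD _ _))// lerD.
- exact: ccontD.
- by move=> x; rewrite (le_trans (cabsD _ _))// lerD.
move=> i; have [f' [df sf]] := hf i; have [g' [dg sg]] := hg i.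
exists (fun x => f' x + g' x); split => [x|]; first exact: isDD.
exact: IH.
Qed.

(** By Leibniz each differentiation turns one product into two, whence the factor [2 ^+ N]. *)
Lemma SB_mul N f g B B' : SB N f B -> SB N g B' ->
  SB N (fun x => f x * g x) (fun x => 2 ^+ N * (B x * B' x)).
Proof.
elim: N f g => [|N IH] f g sf0 sg0.
  split => //; first exact: ccontM (SB_cont sf0) (SB_cont sg0).
  by move=> x; rewrite mul1r cabsM ler_pM ?cabs_ge0// (SB_bound _ sf0, SB_bound _ sg0).
have B0 x := SB_ge0 x sf0; have B0' x := SB_ge0 x sg0.
split; first exact: ccontM (SB_cont sf0) (SB_cont sg0).
  move=> x; apply: (@le_trans _ _ (B x * B' x)).
    by rewrite cabsM ler_pM ?cabs_ge0// (SB_bound _ sf0, SB_bound _ sg0).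
  by rewrite ler_peMl ?mulr_ge0// exprn_ege1// ler1n.
move=> i; have [_ _ /(_ i)[f' [df sf]]] := sf0; have [_ _ /(_ i)[g' [dg sg]]] := sg0.
exists (fun x => f' x * g x + f x * g' x); split => [x|]; first exact: isDM.
have := SB_add (IH _ _ sf (SB_pred sg0)) (IH _ _ (SB_pred sf0) sg).
by apply: SB_le => x; rewrite exprS -mulrA [2 * _]mulr_natl mulr2n.
Qed.

Lemma SB_scale N (k : C) f B : SB N f B -> SB N (fun x => k * f x) (fun x => cabs k * B x).
Proof.
elim: N f => [|N IH] f [cf fb h]; have cc := ccontM (ccont_cst _ k) cf; split => //.
- by move=> x; rewrite cabsM ler_wpM2l ?cabs_ge0.
- by move=> x; rewrite cabsM ler_wpM2l ?cabs_ge0.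
move=> i; have [g [dg sg]] := h i; exists (fun x => k * g x).
by split=> [x|]; [exact: isDZ|exact: IH].
Qed.

Lemma SB_conj N f B : SB N f B -> SB N (fun x => conjc (f x)) B.
Proof.
elim: N f => [|N IH] f [cf fb h]; split => //; try exact: ccont_conj.
- by move=> x; rewrite cabsJ.
- by move=> x; rewrite cabsJ.
move=> i; have [g [dg sg]] := h i; exists (fun x => conjc (g x)).
by split=> [x|]; [exact: isD_conj|exact: IH].
Qed.

Lemma SB_shift N f B (a : V) : SB N f B -> SB N (fun x => f (x + a)) (fun x => B (x + a)).
Proof.
elim: N f => [|N IH] f [cf fb h]; split => //; try exact: ccont_shift.
move=> i; have [g [dg sg]] := h i; exists (fun x => g (x + a)).
by split=> [x|]; [exact: isD_shift|exact: IH].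
Qed.

(* The derivatives of [exp Q] are polynomials in those of [Q], times [exp Q]. *)
Lemma SB_cexp N : exists2 K : R, 0 < K & forall (Q : V -> C) (Q' : 'I_n -> V -> C) P,
  ccont Q -> (forall i x, isD Q x (ee i) (Q' i x)) ->
  (forall x, 1 <= P x) -> (forall i, SB N (Q' i) P) ->
  SB N (fun x => cexp (Q x)) (fun x => K * (P x ^+ N * expR (complex.Re (Q x)))).
Proof.
elim: N => [|N [K K0 IH]].
  exists 1 => // Q Q' P cQ _ P1 _; split => //; first exact: ccont_cexp.
  by move=> x; rewrite cabs_cexp !mul1r.
exists (2 ^+ N * K); first by rewrite mulr_gt0// exprn_gt0.
move=> Q Q' P cQ dQ P1 sQ.
have h x : K * (P x ^+ N * expR (complex.Re (Q x))) <=
    2 ^+ N * (P x * (K * (P x ^+ N * expR (complex.Re (Q x))))).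
  rewrite [leRHS]mulrA ler_peMl//.
    by rewrite !mulr_ge0 ?expR_ge0 ?exprn_ge0 ?ltW// (lt_le_trans ltr01).
  by rewrite (le_trans (P1 x))// ler_peMl ?(le_trans ler01)// exprn_ege1// ler1n.
have s1 := IH Q Q' P cQ dQ P1 (fun i => SB_pred (sQ i)).
split; first exact: ccont_cexp.
  move=> x; rewrite (le_trans (SB_bound x s1))// (le_trans (h x))//.
  by rewrite exprS le_eqVlt; apply/orP; left; apply/eqP; ring.
move=> i; exists (fun x => Q' i x * cexp (Q x)); split => [x|]; first exact: isD_cexp.
have := SB_mul (SB_pred (sQ i)) s1.
by apply: SB_le => x; rewrite exprS le_eqVlt; apply/orP; left; apply/eqP; ring.
Qed.

Lemma is_derive_coord i j x :
  is_derive x (ee i) (fun y : V => y ord0 j) (j == i)%:R.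
Proof.
apply/is_derive_line.
have -> : (fun t : R => (t *: ee i + x) ord0 j) = (fun t : R => (j == i)%:R * t + x ord0 j).
  by apply/funext => t; rewrite !mxE eqxx/= mulrC.
have h : is_derive (0 : R) (1 : R) (fun t : R => (j == i)%:R * t) ((j == i)%:R * 1).
  have := is_derive_mulR (is_derive_cst ((j == i)%:R : R) (0 : R) (1 : R)) (is_derive_id (0 : R) (1 : R)).
  by rewrite mul0r add0r.
have := is_derive_addR h (is_derive_cst (x ord0 j : R) (0 : R) (1 : R)).
by rewrite addr0 mulr1.
Qed.

Lemma continuous_coord j : continuous (fun y : V => y ord0 j).
Proof. by move=> x; exact: coord_continuous. Qed.

Lemma SB_coord N j : SB N (fun y : V => ((y ord0 j)%:C)%C) (@jw R n).
Proof.
have c : ccont (fun y : V => ((y ord0 j)%:C)%C) by apply: ccont_real; exact: continuous_coord.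
have b (x : V) : cabs ((x ord0 j)%:C)%C <= jw x.
  by rewrite cabs_real (le_trans (rV_coord_le x j))// lerDr.
case: N => [|N]; split => // i.
exists (fun _ => (((j == i)%:R : R)%:C)%C); split.
  by move=> x; apply: isD_real; exact: is_derive_coord.
apply: SB_le (SB_cst _ _) => x; rewrite cabs_real ger0_norm// (le_trans _ (jw_ge1 x))//.
by case: (j == i).
Qed.

Lemma is_derive_dot (a : V) i x : is_derive x (ee i) (fun y => dot y a) (a ord0 i).
Proof.
have h : is_derive x (ee i) (\sum_(j < n) (fun y : V => y ord0 j * a ord0 j))
    (\sum_(j < n) ((j == i)%:R * a ord0 j)).
  apply: is_derive_sum => j.
  have := is_derive_mulR (is_derive_coord i j x) (is_derive_cst (a ord0 j : R) x (ee i)).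
  by rewrite mulr0 addr0.
move: h; rewrite (_ : \sum_(j < n) _ = fun y => dot y a); last first.
  by apply/funext => y; rewrite /dot fct_sumE.
by rewrite (bigD1 i)//= eqxx mul1r big1 ?addr0// => j /negPf ->; rewrite mul0r.
Qed.

Lemma continuous_dot (a : V) : continuous (fun y => dot y a).
Proof.
rewrite (_ : (fun y => dot y a) = \sum_(j < n) (fun y : V => y ord0 j * a ord0 j)); last first.
  by apply/funext => y; rewrite /dot fct_sumE.
elim/big_ind : _ => [x|f g cf cg x|j _ x]; first exact: cst_continuous.
  exact: continuousD (cf x) (cg x).
exact: continuousM (@continuous_coord j x) (@cst_continuous _ _ (a ord0 j) x).
Qed.

Lemma le_dot (x y : V) : `|dot x y| <= n%:R * (`|x| * `|y|).
Proof.
rewrite /dot (le_trans (ler_norm_sum _ _ _))//.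
apply: (@le_trans _ _ (\sum_(i < n) `|x| * `|y|)).
  by apply: ler_sum => i _; rewrite normrM ler_pM ?rV_coord_le.
by rewrite sumr_const card_ord mulr_natl.
Qed.

(** One-dimensional mean value theorem on each edge of a staircase path from [x] to [y]. Only
    partial derivatives are used, and in the sup norm the path stays within [|y - x|] of [x]. *)
Lemma mvt_coord (p : V -> R) (g : 'I_n -> V -> R) (x y : V) :
  (forall i z, is_derive z (ee i) p (g i z)) ->
  exists xi : 'I_n -> V, (forall k, `|xi k - x| <= `|y - x|) /\
    p y - p x = \sum_k g k (xi k) * (y ord0 k - x ord0 k).
Proof.
move=> dp.
(* The [k]-th corner of the staircase: the first [k] coordinates are already those of [y]. *)
pose mix (k : nat) : V := \row_i (if (i < k)%N then y ord0 i else x ord0 i).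
have mix0 : mix 0%N = x by apply/rowP => i; rewrite mxE.
have mixn : mix n = y by apply/rowP => i; rewrite mxE ltn_ord.
have mixS (k : 'I_n) : mix k.+1 = (y ord0 k - x ord0 k) *: ee k + mix k.
  apply/rowP => i; rewrite !mxE eqxx/= ltnS leq_eqVlt val_eqE.
  have [->|ik] := eqVneq i k; first by rewrite ltnn mulr1 subrK.
  by rewrite mulr0 add0r.
have step (k : 'I_n) : exists z, `|z - x| <= `|y - x| /\
    p (mix k.+1) - p (mix k) = g k z * (y ord0 k - x ord0 k).
  pose d := y ord0 k - x ord0 k.
  pose psi (t : R) := p ((t * d) *: ee k + mix k).
  have dpsi (t : R) : is_derive t (1 : R) psi (g k ((t * d) *: ee k + mix k) * d).
    have /is_derive_line h := dp k ((t * d) *: ee k + mix k).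
    have h2 : is_derive (0 : R) (1 : R) (fun s : R => d * s) (d * 1).
      have := is_derive_mulR (is_derive_cst (d : R) (0 : R) (1 : R)) (is_derive_id (0 : R) (1 : R)).
      by rewrite mul0r add0r.
    have h' : is_derive (d * 0) (1 : R) (fun s : R => p (s *: ee k + ((t * d) *: ee k + mix k)))
        (g k ((t * d) *: ee k + mix k)) by rewrite mulr0.
    have h3 := @is_derive1_comp _ _ (fun s : R => d * s) _ _ _ h' h2.
    apply/is_derive_line; move: h3; rewrite mulr1.
    congr is_derive; apply/funext => s; rewrite /psi /=; congr p.
    by rewrite addrA -scalerDl; congr (_ *: _ + _); rewrite /GRing.scale/=; ring.
  have [c c01 hc] : exists2 c, c \in `]0, 1[%R & psi 1 - psi 0 = (g k ((c * d) *: ee k + mix k) * d) * (1 - 0).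
    apply: (@MVT R psi (fun t => g k ((t * d) *: ee k + mix k) * d)) => //.
    apply: continuous_subspaceT => t.
    by apply/differentiable_continuous/derivable1_diffP; apply: ex_derive.
  exists ((c * d) *: ee k + mix k); split.
    apply: rV_norm_le => // i; rewrite !mxE eqxx/=.
    move: c01; rewrite in_itv/= => /andP[c0 c1].
    have hi : `|y ord0 i - x ord0 i| <= `|y - x|.
      by have := rV_coord_le (y - x) i; rewrite !mxE.
    have [ik|ik] := eqVneq i k.
      rewrite ik ltnn mulr1 addrK normrM -/d.
      rewrite ik -/d in hi; apply: le_trans hi.
      by rewrite ler_piMl// gtr0_norm// ltW.
    rewrite mulr0 add0r; case: ifP => // _.
    by rewrite subrr normr0.
  move: hc; rewrite /psi subr0 mulr1 mul1r mul0r scale0r add0r => <-.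
  by rewrite mixS.
have [xi hxi] := choice step.
exists xi; split=> [k|]; first by have [] := hxi k.
rewrite -{1}mixn -{1}mix0 -(telescope_sumr (fun k => p (mix k)) (leq0n n)).
by rewrite big_mkord; apply: eq_bigr => k _; have [_ ->] := hxi k.
Qed.

Lemma lipschitz_coord (p : V -> R) (g : 'I_n -> V -> R) (K : R) (x y : V) :
  (forall i z, is_derive z (ee i) p (g i z)) ->
  (forall i z, `|z - x| <= `|y - x| -> `|g i z| <= K) ->
  `|p y - p x| <= n%:R * K * `|y - x|.
Proof.
move=> dp gK; have [xi [hxi ->]] := mvt_coord x y dp.
rewrite (le_trans (ler_norm_sum _ _ _))//.
apply: (@le_trans _ _ (\sum_(i < n) K * `|y - x|)).
  apply: ler_sum => i _; rewrite normrM ler_pM//; first exact: gK.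
  by have := rV_coord_le (y - x) i; rewrite !mxE.
by rewrite sumr_const card_ord -mulrA [leRHS]mulr_natl.
Qed.

Lemma clipschitz (f : V -> C) (g : 'I_n -> V -> C) (K : R) (x y : V) :
  (forall i z, isD f z (ee i) (g i z)) ->
  (forall i z, `|z - x| <= `|y - x| -> cabs (g i z) <= K) ->
  cabs (f y - f x) <= 2 * n%:R * K * `|y - x|.
Proof.
move=> df gK; rewrite (le_trans (cabs_le_ReIm _))//.
have h1 := @lipschitz_coord (fun z => complex.Re (f z)) (fun i z => complex.Re (g i z)) K x y
  (fun i z => (df i z).1) (fun i z h => le_trans (Re_le_cabs _) (gK i z h)).
have h2 := @lipschitz_coord (fun z => complex.Im (f z)) (fun i z => complex.Im (g i z)) K x y
  (fun i z => (df i z).2) (fun i z h => le_trans (Im_le_cabs _) (gK i z h)).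
by rewrite ReB ImB -!mulrA mulr_natl mulr2n mulrA lerD.
Qed.

End SmoothBounds.

Arguments ee {R n} i.

Section SchwartzBounds.
Variables (R : realType) (n : nat).
Local Notation V := 'rV[R]_n.
Local Notation C := R[i].
Implicit Types (f g : V -> C) (B : V -> R).

Lemma cpderiv_nil f : cpderiv [::] f = f.
Proof. by apply/funext => x; rewrite /cpderiv/=; case: (f x). Qed.

Lemma cpderiv_rcons a i f : cpderiv (rcons a i) f = cpderiv a (cpderiv [:: i] f).
Proof.
apply/funext => x; rewrite /cpderiv /pderiv !foldr_rcons /=.
by [].
Qed.

Lemma isD_cpderiv f g i : (forall x, isD f x (ee i) (g x)) -> cpderiv [:: i] f = g.
Proof.
move=> h; apply/funext => x; have [[_ h1] [_ h2]] := h x.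
by apply: complex_ext; rewrite /= -?h1 -?h2.
Qed.

Lemma csmooth_isD f i x : csmooth f -> isD f x (ee i) (cpderiv [:: i] f x).
Proof.
by move=> [/(_ [::])[_ h1] /(_ [::])[_ h2]]; split; apply: derivableP; [exact: h1|exact: h2].
Qed.

Lemma csmooth_cpderiv f i : csmooth f -> csmooth (cpderiv [:: i] f).
Proof.
by move=> [h1 h2]; split=> a; [have := h1 (rcons a i)|have := h2 (rcons a i)];
  rewrite /pderiv foldr_rcons.
Qed.

Lemma SB_of_csmooth N f B : csmooth f ->
  (forall a x, (size a <= N)%N -> cabs (cpderiv a f x) <= B x) -> SB N f B.
Proof.
elim: N f => [|N IH] f sf fB; (split; first by
  have [/(_ [::])[h1 _] /(_ [::])[h2 _]] := sf; split).
- by move=> x; have := fB [::] x isT; rewrite cpderiv_nil.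
- by [].
- by move=> x; have := fB [::] x isT; rewrite cpderiv_nil.
move=> i; exists (cpderiv [:: i] f); split=> [x|]; first exact: csmooth_isD.
apply: IH; first exact: csmooth_cpderiv.
by move=> a x ha; rewrite -cpderiv_rcons; apply: fB; rewrite size_rcons.
Qed.

Lemma SB_cpderiv N f B a x : SB N f B -> (size a <= N)%N -> cabs (cpderiv a f x) <= B x.
Proof.
elim/last_ind: a N f => [|a i IH] N f.
  by move=> sf _; rewrite cpderiv_nil; exact: SB_bound sf.
case: N => [|N]; first by rewrite size_rcons.
rewrite size_rcons ltnS => -[_ _ /(_ i)[g [dg sg]]] aN.
by rewrite cpderiv_rcons (isD_cpderiv dg); exact: IH sg aN.
Qed.

Lemma csmooth_SB f : (forall N, exists B, SB N f B) -> csmooth f.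
Proof.
move=> h.
suff key a N f' B : SB N f' B -> (size a < N)%N ->
    ccont (cpderiv a f') /\ forall i x, exists c, isD (cpderiv a f') x (ee i) c.
  split=> a; have [B sf] := h (size a).+1; have [[c1 c2] d] := key a _ _ _ sf (ltnSn _).
    by split=> // i x; have [c [[h1 _] _]] := d i x.
  by split=> // i x; have [c [_ [h1 _]]] := d i x.
elim/last_ind: a N f' => [|a i IH] [//|N] f' sf.
  rewrite cpderiv_nil => _; split; first exact: SB_cont sf.
  by move=> i x; have [_ _ /(_ i)[g [dg _]]] := sf; exists (g x).
rewrite size_rcons ltnS; case: sf => _ _ /(_ i)[g [dg sg]] aN.
by rewrite cpderiv_rcons (isD_cpderiv dg); exact: IH sg aN.
Qed.

Lemma dot_ge0 (x : V) : 0 <= dot x x.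
Proof. by apply: sumr_ge0 => i _; rewrite -expr2 sqr_ge0. Qed.

Lemma japanese_gt0 (x : V) : 0 < japanese x.
Proof. by rewrite sqrtr_gt0 ltr_pwDl// dot_ge0. Qed.

Lemma japanese_sq (x : V) : japanese x ^+ 2 = 1 + dot x x.
Proof. by rewrite sqr_sqrtr// addr_ge0// dot_ge0. Qed.

Lemma japanese_le (x : V) : japanese x <= n.+1%:R * jw x.
Proof.
rewrite -(@ler_pXn2r _ 2%N) ?nnegrE ?mulr_ge0 ?jw_ge0 ?(ltW (japanese_gt0 x))//.
rewrite japanese_sq exprMn.
have h := le_trans (ler_norm _) (le_dot x x); have j1 := jw_ge1 x.
apply: (@le_trans _ _ (n.+1%:R * jw x ^+ 2)).
  rewrite -natr1 mulrDl mul1r addrC lerD//.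
    apply: le_trans h _; rewrite ler_wpM2l// -expr2 lerXn2r ?nnegrE ?jw_ge0//.
    by rewrite lerDr.
  exact: exprn_ege1.
by rewrite ler_wpM2r ?exprn_ge0 ?jw_ge0// expr2 ler_peMl// ler1n.
Qed.

Lemma jw_le_japanese (x : V) : jw x <= 2 * japanese x.
Proof.
have h : `|x| <= japanese x.
  apply: rV_norm_le => [|i]; first exact: ltW (japanese_gt0 x).
  rewrite -(@ler_pXn2r _ 2%N) ?nnegrE ?(ltW (japanese_gt0 x))// japanese_sq.
  rewrite real_normK ?num_real// /dot (bigD1 i)//= -expr2 addrCA lerDl addr_ge0//.
  by apply: sumr_ge0 => j _; rewrite -expr2 sqr_ge0.
have h1 : 1 <= japanese x.
  rewrite -(@ler_pXn2r _ 2%N) ?nnegrE ?(ltW (japanese_gt0 x))// japanese_sq expr1n.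
  by rewrite lerDl dot_ge0.
by rewrite mulr_natl mulr2n lerD.
Qed.

(** A Schwartz seminorm bound in which the number of derivatives and the (real) order of decay are
    independent. *)
Definition rapid N (r M : R) f := SB N f (fun x => M * jw x `^ (- r)).

Lemma rapid_ge0 N r M f : rapid N r M f -> 0 <= M.
Proof.
by move=> /(SB_ge0 0) h; rewrite -(pmulr_lge0 _ (jw_powR_gt0 (0 : V) (- r))).
Qed.

Lemma rapid_sub N N' r r' M M' f : (N <= N')%N -> r <= r' -> M' <= M ->
  rapid N' r' M' f -> rapid N r M f.
Proof.
move=> NN rr MM h; have M0 := rapid_ge0 h; apply: SB_sub NN _; apply: SB_le h => x.
apply: ler_pM => //; first exact: powR_ge0.
by apply: jw_powR_le; rewrite lerN2.
Qed.

Lemma schwartz_le_rapid_of K M f : schwartz f -> schwartz_le K M f ->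
  0 <= M /\ rapid K K%:R (2 ^+ K * M) f.
Proof.
move=> [sf _] hM; have M0 : 0 <= M.
  apply: le_trans (hM [::] 0 isT).
  by rewrite mulr_ge0 ?cabs_ge0 ?exprn_ge0// ltW// japanese_gt0.
split=> //; apply: SB_of_csmooth => // a x aK.
apply: (@le_trans _ _ (M * (japanese x ^+ K)^-1)).
  by rewrite ler_pdivlMr ?exprn_gt0 ?japanese_gt0// mulrC; exact: hM.
rewrite powR_invn ?jw_ge0// [2 ^+ K * M]mulrC -mulrA ler_wpM2l//.
rewrite ler_pdivlMr ?exprn_gt0 ?jw_gt0// mulrC ler_pdivrMr ?exprn_gt0 ?japanese_gt0//.
by rewrite -exprMn lerXn2r ?nnegrE ?jw_ge0 ?mulr_ge0 ?(ltW (japanese_gt0 x))// jw_le_japanese.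
Qed.

Lemma schwartz_rapid f N r : schwartz f -> exists M, rapid N r M f.
Proof.
move=> sf; pose K := maxn N (Num.truncn `|r|).+1.
have [M /(schwartz_le_rapid_of sf)[M0 hM]] := sf.2 K; exists (2 ^+ K * M).
apply: (rapid_sub _ _ (lexx _) hM); first exact: leq_maxl.
by rewrite (le_trans (ler_norm r))// (le_trans (ltW (truncnS_gt _)))// ler_nat leq_maxr.
Qed.

Lemma schwartz_le_rapid f N M : rapid N N%:R M f -> schwartz_le N (n.+1%:R ^+ N * M) f.
Proof.
move=> h a x aN; have M0 := rapid_ge0 h.
have hb := SB_cpderiv x h aN.
apply: (@le_trans _ _ ((n.+1%:R * jw x) ^+ N * (M * jw x `^ (- N%:R)))).
  apply: ler_pM => //; rewrite ?cabs_ge0 ?exprn_ge0 ?(ltW (japanese_gt0 x))//.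
  by rewrite lerXn2r ?nnegrE ?jw_ge0 ?mulr_ge0 ?jw_ge0 ?(ltW (japanese_gt0 x))// japanese_le.
rewrite exprMn powR_invn ?jw_ge0// -mulrA ler_wpM2l ?exprn_ge0//.
by rewrite mulrCA divff ?mulr1// expf_neq0// gt_eqF// jw_gt0.
Qed.

Lemma schwartz_of_rapid f : (forall N r, exists M, rapid N r M f) -> schwartz f.
Proof.
move=> h; split.
  by apply: csmooth_SB => N; have [M hM] := h N 0; exists (fun x => M * jw x `^ (- 0)).
by move=> N; have [M hM] := h N N%:R; exists (n.+1%:R ^+ N * M); exact: schwartz_le_rapid.
Qed.

Lemma tempered_rapid (u : (V -> C) -> C) : tempered u ->
  exists K N, 0 <= K /\ forall f M, schwartz f -> rapid N N%:R M f -> cabs (u f) <= K * M.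
Proof.
move=> [_ [K [N h]]]; exists (`|K| * n.+1%:R ^+ N), N; split.
  by rewrite mulr_ge0 ?exprn_ge0.
move=> f M sf hf; have M0 := rapid_ge0 hf.
rewrite (le_trans (h _ _ sf (schwartz_le_rapid hf)))// -mulrA ler_wpM2r ?ler_norm//.
by rewrite mulr_ge0// exprn_ge0.
Qed.

End SchwartzBounds.

(** * Fourier transform and Gaussians *)

Section Characters.
Variable R : realType.
Local Notation C := R[i].

Definition I2pi : C := Complex 0 (2 * pi).

Lemma expi2piE (t : R) : expi2pi t = cexp (I2pi * (t%:C)%C).
Proof.
by rewrite expi2pi_cexp; congr cexp; apply: complex_ext; rewrite !ReImE/=; ring.
Qed.

Lemma expi2piD (s t : R) : expi2pi (s + t) = expi2pi s * expi2pi t.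
Proof. by rewrite !expi2piE -cexpD; congr cexp; rewrite rmorphD mulrDr. Qed.

Lemma expi2pi0 : expi2pi (0 : R) = 1.
Proof. by rewrite expi2piE rmorph0 mulr0 cexp0. Qed.

Lemma cabs_expi2pi (t : R) : cabs (expi2pi t) = 1.
Proof. by rewrite expi2pi_cexp cabs_cexp/= expR0. Qed.

Lemma expi2piJ (t : R) : conjc (expi2pi t) = expi2pi (- t).
Proof.
by rewrite !expi2pi_cexp cexpJ; congr cexp; rewrite /= mulrN.
Qed.

Lemma expi2piNl (t : R) : expi2pi (- t) * expi2pi t = 1.
Proof. by rewrite -expi2piD addNr expi2pi0. Qed.

Lemma cabs_I2pi : cabs I2pi = 2 * pi.
Proof. by rewrite cabsE/= expr0n/= add0r sqrtr_sqr ger0_norm// mulr_ge0// pi_ge0. Qed.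

Variable n : nat.
Local Notation V := 'rV[R]_n.

Lemma isD_dot (a : V) i x :
  isD (fun t : V => I2pi * ((dot t a)%:C)%C) x (ee i) (I2pi * ((a ord0 i)%:C)%C).
Proof. by apply/isDZ/isD_real; exact: is_derive_dot. Qed.

Lemma ccont_dot (a : V) : ccont (fun t : V => I2pi * ((dot t a)%:C)%C).
Proof. by apply: ccontM; [exact: ccont_cst|apply: ccont_real; exact: continuous_dot]. Qed.

Lemma isD_chi (a : V) i x : isD (fun t : V => expi2pi (dot t a)) x (ee i)
  (I2pi * ((a ord0 i)%:C)%C * expi2pi (dot x a)).
Proof.
under eq_fun do rewrite expi2piE.
rewrite expi2piE; apply: isD_cexp; exact: isD_dot.
Qed.

Lemma ccont_chi (a : V) : ccont (fun t : V => expi2pi (dot t a)).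
Proof.
under eq_fun do rewrite expi2piE.
by apply: ccont_cexp; exact: ccont_dot.
Qed.

Lemma SB_chi N : exists2 K : R, 0 < K &
  forall a : V, SB N (fun t : V => expi2pi (dot t a)) (fun _ => K * jw a ^+ N).
Proof.
have [K K0 h] := @SB_cexp R n N.
exists (K * (2 * pi + 1) ^+ N); first by rewrite mulr_gt0// exprn_gt0// ltr_pwDr// mulr_ge0// pi_ge0.
move=> a; under eq_fun do rewrite expi2piE.
have p1 : 1 <= 2 * pi + 1 :> R by rewrite lerDr mulr_ge0// pi_ge0.
have := h _ (fun i _ => I2pi * ((a ord0 i)%:C)%C) (fun _ => (2 * pi + 1) * jw a)
  (ccont_dot a) (fun i x => isD_dot a i x) _ _.
move=> /(_ _ _) h2; apply: SB_le (h2 _ _).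
- by move=> x; rewrite ReM/= mul0r mulr0 subr0 expR0 mulr1 exprMn mulrA.
- by move=> x; rewrite (le_trans p1)// ler_peMr ?jw_ge1// (le_trans ler01).
move=> i; apply: SB_le (SB_cst _ _ _) => x.
rewrite cabsM cabs_I2pi cabs_real ler_pM// ?mulr_ge0 ?pi_ge0//.
  by rewrite lerDl.
by rewrite (le_trans (rV_coord_le a i))// lerDr.
Qed.

End Characters.

Section IntegralDerivative.
Context (R : realType) (d : measure_display) (T : measurableType d).
Variable mu : {measure set T -> \bar R}.
Local Notation C := R[i].

Lemma isD_cI (f g : R -> T -> C) (b : T -> R) (a : R) :
  (forall x, cint mu (f x)) ->
  (forall x y, isD (fun x' : R => f x' y) (x : R) (1 : R) (g x y)) ->
  (forall x y, `|x - a| < 1 -> cabs (g x y) <= b y) -> rint mu b ->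
  isD (fun x => cI mu (f x)) (a : R) (1 : R) (cI mu (g a)).
Proof.
move=> fi fg gb ib; split.
  apply: (@is_derive_rI _ _ _ mu (fun x y => complex.Re (f x y)) (fun x y => complex.Re (g x y)) b) => //.
  - by move=> x; exact: (fi x).1.
  - by move=> x y; exact: (fg x y).1.
  - by move=> x y h; exact: le_trans (Re_le_cabs _) (gb x y h).
apply: (@is_derive_rI _ _ _ mu (fun x y => complex.Im (f x y)) (fun x y => complex.Im (g x y)) b) => //.
- by move=> x; exact: (fi x).2.
- by move=> x y; exact: (fg x y).2.
- by move=> x y h; exact: le_trans (Im_le_cabs _) (gb x y h).
Qed.

End IntegralDerivative.

Section FourierDecay.
Variables (R : realType) (n : nat).
Local Notation V := 'rV[R]_n.
Local Notation C := R[i].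
Implicit Types (f g : V -> C).

Lemma ccont_cmf f : ccont f -> cmf f.
Proof. by move=> [? ?]; split; exact: continuous_mf. Qed.

Definition jint (r : R) : R := \int[leb R n]_x jw x `^ (- r).

Lemma jint_ge0 r : 0 <= jint r.
Proof. by apply: Rintegral_ge0 => x _; exact: powR_ge0. Qed.

Lemma rapid_cint (r M : R) f : n%:R < r -> cmf f ->
  (forall x, cabs (f x) <= M * jw x `^ (- r)) -> cint (leb R n) f.
Proof. by move=> nr mf h; apply: cint_dom mf h _; apply: rintZ; exact: rint_decay. Qed.

Lemma rapid_cI_le (r M : R) f : n%:R < r -> cmf f ->
  (forall x, cabs (f x) <= M * jw x `^ (- r)) -> cabs (cI (leb R n) f) <= M * jint r.
Proof.
move=> nr mf h; have ir := rint_decay nr.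
by rewrite (le_trans (cI_le_dom mf h (rintZ M ir)))// rIZ.
Qed.

Lemma ee_norm_le (i : 'I_n) : `|ee i : V| <= 1.
Proof.
apply: rV_norm_le => // j; rewrite mxE eqxx/=.
by case: (j == i); rewrite ?normr0 ?normr1.
Qed.

(* The integral of a translate is constant in the translation parameter. *)
Lemma cI_deriv0 (r M : R) f g (v : V) : n%:R < r -> ccont f -> cmf g ->
  (forall x, isD f x v (g x)) ->
  (forall x, cabs (f x) <= M * jw x `^ (- r)) ->
  (forall x, cabs (g x) <= M * jw x `^ (- r)) -> cI (leb R n) g = 0.
Proof.
move=> nr cf mg dg fb gb.
have r0 : 0 <= r by rewrite (le_trans _ (ltW nr)).
have M0 : 0 <= M.
  by have := le_trans (cabs_ge0 _) (fb 0); rewrite pmulr_lge0// powR_gt0// jw_gt0.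
have fi := rapid_cint nr (ccont_cmf cf) fb.
have H : isD (fun h : R => cI (leb R n) (fun x => f (x + h *: v))) (0 : R) (1 : R)
    (cI (leb R n) (fun x => g (x + (0 : R) *: v))).
  refine (@isD_cI R _ _ (leb R n) (fun h x => f (x + h *: v)) (fun h x => g (x + h *: v))
    (fun x => M * (jw v `^ r * jw x `^ (- r))) 0 _ _ _ _).
  - by move=> h; exact: cint_shift.
  - move=> h x; apply/isD_line.
    have /isD_line[h1 h2] := dg (x + h *: v).
    by split; [move: h1|move: h2]; congr is_derive; apply/funext => t; congr (_ (f _));
      rewrite addrC -addrA -scalerDl addrC [(h + _)%R]addrC /GRing.scale/= mulr1 addrC.
  - move=> h x; rewrite subr0 => h1; rewrite (le_trans (gb _))// ler_wpM2l//.
    rewrite (le_trans (peetreN _ _ r0))// mulrC ler_wpM2r ?powR_ge0//.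
    apply: ge0_ler_powR; rewrite ?nnegrE ?jw_ge0// lerD2l normrZ -[leRHS]mul1r.
    by rewrite ler_wpM2r// ltW.
  - by do 2 apply: rintZ; exact: rint_decay.
have H0 : isD (fun h : R => cI (leb R n) (fun x => f (x + h *: v))) (0 : R) (1 : R) 0.
  rewrite (_ : (fun h : R => _) = fun _ => cI (leb R n) f); first exact: isD_cst.
  by apply/funext => h; rewrite cI_shift//; exact: ccont_cmf.
rewrite -(isD_unique H H0); apply: cI_ext => x; by rewrite scale0r addr0.
Qed.

Lemma fourierE f xi : fourier f xi = cI (leb R n) (fun t => f t * expi2pi (- dot t xi)).
Proof. by []. Qed.

Lemma dotNr (x y : V) : dot x (- y) = - dot x y.
Proof. by rewrite /dot -sumrN; apply: eq_bigr => i _; rewrite mxE mulrN. Qed.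
Lemma dotNl (x y : V) : dot (- x) y = - dot x y.
Proof. by rewrite /dot -sumrN; apply: eq_bigr => i _; rewrite mxE mulNr. Qed.
Lemma dotDl (x y z : V) : dot (x + y) z = dot x z + dot y z.
Proof. by rewrite /dot -big_split; apply: eq_bigr => i _; rewrite mxE mulrDl. Qed.
Lemma dotDr (x y z : V) : dot x (y + z) = dot x y + dot x z.
Proof. by rewrite /dot -big_split; apply: eq_bigr => i _; rewrite mxE mulrDr. Qed.
Lemma dotC (x y : V) : dot x y = dot y x.
Proof. by apply: eq_bigr => i _; rewrite mulrC. Qed.
Lemma dotZl (k : R) (x y : V) : dot (k *: x) y = k * dot x y.
Proof. by rewrite /dot mulr_sumr; apply: eq_bigr => i _; rewrite mxE mulrA. Qed.
Lemma dotZr (k : R) (x y : V) : dot x (k *: y) = k * dot x y.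
Proof. by rewrite dotC dotZl dotC. Qed.

Lemma cmf_chi (a : V) : cmf (fun t : V => expi2pi (- dot t a)).
Proof.
apply: ccont_cmf; under eq_fun do rewrite -dotNr.
exact: ccont_chi.
Qed.

Lemma fourier_bound (r M : R) f xi : n%:R < r -> cmf f ->
  (forall x, cabs (f x) <= M * jw x `^ (- r)) -> cabs (fourier f xi) <= M * jint r.
Proof.
move=> nr mf fb; apply: rapid_cI_le => //; first exact: cmf_mul mf (cmf_chi xi).
by move=> x; rewrite cabsM cabs_expi2pi mulr1.
Qed.

(** Integration by parts: the derivative of [f] times the character has integral zero by
    [cI_deriv0]. *)
Lemma fourier_deriv (r M : R) f g i xi : n%:R < r -> rapid 1 r M f ->
  (forall x, isD f x (ee i) (g x)) ->
  fourier g xi = I2pi R * ((xi ord0 i)%:C)%C * fourier f xi.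
Proof.
move=> nr sf dg.
have cf := SB_cont sf; have sg := @SB_deriv R n 0 _ _ _ i sf dg; have cg := SB_cont sg.
have M0 := rapid_ge0 sf.
pose k := I2pi R * (((- xi) ord0 i)%:C)%C.
have cchi : ccont (fun t : V => expi2pi (- dot t xi)).
  by under eq_fun do rewrite -dotNr; exact: ccont_chi.
have cfc := ccontM cf cchi; have cgc := ccontM cg cchi.
have fb x : cabs (f x * expi2pi (- dot x xi)) <= M * jw x `^ (- r).
  by rewrite cabsM cabs_expi2pi mulr1 (SB_bound x sf).
have gb x : cabs (g x * expi2pi (- dot x xi)) <= M * jw x `^ (- r).
  by rewrite cabsM cabs_expi2pi mulr1 (SB_bound x sg).
have fi := rapid_cint nr (ccont_cmf cfc) fb; have gi := rapid_cint nr (ccont_cmf cgc) gb.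
have h : cI (leb R n) (fun x => g x * expi2pi (- dot x xi) + k * (f x * expi2pi (- dot x xi))) = 0.
  apply: (@cI_deriv0 r (M + cabs k * M) (fun x => f x * expi2pi (- dot x xi)) _ (ee i)) => //.
  - by apply: ccont_cmf; apply: ccontD => //; exact: ccontM (ccont_cst _ k) cfc.
  - move=> x; have := isDM (dg x) (isD_chi (- xi) i x).
    under eq_fun do rewrite dotNr; rewrite dotNr.
    by congr isD; rewrite /k; ring.
  - by move=> x; rewrite (le_trans (fb x))// ler_wpM2r ?powR_ge0// lerDl mulr_ge0 ?cabs_ge0.
  - move=> x; rewrite (le_trans (cabsD _ _))// mulrDl lerD//.
    by rewrite cabsM -mulrA ler_wpM2l ?cabs_ge0.
move: h; rewrite cID//; last exact: cintZ.
rewrite cIZ// => /eqP; rewrite addr_eq0 => /eqP; rewrite -!fourierE => ->.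
by rewrite /k mxE rmorphN mulrN mulNr opprK.
Qed.

Lemma fourier_coord_decay (r M : R) N f (xi : V) i : n%:R < r -> rapid N r M f ->
  (2 * pi * `|xi ord0 i|) ^+ N * cabs (fourier f xi) <= M * jint r.
Proof.
move=> nr; elim: N f => [|N IH] f sf.
  rewrite mul1r; apply: fourier_bound => //; first exact: ccont_cmf (SB_cont sf).
  by move=> x; exact: SB_bound sf.
have [_ _ /(_ i)[g [dg sg]]] := sf.
have s1 : rapid 1 r M f by apply: SB_sub sf.
have := IH _ sg; rewrite (fourier_deriv xi nr s1 dg) !cabsM cabs_I2pi cabs_real.
by rewrite exprSr mulrA.
Qed.

(** The coordinate bound is used at a coordinate realizing the sup norm. With the bound without
    derivatives it controls [1 + |xi|^N], which dominates [jw xi ^+ N] up to [2 ^+ N]. *)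
Lemma fourier_decay (r M : R) N f xi : n%:R < r -> rapid N r M f ->
  cabs (fourier f xi) <= 2 ^+ N.+1 * jint r * M * jw xi `^ (- N%:R).
Proof.
move=> nr sf; have M0 := rapid_ge0 sf; have j0 := jint_ge0 r.
have b0 : cabs (fourier f xi) <= M * jint r.
  apply: fourier_bound => //; first exact: ccont_cmf (SB_cont sf).
  by move=> x; exact: SB_bound sf.
have bN : `|xi| ^+ N * cabs (fourier f xi) <= M * jint r.
  have [->|[i hi]] : `|xi| = 0 \/ exists i, `|xi| = `|xi ord0 i|.
    have [/eqP ->|x0] := boolP (xi == 0); first by left; rewrite normr0.
    right; have := @mx_norm_neq0 R 1 n xi; case; last first.
      by move=> [i j] /= e; exists j; rewrite {1}/Num.norm/= e (ord1 i).
    by apply: contra x0 => /eqP/mx_norm_eq0 ->.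
  - by case: (N) => [|k]; rewrite ?mul1r// expr0n/= mul0r mulr_ge0.
  apply: le_trans (fourier_coord_decay xi i nr sf).
  rewrite ler_wpM2r ?cabs_ge0// lerXn2r ?nnegrE ?mulr_ge0 ?pi_ge0//.
  rewrite hi ler_peMl//; have := @pi_ge2 R; lra.
rewrite powR_invn ?jw_ge0// ler_pdivlMr ?exprn_gt0 ?jw_gt0//.
have jwN : jw xi ^+ N <= 2 ^+ N * (1 + `|xi| ^+ N).
  have [h|h] := leP `|xi| 1.
    rewrite (@le_trans _ _ (2 ^+ N))//; last by rewrite ler_peMr ?exprn_ge0// lerDl exprn_ge0.
    by rewrite lerXn2r ?nnegrE ?jw_ge0// /jw; lra.
  apply: (@le_trans _ _ ((2 * `|xi|) ^+ N)).
    by rewrite lerXn2r ?nnegrE ?jw_ge0 ?mulr_ge0// /jw; lra.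
  by rewrite exprMn ler_wpM2l ?exprn_ge0// lerDr.
apply: (@le_trans _ _ (cabs (fourier f xi) * (2 ^+ N * (1 + `|xi| ^+ N)))).
  by rewrite ler_wpM2l ?cabs_ge0.
rewrite mulrCA exprSr -!mulrA ler_wpM2l ?exprn_ge0// mulrDr mulr1 [_ * `|xi| ^+ N]mulrC.
by rewrite mulr_natl mulr2n [jint r * M]mulrC lerD.
Qed.

End FourierDecay.

Section Gaussian.
Variables (R : realType) (n : nat).
Local Notation V := 'rV[R]_n.
Local Notation C := R[i].

Lemma cexp_real (x : R) : cexp ((x%:C)%C : C) = ((expR x)%:C)%C.
Proof. by apply: complex_ext; rewrite /= ?cos0 ?sin0 ?mulr1 ?mulr0. Qed.

Definition gr (a : R) (x : V) : R := expR (- (pi * a * dot x x)).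

Definition gau (a : R) (x : V) : C := ((gr a x)%:C)%C.

Lemma gr_gt0 a x : 0 < gr a x. Proof. exact: expR_gt0. Qed.
Lemma gr_ge0 a x : 0 <= gr a x. Proof. exact: expR_ge0. Qed.
Lemma cabs_gau a x : cabs (gau a x) = gr a x.
Proof. by rewrite cabs_real ger0_norm// gr_ge0. Qed.
Lemma gr0 a : gr a 0 = 1.
Proof. by rewrite /gr (_ : dot 0 0 = 0) ?mulr0 ?oppr0 ?expR0// /dot big1// => i _; rewrite mxE mul0r. Qed.

Lemma gauE a x : gau a x = cexp (((- (pi * a * dot x x))%:C)%C).
Proof. by rewrite cexp_real. Qed.

Lemma is_derive_dotv (v a x : V) : is_derive x v (fun y => dot y a) (dot v a).
Proof.
apply/is_derive_line.
have -> : (fun t : R => dot (t *: v + x) a) = (fun t : R => dot v a * t + dot x a).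
  by apply/funext => t; rewrite dotDl dotZl mulrC.
have h := is_derive_mulR (is_derive_cst (dot v a : R) (0 : R) (1 : R)) (is_derive_id (0 : R) (1 : R)).
have := is_derive_addR h (is_derive_cst (dot x a : R) (0 : R) (1 : R)).
by rewrite mul0r add0r addr0 mulr1.
Qed.

Lemma is_derive_dotxx (v x : V) : is_derive x v (fun y => dot y y) (2 * dot v x).
Proof.
apply/is_derive_line.
have -> : (fun t : R => dot (t *: v + x) (t *: v + x)) =
    (fun t : R => (dot v v * t + 2 * dot v x) * t + dot x x).
  by apply/funext => t; rewrite !dotDl !dotDr !dotZl !dotZr (dotC x v); ring.
have h := is_derive_mulR (is_derive_cst (dot v v : R) (0 : R) (1 : R)) (is_derive_id (0 : R) (1 : R)).
have h2 := is_derive_addR h (is_derive_cst (2 * dot v x : R) (0 : R) (1 : R)).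
have h3 := is_derive_mulR h2 (is_derive_id (0 : R) (1 : R)).
have := is_derive_addR h3 (is_derive_cst (dot x x : R) (0 : R) (1 : R)).
by congr is_derive; rewrite /cst; ring.
Qed.

Lemma dot_ee (i : 'I_n) (a : V) : dot (ee i) a = a ord0 i.
Proof.
rewrite /dot (bigD1 i)//= mxE !eqxx/= mul1r big1 ?addr0// => j /negPf ji.
by rewrite mxE ji andbF mul0r.
Qed.

Lemma isD_gauQ a (v x : V) : isD (fun y => ((- (pi * a * dot y y))%:C)%C : C) x v
  (((- (2 * pi * a) * dot v x)%:C)%C).
Proof.
apply: isD_real.
have := is_derive_mulR (is_derive_cst (- (pi * a) : R) x v) (is_derive_dotxx v x).
rewrite (_ : (fun y => - (pi * a) * dot y y) = (fun y => - (pi * a * dot y y))); last first.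
  by apply/funext => y; rewrite mulNr.
by congr is_derive; rewrite /cst; ring.
Qed.

Lemma isD_gau a (v x : V) : isD (gau a) x v (((- (2 * pi * a) * dot v x)%:C)%C * gau a x).
Proof.
rewrite (_ : gau a = fun y => cexp (((- (pi * a * dot y y))%:C)%C)); last first.
  by apply/funext => y; rewrite gauE.
apply: isD_cexp; exact: isD_gauQ.
Qed.

Lemma continuous_dotxx : continuous (fun y : V => dot y y).
Proof.
rewrite (_ : (fun y => dot y y) = \sum_(j < n) (fun y : V => y ord0 j * y ord0 j)); last first.
  by apply/funext => y; rewrite /dot fct_sumE.
elim/big_ind : _ => [x|f g cf cg x|j _ x]; first exact: cst_continuous.
  exact: continuousD (cf x) (cg x).
exact: continuousM (@continuous_coord _ _ j x) (@continuous_coord _ _ j x).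
Qed.

Lemma ccont_gauQ a : ccont (fun y : V => ((- (pi * a * dot y y))%:C)%C : C).
Proof.
apply: ccont_real => x; apply: (@continuousN _ _ _ (fun y : V => pi * a * dot y y)).
exact: continuousM (@cst_continuous _ _ (pi * a) x) (@continuous_dotxx x).
Qed.

Lemma sqr_norm_le_dot (x : V) : `|x| ^+ 2 <= dot x x.
Proof.
have h : `|x| <= Num.sqrt (dot x x).
  apply: rV_norm_le => [|i]; first exact: sqrtr_ge0.
  rewrite -sqrtr_sqr ler_wsqrtr// /dot (bigD1 i)//= -expr2 lerDl.
  by apply: sumr_ge0 => j _; rewrite -expr2 sqr_ge0.
by rewrite -(sqr_sqrtr (dot_ge0 x)) lerXn2r ?nnegrE// sqrtr_ge0.
Qed.

Lemma gauss_dom (a : R) (m : nat) : 0 < a ->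
  exists2 M : R, 0 < M & forall x : V, jw x ^+ m * gr a x <= M.
Proof.
move=> a0; case: m => [|m].
  exists 1 => // x; rewrite mul1r /gr -expR0 ler_expR oppr_le0 !mulr_ge0 ?pi_ge0 ?dot_ge0//.
  exact: ltW.
(* For this [b] the Gaussian is the inverse of the [m.+1]-st power of [expR (b * dot x x)], so it is
   enough to dominate a single factor [jw x]. *)
pose b := pi * a / m.+1%:R.
have b0 : 0 < b by rewrite divr_gt0// mulr_gt0// pi_gt0.
pose c := 2 * (1 + b^-1).
have c0 : 0 < c by rewrite mulr_gt0// addr_gt0// invr_gt0.
exists (c ^+ m.+1); first by rewrite exprn_gt0.
move=> x.
have h : jw x <= c * expR (b * dot x x).
  apply: (@le_trans _ _ (c * (1 + b * dot x x))); last first.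
    by rewrite ler_wpM2l ?(ltW c0)// expR_ge1Dx.
  have h1 := sqr_norm_le_dot x; have h2 : 0 <= `|x| by [].
  have h3 : jw x <= 2 * (1 + dot x x) by rewrite /jw; nra.
  apply: le_trans h3 _; rewrite /c -mulrA ler_wpM2l//.
  rewrite mulrDl mul1r mulrDr mulr1 mulrA mulVf ?gt_eqF// mul1r.
  have : 0 <= b^-1 by rewrite invr_ge0 ltW.
  have : 0 <= b * dot x x by rewrite mulr_ge0 ?dot_ge0// ltW.
  lra.
have -> : gr a x = (expR (b * dot x x) ^+ m.+1)^-1.
  rewrite -expRM_natl -expRN; congr (expR (- _)); rewrite /b.
  by rewrite [RHS]mulrA [m.+1%:R * _]mulrC divfK// pnatr_eq0.
rewrite ler_pdivrMr ?exprn_gt0 ?expR_gt0// -exprMn lerXn2r ?nnegrE ?jw_ge0//.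
by rewrite mulr_ge0 ?expR_ge0// ltW.
Qed.

(** The derivatives of [Q] contribute polynomials, which the Gaussian bound on [Re Q] absorbs. [M]
    depends on [Q] only through [K] and [k], so that one constant serves a whole family of
    phases. *)
Lemma rapid_cexp (a K : R) (N k : nat) (r : R) : 0 < a -> 1 <= K ->
  exists M : R, forall (Q : V -> C) (Q' : 'I_n -> V -> C), ccont Q ->
    (forall i x, isD Q x (ee i) (Q' i x)) ->
    (forall i, SB N (Q' i) (fun x => K * jw x ^+ k)) ->
    (forall x, complex.Re (Q x) <= - (pi * a * dot x x)) ->
    rapid N r M (fun x => cexp (Q x)).
Proof.
move=> a0 K1; have [L L0 hL] := @SB_cexp R n N.
pose m := (k * N + (Num.truncn `|r|).+1)%N.
have [M M0 hM] := gauss_dom m a0.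
exists (L * (K ^+ N * M)) => Q Q' cQ dQ sQ rQ.
have P1 (x : V) : 1 <= K * jw x ^+ k :> R.
  by rewrite (le_trans K1)// ler_peMr ?exprn_ege1 ?jw_ge1// (le_trans ler01).
apply: SB_le (hL Q Q' (fun x => K * jw x ^+ k) cQ dQ P1 sQ) => x.
rewrite -!mulrA ler_wpM2l ?(ltW L0)// exprMn -mulrA ler_wpM2l ?exprn_ge0 ?(le_trans ler01)//.
rewrite powRN ler_pdivlMr ?jw_powR_gt0// -exprM.
apply: le_trans (hM x).
rewrite mulrAC; apply: ler_pM; rewrite ?mulr_ge0 ?exprn_ge0 ?powR_ge0 ?jw_ge0 ?expR_ge0//.
  rewrite /m exprD ler_wpM2l ?exprn_ge0 ?jw_ge0// -powR_mulrn ?jw_ge0// jw_powR_le//.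
  by rewrite (le_trans (ler_norm r))// ltW// truncnS_gt.
by rewrite /gr ler_expR.
Qed.

Lemma SB_linear N (k : R) i : SB N (fun x : V => ((k * x ord0 i)%:C)%C : C)
  (fun x => (`|k| + 1) * jw x).
Proof.
have := SB_scale ((k%:C)%C : C) (@SB_coord R n N i).
rewrite (_ : (fun x : V => _ * _) = fun x : V => ((k * x ord0 i)%:C)%C); last first.
  by apply/funext => x; rewrite rmorphM.
by apply: SB_le => x; rewrite cabs_real ler_wpM2r ?jw_ge0// lerDl.
Qed.

Lemma rapid_gau (a : R) N r : 0 < a -> exists M, rapid N r M (gau a).
Proof.
move=> a0; have [|M hM] := @rapid_cexp a (`|- (2 * pi * a)| + 1) N 1%N r a0; first by rewrite lerDr.
exists M; rewrite (_ : gau a = fun y => cexp (((- (pi * a * dot y y))%:C)%C)); last first.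
  by apply/funext => y; rewrite gauE.
apply: (hM _ (fun i x => ((- (2 * pi * a) * x ord0 i)%:C)%C)).
- exact: ccont_gauQ.
- by move=> i x; have := isD_gauQ a (ee i) x; rewrite dot_ee.
- by move=> i; exact: SB_linear.
- by move=> x.
Qed.

Lemma schwartz_gau (a : R) : 0 < a -> schwartz (gau a).
Proof. by move=> a0; apply: schwartz_of_rapid => N r; exact: rapid_gau. Qed.

Lemma ccont_gau a : ccont (gau a).
Proof.
rewrite (_ : gau a = fun y => cexp (((- (pi * a * dot y y))%:C)%C)); last first.
  by apply/funext => y; rewrite gauE.
by apply: ccont_cexp; exact: ccont_gauQ.
Qed.

Lemma gr_decay (a r : R) : 0 < a -> exists M, forall x : V, gr a x <= M * jw x `^ (- r).
Proof.
move=> a0; have [M hM] := rapid_gau 0 r a0; exists M => x.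
by rewrite -cabs_gau; exact: SB_bound hM.
Qed.

Lemma rint_gr (a : R) : 0 < a -> rint (leb R n) (gr a).
Proof.
move=> a0; have [M hM] := gr_decay (n%:R + 1) a0.
apply: (@rint_dom _ _ _ _ _ (fun x => M * jw x `^ (- (n%:R + 1)))).
- by have [h _] := ccont_cmf (ccont_gau a).
- by move=> x; rewrite ger0_norm ?gr_ge0.
- by apply: rintZ; apply: rint_decay; rewrite ltrDl.
Qed.

(** The Gaussian integral, equal to [a^(-n/2)]. It is kept as a symbol, so its powers remain as
    normalizing constants in Fourier inversion, in Parseval and in the symbol of the inverse. *)
Definition mass a : R := \int[leb R n]_x gr a x.

Lemma cI_gau a : cI (leb R n) (gau a) = ((mass a)%:C)%C.
Proof. exact: cI_real. Qed.

Lemma cint_gau (a : R) : 0 < a -> cint (leb R n) (gau a).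
Proof. by move=> a0; exact/cint_real/rint_gr. Qed.

(** Along the ray through [xi] the transform is [phi r]. Integration by parts in the direction [xi]
    gives [phi' = - (2 pi r |xi|^2 / a) phi], and the integrating factor makes [psi] constant. *)
Lemma fourier_gau (a : R) (xi : V) : 0 < a ->
  fourier (gau a) xi = ((mass a)%:C)%C * gau a^-1 xi.
Proof.
move=> a0.
have [M hM] := gr_decay (n%:R + 2) a0.
have M0 : 0 <= M.
  by have := le_trans (gr_ge0 _ _) (hM 0); rewrite pmulr_lge0// powR_gt0// jw_gt0.
have nr : n%:R < n%:R + 1 :> R by rewrite ltrDl.
pose e (r : R) (t : V) : C := expi2pi (dot t (- (r *: xi))).
have ce r : ccont (e r) by exact: ccont_chi.
have cabse r t : cabs (e r t) = 1 by exact: cabs_expi2pi.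
pose phi (r : R) := cI (leb R n) (fun t => gau a t * e r t).
pose D (t : V) : C := ((dot t xi)%:C)%C.
have cD : ccont D by apply: ccont_real; exact: continuous_dot.
have bD t : cabs (D t) <= n%:R * `|xi| * jw t.
  rewrite cabs_real (le_trans (le_dot _ _))// -!mulrA ler_wpM2l// mulrC ler_wpM2l//.
  by rewrite lerDr.
have bgD t : gr a t * cabs (D t) <= (M * (n%:R * `|xi|)) * jw t `^ (- (n%:R + 1)).
  apply: (@le_trans _ _ (M * jw t `^ (- (n%:R + 2)) * (n%:R * `|xi| * jw t))).
    by rewrite ler_pM ?gr_ge0 ?cabs_ge0.
  rewrite -[leRHS]mulrA -[leLHS]mulrA ler_wpM2l// [leLHS]mulrCA ler_wpM2l ?mulr_ge0//.
  by rewrite -[X in _ * X <= _]powRr1 ?jw_ge0// -jw_powRD jw_powR_le//; lra.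
have bg t : gr a t <= M * jw t `^ (- (n%:R + 1)).
  by rewrite (le_trans (hM t))// ler_wpM2l// jw_powR_le//; lra.
have cge r : ccont (fun t => gau a t * e r t) by exact: ccontM (ccont_gau a) (ce r).
have cgDe r : ccont (fun t => D t * (gau a t * e r t)) by exact: ccontM cD (cge r).
have ige r : cint (leb R n) (fun t => gau a t * e r t).
  apply: (rapid_cint nr (ccont_cmf (cge r)) (M := M)) => t.
  by rewrite cabsM cabse mulr1 cabs_gau.
have igDe r : cint (leb R n) (fun t => D t * (gau a t * e r t)).
  apply: (rapid_cint nr (ccont_cmf (cgDe r)) (M := M * (n%:R * `|xi|))) => t.
  by rewrite !cabsM cabse mulr1 cabs_gau mulrC.
have dphi (r : R) : isD phi r (1 : R) (- I2pi R * cI (leb R n) (fun t => D t * (gau a t * e r t))).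
  rewrite -cIZ//.
  refine (@isD_cI R _ _ (leb R n) (fun r t => gau a t * e r t)
    (fun r t => - I2pi R * (D t * (gau a t * e r t)))
    (fun t => 2 * pi * ((M * (n%:R * `|xi|)) * jw t `^ (- (n%:R + 1)))) r _ _ _ _).
  - exact: ige.
  - move=> s t; rewrite (_ : (fun x' => _) = fun s => gau a t * cexp (- I2pi R * D t * (s%:C)%C)); last first.
      apply/funext => x; rewrite /e expi2piE dotNr dotZr; congr (_ * cexp _).
      by rewrite rmorphN rmorphM /=; ring.
    have h := isDZ (gau a t) (isD_cexp (isDZ (- I2pi R * D t) (isD_real (is_derive_id s (1 : R))))).
    move: h; congr isD.
    rewrite /e expi2piE dotNr dotZr (_ : ((1 : R)%:C)%C = 1)// mulr1.
    rewrite (_ : I2pi R * _ = - I2pi R * D t * (s%:C)%C); first by ring.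
    by rewrite rmorphN rmorphM /=; ring.
  - move=> s t _; rewrite cabsM cabsN cabs_I2pi ler_wpM2l ?mulr_ge0 ?pi_ge0//.
    by rewrite !cabsM cabse mulr1 cabs_gau mulrC.
  - by do 2 apply: rintZ; exact: rint_decay.
have key (r : R) : - I2pi R * cI (leb R n) (fun t => D t * (gau a t * e r t)) =
    ((- (2 * pi * r * dot xi xi / a))%:C)%C * phi r.
  (* The integrand is the derivative of [gau a t * e r t] in the direction [xi]. *)
  have : cI (leb R n) (fun t => (((- (2 * pi * a))%:C)%C) * (D t * (gau a t * e r t)) +
      - (I2pi R * ((r * dot xi xi)%:C)%C) * (gau a t * e r t)) = 0.
    apply: (@cI_deriv0 R n (n%:R + 1) (M + (2 * pi * a) * (M * (n%:R * `|xi|)) +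
      cabs (I2pi R * ((r * dot xi xi)%:C)%C) * M) (fun t => gau a t * e r t) _ xi) => //.
    - apply: ccont_cmf; apply: ccontD; apply: ccontM => //; exact: ccont_cst.
    - move=> x; have h1 := isD_gau a xi x.
      have h2 : isD (e r) x xi (- (I2pi R * ((r * dot xi xi)%:C)%C) * e r x).
        rewrite /e expi2piE; under eq_fun do rewrite expi2piE.
        have := isD_cexp (isDZ (I2pi R) (isD_real (is_derive_dotv xi (- (r *: xi)) x))).
        congr isD; congr (_ * _); rewrite dotNr dotZr rmorphN rmorphM /=; ring.
      have := isDM h1 h2; congr isD.
      by rewrite (dotC xi x) rmorphM /= /D; ring.
    - move=> x; rewrite cabsM cabse mulr1 cabs_gau (le_trans (bg x))//.
      rewrite ler_wpM2r ?powR_ge0// -addrA lerDl addr_ge0// !mulr_ge0 ?pi_ge0 ?cabs_ge0//.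
      exact: ltW.
    - move=> x; rewrite (le_trans (cabsD _ _))// [leRHS]mulrDl [X in _ <= X + _]mulrDl -addrA.
      apply: ler_wpDl; first by rewrite mulr_ge0 ?powR_ge0.
      apply: lerD.
        have pa : 0 <= 2 * pi * a by rewrite !mulr_ge0 ?pi_ge0 ?(ltW a0).
        have e1 : cabs (((- (2 * pi * a))%:C)%C : C) = 2 * pi * a.
          by rewrite cabs_real normrN ger0_norm.
        rewrite cabsM e1 !cabsM cabse mulr1 cabs_gau.
        by rewrite -[leRHS]mulrA ler_wpM2l// [cabs _ * _]mulrC.
      rewrite [leLHS](cabsM (- _)) (cabsN (I2pi R * _)) -[leRHS]mulrA ler_wpM2l ?cabs_ge0//.
      by rewrite cabsM cabse mulr1 cabs_gau.
  rewrite cID; [|exact: cintZ|exact: cintZ].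
  rewrite cIZ// cIZ// => /eqP; rewrite addr_eq0 => /eqP h.
  have p0 : (((- (2 * pi * a))%:C)%C : C) != 0.
    by rewrite eq_complex/= eqxx andbT oppr_eq0 !mulf_neq0// gt_eqF// pi_gt0.
  apply: (mulfI p0); rewrite mulrCA h -/(phi r).
  have i2 : I2pi R * I2pi R = ((- (2 * pi) ^+ 2)%:C)%C.
    by apply: complex_ext; rewrite !ReImE/=; ring.
  have -> : - I2pi R * (- (- (I2pi R * ((r * dot xi xi)%:C)%C) * phi r)) =
     - (I2pi R * I2pi R) * ((r * dot xi xi)%:C)%C * phi r by ring.
  rewrite i2 mulrA -!rmorphN -!rmorphM; congr ((_%:C)%C * _).
  by field; rewrite gt_eqF.
pose c := pi * dot xi xi / a.
pose psi (r : R) := phi r * cexp (((c * r * r)%:C)%C).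
have dpsi (r : R) : isD psi r (1 : R) 0.
  have h1 := dphi r; rewrite key in h1.
  have h2 : isD (fun r : R => cexp (((c * r * r)%:C)%C : C)) r (1 : R)
      (((c * r + c * r)%:C)%C * cexp (((c * r * r)%:C)%C)).
    apply: isD_cexp; apply: isD_real.
    have h := is_derive_mulR (is_derive_cst (c : R) r (1 : R)) (is_derive_id r (1 : R)).
    have := is_derive_mulR h (is_derive_id r (1 : R)).
    by congr is_derive; rewrite /=; ring.
  have := isDM h1 h2; congr isD.
  have e0 : - (2 * pi * r * dot xi xi / a) + (c * r + c * r) = 0.
    by rewrite /c; field; rewrite gt_eqF.
  have := congr1 (fun z : R => (z%:C)%C : C) e0; rewrite rmorphD/= rmorph0 => h.
  by rewrite -[RHS](mul0r (phi r * cexp (((c * r * r)%:C)%C))) -h; ring.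
have psi10 : psi 1 = psi 0.
  apply: complex_ext.
    have h (r : R) : is_derive r (1 : R) (fun r => complex.Re (psi r)) (0 : R) by have [] := dpsi r.
    by have := @is_derive_0_is_cst R _ (1 : R) 0 h.
  have h (r : R) : is_derive r (1 : R) (fun r => complex.Im (psi r)) (0 : R) by have [] := dpsi r.
  by have := @is_derive_0_is_cst R _ (1 : R) 0 h.
have phi0 : phi 0 = ((mass a)%:C)%C.
  rewrite -cI_gau; apply: cI_ext => t.
  by rewrite /e dotNr dotZr mul0r oppr0 expi2pi0 mulr1.
have phi1 : phi 1 = fourier (gau a) xi.
  by apply: cI_ext => t; rewrite /e scale1r dotNr.
move: psi10; rewrite /psi phi0 phi1 !mulr0 !mulr1 cexp0 mulr1 => <-.
rewrite gauE -mulrA -cexpD -rmorphD/= (_ : c + _ = 0) ?cexp0 ?mulr1//.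
by rewrite /c; ring.
Qed.

(* Hence [gr b] concentrates at the origin at scale [b^(-1/2)]. *)
Lemma gr_moment (b : R) : 0 < b ->
  rint (leb R n) (fun x => dot x x * gr b x) /\
  \int[leb R n]_x (dot x x * gr b x) = n%:R / (2 * pi * b) * mass b.
Proof.
move=> b0.
have [M hM] := gr_decay (n%:R + 3) b0.
have M0 : 0 <= M.
  by have := le_trans (gr_ge0 _ _) (hM 0); rewrite pmulr_lge0// powR_gt0// jw_gt0.
have nr : n%:R < n%:R + 1 :> R by rewrite ltrDl.
have jgr k x : (k <= 2)%N -> jw x ^+ k * gr b x <= M * jw x `^ (- (n%:R + 1)).
  move=> k2; rewrite (le_trans (ler_wpM2l _ (hM x))) ?exprn_ge0 ?jw_ge0//.
  rewrite mulrCA ler_wpM2l// -powR_mulrn ?jw_ge0// -jw_powRD jw_powR_le//.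
  have : k%:R <= 2 :> R by rewrite ler_nat.
  lra.
have mgr : measurable_fun setT (gr b) by have [h _] := ccont_cmf (ccont_gau b).
have mc i : measurable_fun setT (fun x : V => x ord0 i) by exact: measurable_rV_coord.
have ixx i : rint (leb R n) (fun x => x ord0 i ^+ 2 * gr b x).
  apply: (@rint_dom _ _ _ _ _ (fun x => M * jw x `^ (- (n%:R + 1)))).
  - by apply: measurable_funM => //; exact: measurable_funX.
  - move=> x; rewrite normrM (ger0_norm (gr_ge0 _ _)) normrX.
    apply: le_trans (jgr 2%N x isT); rewrite ler_wpM2r ?gr_ge0// lerXn2r ?nnegrE ?jw_ge0//.
    by rewrite (le_trans (rV_coord_le x i))// lerDr.
  - by apply: rintZ; exact: rint_decay.
have step i : \int[leb R n]_x (x ord0 i ^+ 2 * gr b x) = mass b / (2 * pi * b).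
  have cx : ccont (fun x : V => ((x ord0 i)%:C)%C : C).
    by apply: ccont_real; exact: continuous_coord.
  have cxg : ccont (fun x : V => ((x ord0 i)%:C)%C * gau b x) := ccontM cx (ccont_gau b).
  pose k : C := ((- (2 * pi * b))%:C)%C.
  have ck : cabs k = 2 * pi * b.
    by rewrite cabs_real normrN ger0_norm// !mulr_ge0 ?pi_ge0// ltW.
  have ig := cint_gau b0.
  have ixx' : cint (leb R n) (fun x => ((x ord0 i ^+ 2 * gr b x)%:C)%C) by exact: cint_real.
  (* The integrand is the [i]-th partial derivative of [x_i] times [gau b x]. *)
  have h0 : cI (leb R n) (fun x : V => gau b x + k * ((x ord0 i ^+ 2 * gr b x)%:C)%C) = 0.
    apply: (@cI_deriv0 R n (n%:R + 1) (M + (2 * pi * b) * M) (fun x => ((x ord0 i)%:C)%C * gau b x) _ (ee i)) => //.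
    - apply: cmf_add; first exact: ccont_cmf (ccont_gau b).
      by apply: cmf_mul; [exact: cmf_cst|exact: (cint_cmf ixx')].
    - move=> x; have := isDM (isD_real (is_derive_coord i i x)) (isD_gau b (ee i) x).
      congr isD; rewrite eqxx dot_ee (_ : ((1 : R)%:C)%C = 1)// mul1r; congr (_ + _).
      by rewrite /k /gau rmorphM rmorphM rmorphXn/=; ring.
    - move=> x; rewrite cabsM cabs_gau cabs_real (le_trans _ (le_trans (jgr 1%N x isT) _))//.
        by rewrite ler_wpM2r ?gr_ge0// (le_trans (rV_coord_le x i))// lerDr.
      by rewrite ler_wpM2r ?powR_ge0// lerDl !mulr_ge0 ?pi_ge0// ltW.
    - move=> x; rewrite (le_trans (cabsD _ _))// mulrDl lerD//.
        by rewrite cabs_gau; have := jgr 0%N x isT; rewrite mul1r.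
      rewrite [cabs (k * _)]cabsM ck cabs_real -[leRHS]mulrA ler_wpM2l ?mulr_ge0 ?pi_ge0 ?(ltW b0)//.
      rewrite normrM (ger0_norm (gr_ge0 _ _)) normrX.
      apply: le_trans (jgr 2%N x isT); rewrite ler_wpM2r ?gr_ge0// lerXn2r ?nnegrE ?jw_ge0//.
      by rewrite (le_trans (rV_coord_le x i))// lerDr.
  move: h0; rewrite cID//; last exact: cintZ.
  rewrite cIZ// cI_gau cI_real -rmorphM -rmorphD/= => /(congr1 (@complex.Re R)) /= h.
  have p0 : 2 * pi * b != 0 by rewrite !mulf_neq0// gt_eqF// pi_gt0.
  by apply: (mulfI p0); rewrite mulrCA divff// mulr1; move: h; lra.
have e : (fun x : V => dot x x * gr b x) = (fun x => \sum_(i < n) (x ord0 i ^+ 2 * gr b x)).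
  by apply/funext => x; rewrite /dot mulr_suml; apply: eq_bigr => i _; rewrite expr2.
have isum (s : seq 'I_n) : rint (leb R n) (fun x => \sum_(i <- s) (x ord0 i ^+ 2 * gr b x)) /\
    \int[leb R n]_x (\sum_(i <- s) (x ord0 i ^+ 2 * gr b x)) = (size s)%:R * (mass b / (2 * pi * b)).
  elim: s => [|i s [IH1 IH2]].
    under eq_fun do rewrite big_nil; split; first exact: integrable0.
    by rewrite /Rintegral integral0 mul0r.
  under eq_fun do rewrite big_cons; split; first exact: rintD.
  rewrite (rID (ixx i) IH1) step IH2 (_ : (size (i :: s))%:R = 1 + (size s)%:R :> R) ?nat1r//.
  by have := mulrDl 1 (size s)%:R (mass b / (2 * pi * b)); rewrite mul1r nat1r => ->.
rewrite e; have [h1 h2] := isum (index_enum 'I_n); split=> //.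
have sz : size (index_enum 'I_n) = n by rewrite -[in RHS](size_enum_ord n) enumT.
by apply: (etrans h2); rewrite sz mulrA [RHS]mulrAC.
Qed.

End Gaussian.

Section Positivity.
Variable R : realType.

Definition box n (c : 'rV[R]_n) (r : R) : set 'rV[R]_n :=
  [set x | forall i, `|x ord0 i - c ord0 i| < r].

Lemma measurable_box n (c : 'rV[R]_n) r : measurable (box c r).
Proof.
rewrite (_ : box c r = \bigcap_(k in [set: 'I_n])
    (@rV_coord R n k @^-1` ball (c ord0 k) r)).
  apply: fin_bigcap_measurable => [|k _]; first exact: finite_finset.
  by rewrite -[X in measurable X]setTI; apply: measurable_rV_coord => //; exact: measurable_ball.
rewrite predeqE => x; split => h k.
  by move=> _; rewrite /preimage /= -ball_normE /= distrC; exact: h.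
by have := h k Logic.I; rewrite /preimage /= -ball_normE /= distrC.
Qed.

Lemma leb_box_gt0 n (c : 'rV[R]_n) (r : R) : 0 < r -> (0 < leb R n (box c r))%E.
Proof.
move=> r0; elim: n c => [|n IH] c.
  rewrite [X in (_ < X)%E](_ : _ = \d_(const_mx 0%R : 'rV[R]_0) (box c r))//.
  by rewrite diracE mem_set// => -[].
rewrite leb_consE; last exact: measurable_box.
have -> : @rV_cons R n @^-1` box c r =
    (ball (rV_uncons c).1 r : set (measurableTypeR R)) `*` box (rV_uncons c).2 r.
  rewrite -{1}(rV_unconsK c) predeqE => -[t v]; move: (rV_uncons c) => [t' v'].
  rewrite /setX /preimage /= -ball_normE /=.
  have e0 a (u : 'rV[R]_n) : rV_cons (a, u) ord0 ord0 = a.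
    by have := congr1 fst (@rV_consK R n (a, u)).
  have e1 a (u : 'rV[R]_n) i : rV_cons (a, u) ord0 (lift ord0 i) = u ord0 i.
    have := congr1 (fun p : R * 'rV[R]_n => p.2 ord0 i) (@rV_consK R n (a, u)); rewrite /= => <-.
    by rewrite [RHS]mxE; congr (rV_cons _ _ _); apply/val_inj.
  split=> [h|[h1 h2] i].
    split; first by have := h ord0; rewrite !e0 distrC.
    by move=> i; have := h (lift ord0 i); rewrite !e1.
  by case: (unliftP ord0 i) => [j ->|->]; rewrite ?e0 ?e1 // distrC.
rewrite product_measure1E//; last exact: measurable_box.
  apply: mule_gt0 => //.
  have h := @lebesgue_measure_ball R (rV_uncons c).1 r (ltW r0).
  apply: (@lt_le_trans _ _ ((r *+ 2)%:E)); first by rewrite lte_fin mulrn_wgt0.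
  by rewrite le_eqVlt; apply/orP; left; apply/eqP; exact: esym h.
exact: measurable_ball.
Qed.

Lemma rI_gt0 n (p : 'rV[R]_n -> R) x0 : continuous p -> (forall x, 0 <= p x) ->
  0 < p x0 -> rint (leb R n) p -> 0 < \int[leb R n]_x p x.
Proof.
move=> cp p0 px0 ip.
have /cvgrPdist_lt/(_ (p x0 / 2) ltac:(by rewrite divr_gt0)) := cp x0.
move=> /nbhs_ballP[r /= r0 hr].
pose B := box x0 (r / 2); have mB := measurable_box x0 (r / 2) : measurable B.
have pB x : B x -> p x0 / 2 <= p x.
  move=> Bx; have /hr : ball x0 r x.
    rewrite -ball_normE /=; apply: le_lt_trans (_ : r / 2 < r); last by rewrite ltr_pdivrMr// ltr_pMr// ltr1n.
    apply: rV_norm_le => [|i]; first by rewrite ltW// divr_gt0.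
    by rewrite !mxE distrC ltW.
  by rewrite /= ltr_norml => /andP[_]; lra.
have c0 : 0 < p x0 / 2 by rewrite divr_gt0.
have iB : rint (leb R n) (fun x => (\1_B x : R)).
  apply: (@rint_dom _ _ _ _ _ (fun x => (p x0 / 2)^-1 * p x)).
  - exact: measurable_indic.
  - move=> x; rewrite indicE; case: (boolP (x \in B)) => [/set_mem/pB h|_].
      by rewrite normr1 -ler_pdivrMl ?invr_gt0// invrK mulr1.
    by rewrite normr0 mulr_ge0// invr_ge0 ltW.
  - exact: rintZ.
have lB : (leb R n B < +oo)%E.
  have /integrableP[_] := iB; under eq_integral do rewrite /= ger0_norm//.
  by rewrite integral_indic// setIT.
apply: (@lt_le_trans _ _ (p x0 / 2 * \int[leb R n]_x (\1_B x : R))).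
  rewrite mulr_gt0// /Rintegral integral_indic// setIT fine_gt0// lB andbT.
  by apply: leb_box_gt0; rewrite divr_gt0.
rewrite -rIZ//; apply: rIle => //; first exact: rintZ.
move=> x; rewrite indicE; case: (boolP (x \in B)) => [/set_mem/pB h|_]; first by rewrite mulr1.
by rewrite mulr0.
Qed.

Lemma mass_gt0 n (a : R) : 0 < a -> 0 < mass n a.
Proof.
move=> a0; apply: (@rI_gt0 n (gr a) 0) => //.
- by have [] := @ccont_gau R n a.
- by move=> x; exact: gr_ge0.
- exact: gr_gt0.
- exact: rint_gr.
Qed.

End Positivity.

(** * Fourier inversion and the short-time Fourier transform *)

Section ComplexLimits.
Variable R : realType.
Local Notation C := R[i].

Definition cto (u : nat -> C) (l : C) := cabs (u k - l) @[k --> \oo] --> (0 : R).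

Lemma cto_near (u : nat -> C) l (e : nat -> R) :
  (\forall k \near \oo, cabs (u k - l) <= e k) -> e k @[k --> \oo] --> (0 : R) -> cto u l.
Proof.
move=> ue e0; apply: (@squeeze_cvgr _ _ _ _ (fun=> 0) e) => //; last exact: cvg_cst.
by apply: filterS ue => k h; rewrite cabs_ge0 h.
Qed.

Lemma cto_dom (u : nat -> C) l (e : nat -> R) :
  (forall k, cabs (u k - l) <= e k) -> e k @[k --> \oo] --> (0 : R) -> cto u l.
Proof. by move=> h; apply: cto_near; apply: nearW. Qed.

Lemma cto_ext (u v : nat -> C) l : u =1 v -> cto u l -> cto v l.
Proof. by move=> /funext ->. Qed.

Lemma cto_cst (l : C) : cto (fun=> l) l.
Proof. by apply: (@cto_dom _ _ (fun=> 0)) => [k|]; [rewrite subrr cabs0|exact: cvg_cst]. Qed.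

Lemma ctoD (u v : nat -> C) a b : cto u a -> cto v b -> cto (fun k => u k + v k) (a + b).
Proof.
move=> ua vb; apply: (@cto_dom _ _ (fun k => cabs (u k - a) + cabs (v k - b))).
  by move=> k; rewrite opprD addrACA cabsD.
by rewrite -[X in _ --> X](addr0 0); exact: cvgD ua vb.
Qed.

Lemma ctoM (u v : nat -> C) a b : cto u a -> cto v b -> cto (fun k => u k * v k) (a * b).
Proof.
move=> ua vb.
apply: (@cto_dom _ _ (fun k => cabs (u k - a) * cabs (v k - b) +
   (cabs (u k - a) * cabs b + cabs a * cabs (v k - b)))).
  move=> k; rewrite -!cabsM (_ : u k * v k - a * b =
    (u k - a) * (v k - b) + ((u k - a) * b + a * (v k - b))); last by ring.
  by rewrite (le_trans (cabsD _ _))// lerD2l cabsD.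
have h1 : cabs (u k - a) * cabs (v k - b) @[k --> \oo] --> (0 * 0 : R) by exact: cvgM.
have h2 : cabs (u k - a) * cabs b @[k --> \oo] --> (0 * cabs b : R).
  by apply: cvgM => //; exact: cvg_cst.
have h3 : cabs a * cabs (v k - b) @[k --> \oo] --> (cabs a * 0 : R).
  by apply: cvgM => //; exact: cvg_cst.
have := cvgD h1 (cvgD h2 h3); rewrite !(mul0r, mulr0, addr0); exact.
Qed.

Lemma ctoZ (c : C) (u : nat -> C) a : cto u a -> cto (fun k => c * u k) (c * a).
Proof. exact: ctoM (cto_cst c). Qed.

Lemma cto_unique (u : nat -> C) a b : cto u a -> cto u b -> a = b.
Proof.
move=> ua ub; apply/eqP; rewrite -subr_eq0; apply/eqP/cabs_eq0.
have h : cabs (u k - a) + cabs (u k - b) @[k --> \oo] --> (0 : R).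
  by rewrite -[X in _ --> X](addr0 0); exact: cvgD ua ub.
apply/eqP; rewrite eq_le cabs_ge0 andbT.
apply: (cvgr_to_ge h); apply: nearW => k.
rewrite (_ : a - b = (u k - b) - (u k - a)); last by ring.
rewrite [leRHS]addrC; exact: cabsB.
Qed.

Lemma cto_real (u : nat -> R) (a : R) : u k @[k --> \oo] --> a -> cto (fun k => (u k)%:C%C) (a%:C)%C.
Proof.
move=> h; rewrite /cto; under eq_fun do rewrite -rmorphB cabs_real.
by rewrite -(normr0 R) -(subrr a); apply: cvg_norm; apply: cvgB => //; exact: cvg_cst.
Qed.

Lemma cto_Re (u : nat -> C) l : cto u l -> complex.Re (u k) @[k --> \oo] --> complex.Re l.
Proof.
move=> /cvgrPdist_lt h; apply/cvgrPdist_lt => e /h; apply: filterS => k.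
rewrite sub0r normrN ger0_norm ?cabs_ge0// cabs_distC; apply: le_lt_trans.
by rewrite -ReB Re_le_cabs.
Qed.

Lemma cto_Im (u : nat -> C) l : cto u l -> complex.Im (u k) @[k --> \oo] --> complex.Im l.
Proof.
move=> /cvgrPdist_lt h; apply/cvgrPdist_lt => e /h; apply: filterS => k.
rewrite sub0r normrN ger0_norm ?cabs_ge0// cabs_distC; apply: le_lt_trans.
by rewrite -ImB Im_le_cabs.
Qed.

Lemma cto_ReIm (u : nat -> C) l : complex.Re (u k) @[k --> \oo] --> complex.Re l ->
  complex.Im (u k) @[k --> \oo] --> complex.Im l -> cto u l.
Proof.
move=> hr hi.
apply: (@cto_dom _ _ (fun k => `|complex.Re (u k) - complex.Re l| + `|complex.Im (u k) - complex.Im l|)).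
  by move=> k; rewrite (le_trans (cabs_le_ReIm _))// ReB ImB.
have h (v : nat -> R) (a : R) : v k @[k --> \oo] --> a -> `|v k - a| @[k --> \oo] --> (0 : R).
  by move=> va; rewrite -(normr0 R) -(subrr a); apply: cvg_norm; apply: cvgB => //; exact: cvg_cst.
by rewrite -[X in _ --> X](addr0 0); apply: cvgD; exact: h.
Qed.

Lemma dominated_cto (d : measure_display) (T : measurableType d) (mu : {measure set T -> \bar R})
    (u : nat -> T -> C) (v : T -> C) (b : T -> R) :
  (forall n, cmf (u n)) -> cmf v -> (forall x, cto (fun k => u k x) (v x)) ->
  (forall n x, cabs (u n x) <= b x) -> rint mu b ->
  cint mu v /\ cto (fun k => cI mu (u k)) (cI mu v).
Proof.
move=> mu_ mv uv ub ib.
have [||iv hr hi] := dominated_cI mu_ mv _ _ ub ib.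
- by move=> x; exact: cto_Re.
- by move=> x; exact: cto_Im.
by split=> //; exact: cto_ReIm.
Qed.

Lemma cto_cabs_le (u : nat -> C) l (b : R) : cto u l -> (forall k, cabs (u k) <= b) -> cabs l <= b.
Proof.
move=> ul ub; rewrite -[leRHS]addr0.
have h : b + cabs (u k - l) @[k --> \oo] --> b + 0 by apply: cvgD => //; exact: cvg_cst.
apply: (cvgr_to_ge h); apply: nearW => k.
by rewrite -[in leLHS](subKr (u k) l) (le_trans (cabsB _ _))// lerD.
Qed.

End ComplexLimits.

Section MeasurableComplex.
Context (R : realType) (d : measure_display) (T : measurableType d).
Local Notation C := R[i].

Lemma cmf_comp d' (Y : measurableType d') (f : Y -> C) (phi : T -> Y) :
  measurable_fun setT phi -> cmf f -> cmf (fun x => f (phi x)).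
Proof.
by move=> mphi [mr mi]; split; [exact: (measurableT_comp mr)|exact: (measurableT_comp mi)].
Qed.

Lemma cmf_cexp (f : T -> C) : cmf f -> cmf (fun x => cexp (f x)).
Proof.
move=> [mr mi]; split; apply: measurable_funM.
- exact: measurableT_comp (@measurable_expR R) mr.
- exact: (measurableT_comp (continuous_measurable_fun (@continuous_cos R)) mi).
- exact: measurableT_comp (@measurable_expR R) mr.
- exact: (measurableT_comp (continuous_measurable_fun (@continuous_sin R)) mi).
Qed.

Lemma cmf_expi (b : T -> R) : measurable_fun setT b -> cmf (fun x => expi2pi (b x)).
Proof.
move=> mb; under eq_fun do rewrite expi2piE.
by apply: cmf_cexp; apply: cmf_mul; [exact: cmf_cst|exact: cmf_real].
Qed.

Lemma mf_dot n (f g : T -> 'rV[R]_n) : measurable_fun setT f -> measurable_fun setT g ->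
  measurable_fun setT (fun x => dot (f x) (g x)).
Proof.
move=> mf mg; apply: measurable_sum => i; apply: measurable_funM.
  exact: (measurableT_comp (measurable_rV_coord i) mf).
exact: (measurableT_comp (measurable_rV_coord i) mg).
Qed.

Lemma mf_rVD n (f g : T -> 'rV[R]_n) : measurable_fun setT f -> measurable_fun setT g ->
  measurable_fun setT (fun x => f x + g x).
Proof.
move=> mf mg; apply: measurable_fun_rVP => i; rewrite /comp /rV_coord.
under eq_fun do rewrite mxE; apply: measurable_funD.
  exact: (measurableT_comp (measurable_rV_coord i) mf).
exact: (measurableT_comp (measurable_rV_coord i) mg).
Qed.

Lemma mf_rVN n (f : T -> 'rV[R]_n) : measurable_fun setT f ->
  measurable_fun setT (fun x => - f x).
Proof.
move=> mf; apply: measurable_fun_rVP => i; rewrite /comp /rV_coord.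
under eq_fun do rewrite mxE; apply: mf_opp.
exact: (measurableT_comp (measurable_rV_coord i) mf).
Qed.

Lemma mf_rVB n (f g : T -> 'rV[R]_n) : measurable_fun setT f -> measurable_fun setT g ->
  measurable_fun setT (fun x => f x - g x).
Proof. by move=> mf mg; apply: mf_rVD => //; exact: mf_rVN. Qed.

Lemma mf_lsub n m (f : T -> 'rV[R]_(n + m)) : measurable_fun setT f ->
  measurable_fun setT (fun x => lsubmx (f x)).
Proof.
move=> mf; apply: measurable_fun_rVP => i; rewrite /comp /rV_coord.
under eq_fun do rewrite mxE.
exact: (measurableT_comp (measurable_rV_coord _) mf).
Qed.

Lemma mf_rsub n m (f : T -> 'rV[R]_(n + m)) : measurable_fun setT f ->
  measurable_fun setT (fun x => rsubmx (f x)).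
Proof.
move=> mf; apply: measurable_fun_rVP => i; rewrite /comp /rV_coord.
under eq_fun do rewrite mxE.
exact: (measurableT_comp (measurable_rV_coord _) mf).
Qed.

Lemma mf_jw n (f : T -> 'rV[R]_n) r : measurable_fun setT f ->
  measurable_fun setT (fun x => jw (f x) `^ r).
Proof. by move=> mf; exact: (measurableT_comp (@measurable_jw_powR R n r) mf). Qed.

End MeasurableComplex.

Section FourierInversion.
Variables (R : realType) (n : nat).
Local Notation V := 'rV[R]_n.
Local Notation C := R[i].

Lemma cmf_fourier (F : V -> C) : cmf F -> cmf (fourier F).
Proof.
move=> mF.
apply: (@cmf_cI_param _ _ _ _ _ (leb R n) (fun p : V * V => F p.2 * expi2pi (- dot p.2 p.1))).
apply: cmf_mul; first by apply: cmf_comp mF; exact: measurable_snd.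
apply: cmf_expi; apply: mf_opp; apply: mf_dot; [exact: measurable_snd|exact: measurable_fst].
Qed.

(** Multiplication formula: Fubini moves the Fourier transform from [F] to the Gaussian, whose
    transform is known. *)
Lemma fourier_gau_swap (F : V -> C) (M r a : R) : n%:R < r -> cmf F ->
  (forall t, cabs (F t) <= M * jw t `^ (- r)) -> 0 < a ->
  cI (leb R n) (fun xi => fourier F xi * gau a xi) =
  ((mass n a)%:C)%C * cI (leb R n) (fun t => F t * gau a^-1 t).
Proof.
move=> nr mF bF a0; have iF := rapid_cint nr mF bF.
have mg : cmf (@gau R n a) := ccont_cmf (@ccont_gau R n a).
have mchi : cmf (fun p : V * V => expi2pi (- dot p.2 p.1)).
  by apply: cmf_expi; apply: mf_opp; apply: mf_dot; [exact: measurable_snd|exact: measurable_fst].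
have i1 (xi : V) : cint (leb R n) (fun t => F t * expi2pi (- dot t xi)).
  apply: (rapid_cint nr _ (M := M)); first by apply: cmf_mul => //; exact: cmf_chi.
  by move=> t; rewrite cabsM cabs_expi2pi mulr1.
have i2 (t : V) : cint (leb R n) (fun xi => gau a xi * expi2pi (- dot xi t)).
  apply: (cint_dom _ (b := gr a)); first by apply: cmf_mul => //; exact: cmf_chi.
    by move=> xi; rewrite cabsM cabs_expi2pi mulr1 cabs_gau.
  exact: rint_gr.
transitivity (cI (leb R n) (fun xi => cI (leb R n) (fun t => gau a xi * (F t * expi2pi (- dot t xi))))).
  by apply: cI_ext => xi; rewrite cIZ// mulrC.
rewrite (@cI_swap _ _ _ _ _ (leb R n) (leb R n)
  (fun xi t => gau a xi * (F t * expi2pi (- dot t xi)))); last first.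
  apply: (@cint_prod _ _ _ _ _ _ _ _ (fun xi t => gr a xi * cabs (F t))
    (fun xi => gr a xi * \int[leb R n]_t cabs (F t))).
  - apply: cmf_mul; first by apply: cmf_comp mg; exact: measurable_fst.
    by apply: cmf_mul => //; apply: cmf_comp mF; exact: measurable_snd.
  - by move=> xi t /=; rewrite !cabsM cabs_expi2pi mulr1 cabs_gau.
  - by move=> xi; apply: rintZ; exact: cint_cabs.
  - by move=> xi; rewrite rIZ//; exact: cint_cabs.
  - under eq_fun do rewrite mulrC.
    by apply: rintZ; exact: rint_gr.
rewrite -cIZ; last first.
  apply: (cint_dom _ (b := fun t => cabs (F t))); last exact: cint_cabs.
    by apply: cmf_mul => //; exact: ccont_cmf (@ccont_gau R n _).
  move=> t; rewrite cabsM cabs_gau ler_piMr ?cabs_ge0// /gr -expR0 ler_expR oppr_le0.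
  by rewrite !mulr_ge0 ?pi_ge0 ?dot_ge0// invr_ge0 ltW.
apply: cI_ext => t; rewrite mulrCA -fourier_gau// fourierE -cIZ//.
by apply: cI_ext => xi; rewrite mulrCA (dotC t).
Qed.

(** The Lipschitz bound reduces the error to the first moment of [gr b], which is of order
    [b^(-1/2)] times its mass. *)
Lemma gau_concentrate (F : V -> C) (L b : R) : 0 < b -> 0 <= L -> cmf F ->
  (forall t, cabs (F t - F 0) <= L * `|t|) ->
  cabs (cI (leb R n) (fun t => F t * gau b t) - F 0 * ((mass n b)%:C)%C) <=
  L * (1 + n%:R) / Num.sqrt b * mass n b.
Proof.
move=> b0 L0 mF bF; have mg : cmf (@gau R n b) := ccont_cmf (@ccont_gau R n b).
have [im em] := @gr_moment R n b b0.
have ig := @rint_gr R n b b0.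
pose c := Num.sqrt b; have c0 : 0 < c by rewrite sqrtr_gt0.
have cb : b = c ^+ 2 by rewrite sqr_sqrtr// ltW.
(* The arithmetic-geometric inequality at scale [c = sqrt b] trades the first moment for the second
   one, computed in [gr_moment]. *)
have tle (t : V) : `|t| <= c^-1 + c * dot t t.
  have h := sqr_norm_le_dot t; have ci : c * c^-1 = 1 by rewrite divff// gt_eqF.
  have ci0 : 0 < c^-1 by rewrite invr_gt0.
  rewrite -(@ler_pM2l _ c)// mulrDr ci.
  have h2 : (c * `|t|) ^+ 2 <= c * (c * dot t t).
    by rewrite exprMn expr2 mulrA -!mulrA ler_wpM2l ?(ltW c0)// ler_wpM2l ?(ltW c0).
  by have := sqr_ge0 (c * `|t| - 1); nra.
have bd t : cabs ((F t - F 0) * gau b t) <= L * (c^-1 * gr b t + c * (dot t t * gr b t)).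
  rewrite cabsM cabs_gau [leRHS](_ : _ = L * (c^-1 + c * dot t t) * gr b t); last by ring.
  by rewrite ler_wpM2r ?gr_ge0// (le_trans (bF t))// ler_wpM2l.
have ib : rint (leb R n) (fun t => L * (c^-1 * gr b t + c * (dot t t * gr b t))).
  by apply: rintZ; apply: rintD; exact: rintZ.
have mD : cmf (fun t => (F t - F 0) * gau b t).
  apply: cmf_mul => //; apply: cmf_add => //; exact: cmf_cst.
have iD := cint_dom mD bd ib.
have -> : cI (leb R n) (fun t => F t * gau b t) - F 0 * ((mass n b)%:C)%C =
    cI (leb R n) (fun t => (F t - F 0) * gau b t).
  have -> : F 0 * ((mass n b)%:C)%C = cI (leb R n) (fun t => F 0 * gau b t).
    by rewrite (cIZ _ (@cint_gau R n b b0)) cI_gau.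
  rewrite -cIB//.
  - by apply: cI_ext => t; ring.
  - rewrite (_ : (fun t => F t * _) = fun t => (F t - F 0) * gau b t + F 0 * gau b t); last first.
      by apply/funext => t; ring.
    by apply: cintD => //; apply: cintZ; exact: cint_gau.
  - by apply: cintZ; exact: cint_gau.
rewrite (le_trans (cI_le_dom mD bd ib))// rIZ; last by apply: rintD; exact: rintZ.
rewrite (rID (rintZ c^-1 ig) (rintZ c im)) (rIZ _ ig) (rIZ _ im).
rewrite em -/(mass n b) -!mulrA ler_wpM2l// -/c.
have m0 := ltW (@mass_gt0 R n b b0).
have -> : c * (n%:R * ((2 * (pi * b))^-1 * mass n b)) = n%:R / (2 * pi) * (c^-1 * mass n b).
  have -> : (2 * (pi * b))^-1 = (2 * pi)^-1 * (c^-1 * c^-1) by rewrite mulrA cb expr2 !invfM.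
  transitivity (n%:R / (2 * pi) * (c / c) * (c^-1 * mass n b)); first by ring.
  by rewrite divff ?mulr1// gt_eqF.
rewrite [leRHS]mulrDl [X in _ <= X + _]mul1r lerD2l ler_wpM2r ?mulr_ge0 ?invr_ge0 ?(ltW c0)//.
rewrite ler_pdivrMr ?mulr_gt0 ?pi_gt0// ler_peMr// (le_trans _ (_ : 2 * 2 <= _))//.
  lra.
by rewrite ler_wpM2l// pi_ge2.
Qed.

Lemma schwartz_cont (f : V -> C) : schwartz f -> ccont f.
Proof. by move=> /(@schwartz_rapid _ _ _ 0%N 0)[M /SB_cont]. Qed.

Lemma schwartz_cmf (f : V -> C) : schwartz f -> cmf f.
Proof. by move=> /schwartz_cont/ccont_cmf. Qed.

Lemma schwartz_decay (f : V -> C) (r : R) : schwartz f ->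
  exists2 M : R, 0 <= M & forall x, cabs (f x) <= M * jw x `^ (- r).
Proof.
move=> /(@schwartz_rapid _ _ _ 0%N r)[M hM]; exists M; first exact: rapid_ge0 hM.
by move=> x; exact: SB_bound hM.
Qed.

Lemma schwartz_cint (f : V -> C) : schwartz f -> cint (leb R n) f.
Proof.
move=> sf; have [M _ hM] := schwartz_decay (n%:R + 1) sf.
by apply: rapid_cint hM; rewrite ?ltrDl//; exact: schwartz_cmf.
Qed.

Lemma schwartz_lip (f : V -> C) : schwartz f ->
  exists2 L : R, 0 <= L & forall x y, cabs (f y - f x) <= L * `|y - x|.
Proof.
move=> sf; have [M hM] := @schwartz_rapid _ _ _ 1%N 0 sf.
have M0 := rapid_ge0 hM.
exists (2 * n%:R * M); first by rewrite !mulr_ge0.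
move=> x y; apply: (@clipschitz _ _ f (fun i => cpderiv [:: i] f)) => [i z|i z _].
  by apply: csmooth_isD; case: sf.
have := SB_cpderiv z hM (isT : (size [:: i] <= 1)%N).
by rewrite oppr0 powRr0 mulr1.
Qed.

Lemma gau_regularization (F : V -> C) : schwartz F ->
  exists2 L : R, 0 <= L & forall k : nat,
    cabs (cI (leb R n) (fun xi => fourier F xi * gau (k.+1%:R)^-1 xi) -
      F 0 * ((mass n (k.+1%:R)^-1 * mass n k.+1%:R)%:C)%C) <=
    L / Num.sqrt k.+1%:R * (mass n (k.+1%:R)^-1 * mass n k.+1%:R).
Proof.
move=> sF; have [L L0 hL] := schwartz_lip sF.
have [M M0 hM] := schwartz_decay (n%:R + 1) sF.
exists (L * (1 + n%:R)); first by rewrite mulr_ge0// addr_ge0.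
move=> k; pose b : R := k.+1%:R; have b0 : 0 < b by [].
have bi : 0 < b^-1 by rewrite invr_gt0.
rewrite (fourier_gau_swap _ (schwartz_cmf sF) hM bi) ?ltrDl// invrK.
rewrite rmorphM/= (mulrCA (F 0)) -mulrBr cabsM cabs_real ger0_norm; last first.
  by rewrite ltW// mass_gt0.
rewrite (mulrCA _ (mass n b^-1)) ler_wpM2l//; first by rewrite ltW// mass_gt0.
apply: gau_concentrate => //; first exact: schwartz_cmf.
by move=> t; have := hL 0 t; rewrite subr0.
Qed.

Lemma cto_gau_reg (F : V -> C) : schwartz F ->
  cto (fun k => cI (leb R n) (fun xi => fourier F xi * gau (k.+1%:R)^-1 xi))
    (cI (leb R n) (fourier F)).
Proof.
move=> sF; have [M hM] := @schwartz_rapid _ _ _ n.+1 (n%:R + 1) sF.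
have nr : n%:R < n%:R + 1 :> R by rewrite ltrDl.
have mF := cmf_fourier (schwartz_cmf sF).
pose B := 2 ^+ n.+2 * jint n (n%:R + 1) * M.
have bF xi : cabs (fourier F xi) <= B * jw xi `^ (- n.+1%:R) by exact: fourier_decay.
have ib : rint (leb R n) (fun xi => B * jw xi `^ (- n.+1%:R)).
  by apply: rintZ; apply: rint_decay; rewrite ltr_nat.
refine (proj2 (dominated_cto _ mF _ _ ib)).
- by move=> k; apply: cmf_mul => //; exact: ccont_cmf (@ccont_gau R n _).
- move=> xi; rewrite -[X in cto _ X]mulr1; apply: ctoZ; apply: cto_real.
  have h : - (pi * dot xi xi) * harmonic k @[k --> \oo] --> (- (pi * dot xi xi) * 0 : R).
    by apply: cvgM; [exact: cvg_cst|exact: cvg_harmonic].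
  rewrite mulr0 in h.
  have h2 : expR (- (pi * dot xi xi) * harmonic k) @[k --> \oo] --> (expR 0 : R).
    exact: (continuous_cvg _ (@continuous_expR R 0) h).
  rewrite expR0 in h2; rewrite (_ : (fun k : nat => gr _ _) = fun k => expR (- (pi * dot xi xi) * harmonic k))//.
  by apply/funext => k; rewrite /gr /harmonic /=; congr expR; ring.
- move=> k xi; rewrite cabsM cabs_gau (le_trans _ (bF xi))// ler_piMr ?cabs_ge0//.
  by rewrite /gr -expR0 ler_expR oppr_le0 !mulr_ge0 ?pi_ge0 ?dot_ge0// invr_ge0.
Qed.

(** Comparison with the Gaussian [G]: the regularized integrals [Y k] of [F] and [X k] of [G] are
    close to [F 0 * m k] and [m k], so [Y k - X k * F 0] tends to 0. The limit of [X k] then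
    supplies the constant, although [m k] itself is not evaluated. *)
Lemma fourier_inv0 (F : V -> C) : schwartz F ->
  cI (leb R n) (fourier F) = ((mass n 1 ^+ 2)%:C)%C * F 0.
Proof.
move=> sF; pose G : V -> C := gau 1.
have sG : schwartz G by apply: schwartz_gau.
have G0 : G 0 = 1 by rewrite /G /gau gr0.
have eG : cI (leb R n) (fourier G) = ((mass n 1 ^+ 2)%:C)%C.
  transitivity (cI (leb R n) (fun xi => ((mass n 1)%:C)%C * gau 1 xi)).
    by apply: cI_ext => xi; rewrite fourier_gau// invr1.
  by rewrite (cIZ _ (@cint_gau R n 1 ltr01)) cI_gau -rmorphM expr2.
have [L L0 hL] := gau_regularization sF; have [K K0 hK] := gau_regularization sG.
pose X (k : nat) := cI (leb R n) (fun xi => fourier G xi * gau (k.+1%:R)^-1 xi).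
pose Y (k : nat) := cI (leb R n) (fun xi => fourier F xi * gau (k.+1%:R)^-1 xi).
have YF : cto Y (cI (leb R n) (fourier F)) := cto_gau_reg sF.
have XG : cto X ((mass n 1 ^+ 2)%:C)%C by rewrite -eG; exact: cto_gau_reg sG.
pose m k := mass n (k.+1%:R : R)^-1 * mass n (k.+1%:R : R).
have m0 k : 0 <= m k by rewrite mulr_ge0// ltW// mass_gt0// invr_gt0.
pose e (k : nat) : R := (Num.sqrt k.+1%:R)^-1.
have e0 k : 0 <= e k by rewrite invr_ge0 sqrtr_ge0.
have eto0 : e k @[k --> \oo] --> (0 : R).
  have h : Num.sqrt (harmonic k) @[k --> \oo] --> (Num.sqrt 0 : R).
    exact: (continuous_cvg _ (@sqrt_continuous R 0) (@cvg_harmonic R)).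
  rewrite sqrtr0 in h; rewrite (_ : e = fun k => Num.sqrt (harmonic k))//.
  by apply/funext => k; rewrite /e /harmonic sqrtrV ?ler0n.
apply: (@cto_unique _ Y) => //.
pose c := cabs ((mass n 1 ^+ 2)%:C%C : C) + 1.
have hX : \forall k \near \oo, cabs (X k) <= c.
  move: XG => /cvgrPdist_lt/(_ 1 ltr01); apply: filterS => k.
  rewrite sub0r normrN ger0_norm ?cabs_ge0// => h.
  by rewrite -(subrK ((mass n 1 ^+ 2)%:C%C) (X k)) (le_trans (cabsD _ _))// addrC lerD2l ltW.
(* Boundedness of [m k] is read off from that of [X k]: their distance is [K * e k * m k],
   eventually at most half of [m k]. *)
have hm : \forall k \near \oo, m k <= 2 * c.
  have hKe : K * e k @[k --> \oo] --> (K * 0 : R) by apply: cvgM => //; exact: cvg_cst.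
  rewrite mulr0 in hKe; move/cvgrPdist_lt : hKe => /(_ 2^-1 ltac:(by rewrite invr_gt0)) hKe.
  apply: filterS2 hX hKe => k Xc; rewrite sub0r normrN ger0_norm ?mulr_ge0// => Ke.
  have := hK k; rewrite G0 mul1r -/(m k) -/(e k) => h.
  have h2 : m k <= cabs (X k) + cabs (X k - ((m k)%:C)%C).
    have := cabsB (X k) (X k - ((m k)%:C)%C).
    by rewrite opprB addrC subrK cabs_real ger0_norm.
  have : K * e k * m k <= 2^-1 * m k by rewrite ler_wpM2r// ltW.
  by move: h; rewrite /X; lra.
have YXF : cto (fun k => Y k - X k * F 0) 0.
  apply: (@cto_near _ _ _ (fun k => (L + K * cabs (F 0)) * (2 * c) * e k)); last first.
    by rewrite -[X in _ --> X](mulr0 ((L + K * cabs (F 0)) * (2 * c))); apply: cvgM => //; exact: cvg_cst.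
  apply: filterS hm => k hmk; rewrite subr0.
  have -> : Y k - X k * F 0 = (Y k - F 0 * ((m k)%:C)%C) - (X k - ((m k)%:C)%C) * F 0 by ring.
  have h1 := hL k; have h2 := hK k; rewrite G0 mul1r in h2.
  rewrite (le_trans (cabsB _ _))// cabsM.
  apply: (@le_trans _ _ (L * e k * m k + K * e k * m k * cabs (F 0))).
    by rewrite lerD// ler_wpM2r// cabs_ge0.
  have -> : L * e k * m k + K * e k * m k * cabs (F 0) = (L + K * cabs (F 0)) * e k * m k by ring.
  rewrite -[leLHS]mulrA -[leRHS]mulrA ler_wpM2l ?addr_ge0 ?mulr_ge0 ?cabs_ge0//.
  by rewrite mulrC ler_wpM2r.
have := ctoD YXF (ctoM XG (cto_cst (F 0))); rewrite add0r.
by apply: cto_ext => k; rewrite subrK.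
Qed.

Lemma fourier_inv (F : V -> C) (t : V) : schwartz F ->
  schwartz (fun s => F (s + t)) ->
  cI (leb R n) (fun xi => fourier F xi * expi2pi (dot t xi)) = ((mass n 1 ^+ 2)%:C)%C * F t.
Proof.
move=> sF sFt; have mF := schwartz_cmf sF.
rewrite -[in RHS](add0r t) -(fourier_inv0 sFt); apply: cI_ext => xi.
rewrite [RHS]fourierE.
have mh : cmf (fun s : V => F s * expi2pi (- dot s xi)) by apply: cmf_mul => //; exact: cmf_chi.
transitivity (cI (leb R n) (fun s => expi2pi (dot t xi) * (F (s + t) * expi2pi (- dot (s + t) xi)))).
  rewrite cIZ; first by rewrite mulrC fourierE -(cI_shift t mh).
  apply: (@cint_shift _ _ t (fun s => F s * expi2pi (- dot s xi))).
  apply: (cint_dom mh (b := fun s => cabs (F s))); last exact/cint_cabs/schwartz_cint.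
  by move=> s; rewrite cabsM cabs_expi2pi mulr1.
apply: cI_ext => s; rewrite dotDl opprD expi2piD.
have := expi2piNl (dot t xi); set A := expi2pi (- _); set B := expi2pi _ => AB.
transitivity (F (s + t) * expi2pi (- dot s xi) * (A * B)); first by ring.
by rewrite AB mulr1.
Qed.

Lemma schwartz_shift (f : V -> C) (a : V) : schwartz f -> schwartz (fun x => f (x + a)).
Proof.
move=> sf; apply: schwartz_of_rapid => N r.
have [M hM] := schwartz_rapid N `|r| sf.
exists (M * jw a `^ `|r|); apply: SB_le (SB_shift a hM) => x.
have h := peetreN (x + a) (- a) (normr_ge0 r); rewrite addrK jwN in h.
have := SB_ge0 x hM; rewrite pmulr_lge0 ?jw_powR_gt0// => M0.
rewrite -mulrA ler_wpM2l//.
have h2 := peetreN x a (normr_ge0 r); rewrite (le_trans h2)// mulrC ler_wpM2l ?powR_ge0//.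
by rewrite jw_powR_le// lerN2 ler_norm.
Qed.

Lemma schwartz_conj (f : V -> C) : schwartz f -> schwartz (fun x => conjc (f x)).
Proof.
move=> sf; apply: schwartz_of_rapid => N r.
by have [M hM] := schwartz_rapid N r sf; exists M; exact: SB_conj.
Qed.

Lemma schwartzM (f g : V -> C) : schwartz f -> schwartz g -> schwartz (fun x => f x * g x).
Proof.
move=> sf sg; apply: schwartz_of_rapid => N r.
have [M hM] := schwartz_rapid N r sf; have [K hK] := schwartz_rapid N 0 sg.
exists (2 ^+ N * (M * K)); apply: SB_le (SB_mul hM hK) => x.
by rewrite oppr0 powRr0 mulr1 mulrAC !mulrA.
Qed.

Lemma schwartzZ (k : C) (f : V -> C) : schwartz f -> schwartz (fun x => k * f x).
Proof.
move=> sf; apply: schwartz_of_rapid => N r.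
have [M hM] := schwartz_rapid N r sf.
by exists (cabs k * M); apply: SB_le (SB_scale k hM) => x; rewrite mulrA.
Qed.

Lemma schwartzD (f g : V -> C) : schwartz f -> schwartz g -> schwartz (fun x => f x + g x).
Proof.
move=> sf sg; apply: schwartz_of_rapid => N r.
have [M hM] := schwartz_rapid N r sf; have [K hK] := schwartz_rapid N r sg.
by exists (M + K); apply: SB_le (SB_add hM hK) => x; rewrite mulrDl.
Qed.

Lemma schwartz_chi (f : V -> C) (a : V) : schwartz f ->
  schwartz (fun t => expi2pi (dot t a) * f t).
Proof.
move=> sf; apply: schwartz_of_rapid => N r.
have [M hM] := schwartz_rapid N r sf; have [K _ hK] := @SB_chi R n N.
exists (2 ^+ N * (K * jw a ^+ N * M)); apply: SB_le (SB_mul (hK a) hM) => x.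
by rewrite !mulrA.
Qed.

Lemma schwartz_tf (f : V -> C) (x xi : V) : schwartz f -> schwartz (tf_shift x xi f).
Proof. by move=> sf; apply: schwartz_chi; exact: schwartz_shift. Qed.

(** The factors are concentrated at [0] and at [- a], so they are not large together; Peetre's
    inequality spends [q] orders of decay of [f] to express this as decay in [a]. *)
Lemma rapid_mul_shift N (r q M K : R) (f g : V -> C) (a : V) : 0 <= q ->
  rapid N (r + q) M f -> rapid N q K g ->
  rapid N r (2 ^+ N * (M * K) * jw a `^ (- q)) (fun t => f t * g (t + a)).
Proof.
move=> q0 hf hg; have M0 := rapid_ge0 hf; have K0 := rapid_ge0 hg.
apply: SB_le (SB_mul hf (SB_shift a hg)) => x.
rewrite opprD jw_powRD.
have h : jw x `^ (- q) * jw (x + a) `^ (- q) <= jw a `^ (- q).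
  have := peetreN (x + a) (- x) q0; rewrite addrAC subrr add0r jwN => h.
  rewrite -(ler_pM2r (jw_powR_gt0 x q)) mulrAC -jw_powRD addNr powRr0 mul1r.
  have := peetreN a x q0; rewrite addrC. rewrite mulrC => h2.
  by rewrite (le_trans h2)// mulrC.
rewrite [leLHS](_ : _ = 2 ^+ N * (M * K) * (jw x `^ (- q) * jw (x + a) `^ (- q)) * jw x `^ (- r)); last by ring.
by rewrite ler_wpM2r ?powR_ge0// ler_wpM2l// !mulr_ge0.
Qed.

End FourierInversion.

Section STFT.
Variables (R : realType) (n : nat).
Local Notation V := 'rV[R]_n.
Local Notation W := 'rV[R]_(n + n).
Local Notation C := R[i].
Local Notation mV := (leb R n).
Local Notation mW := (leb R (n + n)).

Definition tfa (a : W) (g : V -> C) : V -> C := tf_shift (lsubmx a) (rsubmx a) g.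

Lemma innerE (f g : V -> C) : inner f g = cI mV (fun x => f x * conjc (g x)).
Proof. by []. Qed.

Lemma jw_lsub n1 n2 (a : 'rV[R]_(n1 + n2)) : jw (lsubmx a) <= jw a.
Proof. by rewrite lerD2l; apply: rV_norm_le => // i; rewrite mxE; exact: rV_coord_le. Qed.

Lemma jw_rsub n1 n2 (a : 'rV[R]_(n1 + n2)) : jw (rsubmx a) <= jw a.
Proof. by rewrite lerD2l; apply: rV_norm_le => // i; rewrite mxE; exact: rV_coord_le. Qed.

Lemma jw_le_lrsub n1 n2 (a : 'rV[R]_(n1 + n2)) : jw a <= jw (lsubmx a) * jw (rsubmx a).
Proof.
have l1 := jw_ge1 (lsubmx a); have r1 := jw_ge1 (rsubmx a).
have h : `|a| <= Num.max `|lsubmx a| `|rsubmx a|.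
  apply: rV_norm_le => [|i]; first by rewrite le_max normr_ge0.
  rewrite -[a]hsubmxK; case: (splitP i) => j ij.
    rewrite (_ : i = lshift _ j); last exact/val_inj.
    by rewrite row_mxEl hsubmxK le_max rV_coord_le.
  rewrite (_ : i = rshift _ j); last exact/val_inj.
  by rewrite row_mxEr hsubmxK le_max rV_coord_le orbT.
have x0 := normr_ge0 (lsubmx a); have y0 := normr_ge0 (rsubmx a).
have {}h : `|a| <= `|lsubmx a| + `|rsubmx a| by rewrite (le_trans h)// ge_max lerDl lerDr x0 y0.
have xy := mulr_ge0 x0 y0; rewrite /jw mulrDl mul1r mulrDr mulr1 -addrA lerD2l.
apply: (le_trans h); rewrite [leLHS]addrC lerD2l.
by rewrite lerDl.
Qed.

Lemma cmf_tfa (g : V -> C) : cmf g -> cmf (fun p : W * V => tfa p.1 g p.2).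
Proof.
move=> mg; apply: cmf_mul.
  apply: cmf_expi; apply: mf_dot; first exact: measurable_snd.
  by apply: mf_rsub; exact: measurable_fst.
apply: cmf_comp mg; apply: mf_rVB; first exact: measurable_snd.
by apply: mf_lsub; exact: measurable_fst.
Qed.

Lemma cmf_tf (a : W) (g : V -> C) : cmf g -> cmf (tfa a g).
Proof.
move=> mg; apply: cmf_mul; first by apply: cmf_expi; apply: mf_dot.
by apply: cmf_comp mg; apply: mf_rVB.
Qed.

Lemma cmf_stft (f g : V -> C) : cmf f -> cmf g -> cmf (fun a : W => inner f (tfa a g)).
Proof.
move=> mf mg.
apply: (@cmf_cI_param _ _ _ _ _ (leb R n) (fun p : W * V => f p.2 * conjc (tfa p.1 g p.2))).
apply: cmf_mul; first by apply: cmf_comp mf; exact: measurable_snd.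
by apply: cmf_conj; exact: cmf_tfa.
Qed.

Lemma cabs_tfa a g x : cabs (tfa a g x) = cabs (g (x - lsubmx a)).
Proof. by rewrite /tfa /tf_shift cabsM cabs_expi2pi mul1r. Qed.

Lemma stft_fourier (f g : V -> C) (a : W) :
  inner f (tfa a g) = fourier (fun t => f t * conjc (g (t - lsubmx a))) (rsubmx a).
Proof.
rewrite fourierE innerE; apply: cI_ext => t.
by rewrite /tfa /tf_shift conjcM expi2piJ -mulrA [X in _ * X]mulrC.
Qed.

(** The windowed product is small when the window is far away, and its smoothness gives decay of its
    Fourier transform in frequency. *)
Lemma stft_decay (f g : V -> C) (r : R) : 0 <= r -> schwartz f -> schwartz g ->
  exists2 M : R, 0 <= M & forall a : W, cabs (inner f (tfa a g)) <= M * jw a `^ (- r).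
Proof.
move=> r0 sf sg; pose N := (Num.truncn r).+1.
have rN : r <= N%:R by rewrite ltW// truncnS_gt.
have N0 : 0 <= N%:R :> R by [].
have [M hM] := schwartz_rapid N (n%:R + 1 + N%:R) sf.
have [K hK] := schwartz_rapid N N%:R (schwartz_conj sg).
have nr : n%:R < n%:R + 1 :> R by rewrite ltrDl.
have M0 := rapid_ge0 hM; have K0 := rapid_ge0 hK.
have A0 : 0 <= 2 ^+ N.+1 * jint n (n%:R + 1) * (2 ^+ N * (M * K)).
  apply: mulr_ge0; apply: mulr_ge0; rewrite ?exprn_ge0 ?jint_ge0//.
  exact: mulr_ge0.
exists (2 ^+ N.+1 * jint n (n%:R + 1) * (2 ^+ N * (M * K))) => //.
move=> a; rewrite stft_fourier.
have := fourier_decay (rsubmx a) nr (rapid_mul_shift (- lsubmx a) N0 hM hK).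
move=> /le_trans; apply; rewrite jwN mulrA -[leLHS]mulrA ler_wpM2l//.
have h : jw a `^ r <= jw (lsubmx a) `^ r * jw (rsubmx a) `^ r.
  by rewrite -powRM ?jw_ge0// ge0_ler_powR ?nnegrE ?mulr_ge0 ?jw_ge0// jw_le_lrsub.
have le (x : V) : jw x `^ (- N%:R) <= (jw x `^ r)^-1.
  by rewrite -powRN jw_powR_le// lerN2.
apply: (@le_trans _ _ ((jw (lsubmx a) `^ r)^-1 * (jw (rsubmx a) `^ r)^-1)).
  by rewrite ler_pM ?powR_ge0.
by rewrite -invfM powRN lef_pV2 ?posrE ?mulr_gt0 ?jw_powR_gt0.
Qed.

(** The squared norm of the window, written with a reflected argument because the inversion formula
    integrates [|g (t - x)|^2] over [x]. *)
Definition wenergy (g : V -> C) : R := \int[mV]_x (cabs (g (- x)) ^+ 2).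

(** The constant of the resolution of the identity by time-frequency shifts of [g]: the energy of
    the window times the factor of Fourier inversion. *)
Definition kap (g : V -> C) : R := mass n 1 ^+ 2 * wenergy g.

Lemma rint_wenergy (g : V -> C) : schwartz g -> rint mV (fun x => cabs (g (- x)) ^+ 2).
Proof.
move=> sg; have [M M0 hM] := schwartz_decay (n%:R + 1) sg.
have [K K0 hK] := schwartz_decay 0 sg.
apply: (@rint_dom _ _ _ _ _ (fun x => K * M * jw x `^ (- (n%:R + 1)))).
- apply: measurable_funX; apply: cmf_cabs; apply: cmf_comp (schwartz_cmf sg).
  exact: mf_rVN.
- move=> x; rewrite ger0_norm ?sqr_ge0// expr2 -mulrA ler_pM ?cabs_ge0//.
    by rewrite (le_trans (hK _))// oppr0 powRr0 mulr1.
  by rewrite (le_trans (hM _))// jwN.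
- by apply: rintZ; apply: rint_decay; rewrite ltrDl.
Qed.

Lemma kap_gt0 (g : V -> C) : schwartz g -> (exists x, g x <> 0) -> 0 < kap g.
Proof.
move=> sg [x gx]; rewrite mulr_gt0 ?exprn_gt0 ?mass_gt0//.
apply: (@rI_gt0 R n _ (- x)); last exact: rint_wenergy.
- have [cr ci] := schwartz_cont sg.
  under eq_fun do rewrite cabs_sq.
  have cN (p : V -> R) : continuous p -> continuous (fun y : V => p (- y)).
    by move=> cp y; apply: (@continuous_comp _ _ _ (fun y : V => - y)); [exact: opp_continuous|exact: cp].
  have cr' := cN _ cr; have ci' := cN _ ci.
  move=> y; apply: (@continuousD _ _ _ (fun y : V => complex.Re (g (- y)) ^+ 2)).
    exact: continuousM (cr' y) (cr' y).
  exact: continuousM (ci' y) (ci' y).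
- by move=> y; exact: sqr_ge0.
- rewrite opprK exprn_gt0// lt_neqAle cabs_ge0 andbT eq_sym.
  by apply/eqP => /cabs_eq0.
Qed.

Lemma kap_neq0 (g : V -> C) : schwartz g -> (exists x, g x <> 0) -> ((kap g)%:C)%C != 0 :> C.
Proof. by move=> sg h; rewrite eq_complex/= eqxx andbT gt_eqF// kap_gt0. Qed.

(** For a fixed position [x], the integral over frequencies is Fourier inversion for [f] times the
    conjugate of the window shifted by [x]; the remaining integral over [x] is the energy of the
    window. *)
Lemma stft_inversion (f g : V -> C) (t : V) : schwartz f -> schwartz g ->
  ((kap g)%:C)%C * f t = cI mW (fun a => inner f (tfa a g) * tfa a g t).
Proof.
move=> sf sg; have mf := schwartz_cmf sf; have mg := schwartz_cmf sg.
have mtf : cmf (fun a : W => tfa a g t).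
  have m2 : measurable_fun setT (fun a : W => (a, t)).
    by apply: measurable_fun_pair => //; exact: measurable_cst.
  exact: (cmf_comp m2 (cmf_tfa mg)).
have mF : cmf (fun a : W => inner f (tfa a g) * tfa a g t).
  by apply: cmf_mul => //; exact: cmf_stft.
have iF : cint mW (fun a : W => inner f (tfa a g) * tfa a g t).
  have nr : (n + n)%:R < (n + n)%:R + 1 :> R by rewrite ltrDl.
  have [|M M0 hM] := @stft_decay f g ((n + n)%:R + 1) _ sf sg; first by rewrite addr_ge0.
  have [K K0 hK] := schwartz_decay 0 sg.
  apply: (rapid_cint nr mF (M := M * K)) => a.
  rewrite cabsM mulrAC ler_pM ?cabs_ge0//.
  by rewrite cabs_tfa (le_trans (hK _))// oppr0 powRr0 mulr1.
rewrite cI_app// -(cI_prod1 _).2; last exact/(cint_app mF).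
transitivity (cI mV (fun x : V => ((mass n 1 ^+ 2)%:C)%C * f t * (g (t - x) * conjc (g (t - x))))).
  rewrite cIZ.
    rewrite /kap rmorphM/= -!mulrA; congr (_ * _); rewrite mulrC; congr (_ * _).
    rewrite /wenergy -cI_real.
    have mh : cmf (fun x : V => g (t - x) * conjc (g (t - x))).
      have m1 : measurable_fun setT (fun x : V => t - x) by apply: mf_rVB.
      by apply: cmf_mul; [|apply: cmf_conj]; exact: cmf_comp m1 mg.
    rewrite -(cI_shift t mh); apply: cI_ext => x.
    by rewrite opprD addrCA subrr addr0 mulcJ.
  apply: (@cint_dom _ _ _ _ _ (fun x : V => cabs (g (- (x - t))) ^+ 2)).
  - have m1 : measurable_fun setT (fun x : V => t - x) by apply: mf_rVB.
    by apply: cmf_mul; [|apply: cmf_conj]; exact: cmf_comp m1 mg.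
  - by move=> x; rewrite cabsM cabsJ -expr2 opprB.
  - exact: (@rint_shift _ _ (- t) (fun x => cabs (g (- x)) ^+ 2) (rint_wenergy sg)).
apply: cI_ext => x.
have sFx : schwartz (fun s => f s * conjc (g (s - x))).
  by apply: schwartzM => //; apply: schwartz_conj; exact: schwartz_shift.
have h := fourier_inv sFx (schwartz_shift t sFx).
transitivity (g (t - x) * (((mass n 1 ^+ 2)%:C)%C * (f t * conjc (g (t - x))))); first by ring.
rewrite -h -cIZ.
  apply: cI_ext => xi; rewrite stft_fourier /tfa /tf_shift /rV_app row_mxKl row_mxKr; ring.
have [M hM] := @schwartz_rapid _ _ _ n.+1 (n%:R + 1) sFx.
have nr : n%:R < n%:R + 1 :> R by rewrite ltrDl.
have nr' : n%:R < n.+1%:R :> R by rewrite ltr_nat.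
apply: (rapid_cint nr' _ (M := 2 ^+ n.+2 * jint n (n%:R + 1) * M)).
  apply: cmf_mul; first by apply: cmf_fourier; exact: schwartz_cmf.
  by apply: cmf_expi; apply: mf_dot.
by move=> xi; rewrite cabsM cabs_expi2pi mulr1; exact: fourier_decay.
Qed.

End STFT.

(** * Tempered distributions and phase-space superpositions *)

Section IntegralSmoothness.
Variables (R : realType) (n : nat).
Local Notation V := 'rV[R]_n.
Local Notation C := R[i].
Context (d : measure_display) (T : measurableType d).
Variable mu : {measure set T -> \bar R}.

Lemma cmf_cto (u : nat -> T -> C) (v : T -> C) : (forall k, cmf (u k)) ->
  (forall x, cto (fun k => u k x) (v x)) -> cmf v.
Proof.
move=> mu_ uv; split.
  refine (@measurable_fun_cvg _ _ _ setT (fun k x => complex.Re (u k x)) _ _ _).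
    by move=> k; exact: (mu_ k).1.
  by move=> x _; exact: cto_Re.
refine (@measurable_fun_cvg _ _ _ setT (fun k x => complex.Im (u k x)) _ _ _).
  by move=> k; exact: (mu_ k).2.
by move=> x _; exact: cto_Im.
Qed.

Lemma isD_along (f : V -> C) (x v : V) (t : R) (c : C) : isD f (t *: v + x) v c ->
  isD (fun s : R => f (s *: v + x)) t (1 : R) c.
Proof.
move=> /isD_line[h1 h2]; apply/isD_line; split; [move: h1|move: h2];
  by congr is_derive; apply/funext => s; congr (_ (f _));
  rewrite addrA -scalerDl /GRing.scale/= mulr1.
Qed.

Lemma derive_harmonic (p : R -> R) (a : R) : is_derive (0 : R) (1 : R) p a ->
  (k.+1%:R : R) * (p (k.+1%:R^-1 : R) - p 0) @[k --> \oo] --> a.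
Proof.
move=> [dp <-]; have := dp; rewrite /derivable => /cvg_ex[l].
rewrite /derive => hl; rewrite (cvg_lim _ hl)//.
move/cvgr_dnbhsP : hl => /(_ (fun k : nat => (k.+1%:R^-1 : R))) h.
have hne k : (k.+1%:R^-1 : R) != 0 by rewrite invr_eq0 pnatr_eq0.
have {}h := h (conj hne (@cvg_harmonic R)).
apply: cvg_trans h; apply: near_eq_cvg; apply: nearW => k.
by rewrite /= /GRing.scale/= mulr1 addr0 invrK.
Qed.

(** The derivative is the limit of the difference quotients of step [1 / (k + 1)], each measurable
    in the parameter. *)
Lemma cmf_derive (f g : T -> V -> C) (v x : V) : (forall y, cmf (fun a => f a y)) ->
  (forall a, isD (f a) x v (g a x)) -> cmf (fun a => g a x).
Proof.
move=> mf df.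
apply: (@cmf_cto (fun k a => ((k.+1%:R : R)%:C)%C *
  (f a ((k.+1%:R^-1 : R) *: v + x) - f a ((0 : R) *: v + x)))).
  move=> k; apply: cmf_mul; first exact: cmf_cst.
  by apply: cmf_add; [|apply: cmf_opp]; exact: mf.
move=> a; have /isD_line[h1 h2] := df a.
have e (r : R) (z : C) : complex.Re ((r%:C)%C * z) = r * complex.Re z /\
    complex.Im ((r%:C)%C * z) = r * complex.Im z.
  by rewrite !ReImE/= mul0r mul0r subr0 addr0.
apply: cto_ReIm.
  by under eq_fun do rewrite (e _ _).1 ReB; exact: (derive_harmonic h1).
by under eq_fun do rewrite (e _ _).2 ImB; exact: (derive_harmonic h2).
Qed.

Lemma lip_ccont (f : V -> C) (K : R) : (forall x y, cabs (f y - f x) <= K * `|y - x|) -> ccont f.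
Proof.
move=> lf.
have key (p : V -> R) : (forall x y, `|p y - p x| <= K * `|y - x|) -> continuous p.
  move=> lp x; apply/(@cvgrPdist_lt _ _ _ (nbhs x) (nbhs_filter x)) => e e0.
  have K1 : 0 < `|K| + 1 by rewrite ltr_wpDl.
  apply/nbhs_ballP; exists (e / (`|K| + 1)); first by rewrite /= divr_gt0.
  move=> y; rewrite -ball_normE /= => h; rewrite distrC (le_lt_trans (lp x y))//.
  rewrite (@le_lt_trans _ _ ((`|K| + 1) * `|y - x|))//.
    by rewrite ler_wpM2r// (le_trans (ler_norm K))// lerDl.
  by rewrite -ltr_pdivlMl// mulrC distrC.
split; apply: key => x y.
  by rewrite -ReB (le_trans (Re_le_cabs _)).
by rewrite -ImB (le_trans (Im_le_cabs _)).
Qed.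

Lemma SB_cpderiv_isD N (f : V -> C) B i x : SB N.+1 f B ->
  isD f x (ee i) (cpderiv [:: i] f x) /\ SB N (cpderiv [:: i] f) B.
Proof. by move=> [_ _ /(_ i)[g [dg sg]]]; rewrite (isD_cpderiv dg). Qed.

Lemma isD_of_along (F : V -> C) (x v : V) (c : C) :
  isD (fun t : R => F (t *: v + x)) (0 : R) (1 : R) c -> isD F x v c.
Proof. by move=> [h1 h2]; apply/isD_line; split. Qed.

Section OneStep.
Variables (r : R) (f : T -> V -> C) (b : T -> R).
Hypotheses (r0 : 0 <= r) (ib : rint mu b) (mf : forall x, cmf (fun a => f a x)).
Hypothesis sf : forall a, SB 1 (f a) (fun x => b a * jw x `^ (- r)).

Let b0 a : 0 <= b a.
Proof. by have := SB_ge0 0 (sf a); rewrite pmulr_lge0 ?jw_powR_gt0. Qed.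

Let le1 (x : V) a : b a * jw x `^ (- r) <= b a.
Proof. by rewrite ler_piMr// jw_powRN_le1. Qed.

Let bd x a : cabs (f a x) <= b a * jw x `^ (- r).
Proof. exact: SB_bound (sf a). Qed.

Lemma SB_cI_bound x : cabs (cI mu (fun a => f a x)) <= (\int[mu]_a b a) * jw x `^ (- r).
Proof.
rewrite mulrC -rIZ//; apply: cI_le_dom => //; last exact: rintZ.
by move=> a; rewrite mulrC.
Qed.

Lemma cmf_cpderiv i x : cmf (fun a => cpderiv [:: i] (f a) x).
Proof.
apply: (@cmf_derive f (fun a => cpderiv [:: i] (f a)) (ee i) x mf) => a.
exact: (SB_cpderiv_isD i x (sf a)).1.
Qed.

Let bG i a x : cabs (cpderiv [:: i] (f a) x) <= b a.
Proof. by rewrite (le_trans _ (le1 x a))//; exact: SB_bound (SB_cpderiv_isD i x (sf a)).2. Qed.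

Lemma isD_cI_param i x : isD (fun x => cI mu (fun a => f a x)) x (ee i)
  (cI mu (fun a => cpderiv [:: i] (f a) x)).
Proof.
apply: isD_of_along.
have h := @isD_cI R _ _ mu (fun t a => f a (t *: ee i + x))
  (fun t a => cpderiv [:: i] (f a) (t *: ee i + x)) b 0.
rewrite (_ : cI mu (fun a => cpderiv [:: i] (f a) x) =
  cI mu (fun a => cpderiv [:: i] (f a) ((0 : R) *: ee i + x))); last by rewrite scale0r add0r.
apply: h => //.
- by move=> t; apply: (cint_dom (mf _) (b := b)) => // a; rewrite (le_trans (bd _ _)).
- by move=> t a; apply: isD_along; exact: (SB_cpderiv_isD i _ (sf a)).1.
Qed.

Lemma ccont_cI_param : ccont (fun x => cI mu (fun a => f a x)).
Proof.
apply: (@lip_ccont _ (2 * n%:R * \int[mu]_a b a)) => x y.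
apply: (clipschitz isD_cI_param) => i z _.
by apply: cI_le_dom => //; exact: cmf_cpderiv.
Qed.

End OneStep.

(* One derivative is spent on the continuity of the integral. *)
Lemma SB_cI N (r : R) (f : T -> V -> C) (b : T -> R) : 0 <= r -> rint mu b ->
  (forall x, cmf (fun a => f a x)) ->
  (forall a, SB N.+1 (f a) (fun x => b a * jw x `^ (- r))) ->
  SB N (fun x => cI mu (fun a => f a x)) (fun x => (\int[mu]_a b a) * jw x `^ (- r)).
Proof.
move=> r0 ib; elim: N f => [|N IH] f mf sf;
  have sf1 a : SB 1 (f a) (fun x => b a * jw x `^ (- r)) by exact: SB_sub (sf a).
  by split=> [|x|//]; [exact: ccont_cI_param sf1|exact: SB_cI_bound sf1 x].
split=> [|x|i]; [exact: ccont_cI_param sf1|exact: SB_cI_bound sf1 x|].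
exists (fun x => cI mu (fun a => cpderiv [:: i] (f a) x)); split.
  by move=> x; exact: isD_cI_param sf1 i x.
apply: IH => [x|a]; first exact: cmf_cpderiv sf1 i x.
exact: (SB_cpderiv_isD i 0 (sf a)).2.
Qed.

End IntegralSmoothness.

Section ShiftLipschitz.
Variables (R : realType) (n : nat).
Local Notation V := 'rV[R]_n.
Local Notation W := 'rV[R]_(n + n).
Local Notation C := R[i].

Lemma schwartz_cpderiv (f : V -> C) i : schwartz f -> schwartz (cpderiv [:: i] f).
Proof.
move=> sf; apply: schwartz_of_rapid => N r.
have [M hM] := schwartz_rapid N.+1 r sf; exists M.
exact: (SB_cpderiv_isD i 0 hM).2.
Qed.

Lemma fin_bound (I : finType) (P : I -> R -> Prop) : (forall i, exists2 c, 0 <= c & P i c) ->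
  (forall i c c', c <= c' -> P i c -> P i c') -> exists2 c, 0 <= c & forall i, P i c.
Proof.
move=> h mono.
have h' i : exists c, 0 <= c /\ P i c by have [c c0 Pc] := h i; exists c.
have [c hc] := @boolp.choice _ _ (fun i c => 0 <= c /\ P i c) h'.
exists (\sum_i c i) => [|i]; first by apply: sumr_ge0 => i _; exact: (hc i).1.
apply: mono (hc i).2; rewrite (bigD1 i)//= lerDl sumr_ge0// => j _; exact: (hc j).1.
Qed.

(** The power of [jw x ^+ 2 * jw x'] is the price for comparing the decay at [t] with the decay at
    points as close to [t - x] as [t - x'] is. *)
Definition lipw (r : R) (x x' : V) : R := jw x `^ (2 * r) * jw x' `^ r * `|x' - x|.

Lemma lipw_ge0 r x x' : 0 <= lipw r x x'.
Proof. by rewrite /lipw !mulr_ge0 ?powR_ge0. Qed.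

Lemma shift_lip0 (r M : R) (g : V -> C) (x x' t : V) : 0 <= r -> rapid 1 r M g ->
  cabs (g (t - x') - g (t - x)) <= (2 * n%:R * M) * lipw r x x' * jw t `^ (- r).
Proof.
move=> r0 hM; have M0 := rapid_ge0 hM.
have exx : (t - x') - (t - x) = x - x' by rewrite opprB addrC addrA subrK.
have h := @clipschitz R n g (fun i => cpderiv [:: i] g)
   (M * (jw x `^ (2 * r) * jw x' `^ r) * jw t `^ (- r)) (t - x) (t - x').
rewrite exx (distrC x) in h.
rewrite [leRHS](_ : _ = 2 * n%:R * (M * (jw x `^ (2 * r) * jw x' `^ r) * jw t `^ (- r)) * `|x' - x|);
  last by rewrite /lipw; ring.
apply: h => [i z|i z hz]; first by have [] := SB_cpderiv_isD (N := 0%N) i z hM.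
apply: (le_trans (SB_bound z (SB_cpderiv_isD (N := 0%N) i z hM).2)).
rewrite -mulrA ler_wpM2l//.
have zx : jw (z - t) <= jw x ^+ 2 * jw x'.
  have -> : z - t = (z - (t - x)) - x by rewrite opprB addrA addrAC addrK.
  have h1 : jw (z - (t - x)) <= jw x * jw x'.
    by rewrite (le_trans _ (le_trans (jwD x (- x')) _)) ?jwN// lerD2l (le_trans hz)// distrC.
  by rewrite (le_trans (jwD _ _))// jwN expr2 mulrAC ler_wpM2r ?jw_ge0.
have := peetreN t (z - t) r0; rewrite addrCA subrr addr0 => /le_trans; apply.
rewrite mulrC ler_wpM2r ?powR_ge0//.
apply: (@le_trans _ _ ((jw x ^+ 2 * jw x') `^ r)).
  by rewrite ge0_ler_powR ?nnegrE ?mulr_ge0 ?exprn_ge0 ?jw_ge0.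
by rewrite powRM ?exprn_ge0 ?jw_ge0// -powR_mulrn ?jw_ge0// -powRrM.
Qed.

Lemma rapid_shift_lip N (r : R) (g : V -> C) : 0 <= r -> schwartz g ->
  exists2 c : R, 0 <= c & forall x x' : V,
    SB N (fun t => g (t - x') - g (t - x)) (fun t => c * lipw r x x' * jw t `^ (- r)).
Proof.
move=> r0; elim: N g => [|N IH] g sg; have [M hM] := schwartz_rapid 1%N r sg;
  have M0 := rapid_ge0 hM; have [c0 _ _] := SB_sub (leqnn 1) hM;
  have cg x x' : ccont (fun t : V => g (t - x') - g (t - x)) by
    (under eq_fun do rewrite -mulN1r; apply: ccontD (ccont_shift _ c0) _;
     exact: ccontM (ccont_cst _ _) (ccont_shift _ c0)).
  exists (2 * n%:R * M); first by rewrite !mulr_ge0.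
  by move=> x x'; split=> // t; exact: shift_lip0.
have [|i c c' cc' h x x'|c c1 hc] := @fin_bound _ (fun i c => forall x x' : V,
    SB N (fun t => cpderiv [:: i] g (t - x') - cpderiv [:: i] g (t - x))
      (fun t => c * lipw r x x' * jw t `^ (- r))).
- by move=> i; apply: IH; exact: schwartz_cpderiv.
- refine (SB_le _ (h x x')) => t /=; rewrite ler_wpM2r ?powR_ge0//.
  by rewrite ler_wpM2r ?lipw_ge0.
have M1 : 0 <= 2 * n%:R * M by rewrite !mulr_ge0.
exists (2 * n%:R * M + c); first by rewrite addr_ge0.
move=> x x'; split => //.
  move=> t; rewrite (le_trans (shift_lip0 x x' t r0 hM))//.
  rewrite ler_wpM2r ?powR_ge0//.
  by rewrite ler_wpM2r ?lipw_ge0// lerDl.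
move=> i; exists (fun t => cpderiv [:: i] g (t - x') - cpderiv [:: i] g (t - x)); split.
  have dg z : isD g z (ee i) (cpderiv [:: i] g z) by have [] := SB_cpderiv_isD (N := 0%N) i z hM.
  by move=> t; apply: isDB; apply: isD_shift; exact: dg.
apply: SB_le (hc i x x') => t /=; rewrite ler_wpM2r ?powR_ge0//.
by rewrite ler_wpM2r ?lipw_ge0// lerDr.
Qed.

Lemma chi_lip0 (xi xi' t : V) :
  cabs (expi2pi (dot t xi') - expi2pi (dot t xi)) <= 4 * pi * n%:R * `|xi' - xi| * jw t.
Proof.
have h := @clipschitz R n (fun y => expi2pi (dot y t))
   (fun i y => I2pi R * ((t ord0 i)%:C)%C * expi2pi (dot y t)) (2 * pi * jw t) xi xi'.
rewrite [leRHS](_ : _ = 2 * n%:R * (2 * pi * jw t) * `|xi' - xi|); last by ring.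
rewrite (dotC t) (dotC t xi); apply: h => i z; first exact: isD_chi.
move=> _; rewrite !cabsM cabs_expi2pi mulr1 cabs_I2pi cabs_real ler_wpM2l ?mulr_ge0 ?pi_ge0//.
by rewrite (le_trans (rV_coord_le t i))// lerDr.
Qed.

Lemma SB_chi_lip N : exists2 K : R, 0 <= K & forall xi xi' : V,
  SB N (fun t => expi2pi (dot t xi') - expi2pi (dot t xi))
    (fun t => K * (jw xi ^+ N * jw xi' ^+ N * `|xi' - xi|) * jw t).
Proof.
have cc (xi xi' : V) : ccont (fun t : V => expi2pi (dot t xi') - expi2pi (dot t xi)).
  under eq_fun do rewrite -mulN1r; apply: ccontD (ccont_chi _) _.
  exact: ccontM (ccont_cst _ _) (ccont_chi _).
elim: N => [|N [K K0 IH]].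
  exists (4 * pi * n%:R); first by rewrite !mulr_ge0 ?pi_ge0.
  by move=> xi xi'; split=> // t; rewrite mul1r mul1r; exact: chi_lip0.
have [L /ltW L0 hL] := @SB_chi R n N.
pose K' : R := 4 * pi * n%:R + 2 * pi * (K + L).
have p0 : 0 <= pi :> R := pi_ge0 R.
have c1 : 0 <= 4 * pi * n%:R :> R by exact: mulr_ge0 (mulr_ge0 _ p0) _.
have c2 : 0 <= 2 * pi * (K + L) by exact: mulr_ge0 (mulr_ge0 _ p0) (addr_ge0 K0 L0).
have K'0 : 0 <= K' := addr_ge0 c1 c2.
exists K' => // xi xi'.
have j1 (y : V) k : 1 <= jw y ^+ k :> R by rewrite exprn_ege1// jw_ge1.
split=> // [t|i].
  rewrite (le_trans (chi_lip0 xi xi' t))// ler_wpM2r ?jw_ge0//.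
  apply: ler_pM; rewrite ?mulr_ge0//.
    by rewrite /K' lerDl.
  by rewrite ler_peMl// -[leLHS]mul1r ler_pM.
pose d := xi' - xi.
exists (fun t => I2pi R * (((xi' ord0 i)%:C)%C * (expi2pi (dot t xi') - expi2pi (dot t xi)) +
   ((d ord0 i)%:C)%C * expi2pi (dot t xi))); split.
  move=> t; have := isDB (isD_chi xi' i t) (isD_chi xi i t); congr isD.
  by rewrite /d !mxE rmorphB /=; ring.
apply: SB_le (SB_scale (I2pi R) (SB_add (SB_scale ((xi' ord0 i)%:C)%C (IH xi xi'))
  (SB_scale ((d ord0 i)%:C)%C (hL xi)))) => t.
rewrite cabs_I2pi !cabs_real.
have h1 : `|xi' ord0 i| <= jw xi' by rewrite (le_trans (rV_coord_le _ _))// lerDr.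
have h2 : `|d ord0 i| <= `|xi' - xi| by exact: rV_coord_le.
have x1 := jw_ge1 xi; have x1' := jw_ge1 xi'; have t1 := jw_ge1 t.
have n0 : 0 <= `|xi' - xi| by [].
pose A := jw xi ^+ N.+1 * jw xi' ^+ N.+1 * `|xi' - xi| * jw t.
have A0 : 0 <= A by rewrite /A !mulr_ge0 ?exprn_ge0 ?jw_ge0.
have g1 : `|xi' ord0 i| * (K * (jw xi ^+ N * jw xi' ^+ N * `|xi' - xi|) * jw t) <= K * A.
  rewrite [leLHS](_ : _ = K * (`|xi' ord0 i| * jw xi ^+ N * jw xi' ^+ N * `|xi' - xi| * jw t)); last by ring.
  rewrite ler_wpM2l// /A; do 2 rewrite ler_wpM2r ?jw_ge0//.
  rewrite [jw xi' ^+ N.+1]exprS mulrA ler_wpM2r ?exprn_ge0 ?jw_ge0// mulrC ler_pM ?exprn_ge0 ?jw_ge0//.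
  by rewrite ler_weXn2l.
have g2 : `|d ord0 i| * (L * jw xi ^+ N) <= L * A.
  rewrite mulrCA ler_wpM2l// /A mulrC -!mulrA.
  apply: ler_pM; rewrite ?exprn_ge0 ?jw_ge0//; first by rewrite ler_weXn2l.
  rewrite (le_trans h2)// mulrCA ler_peMr// -[leLHS]mul1r ler_pM//.
apply: (@le_trans _ _ (2 * pi * (K * A + L * A))).
  by rewrite ler_wpM2l ?mulr_ge0// lerD.
rewrite -mulrDl mulrA [leRHS](_ : _ = K' * A); last by rewrite /A; ring.
by rewrite ler_wpM2r// /K' lerDr.
Qed.

Definition awt (p : R) (a a' : W) : R := (jw a * jw a') `^ p.

Lemma awt_ge0 p a a' : 0 <= awt p a a'. Proof. exact: powR_ge0. Qed.

Lemma norm_lsub (a : W) : `|lsubmx a : V| <= `|a|.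
Proof. by have := jw_lsub a; rewrite lerD2l. Qed.

Lemma norm_rsub (a : W) : `|rsubmx a : V| <= `|a|.
Proof. by have := jw_rsub a; rewrite lerD2l. Qed.

Lemma lsubB (a b : W) : lsubmx a - lsubmx b = lsubmx (a - b) :> V.
Proof. by apply/rowP => i; rewrite !mxE. Qed.

Lemma rsubB (a b : W) : rsubmx a - rsubmx b = rsubmx (a - b) :> V.
Proof. by apply/rowP => i; rewrite !mxE. Qed.

(** In every seminorm a time-frequency shift depends on its parameter in a locally Lipschitz way
    with polynomial constants; this controls the Riemann sums in [stft_exchange]. *)
Lemma rapid_tfa_lip N (r : R) (g : V -> C) : 0 <= r -> schwartz g ->
  exists2 c : R, 0 <= c & exists2 p : R, 0 <= p & forall a a' : W,
    SB N (fun t => tfa a' g t - tfa a g t)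
      (fun t => c * (awt p a a' * `|a' - a|) * jw t `^ (- r)).
Proof.
move=> r0 sg; have r1 : 0 <= r + 1 by rewrite addr_ge0.
have [c1 c10 h1] := rapid_shift_lip N r0 sg.
have [K K0 h2] := SB_chi_lip N.
have [L /ltW L0 h3] := @SB_chi R n N.
have [M hM] := schwartz_rapid N (r + 1) sg.
have M0 := rapid_ge0 hM.
exists (2 ^+ N * (K * M) + 2 ^+ N * (L * c1)).
  by apply: addr_ge0; apply: mulr_ge0; rewrite ?exprn_ge0// mulr_ge0.
pose p := N%:R + (2 * r + 1).
have p0 : 0 <= p by rewrite !addr_ge0// mulr_ge0.
exists p => // a a'.
pose x : V := lsubmx a; pose x' : V := lsubmx a'.
pose xi : V := rsubmx a; pose xi' : V := rsubmx a'.
have -> : (fun t => tfa a' g t - tfa a g t) = (fun t =>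
   (expi2pi (dot t xi') - expi2pi (dot t xi)) * g (t - x') +
   expi2pi (dot t xi) * (g (t - x') - g (t - x))).
  by apply/funext => t; rewrite /tfa /tf_shift; ring.
apply: SB_le (SB_add (SB_mul (h2 xi xi') (SB_shift (- x') hM)) (SB_mul (h3 xi) (h1 x x'))) => t /=.
have d0 : 0 <= `|a' - a| by [].
have dx : `|x' - x| <= `|a' - a| by rewrite lsubB norm_lsub.
have dxi : `|xi' - xi| <= `|a' - a| by rewrite rsubB norm_rsub.
have pw (q : R) (b : W) : 0 <= q -> jw (lsubmx b : V) `^ q <= jw b `^ q.
  by move=> q0; rewrite ge0_ler_powR ?nnegrE ?jw_ge0// jw_lsub.
have pwr (b : W) : jw (rsubmx b : V) ^+ N <= jw b `^ N%:R.
  by rewrite powR_mulrn ?jw_ge0// lerXn2r ?nnegrE ?jw_ge0// jw_rsub.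
have awtE : awt p a a' = (jw a `^ N%:R * jw a' `^ N%:R) * (jw a `^ (2 * r + 1) * jw a' `^ (2 * r + 1)).
  rewrite /awt powRM ?jw_ge0// !jw_powRD; ring.
have one (b : W) q : 0 <= q -> 1 <= jw b `^ q.
  by move=> q0; have := jw_powR_le b q0; rewrite powRr0.
have r21 : 0 <= 2 * r + 1 by rewrite addr_ge0// mulr_ge0.
have B1 : jw xi ^+ N * jw xi' ^+ N <= jw a `^ N%:R * jw a' `^ N%:R.
  by rewrite ler_pM ?exprn_ge0 ?jw_ge0 ?pwr.
have B2 : jw x' `^ (r + 1) <= jw a `^ (2 * r + 1) * jw a' `^ (2 * r + 1).
  rewrite -[leLHS]mul1r ler_pM ?powR_ge0 ?one// (le_trans (pw _ _ r1))// jw_powR_le//.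
  by rewrite lerD2r ler_peMl// ler1n.
have B3 : jw x `^ (2 * r) * jw x' `^ r <= jw a `^ (2 * r + 1) * jw a' `^ (2 * r + 1).
  rewrite ler_pM ?powR_ge0// (le_trans (pw _ _ _))// ?mulr_ge0// jw_powR_le//; lra.
rewrite [leRHS](_ : _ = 2 ^+ N * (K * M) * (awt p a a' * `|a' - a|) * jw t `^ (- r) +
   2 ^+ N * (L * c1) * (awt p a a' * `|a' - a|) * jw t `^ (- r)); last by ring.
apply: lerD.
  have T : jw t * jw (t - x') `^ (- (r + 1)) <= jw x' `^ (r + 1) * jw t `^ (- r).
    have h := peetreN t (- x') r1; rewrite jwN in h.
    apply: (le_trans (ler_wpM2l (jw_ge0 _) h)); rewrite mulrCA mulrC.
    have e : jw t * jw t `^ (- (r + 1)) = jw t `^ (- r).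
      rewrite -[X in X * _ = _]powRr1 ?jw_ge0// -jw_powRD; congr (_ `^ _); ring.
    by rewrite -e le_eqVlt; apply/orP; left; apply/eqP; ring.
  rewrite [leLHS](_ : _ = 2 ^+ N * (K * M) * ((jw xi ^+ N * jw xi' ^+ N * `|xi' - xi|) *
     (jw t * jw (t - x') `^ (- (r + 1))))); last by ring.
  rewrite -[leRHS]mulrA ler_wpM2l//; first by apply: mulr_ge0; rewrite ?exprn_ge0// mulr_ge0.
  apply: (le_trans (ler_pM _ _ (ler_pM _ _ B1 dxi) T));
    rewrite ?mulr_ge0 ?exprn_ge0 ?powR_ge0 ?jw_ge0//.
  rewrite mulrA ler_wpM2r ?powR_ge0// awtE mulrAC ler_wpM2r//.
  by rewrite ler_wpM2l ?mulr_ge0 ?powR_ge0.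
rewrite [leLHS](_ : _ = 2 ^+ N * (L * c1) * (jw xi ^+ N * lipw r x x') * jw t `^ (- r)); last by ring.
rewrite ler_wpM2r ?powR_ge0// ler_wpM2l//; first by apply: mulr_ge0; rewrite ?exprn_ge0// mulr_ge0.
rewrite /lipw mulrA ler_pM ?mulr_ge0 ?exprn_ge0 ?powR_ge0 ?jw_ge0// awtE.
rewrite ler_pM ?mulr_ge0 ?exprn_ge0 ?powR_ge0 ?jw_ge0//.
by rewrite (le_trans (pwr a))// ler_peMr ?powR_ge0// one.
Qed.

End ShiftLipschitz.

Section Exchange.
Variables (R : realType) (n : nat).
Local Notation V := 'rV[R]_n.
Local Notation W := 'rV[R]_(n + n).
Local Notation C := R[i].
Local Notation mW := (leb R (n + n)).
Variable u : (V -> C) -> C.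
Hypothesis tu : tempered u.

Lemma temperedD f g : schwartz f -> schwartz g -> u (fun x => f x + g x) = u f + u g.
Proof.
move=> sf sg; have := tu.1 1 f g sf sg; rewrite mul1r => <-.
by congr u; apply/funext => x; rewrite mul1r.
Qed.

Lemma schwartz0 : schwartz (fun _ : V => 0 : C).
Proof.
have := schwartzZ 0 (@schwartz_gau R n 1 ltr01).
by under eq_fun do rewrite mul0r.
Qed.

Lemma tempered0 : u (fun _ => 0) = 0.
Proof.
have := temperedD schwartz0 schwartz0.
rewrite (_ : (fun x : V => 0 + 0) = fun=> 0); last by apply/funext => x; rewrite addr0.
by move=> h; apply: (addrI (u (fun=> 0))); rewrite addr0.
Qed.

Lemma temperedZ k f : schwartz f -> u (fun x => k * f x) = k * u f.
Proof.
move=> sf; have := tu.1 k f _ sf schwartz0; rewrite tempered0 addr0 => <-.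
by congr u; apply/funext => x; rewrite addr0.
Qed.

Lemma temperedB f g : schwartz f -> schwartz g -> u (fun x => f x - g x) = u f - u g.
Proof.
move=> sf sg; have := temperedD sf (schwartzZ (-1) sg); rewrite temperedZ// mulN1r => <-.
by congr u; apply/funext => x; rewrite mulN1r.
Qed.

Lemma schwartz_sum (I : Type) (s : seq I) (f : I -> V -> C) : (forall i, schwartz (f i)) ->
  schwartz (fun x => \sum_(i <- s) f i x).
Proof.
move=> sf; elim: s => [|i s IH]; first by under eq_fun do rewrite big_nil; exact: schwartz0.
by under eq_fun do rewrite big_cons; exact: schwartzD.
Qed.

Lemma tempered_sum (I : Type) (s : seq I) (f : I -> V -> C) : (forall i, schwartz (f i)) ->
  u (fun x => \sum_(i <- s) f i x) = \sum_(i <- s) u (f i).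
Proof.
move=> sf; elim: s => [|i s IH].
  by rewrite [RHS]big_nil -[RHS]tempered0; congr u; apply/funext => x; rewrite big_nil.
rewrite big_cons -IH -temperedD//; last exact: schwartz_sum.
by congr u; apply/funext => x; rewrite big_cons.
Qed.

Lemma tempered_tfa (g : V -> C) : schwartz g ->
  exists2 K : R, 0 <= K & exists2 p : R, 0 <= p & forall a a' : W,
    cabs (u (tfa a' g) - u (tfa a g)) <= K * (awt p a a' * `|a' - a|).
Proof.
move=> sg; have [K [N [K0 hK]]] := tempered_rapid tu.
have [c c0 [p p0 h]] := rapid_tfa_lip N (ler0n R N) sg.
exists (K * c); first exact: mulr_ge0.
exists p => // a a'.
have sa b : schwartz (tfa b g) by exact: schwartz_tf.
rewrite -temperedB// -mulrA; apply: hK; last exact: h.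
by under eq_fun do rewrite -mulN1r; apply: schwartzD => //; exact: schwartzZ.
Qed.

Lemma awt_cval p (N : nat) (a : W) : 0 <= p ->
  awt p a (cval (cell N a)) * `|cval (cell N a) - a| <= 2 `^ (p + 1) * jw a `^ (2 * p + 1).
Proof.
move=> p0; have b := cval_bound N a.
have j : jw (cval (cell N a)) <= 2 * jw a by rewrite /jw; have := normr_ge0 a; lra.
have d : `|cval (cell N a) - a| <= 2 * jw a.
  rewrite (le_trans (ler_normB _ _))//; rewrite /jw; have := normr_ge0 a; lra.
apply: (@le_trans _ _ ((jw a * (2 * jw a)) `^ p * (2 * jw a))).
  apply: ler_pM => //; first exact: awt_ge0.
  by rewrite ge0_ler_powR ?nnegrE ?mulr_ge0 ?jw_ge0// ler_wpM2l ?jw_ge0.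
rewrite le_eqVlt; apply/orP; left; apply/eqP.
have -> : (jw a * (2 * jw a)) `^ p = 2 `^ p * jw a `^ (2 * p).
  by rewrite mulrCA powRM ?mulr_ge0 ?jw_ge0// powRM ?jw_ge0// -jw_powRD; congr (_ * _ `^ _); ring.
rewrite powRD ?pnatr_eq0 ?implybT// powRr1// jw_powRD powRr1 ?jw_ge0//.
by rewrite mulrACA.
Qed.

Lemma cvg_awt_cval p (a : W) : 0 <= p ->
  awt p a (cval (cell N a)) * `|cval (cell N a) - a| @[N --> \oo] --> (0 : R).
Proof.
move=> p0; have b N := cval_bound N a.
have h : `|cval (cell N a) - a| @[N --> \oo] --> (0 : R).
  rewrite -(normr0 W) -(subrr a); apply: cvg_norm; apply: cvgB; last exact: cvg_cst.
  exact: cvg_cval.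
pose K := (jw a * (2 * jw a)) `^ p.
have hK : K * `|cval (cell N a) - a| @[N --> \oo] --> (0 : R).
  by rewrite -[X in _ --> X](mulr0 K); apply: cvgM => //; exact: cvg_cst.
apply: (@squeeze_cvgr _ _ _ _ (fun=> 0) _ _ _ _ _ hK); last exact: cvg_cst.
apply: nearW => N; rewrite mulr_ge0 ?awt_ge0//= ler_wpM2r//.
rewrite ge0_ler_powR ?nnegrE ?mulr_ge0 ?jw_ge0// ler_wpM2l ?jw_ge0//.
by have := b N; rewrite /jw; have := normr_ge0 a; lra.
Qed.

Lemma cto_tempered_cval (g : V -> C) (a : W) : schwartz g ->
  cto (fun N => u (tfa (cval (cell N a)) g)) (u (tfa a g)).
Proof.
move=> sg; have [K K0 [p p0 h]] := tempered_tfa sg.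
apply: (cto_dom (fun N => h a _)).
rewrite -[X in _ --> X](mulr0 K); apply: cvgM; first exact: cvg_cst.
exact: cvg_awt_cval.
Qed.

Lemma cmf_cell (F : W -> C) N : cmf (fun a : W => F (cval (cell N a))).
Proof.
split.
  apply: (measurable_fin_comp (k := fun x => cell N x) (fun c => complex.Re (F (cval c)))).
  exact: measurable_cell.
apply: (measurable_fin_comp (k := fun x => cell N x) (fun c => complex.Im (F (cval c)))).
exact: measurable_cell.
Qed.

Lemma cmf_tempered (g : V -> C) : schwartz g -> cmf (fun a : W => u (tfa a g)).
Proof.
move=> sg; apply: (cmf_cto (u := fun N a => u (tfa (cval (cell N a)) g))) => [N|a].
  exact: (cmf_cell (fun a => u (tfa a g))).
exact: cto_tempered_cval.
Qed.

Lemma tempered_tfa_bound (g : V -> C) : schwartz g ->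
  exists2 K : R, 0 <= K & exists2 p : R, 0 <= p & forall a : W,
    cabs (u (tfa a g)) <= K * jw a `^ p.
Proof.
move=> sg; have [K K0 [p p0 h]] := tempered_tfa sg.
exists (cabs (u (tfa 0 g)) + K); first by rewrite addr_ge0 ?cabs_ge0.
exists (p + 1); first by rewrite addr_ge0.
move=> a; have := h 0 a; rewrite subr0 /awt (_ : jw 0 = 1) ?mul1r; last by rewrite /jw normr0 addr0.
move=> {}h; rewrite -(subrK (u (tfa 0 g)) (u (tfa a g))) (le_trans (cabsD _ _))// addrC mulrDl.
apply: lerD.
  rewrite ler_peMr ?cabs_ge0//; have := @jw_powR_le _ _ a 0 (p + 1).
  by rewrite powRr0; apply; rewrite addr_ge0.
rewrite (le_trans h)// ler_wpM2l// jw_powRD ler_wpM2l ?powR_ge0// powRr1 ?jw_ge0//.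
by rewrite lerDr.
Qed.

End Exchange.

Section StftExchange.
Variables (R : realType) (n : nat).
Local Notation V := 'rV[R]_n.
Local Notation W := 'rV[R]_(n + n).
Local Notation C := R[i].
Local Notation mW := (leb R (n + n)).

(** Evaluating [G] at cell representatives turns the integral into a finite combination, through
    which a merely linear functional can pass. *)
Lemma cI_cell (mu : {measure set W -> \bar R}) (F : W -> C) (G : W -> C) N : cint mu F ->
  cint mu (fun a => F a * G (cval (cell N a))) /\
  cI mu (fun a => F a * G (cval (cell N a))) =
  \sum_(c : cell_type N (n + n)) G (cval c) * cI mu (fun a => F a * ((\1_[set x : W | cell N x = c] a)%:C)%C).
Proof.
move=> iF; have mF := cint_cmf iF.
have ic (c : cell_type N (n + n)) : cint mu (fun a => F a * ((\1_[set x : W | cell N x = c] a)%:C)%C).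
  apply: (cint_dom _ (b := fun a => cabs (F a))); last exact: cint_cabs.
    by apply: cmf_mul => //; apply: cmf_real; apply: measurable_indic; exact: measurable_cell.
  move=> a; rewrite cabsM cabs_real ler_piMr ?cabs_ge0// indicE.
  by case: (_ \in _); rewrite ?normr1 ?normr0.
have e : (fun a => F a * G (cval (cell N a))) = (fun a =>
    \sum_(c : cell_type N (n + n)) G (cval c) * (F a * ((\1_[set x : W | cell N x = c] a)%:C)%C)).
  apply/funext => a; rewrite (bigD1 (cell N a))//= indicE mem_set// mulr1 big1 ?addr0 1?mulrC//.
  by move=> c ca; rewrite indicE memNset ?mulr0// => /= h; rewrite -h eqxx in ca.
rewrite e; split; first by apply: cint_sum => c; exact: cintZ.
by rewrite cI_sum; [apply: eq_bigr => c _; rewrite cIZ|move=> c; exact: cintZ].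
Qed.

(** The Riemann sums [Th N] of the inversion formula are finite combinations of shifts of [g], so
    [u] acts on them termwise. They converge to [kap g] times [f] in the seminorm that controls [u]:
    the error is at most the integral of [b N], which tends to 0 by dominated convergence. *)
Lemma stft_exchange (u : (V -> C) -> C) (f g : V -> C) : tempered u -> schwartz f -> schwartz g ->
  cint mW (fun a => inner f (tfa a g) * u (tfa a g)) /\
  ((kap g)%:C)%C * u f = cI mW (fun a => inner f (tfa a g) * u (tfa a g)).
Proof.
move=> tu sf sg; pose F (a : W) := inner f (tfa a g).
have sa b : schwartz (tfa b g) by exact: schwartz_tf.
have mF : cmf F by apply: cmf_stft; exact: schwartz_cmf.
have [K K0 [p p0 hu]] := tempered_tfa_bound tu sg.
pose q : R := (n + n)%:R + 1.
have q0 : 0 <= q by rewrite addr_ge0.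
have nq : (n + n)%:R < q by rewrite ltrDl.
have dF (r : R) : 0 <= r -> exists2 M : R, 0 <= M & forall a, cabs (F a) <= M * jw a `^ (- r).
  by move=> r0; exact: stft_decay.
have iF : cint mW F by have [M M0 hM] := dF q q0; exact: rapid_cint nq mF hM.
have mu_ := cmf_tempered tu sg.
have iFu : cint mW (fun a => F a * u (tfa a g)).
  have [|M M0 hM] := dF (q + p); first by rewrite addr_ge0.
  apply: (rapid_cint nq _ (M := M * K)); first exact: cmf_mul.
  move=> a; rewrite cabsM (le_trans (ler_pM (cabs_ge0 _) (cabs_ge0 _) (hM a) (hu a)))//.
  by rewrite mulrACA -jw_powRD opprD addrNK.
split=> //.
have [L [N0 [L0 hL]]] := tempered_rapid tu.
(* One derivative beyond the order [N0] of [u], because integration under [SB_cI] loses one. *)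
have [c c0 [p' p'0 hlip]] := rapid_tfa_lip N0.+1 (ler0n R N0) sg.
pose al (N : nat) (a : W) : W := cval (cell N a).
pose b (N : nat) (a : W) := cabs (F a) * (c * (awt p' a (al N a) * `|al N a - a|)).
have mb N : measurable_fun setT (b N).
  apply: measurable_funM; first exact: cmf_cabs.
  apply: measurable_funM; first exact: measurable_cst.
  have mal : measurable_fun setT (al N).
    by apply: measurable_fun_rVP => i;
      apply: (measurable_fin_comp (k := fun x => cell N x) (fun c => (cval c : W) ord0 i)); exact: measurable_cell.
  have mjw (h : W -> W) : measurable_fun setT h -> measurable_fun setT (fun a => jw (h a)).
    by move=> mh; have := mf_jw 1 mh; under eq_fun do rewrite powRr1 ?jw_ge0//.
  apply: measurable_funM.
    apply: (measurableT_comp (measurable_powR p')).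
    by apply: measurable_funM; exact: mjw.
  have := mjw _ (mf_rVB mal (@measurable_id _ W setT)) => m1.
  have := measurable_funB m1 (@measurable_cst _ _ W R setT 1).
  by congr measurable_fun; apply/funext => a; rewrite /= /jw addrC addKr.
have [B B0 [ib bB]] : exists2 B : W -> R, (forall a, 0 <= B a) & rint mW B /\ forall N a, b N a <= B a.
  pose e := 2 * p' + 1; have e0 : 0 <= e by rewrite addr_ge0// mulr_ge0.
  have [|M M0 hM] := dF (q + e); first by rewrite addr_ge0.
  exists (fun a => M * (c * 2 `^ (p' + 1)) * jw a `^ (- q)).
    by move=> a; rewrite !mulr_ge0 ?powR_ge0.
  split; first by apply: rintZ; exact: rint_decay.
  move=> N a; rewrite /b (le_trans (ler_pM (cabs_ge0 _) _ (hM a) (ler_wpM2l c0 (awt_cval N a p'0))))//.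
    by rewrite !mulr_ge0 ?awt_ge0.
  have -> : jw a `^ (- (q + e)) = jw a `^ (- q) * jw a `^ (- e) by rewrite opprD jw_powRD.
  rewrite -/e.
  rewrite [leLHS](_ : _ = M * (c * 2 `^ (p' + 1)) * jw a `^ (- q) * (jw a `^ (- e) * jw a `^ e)); last by ring.
  by rewrite -jw_powRD addNr powRr0 mulr1.
have b0 N a : 0 <= b N a by rewrite /b !mulr_ge0 ?cabs_ge0 ?awt_ge0.
have ibN N : rint mW (b N).
  by apply: (rint_dom _ _ ib) => // a; rewrite ger0_norm.
have bto0 : \int[mW]_a b N a @[N --> \oo] --> (0 : R).
  have [|||_] := @dominated_rint R _ _ mW b (fun=> 0) B mb _ _ _ ib.
  - exact: measurable_cst.
  - move=> a; rewrite -[X in _ --> X](mulr0 (cabs (F a))); apply: cvgM; first exact: cvg_cst.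
    rewrite -[X in _ --> X](mulr0 c); apply: cvgM; first exact: cvg_cst.
    exact: cvg_awt_cval.
  - by move=> N a; rewrite ger0_norm.
  by rewrite /Rintegral integral0.
pose Th (N : nat) (t : V) := cI mW (fun a => F a * tfa (al N a) g t).
have ThE N t : cint mW (fun a => F a * tfa (al N a) g t) /\ Th N t =
   \sum_(k : cell_type N (n + n)) cI mW (fun a => F a * ((\1_[set x : W | cell N x = k] a)%:C)%C) * tfa (cval k) g t.
  have [h1 h2] := cI_cell (fun a => tfa a g t) N iF; split=> //.
  by rewrite /Th h2; apply: eq_bigr => k _; rewrite mulrC.
have sTh N : schwartz (Th N).
  rewrite (_ : Th N = fun t => \sum_(k : cell_type N (n + n))
    cI mW (fun a => F a * ((\1_[set x : W | cell N x = k] a)%:C)%C) * tfa (cval k) g t).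
    by apply: schwartz_sum => k; exact: schwartzZ.
  by apply/funext => t; exact: (ThE N t).2.
have uTh N : u (Th N) = cI mW (fun a => F a * u (tfa (al N a) g)).
  rewrite (_ : Th N = fun t => \sum_(k : cell_type N (n + n))
    cI mW (fun a => F a * ((\1_[set x : W | cell N x = k] a)%:C)%C) * tfa (cval k) g t); last first.
    by apply/funext => t; exact: (ThE N t).2.
  rewrite tempered_sum//; last by move=> k; exact: schwartzZ.
  have [_ ->] := cI_cell (fun a => u (tfa a g)) N iF.
  by apply: eq_bigr => k _; rewrite temperedZ// mulrC.
have mtf t : cmf (fun a : W => tfa a g t).
  have m2 : measurable_fun setT (fun a : W => (a, t)).
    by apply: measurable_fun_pair => //; exact: measurable_cst.
  exact: (cmf_comp m2 (cmf_tfa (schwartz_cmf sg))).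
have ift t : cint mW (fun a => F a * tfa a g t).
  have [M M0 hM] := schwartz_decay 0 sg.
  apply: (cint_dom _ (b := fun a => M * cabs (F a))); first exact: cmf_mul.
    move=> a; rewrite cabsM mulrC ler_wpM2r ?cabs_ge0// cabs_tfa (le_trans (hM _))//.
    by rewrite oppr0 powRr0 mulr1.
  by apply: rintZ; exact: cint_cabs.
have E1 : cto (fun N => u (Th N)) (((kap g)%:C)%C * u f).
  apply: (@cto_dom _ _ _ (fun N => L * \int[mW]_a b N a)); last first.
    by rewrite -[X in _ --> X](mulr0 L); apply: cvgM => //; exact: cvg_cst.
  move=> N; rewrite -temperedZ// -temperedB//; last exact: schwartzZ.
  apply: hL.
    by under eq_fun do rewrite -mulN1r; apply: schwartzD => //; do 2 apply: schwartzZ.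
  rewrite (_ : (fun x => _) = fun x => cI mW (fun a => F a * (tfa (al N a) g x - tfa a g x))); last first.
    apply/funext => x; rewrite (stft_inversion x sf sg) -cIB//; last exact: (ThE N x).1.
    by apply: cI_ext => a; rewrite mulrBr.
  apply: SB_cI => //.
    move=> x; apply: cmf_mul => //; apply: cmf_add; first exact: (cmf_cell (fun a => tfa a g x)).
    exact: cmf_opp.
  move=> a; apply: SB_le (SB_scale (F a) (hlip a (al N a))) => x.
  by rewrite /b !mulrA.
apply: (cto_unique E1).
apply: (@cto_ext _ (fun N => cI mW (fun a => F a * u (tfa (al N a) g)))) => [N|]; first by rewrite uTh.
have := @dominated_cto R _ _ mW (fun N a => F a * u (tfa (al N a) g)) (fun a => F a * u (tfa a g))
  (fun a => cabs (F a) * (K * (3 `^ p * jw a `^ p))).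
move=> [|||||_ //].
- by move=> N; apply: cmf_mul => //; exact: (cmf_cell (fun a => u (tfa a g))).
- exact: cmf_mul.
- by move=> a; apply: ctoZ; exact: cto_tempered_cval.
- move=> N a; rewrite cabsM ler_wpM2l ?cabs_ge0// (le_trans (hu _))// ler_wpM2l//.
  rewrite -powRM ?jw_ge0// ge0_ler_powR ?nnegrE ?mulr_ge0 ?jw_ge0//.
  by have := cval_bound N a; rewrite /al /jw; have := normr_ge0 a; lra.
have [|M M0 hM] := dF (q + p); first by rewrite addr_ge0.
apply: (@rint_dom _ _ _ _ _ (fun a => M * (K * 3 `^ p) * jw a `^ (- q))).
- apply: measurable_funM; first exact: cmf_cabs.
  by do 2 (apply: measurable_funM; first exact: measurable_cst); exact: mf_jw.
- move=> a; rewrite ger0_norm ?mulr_ge0 ?cabs_ge0 ?powR_ge0//.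
  rewrite (le_trans (ler_wpM2r _ (hM a))) ?mulr_ge0 ?powR_ge0//.
  rewrite opprD jw_powRD [leLHS](_ : _ = M * (K * 3 `^ p) * jw a `^ (- q) * (jw a `^ (- p) * jw a `^ p)); last by ring.
  by rewrite -jw_powRD addNr powRr0 mulr1.
- by apply: rintZ; exact: rint_decay.
Qed.

End StftExchange.

(** * Bounded operators on L^2 *)

Section L2.
Variables (R : realType) (n : nat).
Local Notation V := 'rV[R]_n.
Local Notation C := R[i].
Local Notation mV := (leb R n).
Implicit Types f g h : V -> C.

Definition l2 f := cmf f /\ rint mV (fun x => cabs (f x) ^+ 2).

Definition nrm f : R := Num.sqrt (\int[mV]_x (cabs (f x) ^+ 2)).

Lemma nrm_ge0 f : 0 <= nrm f. Proof. exact: sqrtr_ge0. Qed.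

Lemma L2norm_sq f : (L2norm f `^ 2 = \int[mV]_x (cabs (f x) ^+ 2)%:E)%E.
Proof.
rewrite /L2norm powR_Lnorm//; apply: eq_integral => x _.
by rewrite poweR_EFin ger0_norm ?cabs_ge0// powR_mulrn ?cabs_ge0.
Qed.

Lemma L2P f : L2 f <-> l2 f.
Proof.
have e : (\int[mV]_x `|(cabs (f x) ^+ 2)%:E| = L2norm f `^ 2)%E.
  by rewrite L2norm_sq; apply: eq_integral => x _; rewrite gee0_abs// lee_fin sqr_ge0.
split=> [[mr mi fin]|[[mr mi] /integrableP[mf fin]]].
  have mf : cmf f by [].
  split=> //; apply/integrableP; split.
    by apply/measurable_EFinP; apply: measurable_funX; exact: cmf_cabs.
  by rewrite /= e poweR_lty.
split=> //; move: fin; rewrite /= e; by apply: lty_poweRy; rewrite pnatr_eq0.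
Qed.

Lemma L2normE f : l2 f -> L2norm f = (nrm f)%:E.
Proof.
move=> lf; have [_ _ fin] := (L2P f).2 lf.
have p0 : (0 <= L2norm f)%E by exact: Lnorm_ge0.
have fn : L2norm f \is a fin_num by rewrite ge0_fin_numE.
rewrite -(fineK fn); congr EFin.
have v0 : 0 <= fine (L2norm f) by exact: fine_ge0.
rewrite /nrm /Rintegral -L2norm_sq -(fineK fn) poweR_EFin/= powR_mulrn//.
by rewrite sqrtr_sqr ger0_norm.
Qed.

Lemma l2_sq_ge0 f : 0 <= \int[mV]_x (cabs (f x) ^+ 2).
Proof. by apply: Rintegral_ge0 => x _; exact: sqr_ge0. Qed.

Lemma nrm_sq f : nrm f ^+ 2 = \int[mV]_x (cabs (f x) ^+ 2).
Proof. by rewrite sqr_sqrtr// l2_sq_ge0. Qed.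

Lemma l2_dom f (b : V -> R) : cmf f -> (forall x, cabs (f x) <= b x) ->
  rint mV (fun x => b x ^+ 2) -> l2 f /\ nrm f <= Num.sqrt (\int[mV]_x (b x ^+ 2)).
Proof.
move=> mf fb ib.
have le x : cabs (f x) ^+ 2 <= b x ^+ 2.
  by rewrite lerXn2r ?nnegrE ?cabs_ge0// (le_trans (cabs_ge0 (f x))).
have i2 : rint mV (fun x => cabs (f x) ^+ 2).
  apply: (rint_dom _ _ ib); first by apply: measurable_funX; exact: cmf_cabs.
  by move=> x; rewrite ger0_norm ?sqr_ge0.
by split=> //; apply: ler_wsqrtr; exact: rIle.
Qed.

Lemma l2D f g : l2 f -> l2 g -> l2 (fun x => f x + g x).
Proof.
move=> [mf if2] [mg ig2]; split; first exact: cmf_add.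
apply: (@rint_dom _ _ _ _ _ (fun x => 2 * cabs (f x) ^+ 2 + 2 * cabs (g x) ^+ 2)).
- by apply: measurable_funX; apply: cmf_cabs; exact: cmf_add.
- move=> x; rewrite ger0_norm ?sqr_ge0//.
  have := cabsD (f x) (g x); have := cabs_ge0 (f x + g x); have := sqr_ge0 (cabs (f x) - cabs (g x)).
  have := cabs_ge0 (f x); have := cabs_ge0 (g x); nra.
- by apply: rintD; exact: rintZ.
Qed.

Lemma l2Z (k : C) f : l2 f -> l2 (fun x => k * f x).
Proof.
move=> [mf if2]; split; first by apply: cmf_mul => //; exact: cmf_cst.
by under eq_fun do rewrite cabsM exprMn; exact: rintZ.
Qed.

Lemma l2B f g : l2 f -> l2 g -> l2 (fun x => f x - g x).
Proof.
move=> lf lg; have := l2D lf (l2Z (-1) lg).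
by under eq_fun do rewrite mulN1r.
Qed.

Lemma cint_inner f g : l2 f -> l2 g -> cint mV (fun x => f x * conjc (g x)).
Proof.
move=> [mf if2] [mg ig2].
apply: (@cint_dom _ _ _ _ _ (fun x => 2^-1 * (cabs (f x) ^+ 2 + cabs (g x) ^+ 2))).
- by apply: cmf_mul => //; exact: cmf_conj.
- move=> x; rewrite cabsM cabsJ; have := sqr_ge0 (cabs (f x) - cabs (g x)); nra.
- by apply: rintZ; exact: rintD.
Qed.

(** The right-hand side of the hypothesis is minimal at [t = b / a], with value [2 a b]. *)
Lemma amgm_le (I a b : R) : 0 <= a -> 0 <= b ->
  (forall t, 0 < t -> 2 * I <= t * a ^+ 2 + t^-1 * b ^+ 2) -> I <= a * b.
Proof.
move=> a0 b0 h; apply/ler_addgt0Pr => e e0.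
(* The perturbation [d] keeps the quotient [(b + d) / (a + d)] defined and positive when [a] or [b]
   vanishes, at a total cost of at most [e]. *)
pose d := e / (a + b + 1).
have ab : 0 < a + b + 1 by rewrite ltr_wpDl// addr_ge0.
have d0 : 0 < d by rewrite divr_gt0.
have bd : 0 < b + d by rewrite ltr_wpDl.
have ad : 0 < a + d by rewrite ltr_wpDl.
have := h ((b + d) / (a + d)) ltac:(by rewrite divr_gt0).
rewrite invf_div.
have h1 : (b + d) / (a + d) * a ^+ 2 <= (b + d) * a.
  rewrite -mulrA ler_wpM2l ?(ltW bd)// mulrC ler_pdivrMr// expr2 ler_wpM2l//.
  by rewrite lerDl ltW.
have h2 : (a + d) / (b + d) * b ^+ 2 <= (a + d) * b.
  rewrite -mulrA ler_wpM2l ?(ltW ad)// mulrC ler_pdivrMr// expr2 ler_wpM2l//.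
  by rewrite lerDl ltW.
have h3 : d * (a + b) <= e.
  rewrite /d mulrAC ler_pdivrMr// ler_wpM2l ?(ltW e0)// lerDl//.
nra.
Qed.

Lemma inner_le f g : l2 f -> l2 g -> cabs (inner f g) <= nrm f * nrm g.
Proof.
move=> lf lg; rewrite innerE (le_trans (cI_le (cint_inner lf lg)))//.
apply: amgm_le; rewrite ?nrm_ge0// => t t0.
rewrite !nrm_sq -!rIZ; [|exact: lg.2|exact: lf.2|exact/cint_cabs/cint_inner].
rewrite -rID; [|by apply: rintZ; exact: lf.2|by apply: rintZ; exact: lg.2].
apply: rIle.
- by apply: rintZ; exact/cint_cabs/cint_inner.
- by apply: rintD; apply: rintZ; [exact: lf.2|exact: lg.2].
move=> x; rewrite cabsM cabsJ.
have h := sqr_ge0 (t * cabs (f x) - cabs (g x)).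
rewrite -(ler_pM2l t0) mulrDr (mulrA t t^-1) divff ?gt_eqF// mul1r.
by move: h; rewrite sqrrB exprMn; nra.
Qed.

Lemma innerDl f g h : l2 f -> l2 g -> l2 h -> inner (fun x => f x + g x) h = inner f h + inner g h.
Proof.
move=> lf lg lh; rewrite !innerE -cID; [|exact: cint_inner|exact: cint_inner].
by apply: cI_ext => x; rewrite mulrDl.
Qed.

Lemma innerZl (k : C) f h : l2 f -> l2 h -> inner (fun x => k * f x) h = k * inner f h.
Proof.
move=> lf lh; rewrite !innerE -cIZ; last exact: cint_inner.
by apply: cI_ext => x; rewrite mulrA.
Qed.

Lemma inner_conj f h : l2 f -> l2 h -> inner h f = conjc (inner f h).
Proof.
move=> lf lh; rewrite !innerE -cI_conj; last exact: cint_inner.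
by apply: cI_ext => x; rewrite conjcM conjcK mulrC.
Qed.

Lemma innerBl f g h : l2 f -> l2 g -> l2 h -> inner (fun x => f x - g x) h = inner f h - inner g h.
Proof.
move=> lf lg lh; rewrite -mulN1r -innerZl// -innerDl//; last exact: l2Z.
by congr inner; apply/funext => x; rewrite mulN1r.
Qed.

Lemma inner_self f : inner f f = ((nrm f ^+ 2)%:C)%C.
Proof. by rewrite nrm_sq -cI_real innerE; apply: cI_ext => x; rewrite mulcJ. Qed.

Lemma inner_ae f f' h : cmf f -> cmf f' -> cmf h -> ae_equal f f' -> inner f h = inner f' h.
Proof.
move=> mf mf' mh ff'; rewrite !innerE /cI.
have m1 : cmf (fun x => f x * conjc (h x)) by apply: cmf_mul => //; exact: cmf_conj.
have m2 : cmf (fun x => f' x * conjc (h x)) by apply: cmf_mul => //; exact: cmf_conj.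
by congr Complex; rewrite /Rintegral; congr fine; apply: ae_eq_integral => //;
  try (by apply/measurable_EFinP; first [exact: m1.1|exact: m1.2|exact: m2.1|exact: m2.2]);
  apply: filterS ff' => x /= ->.
Qed.

Lemma decay_l2 f (M r : R) : n%:R < r -> cmf f -> 0 <= M ->
  (forall x, cabs (f x) <= M * jw x `^ (- r)) -> l2 f /\ nrm f <= M * Num.sqrt (jint n r).
Proof.
move=> nr mf M0 hf.
have r0 : 0 <= r by rewrite (le_trans _ (ltW nr)).
have le x : cabs (f x) ^+ 2 <= M ^+ 2 * jw x `^ (- r).
  apply: (@le_trans _ _ ((M * jw x `^ (- r)) ^+ 2)).
    by rewrite lerXn2r ?nnegrE ?cabs_ge0// (le_trans (cabs_ge0 (f x))).
  rewrite exprMn ler_wpM2l ?sqr_ge0// expr2 ler_piMr ?powR_ge0//.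
  exact: jw_powRN_le1.
have ib : rint mV (fun x => M ^+ 2 * jw x `^ (- r)) by apply: rintZ; exact: rint_decay.
have i2 : rint mV (fun x => cabs (f x) ^+ 2).
  apply: (rint_dom _ _ ib); first by apply: measurable_funX; exact: cmf_cabs.
  by move=> x; rewrite ger0_norm ?sqr_ge0.
split=> //; apply: (@le_trans _ _ (Num.sqrt (M ^+ 2 * jint n r))).
  apply: ler_wsqrtr; rewrite /jint -rIZ; last exact: rint_decay.
  exact: rIle.
by rewrite sqrtrM ?sqr_ge0// sqrtr_sqr ger0_norm.
Qed.

Lemma schwartz_l2 f : schwartz f -> l2 f.
Proof.
move=> sf; have [M M0 hM] := schwartz_decay (n%:R + 1) sf.
by have [|//] := decay_l2 _ (schwartz_cmf sf) M0 hM; rewrite ltrDl.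
Qed.

Lemma tf_l2 (a : 'rV[R]_(n + n)) g : l2 g -> l2 (tfa a g).
Proof.
move=> [mg ig]; split; first exact: cmf_tf.
under eq_fun do rewrite cabs_tfa.
exact: (@rint_shift _ _ (- lsubmx a) (fun x => cabs (g x) ^+ 2)).
Qed.

Lemma nrm_tf (a : 'rV[R]_(n + n)) g : l2 g -> nrm (tfa a g) = nrm g.
Proof.
move=> [mg ig]; rewrite /nrm; under eq_Rintegral do rewrite cabs_tfa.
by rewrite (rI_shift (- lsubmx a) (rint_mf ig)).
Qed.

Record bounded_op (T : (V -> C) -> (V -> C)) (K : R) : Prop := BoundedOp {
  bop_ge0 : 0 <= K;
  bop_l2 : forall f, l2 f -> l2 (T f);
  bop_lin : forall (a : C) f g, l2 f -> l2 g ->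
    ae_equal (T (fun x => a * f x + g x)) (fun x => a * T f x + T g x);
  bop_nrm : forall f, l2 f -> nrm (T f) <= K * nrm f }.

Lemma L2_bounded_op T : L2_bounded T -> exists K, bounded_op T K.
Proof.
move=> [h1 h2 [K hK]]; exists `|K|; split=> //.
- by move=> f /L2P/h1/L2P.
- by move=> a f g /L2P lf /L2P lg; exact: h2.
- move=> f lf; have l2T : l2 (T f) by apply/L2P/h1/L2P.
  have := hK f ((L2P f).2 lf); rewrite !L2normE// -EFinM lee_fin => /le_trans; apply.
  by rewrite ler_wpM2r ?nrm_ge0// ler_norm.
Qed.

Lemma bounded_op_id : bounded_op id 1.
Proof. by split=> // [a f g _ _|f _]; [exact: aeW|rewrite mul1r]. Qed.

Lemma l2_0 : l2 (fun=> 0).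
Proof. by apply: schwartz_l2; exact: schwartz0. Qed.

Section BoundedOp.
Variables (T : (V -> C) -> (V -> C)) (K : R).
Hypothesis bT : bounded_op T K.

Lemma inner_lin (a : C) f g h : l2 f -> l2 g -> l2 h ->
  inner (T (fun x => a * f x + g x)) h = a * inner (T f) h + inner (T g) h.
Proof.
move=> lf lg lh; have lTf := bop_l2 bT lf; have lTg := bop_l2 bT lg.
rewrite -innerZl// -innerDl//; last exact: l2Z.
apply: inner_ae; [|by apply: cmf_add; [apply: cmf_mul; [exact: cmf_cst|exact: lTf.1]|exact: lTg.1]|exact: lh.1|exact: (bop_lin bT)].
by have [] := bop_l2 bT (l2D (l2Z a lf) lg).
Qed.

Lemma inner_T_le f h : l2 f -> l2 h -> cabs (inner (T f) h) <= K * nrm f * nrm h.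
Proof.
move=> lf lh; rewrite (le_trans (inner_le (bop_l2 bT lf) lh))//.
by rewrite ler_wpM2r ?nrm_ge0// bop_nrm.
Qed.

Lemma inner_TB f g h : l2 f -> l2 g -> l2 h ->
  inner (T (fun x => f x - g x)) h = inner (T f) h - inner (T g) h.
Proof.
move=> lf lg lh; have := inner_lin (-1) lg lf lh; rewrite mulN1r addrC => <-.
by congr inner; congr T; apply/funext => x; rewrite mulN1r addrC.
Qed.

(** Through this, the statements on tempered functionals (measurability in the shift, polynomial
    bounds, [stft_exchange]) apply to matrix coefficients of bounded operators. *)
Lemma tempered_inner h : l2 h -> tempered (fun f => inner (T f) h).
Proof.
move=> lh; split.
  by move=> a f g /schwartz_l2 lf /schwartz_l2 lg; exact: inner_lin.
pose r : R := n.+1%:R.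
have nr : n%:R < r by rewrite ltr_nat.
exists (K * (2 ^+ n.+1 * Num.sqrt (jint n r)) * nrm h), n.+1 => f M sf hf.
rewrite (le_trans (inner_T_le (schwartz_l2 sf) lh))// [leRHS]mulrAC ler_wpM2r ?nrm_ge0//.
rewrite -mulrA ler_wpM2l ?(bop_ge0 bT)//.
have hM x : cabs (f x) <= (2 ^+ n.+1 * M) * jw x `^ (- r).
  have := hf [::] x isT; rewrite cpderiv_nil => h1.
  rewrite powRN ler_pdivlMr ?jw_powR_gt0// powR_mulrn ?jw_ge0// mulrC.
  apply: (@le_trans _ _ (2 ^+ n.+1 * (japanese x ^+ n.+1 * cabs (f x)))).
    rewrite mulrA ler_wpM2r ?cabs_ge0// -exprMn lerXn2r ?nnegrE ?jw_ge0 ?mulr_ge0//.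
      by rewrite ltW// japanese_gt0.
    exact: jw_le_japanese.
  by rewrite ler_wpM2l// exprn_ge0.
have M0 : 0 <= 2 ^+ n.+1 * M.
  by have := le_trans (cabs_ge0 _) (hM 0); rewrite pmulr_lge0 ?jw_powR_gt0.
have [_ h2] := decay_l2 nr (schwartz_cmf sf) M0 hM.
by rewrite (le_trans h2)// mulrAC.
Qed.

End BoundedOp.

End L2.

(** * Schwartz approximation of indicators of boxes *)

Section BoxApproximation.
Variables (R : realType) (n : nat).
Local Notation V := 'rV[R]_n.
Local Notation C := R[i].
Local Notation mV := (leb R n).

Definition pgrowth N (p : V -> R) := exists2 K : R, 1 <= K &
  exists k : nat, SB N (fun x => ((p x)%:C)%C : C) (fun x => K * jw x ^+ k).

Lemma pgrowth_cst N (c : R) : pgrowth N (fun=> c).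
Proof.
exists (`|c| + 1); first by rewrite lerDr.
exists 0%N; refine (SB_le _ (@SB_cst R n N _)) => x.
by rewrite cabs_real expr0 mulr1 lerDl.
Qed.

Lemma pgrowth_coord N i : pgrowth N (fun x => x ord0 i).
Proof. by exists 1 => //; exists 1%N; refine (SB_le _ (@SB_coord R n N i)) => x; rewrite mul1r. Qed.

Lemma pgrowthD N p q : pgrowth N p -> pgrowth N q -> pgrowth N (fun x => p x + q x).
Proof.
move=> [K K1 [k hp]] [L L1 [l hq]]; exists (K + L); first by rewrite ler_wpDr// (le_trans ler01).
exists (k + l)%N; have K0 := le_trans ler01 K1; have L0 := le_trans ler01 L1.
have := SB_add hp hq; rewrite (_ : (fun x => _ + _) = fun x => ((p x + q x)%:C)%C); last first.
  by apply/funext => x; rewrite rmorphD.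
apply: SB_le => x; rewrite mulrDl lerD// ler_wpM2l// ler_weXn2l ?jw_ge1 ?leq_addr ?leq_addl//.
Qed.

Lemma pgrowthM N p q : pgrowth N p -> pgrowth N q -> pgrowth N (fun x => p x * q x).
Proof.
move=> [K K1 [k hp]] [L L1 [l hq]]; exists (2 ^+ N * (K * L)).
  by rewrite -[leLHS]mul1r ler_pM// ?exprn_ege1 ?ler1n// -[leLHS]mul1r ler_pM.
exists (k + l)%N.
have := SB_mul hp hq; rewrite (_ : (fun x => ((p x)%:C)%C * _) = fun x => ((p x * q x)%:C)%C); last first.
  by apply/funext => x; rewrite rmorphM.
by apply: SB_le => x; rewrite exprD le_eqVlt; apply/orP; left; apply/eqP; ring.
Qed.

Lemma pgrowthX N p m : pgrowth N p -> pgrowth N (fun x => p x ^+ m).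
Proof.
move=> hp; elim: m => [|m IH].
  by under eq_fun do rewrite expr0; exact: pgrowth_cst.
by under eq_fun do rewrite exprS; exact: pgrowthM.
Qed.

Lemma pgrowth_sum N (s : seq 'I_n) (p : 'I_n -> V -> R) : (forall i, pgrowth N (p i)) ->
  pgrowth N (fun x => \sum_(i <- s) p i x).
Proof.
move=> hp; elim: s => [|i s IH].
  by under eq_fun do rewrite big_nil; exact: pgrowth_cst.
by under eq_fun do rewrite big_cons; exact: pgrowthD.
Qed.

Lemma schwartz_pexp (p : V -> R) : (forall N, pgrowth N p) -> (forall x, 0 <= p x) ->
  schwartz (fun x => ((expR (- p x) * gr 1 x)%:C)%C : C).
Proof.
move=> hp p0; pose q (x : V) := - 1 * p x + (- pi) * (\sum_(i < n) x ord0 i * x ord0 i).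
have hq N : pgrowth N q.
  apply: pgrowthD; apply: pgrowthM => //; try exact: pgrowth_cst.
  by apply: pgrowth_sum => i; apply: pgrowthM; exact: pgrowth_coord.
have qE x : q x = - p x - pi * 1 * dot x x by rewrite /q mulN1r mulNr mulr1.
apply: schwartz_of_rapid => N r; have [K K1 [k hK]] := hq N.+1.
have [M hM] := @rapid_cexp R n 1 K N k r ltr01 K1; exists M.
rewrite (_ : (fun x => _) = fun x => cexp ((q x)%:C)%C); last first.
  by apply/funext => x; rewrite cexp_real qE /gr expRD.
apply: (hM _ (fun i => cpderiv [:: i] (fun x => ((q x)%:C)%C))).
- by have [] := hK.
- by move=> i x; exact: (SB_cpderiv_isD i x hK).1.
- by move=> i; exact: (SB_cpderiv_isD i 0 hK).2.
- by move=> x /=; rewrite qE gerDr oppr_le0.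
Qed.

Definition obox (a b : V) : set V := [set x | forall i, a ord0 i < x ord0 i < b ord0 i].

(** The affine map sending the [i]-th side of the box to [(-1, 1)]. *)
Definition boxq (a b x : V) (i : 'I_n) : R :=
  2 / (b ord0 i - a ord0 i) * x ord0 i + - ((a ord0 i + b ord0 i) / (b ord0 i - a ord0 i)).

Lemma boxq_lt1 (a b x : V) i : a ord0 i < b ord0 i ->
  (`|boxq a b x i| < 1) = (a ord0 i < x ord0 i < b ord0 i).
Proof.
move=> ab; have d0 : 0 < b ord0 i - a ord0 i by rewrite subr_gt0.
have -> : boxq a b x i = (2 * x ord0 i - (a ord0 i + b ord0 i)) / (b ord0 i - a ord0 i).
  by rewrite /boxq; ring.
rewrite normrM (gtr0_norm (_ : 0 < (_ - _)^-1)) ?invr_gt0// ltr_pdivrMr// mul1r ltr_norml.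
by apply/idP/idP => /andP[h1 h2]; apply/andP; split; lra.
Qed.

(** A polynomial whose [expR (- _)] tends to the indicator of the open box: inside, [k q^(2k)] tends
    to 0, and outside some [|q|] is at least 1. The prefactor [k.+1] settles the boundary points,
    where [|q| = 1]. *)
Definition boxp (a b : V) (k : nat) (x : V) : R :=
  k.+1%:R * \sum_(i < n) boxq a b x i ^+ (2 * k.+1).

Lemma boxp_ge0 a b k x : 0 <= boxp a b k x.
Proof.
rewrite mulr_ge0// sumr_ge0// => i _; rewrite mul2n -addnn exprD -expr2; exact: sqr_ge0.
Qed.

Lemma pgrowth_boxp a b k N : pgrowth N (boxp a b k).
Proof.
apply: pgrowthM; first exact: pgrowth_cst.
apply: pgrowth_sum => i; apply: pgrowthX; apply: pgrowthD; last exact: pgrowth_cst.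
by apply: pgrowthM; [exact: pgrowth_cst|exact: pgrowth_coord].
Qed.

(** The [k] powers [y^j] with [j < k] are all at least [y^k], and their sum times [1 - y] is
    [1 - y^k]. *)
Lemma natX_bound (y : R) k : 0 <= y < 1 -> k%:R * y ^+ k * (1 - y) <= 1 - y ^+ k.
Proof.
move=> /andP[y0 y1]; elim: k => [|k IH]; first by rewrite !mul0r subrr.
have h0 : 0 <= y ^+ k by rewrite exprn_ge0.
have h1 : y ^+ k <= 1 by rewrite exprn_ile1// ltW.
rewrite exprS -natr1; have := ler_wpM2l y0 IH.
have yP : y * y ^+ k <= 1 by rewrite mulr_ile1// ltW.
have : 0 <= (1 - y) * (1 - y * y ^+ k) by rewrite mulr_ge0// subr_ge0// ltW.
lra.
Qed.

Lemma natX_cvg0 (q : R) : `|q| < 1 -> k.+1%:R * q ^+ (2 * k.+1) @[k --> \oo] --> (0 : R).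
Proof.
move=> q1; pose y := `|q|; have y0 : 0 <= y by exact: normr_ge0.
have y1 : 0 < 1 - y by rewrite subr_gt0.
have h : (1 - y)^-1 * y ^+ k @[k --> \oo] --> (0 : R).
  rewrite -[X in _ --> X](mulr0 (1 - y)^-1); apply: cvgM; first exact: cvg_cst.
  by apply: cvg_expr; rewrite ger0_norm.
apply: (@squeeze_cvgr _ _ _ _ (fun=> 0) _ _ _ _ _ h); last exact: cvg_cst.
apply: nearW => k; have e : q ^+ (2 * k.+1) = y ^+ k.+1 * y ^+ k.+1.
  by rewrite -exprMn /y -normrM -expr2 ger0_norm ?sqr_ge0// -exprM.
rewrite e mulrA; apply/andP; split; first by rewrite !mulr_ge0 ?exprn_ge0.
apply: ler_pM; rewrite ?mulr_ge0 ?exprn_ge0//.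
  rewrite -(ler_pM2r y1) mulVf ?gt_eqF// (le_trans (natX_bound _ _))//.
    by rewrite y0.
  by rewrite gerDl oppr_le0 exprn_ge0.
by rewrite exprS ler_piMl ?exprn_ge0// ltW.
Qed.

Lemma boxp_cvg (a b x : V) : (forall i, a ord0 i < b ord0 i) ->
  expR (- boxp a b k x) @[k --> \oo] --> (\1_(obox a b) x : R).
Proof.
move=> ab; rewrite indicE; case: (boolP (x \in obox a b)) => [/set_mem xab|/negP xab].
  have h : boxp a b k x @[k --> \oo] --> (0 : R).
    rewrite /boxp; under eq_fun do rewrite mulr_sumr.
    have H (l : seq 'I_n) :
        \sum_(i <- l) k.+1%:R * boxq a b x i ^+ (2 * k.+1) @[k --> \oo] --> (0 : R).
      elim: l => [|i l IH].
        by under eq_fun do rewrite big_nil; exact: cvg_cst.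
      rewrite (_ : (fun k : nat => _) = fun k => k.+1%:R * boxq a b x i ^+ (2 * k.+1) +
        \sum_(i <- l) k.+1%:R * boxq a b x i ^+ (2 * k.+1)); last first.
        by apply/funext => k; rewrite big_cons.
      rewrite -[X in _ --> X](addr0 0); apply: cvgD IH.
      by apply: natX_cvg0; rewrite boxq_lt1//; exact: xab.
    exact: H.
  have h2 : - boxp a b k x @[k --> \oo] --> (- 0 : R) by exact: cvgN.
  have h3 : expR (- boxp a b k x) @[k --> \oo] --> (expR (- 0) : R).
    exact: (continuous_cvg _ (@continuous_expR R (- 0)) h2).
  by rewrite oppr0 expR0 in h3.
have [i hi] : exists i, 1 <= `|boxq a b x i|.
  apply: contrapT => /forallNP h; apply: xab; rewrite inE => i.
  by rewrite -boxq_lt1// ltNge; apply/negP; exact: h.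
apply: (@squeeze_cvgr _ _ _ _ (fun=> 0) _ _ _ _ _ (@cvg_harmonic R)); last exact: cvg_cst.
apply: nearW => k; rewrite expR_ge0/= /harmonic expRN lef_pV2 ?posrE ?expR_gt0//.
apply: (@le_trans _ _ (1 + k.+1%:R)); first by rewrite lerDr.
rewrite (le_trans (expR_ge1Dx _))// ler_expR /boxp ler_peMr// (bigD1 i)//=.
have e0 j : 0 <= boxq a b x j ^+ (2 * k.+1) by rewrite mul2n -addnn exprD -expr2 sqr_ge0.
apply: ler_wpDr; first by apply: sumr_ge0 => j _; exact: e0.
by rewrite -(ger0_norm (e0 i)) normrX exprn_ege1.
Qed.

End BoxApproximation.

Import HBSimple HBNNSimple.

(** * Density of Schwartz functions as an induction principle *)

Section Density.
Variables (R : realType) (n : nat).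
Local Notation V := 'rV[R]_n.
Local Notation C := R[i].
Local Notation mV := (leb R n).
Local Notation G := (@gau R n 1).

Lemma measurable_obox (a b : V) : measurable (obox a b).
Proof.
rewrite (_ : obox a b = \bigcap_(k in [set: 'I_n]) (@rV_coord R n k @^-1` `]a ord0 k, b ord0 k[%classic)).
  apply: fin_bigcap_measurable => [|k _]; first exact: finite_finset.
  by rewrite -[X in measurable X]setTI; apply: measurable_rV_coord => //; exact: measurable_itv.
rewrite predeqE => x; split => h k.
  by move=> _; rewrite /= in_itv /=; exact: h.
by have := h k Logic.I; rewrite /preimage /= in_itv.
Qed.

Definition oboxes : set (set V) := [set A | exists a b, A = obox a b].

Lemma oboxes_setI : setI_closed oboxes.
Proof.
move=> A B [a [b ->]] [c [e ->]].
exists (\row_i Num.max (a ord0 i) (c ord0 i)), (\row_i Num.min (b ord0 i) (e ord0 i)).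
rewrite predeqE => x; split.
  by move=> [h1 h2] i; rewrite !mxE gt_max lt_min; move: (h1 i) (h2 i) => /andP[-> ->] /andP[-> ->].
by move=> h; split=> i; have := h i; rewrite !mxE gt_max lt_min
  => /andP[/andP[ha hc] /andP[hb he]]; apply/andP.
Qed.

(** The preimage of an open interval under a coordinate is a countable union of boxes growing in the
    other coordinates. *)
Lemma measurable_sub_oboxes : (measurable : set (set V)) `<=` <<s oboxes >>.
Proof.
apply: smallest_sub; first exact: smallest_sigma_algebra.
rewrite -bigcup_seq; apply: bigcup_sub => i _ _ [B mB <-].
have sa : sigma_algebra setT [set B : set R | <<s oboxes >> (setT `&` @rV_coord R n i @^-1` B)].
  have [s0 sC sU] := smallest_sigma_algebra setT oboxes; split.
  - by rewrite /= preimage_set0 setI0.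
  - move=> A /=; rewrite !setTI => hA; rewrite setTD preimage_setC -setTD; exact: sC.
  - by move=> F hF /=; rewrite setTI preimage_bigcup; apply: sU => k; have := hF k; rewrite /= setTI.
suff : <<s @RGenOpens.G R >> `<=` [set B : set R | <<s oboxes >> (setT `&` @rV_coord R n i @^-1` B)].
  have mB' : (@ocitv R).-sigma.-measurable B by exact: mB.
  by rewrite RGenOpens.measurableE in mB'; apply.
apply: smallest_sub => // _ [x [y ->]] /=; rewrite setTI.
have -> : @rV_coord R n i @^-1` `]x, y[%classic =
    \bigcup_k obox (\row_j (if j == i then x else - k%:R)) (\row_j (if j == i then y else k%:R)).
  rewrite predeqE => t; split.
    rewrite /preimage /= in_itv /= => h; exists (Num.truncn `|t|).+1 => // j; rewrite !mxE.
    case: eqP => [->//|_]; have : `|t ord0 j| < (Num.truncn `|t|).+1%:R.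
      by rewrite (le_lt_trans (rV_coord_le t j))// truncnS_gt.
    by rewrite ltr_norml.
  by move=> [k _ /(_ i)]; rewrite !mxE eqxx /preimage /= in_itv.
have [s0 sC sU] := smallest_sigma_algebra setT oboxes.
by apply: sU => k; apply: sub_sigma_algebra; eexists; eexists; reflexivity.
Qed.

Section Induction.
Variable P : (V -> C) -> Prop.
Hypothesis Plin : forall (a : C) f g, l2 f -> l2 g -> P f -> P g -> P (fun x => a * f x + g x).
Hypothesis Plim : forall (u : nat -> V -> C) f (b : V -> R), (forall k, l2 (u k)) -> l2 f ->
  (forall x, cto (fun k => u k x) (f x)) -> (forall k x, cabs (u k x) <= b x) ->
  measurable_fun setT b -> rint mV (fun x => b x ^+ 2) -> (forall k, P (u k)) -> P f.
Hypothesis Psch : forall f, schwartz f -> P f.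

(** The Gaussian factor keeps indicators square integrable even for sets of infinite measure, so
    that the class [Pset] contains the whole space. *)
Let gI (p : V -> R) : V -> C := fun x => ((p x * gr 1 x)%:C)%C.

Let mgr : measurable_fun setT (@gr R n 1).
Proof. exact: (ccont_cmf (@ccont_gau R n 1)).1. Qed.

Let igr2 : rint mV (fun x => gr 1 x ^+ 2).
Proof.
have [_] := schwartz_l2 (@schwartz_gau R n 1 ltr01).
by under eq_fun do rewrite cabs_gau.
Qed.

Let gI_l2 (p : V -> R) : measurable_fun setT p -> (forall x, `|p x| <= 1) -> l2 (gI p).
Proof.
move=> mp p1; have [|x|//] := @l2_dom R n (gI p) (gr 1) _ _ igr2.
  by apply: cmf_real; exact: measurable_funM.
by rewrite cabs_real normrM (ger0_norm (gr_ge0 _ _)) ler_piMl ?gr_ge0.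
Qed.

Let Pset (A : set V) : Prop := measurable A /\ P (gI (\1_A)).

Let i1 (A : set V) x : `|(\1_A x : R)| <= 1.
Proof. by rewrite indicE; case: (_ \in _); rewrite ?normr1 ?normr0. Qed.

Let Pset_box a b : Pset (obox a b).
Proof.
split; first exact: measurable_obox.
have [ab|/existsNP[i /negP]] := pselect (forall i, a ord0 i < b ord0 i); last first.
  rewrite -leNgt => ba.
  rewrite (_ : gI _ = fun=> 0); first by apply: Psch; exact: schwartz0.
  apply/funext => x; rewrite /gI indicE memNset ?mul0r// => /(_ i)/andP[h1 h2].
  by have := lt_trans h1 h2; rewrite ltNge ba.
apply: (@Plim (fun k => gI (fun x => expR (- boxp a b k x))) _ (gr 1)) => //.
- move=> k; apply: schwartz_l2; apply: schwartz_pexp => [N|x]; [exact: pgrowth_boxp|exact: boxp_ge0].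
- by apply: gI_l2 => //; apply: measurable_indic; exact: measurable_obox.
- move=> x; apply: cto_real; apply: cvgM; last exact: cvg_cst.
  exact: boxp_cvg.
- move=> k x; rewrite cabs_real normrM (ger0_norm (gr_ge0 _ _)) ler_piMl ?gr_ge0//.
  by rewrite ger0_norm ?expR_ge0// -expR0 ler_expR oppr_le0 boxp_ge0.
- move=> k; apply: Psch; apply: schwartz_pexp => [N|x]; [exact: pgrowth_boxp|exact: boxp_ge0].
Qed.

Let Pset_all (A : set V) : measurable A -> P (gI (\1_A)).
Proof.
move=> mA; suff : <<s oboxes >> `<=` Pset by move=> /(_ A (measurable_sub_oboxes mA))[].
have l2I B : measurable B -> l2 (gI (\1_B)).
  by move=> mB; apply: gI_l2 => //; exact: measurable_indic.
apply: (lambda_system_subset oboxes_setI); [split| |by []].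
- by [].
- split=> //; rewrite (_ : gI _ = gau 1); first by apply: Psch; exact: schwartz_gau.
  by apply/funext => x; rewrite /gI indicT mul1r.
- move=> B D DB [mB PB] [mD PD]; split; first exact: measurableD.
  have := Plin (-1) (l2I _ mD) (l2I _ mB) PD PB; congr P; apply/funext => x.
  rewrite /gI mulN1r addrC -rmorphB /= -mulrBl; congr ((_ * _)%:C)%C.
  rewrite !indicE in_setD; case: (boolP (x \in D)) => [xD|xD] /=; last by rewrite subr0 andbT.
  by rewrite (mem_set (DB _ (set_mem xD))) andbF subrr.
- move=> F ndF PF; have mF k : measurable (F k) by have [] := PF k.
  have mU : measurable (\bigcup_k F k) by exact: bigcup_measurable.
  split=> //.
  apply: (@Plim (fun k => gI (\1_(F k))) _ (gr 1)) => //.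
  + by move=> k; exact: l2I.
  + exact: l2I.
  + move=> x; apply: cto_real; apply: cvgM; last exact: cvg_cst.
    rewrite !indicE; case: (boolP (x \in \bigcup_k F k)) => [/set_mem[k _ Fkx]|/negP xF].
      apply: cvg_near_cst; exists k => // m /= km; rewrite indicE mem_set//.
      by have /subsetPset := ndF _ _ km; apply.
    apply: cvg_near_cst; apply: nearW => k; rewrite indicE memNset// => Fkx.
    by apply: xF; rewrite inE; exists k.
  + by move=> k x; rewrite cabs_real normrM (ger0_norm (gr_ge0 _ _)) ler_piMl ?gr_ge0.
  + by move=> k; have [] := PF k.
- by move=> _ [a [b ->]]; exact: Pset_box.
Qed.

Let P0 : P (fun=> 0). Proof. by apply: Psch; exact: schwartz0. Qed.

Let Pnneg (f : V -> R) : measurable_fun setT f -> (forall x, 0 <= f x) ->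
  rint mV (fun x => f x ^+ 2) -> P (fun x => ((f x)%:C)%C).
Proof.
(* Dividing by the Gaussian first makes the simple approximations of [h], multiplied back by it,
   stay below [f], which serves as the dominating function. *)
move=> mf f0 if2; pose h (x : V) := f x / gr 1 x.
have h0 x : 0 <= h x by rewrite divr_ge0// gr_ge0.
have mh : measurable_fun setT (EFin \o h).
  apply/measurable_EFinP; apply: measurable_funM => //.
  rewrite (_ : (fun x => (gr 1 x)^-1) = fun x => gr (-1) x).
    exact: (ccont_cmf (@ccont_gau R n (-1))).1.
  by apply/funext => x; rewrite /gr -expRN; congr expR; ring.
have hE x : h x * gr 1 x = f x by rewrite /h divfK// gt_eqF// gr_gt0.
pose s (k : nat) (x : V) : R := nnsfun_approx measurableT mh k x.
have h0' x : [set: V] x -> (0 <= (EFin \o h) x)%E by move=> _; rewrite lee_fin.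
have s0 k x : 0 <= s k x by exact: fun_ge0.
have sh k x : s k x <= h x.
  by have := @le_approx _ _ R setT (EFin \o h) k x h0' Logic.I; rewrite /s nnsfun_approxE lee_fin.
have scvg x : s k x @[k --> \oo] --> h x.
  by have := cvg_nnsfun_approx measurableT mh h0' (Logic.I : setT x); move=> /fine_cvgP[_].
have ms k : measurable_fun setT (s k) by exact: measurable_funP.
have l2s k : l2 (gI (s k)).
  have [|x|//] := @l2_dom R n (gI (s k)) f _ _ if2.
    by apply: cmf_real; exact: measurable_funM.
  by rewrite cabs_real ger0_norm ?mulr_ge0 ?gr_ge0// -hE ler_wpM2r ?gr_ge0.
have lf : l2 (fun x => ((f x)%:C)%C).
  split; first exact: cmf_real.
  by under eq_fun do rewrite cabs_real ger0_norm//.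
apply: (@Plim (fun k => gI (s k)) _ f) => //.
- move=> x; apply: cto_real; rewrite -hE; apply: cvgM => //; exact: cvg_cst.
- by move=> k x; rewrite cabs_real ger0_norm ?mulr_ge0 ?gr_ge0// -hE ler_wpM2r ?gr_ge0.
move=> k; pose F := nnsfun_approx measurableT mh k.
have key (l : seq R) : l2 (gI (fun x => \sum_(y <- l) (y * \1_(F @^-1` [set y]) x))) /\
    P (gI (fun x => \sum_(y <- l) (y * \1_(F @^-1` [set y]) x))).
  elim: l => [|y l [IH1 IH2]].
    rewrite (_ : gI _ = fun=> 0); first by split; [exact: l2_0|exact: P0].
    by apply/funext => x; rewrite /gI big_nil mul0r.
  have mA : measurable (F @^-1` [set y]) by exact: measurable_sfunP.
  have lA : l2 (gI (\1_(F @^-1` [set y]))).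
    by apply: gI_l2 => //; exact: measurable_indic.
  rewrite (_ : gI _ = fun x => ((y%:C)%C : C) * gI (\1_(F @^-1` [set y])) x +
     gI (fun x => \sum_(y <- l) (y * \1_(F @^-1` [set y]) x)) x).
    by split; [apply: l2D => //; exact: l2Z|apply: Plin => //; exact: Pset_all].
  by apply/funext => x; rewrite /gI big_cons -rmorphM -rmorphD /= mulrDl mulrA.
have := (key (finmap.enum_fset (fset_set (range F)))).2; congr P; apply/funext => x; rewrite /gI; congr ((_ * _)%:C)%C.
by rewrite /s fimfunE fsbig_finite.
Qed.

Let Preal (f : V -> R) : measurable_fun setT f -> rint mV (fun x => f x ^+ 2) ->
  P (fun x => ((f x)%:C)%C).
Proof.
move=> mf if2; pose p (x : V) := Num.max (f x) 0; pose m (x : V) := Num.max (- f x) 0.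
have mp : measurable_fun setT p by exact: measurable_maxr.
have mm : measurable_fun setT m by apply: measurable_maxr => //; exact: mf_opp.
have p0 x : 0 <= p x by rewrite le_max lexx orbT.
have m0 x : 0 <= m x by rewrite le_max lexx orbT.
have pl x : p x ^+ 2 <= f x ^+ 2.
  by rewrite /p maxEle; case: ifP => _; rewrite ?lexx// expr0n sqr_ge0.
have ml x : m x ^+ 2 <= f x ^+ 2.
  by rewrite /m maxEle; case: ifP => _; rewrite ?sqrrN ?lexx// expr0n sqr_ge0.
have ip : rint mV (fun x => p x ^+ 2).
  by apply: (rint_dom _ _ if2) => [|x]; [exact: measurable_funX|rewrite ger0_norm ?sqr_ge0].
have im : rint mV (fun x => m x ^+ 2).
  by apply: (rint_dom _ _ if2) => [|x]; [exact: measurable_funX|rewrite ger0_norm ?sqr_ge0].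
have lp : l2 (fun x => ((p x)%:C)%C).
  by split; [exact: cmf_real|under eq_fun do rewrite cabs_real ger0_norm//].
have lm : l2 (fun x => ((m x)%:C)%C).
  by split; [exact: cmf_real|under eq_fun do rewrite cabs_real ger0_norm//].
have := Plin (-1) lm lp (Pnneg mm m0 im) (Pnneg mp p0 ip); congr P; apply/funext => x.
rewrite mulN1r addrC -rmorphB /=; congr (_%:C)%C; rewrite /p /m.
have [h|h] := leP (f x) 0; first by rewrite max_l ?oppr_ge0// sub0r opprK.
by rewrite max_r ?subr0// oppr_le0 ltW.
Qed.

(** Monotone class argument: boxes are limits of Schwartz functions, measurable sets follow by the
    lambda-system theorem, then simple, nonnegative, real and complex functions by linearity and
    dominated limits. *)
Lemma L2_ind f : l2 f -> P f.
Proof.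
move=> [[mr mi] if2].
have ir : rint mV (fun x => complex.Re (f x) ^+ 2).
  apply: (rint_dom _ _ if2) => [|x]; first exact: measurable_funX.
  by rewrite ger0_norm ?sqr_ge0// cabs_sq lerDl sqr_ge0.
have ii : rint mV (fun x => complex.Im (f x) ^+ 2).
  apply: (rint_dom _ _ if2) => [|x]; first exact: measurable_funX.
  by rewrite ger0_norm ?sqr_ge0// cabs_sq lerDr sqr_ge0.
have lr : l2 (fun x => ((complex.Re (f x))%:C)%C).
  by split; [exact: cmf_real|under eq_fun do rewrite cabs_real -normrX ger0_norm ?sqr_ge0//].
have li : l2 (fun x => ((complex.Im (f x))%:C)%C).
  by split; [exact: cmf_real|under eq_fun do rewrite cabs_real -normrX ger0_norm ?sqr_ge0//].
have := Plin (Complex 0 1) li lr (Preal mi ii) (Preal mr ir); congr P; apply/funext => x.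
by apply: complex_ext; rewrite !ReImE/=; ring.
Qed.

End Induction.

End Density.

Section Isometry.
Variables (R : realType) (n : nat).
Local Notation V := 'rV[R]_n.
Local Notation W := 'rV[R]_(n + n).
Local Notation C := R[i].
Local Notation mV := (leb R n).
Local Notation mW := (leb R (n + n)).

Lemma l2_dominated (u : nat -> V -> C) (f : V -> C) (b : V -> R) : (forall k, l2 (u k)) -> l2 f ->
  (forall x, cto (fun k => u k x) (f x)) -> (forall k x, cabs (u k x) <= b x) ->
  measurable_fun setT b -> rint mV (fun x => b x ^+ 2) ->
  nrm (fun x => u k x - f x) @[k --> \oo] --> (0 : R).
Proof.
move=> lu lf uf ub mb ib.
have fb x : cabs (f x) <= b x by exact: cto_cabs_le (uf x) (fun k => ub k x).
have h : \int[mV]_x (cabs (u k x - f x) ^+ 2) @[k --> \oo] --> (0 : R).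
  have [|||||_] := @dominated_rint R _ _ mV (fun k x => cabs (u k x - f x) ^+ 2) (fun=> 0)
      (fun x => 4 * b x ^+ 2).
  - by move=> k; apply: measurable_funX; apply: cmf_cabs; exact: (l2B (lu k) lf).1.
  - exact: measurable_cst.
  - move=> x; rewrite -[X in _ --> X](mulr0 (0 : R)); under eq_fun do rewrite expr2.
    by apply: cvgM; exact: uf.
  - move=> k x; rewrite ger0_norm ?sqr_ge0// (_ : 4 * b x ^+ 2 = (2 * b x) ^+ 2); last by ring.
    have b0 : 0 <= b x by rewrite (le_trans (cabs_ge0 _) (fb x)).
    rewrite lerXn2r ?nnegrE ?cabs_ge0 ?mulr_ge0// (le_trans (cabsB _ _))//.
    by have := ub k x; have := fb x; lra.
  - exact: rintZ.
  by rewrite /Rintegral integral0.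
have h2 : nrm (fun x => u k x - f x) @[k --> \oo] --> (Num.sqrt 0 : R).
  exact: (continuous_cvg _ (@sqrt_continuous R 0) h).
by rewrite sqrtr0 in h2.
Qed.

(* Stated for a bounded operator so that [T = id] gives the isometry property of the
   short-time Fourier transform; the Schwartz case extends to L^2 by density. *)
Lemma stft_synthesis (T : (V -> C) -> V -> C) (K : R) (g f h : V -> C) (b : W -> R) :
  bounded_op T K -> schwartz g -> l2 f -> l2 h -> rint mW b ->
  (forall a, cabs (inner (T (tfa a g)) h) <= b a) ->
  ((kap g)%:C)%C * inner (T f) h = cI mW (fun a => inner f (tfa a g) * inner (T (tfa a g)) h).
Proof.
move=> bT sg lf lh ib hb; have lg := schwartz_l2 sg.
have tu := tempered_inner bT lh.
have mTh : cmf (fun a : W => inner (T (tfa a g)) h) := cmf_tempered tu sg.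
have lga a : l2 (tfa a g) by exact: tf_l2.
have bnd f' a : l2 f' -> cabs (inner f' (tfa a g)) <= nrm f' * nrm g.
  by move=> lf'; rewrite -(nrm_tf a lg); exact: inner_le.
have ci f' : l2 f' -> cint mW (fun a => inner f' (tfa a g) * inner (T (tfa a g)) h).
  move=> lf'; apply: (cint_dom _ (b := fun a => nrm f' * nrm g * b a)); last exact: rintZ.
    by apply: cmf_mul => //; apply: cmf_stft; [exact: lf'.1|exact: schwartz_cmf].
  by move=> a; rewrite cabsM ler_pM ?cabs_ge0// bnd.
move: f lf; apply: L2_ind => [a f f' lf lf' Pf Pf'|u f bb lu lf uf ub mbb ibb Pu|f sf]; last first.
- exact: (stft_exchange tu sf sg).2.
- have d := l2_dominated lu lf uf ub mbb ibb.
  apply: (@cto_unique _ (fun k => ((kap g)%:C)%C * inner (T (u k)) h)).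
    apply: ctoZ; apply: (@cto_dom _ _ _ (fun k => K * nrm h * nrm (fun x => u k x - f x))).
      move=> k; rewrite -(inner_TB bT)// [leRHS]mulrAC; apply: (inner_T_le bT) => //.
      exact: l2B.
    by rewrite -[X in _ --> X](mulr0 (K * nrm h)); apply: cvgM => //; exact: cvg_cst.
  apply: (@cto_dom _ _ _ (fun k => (nrm g * \int[mW]_a b a) * nrm (fun x => u k x - f x))); last first.
    by rewrite -[X in _ --> X](mulr0 (nrm g * \int[mW]_a b a)); apply: cvgM => //; exact: cvg_cst.
  move=> k; rewrite Pu -cIB; [|exact: ci|exact: ci].
  rewrite [leRHS](_ : _ = \int[mW]_a (nrm (fun x => u k x - f x) * nrm g * b a)); last first.
    by rewrite rIZ//; ring.
  apply: cI_le_dom; last exact: rintZ.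
    apply: cmf_add; [|apply: cmf_opp]; apply: cmf_mul => //; apply: cmf_stft;
      by [exact: (lu k).1|exact: lf.1|exact: schwartz_cmf].
  move=> a; rewrite -mulrBl -innerBl// cabsM ler_pM ?cabs_ge0//.
  by apply: bnd; exact: l2B.
rewrite (inner_lin bT a lf lf' lh) [LHS]mulrDr.
rewrite [X in X + _ = _]mulrCA.
rewrite Pf Pf'.
rewrite -(cIZ a (ci f lf)).
rewrite -(cID (cintZ a (ci f lf)) (ci f' lf')).
apply: cI_ext => x; rewrite (innerDl (l2Z a lf) lf' (lga x)) (innerZl a lf (lga x)).
by rewrite mulrDl mulrA.
Qed.

End Isometry.

(** Completeness of row vectors, for the fixed-point argument in [solve]. *)
HB.instance Definition _ (R : realType) (m n : nat) :=
  Uniform_isComplete.Build 'M[R]_(m, n) (@cauchy_cvg _).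

(** * Global inversion *)

Section DeterminantBound.
Variable R : realType.

Definition detc (m : nat) (B : R) : R := (#|{perm 'I_m}|)%:R * B ^+ m.

Lemma det_le m (A : 'M[R]_m) (B : R) : 0 <= B -> (forall i j, `|A i j| <= B) -> `|\det A| <= detc m B.
Proof.
move=> B0 hA; rewrite /determinant /detc (le_trans (ler_norm_sum _ _ _))//.
apply: (@le_trans _ _ (\sum_(s : {perm 'I_m}) B ^+ m)); last by rewrite sumr_const mulr_natl.
apply: ler_sum => s _; rewrite normrM normrX normrN1 expr1n mul1r normr_prod.
apply: (@le_trans _ _ (\prod_(i < m) B)); last by rewrite prodr_const card_ord.
by apply: ler_prod => i _; rewrite normr_ge0 hA.
Qed.

Lemma mulmx_le m k (v : 'rV[R]_m) (A : 'M[R]_(m, k)) (B : R) : 0 <= B ->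
  (forall i j, `|A i j| <= B) -> `|v *m A| <= m%:R * B * `|v|.
Proof.
move=> B0 hA; apply: rV_norm_le => [|j]; first by rewrite !mulr_ge0.
rewrite mxE (le_trans (ler_norm_sum _ _ _))//.
apply: (@le_trans _ _ (\sum_(i < m) B * `|v|)); last first.
  by rewrite sumr_const card_ord -[leLHS]mulr_natl mulrA.
by apply: ler_sum => i _; rewrite normrM mulrC ler_pM// rV_coord_le.
Qed.

(** Cramer's rule: [\det A *: v] is [v *m A *m \adj A], and the cofactors are bounded by Leibniz'
    formula. *)
Lemma inverse_bound m (A : 'M[R]_m) (B delta : R) (v : 'rV[R]_m) : 0 <= B -> 0 < delta ->
  (forall i j, `|A i j| <= B) -> delta <= `|\det A| ->
  `|v| <= m%:R * detc m.-1 B / delta * `|v *m A|.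
Proof.
move=> B0 d0 hA dA.
have h : `|\det A *: v| <= m%:R * detc m.-1 B * `|v *m A|.
  have -> : \det A *: v = v *m A *m \adj A by rewrite -mulmxA mul_mx_adj mul_mx_scalar.
  apply: mulmx_le => [|i j]; first by rewrite mulr_ge0// exprn_ge0.
  rewrite mxE /cofactor normrM normrX normrN1 expr1n mul1r.
  by apply: det_le => // k l; rewrite !mxE.
rewrite normrZ in h; rewrite mulrAC ler_pdivlMr// mulrC.
by apply: le_trans h; rewrite ler_wpM2r.
Qed.

End DeterminantBound.

(* Hadamard's global inversion theorem in quantitative form.  The image of the
   segment [a, b] is deformed into the segment [f a, f b] through a chain of
   points along which local inverses are followed. *)
Section Hadamard.
Variables (R : realType) (n : nat).
Local Notation V := 'rV[R]_n.
Variables (L delta : R) (L0 : 0 < L) (d0 : 0 < delta).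
Variables (f : V -> V) (g : 'I_n -> 'I_n -> V -> R).
Hypothesis df : forall i j z, is_derive z (ee i) (fun y => f y ord0 j) (g i j z).
Hypothesis gb : forall i j z, `|g i j z| <= L.
Hypothesis gl : forall i j z w, `|g i j z - g i j w| <= L * `|z - w|.
Hypothesis gd : forall z, delta <= `|\det (\matrix_(i < n, j < n) g i j z)|.

Let J z : 'M[R]_n := \matrix_(i, j) g i j z.

Definition hadc : R := n%:R * detc n.-1 L / delta + 1.
Local Notation M := hadc.

Let M0 : 0 < M.
Proof. by rewrite ltr_wpDl// divr_ge0 ?(ltW d0)// !mulr_ge0// exprn_ge0// ltW. Qed.

Let Jinv (v : V) z : `|v| <= M * `|v *m J z|.
Proof.
have h := @inverse_bound R n (J z) L delta v (ltW L0) d0.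
apply: (le_trans (h _ (gd z))) => [i j|]; first by rewrite mxE.
by rewrite ler_wpM2r// /hadc lerDl.
Qed.

Let K : R := n%:R * L + 1.
Let K0 : 0 < K. Proof. by rewrite ltr_wpDl// mulr_ge0// ltW. Qed.

(** Linearization error inside a ball of radius [r]: the intermediate points of the mean value
    theorem lie within [2 r] of [y'], hence within [3 r] of [x]. *)
Let lin (x y y' : V) (r : R) : `|y - x| <= r -> `|y' - x| <= r ->
  `|f y - f y' - (y - y') *m J x| <= K * (3 * r) * `|y - y'|.
Proof.
move=> yr y'r; have r0 : 0 <= r by rewrite (le_trans _ yr).
apply: rV_norm_le => [|j]; first by rewrite !mulr_ge0// ltW.
have [xi [hxi e]] := mvt_coord y' y (fun i z => df i j z).
rewrite !mxE e -sumrB (le_trans (ler_norm_sum _ _ _))//.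
apply: (@le_trans _ _ (\sum_(i < n) (L * (3 * r)) * `|y - y'|)); last first.
  rewrite sumr_const card_ord -[leLHS]mulr_natl mulrA ler_wpM2r// mulrA ler_wpM2r ?mulr_ge0//.
  by rewrite lerDl.
apply: ler_sum => i _; rewrite !mxE mulrC -mulrBr mulrC normrM.
rewrite ler_pM//; last by have := rV_coord_le (y - y') i; rewrite !mxE.
rewrite (le_trans (gl _ _ _ _))// ler_wpM2l ?(ltW L0)//.
have -> : xi i - x = (xi i - y') + (y' - x) by rewrite addrA subrK.
rewrite (le_trans (ler_normD _ _))//.
have h : `|y - y'| <= r + r.
  have -> : y - y' = (y - x) - (y' - x) by rewrite opprB addrA subrK.
  by rewrite (le_trans (ler_normB _ _))// lerD.
by have := hxi i; lra.
Qed.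

Let flip (x y : V) : `|f y - f x| <= K * `|y - x|.
Proof.
apply: rV_norm_le => [|j]; first by rewrite mulr_ge0// ltW.
rewrite !mxE (le_trans (lipschitz_coord (fun i z => df i j z) (fun i z _ => gb i j z)))//.
by rewrite ler_wpM2r// lerDl.
Qed.

(** The radius below which the linearization error, after inversion of the Jacobian, is at most half
    of the distance ([half]). *)
Let r0 : R := (6 * K * M)^-1.
Let r00 : 0 < r0. Proof. by rewrite invr_gt0 !mulr_gt0. Qed.

Let half (t : R) : M * (K * (3 * r0) * t) = t / 2.
Proof.
have e : K * M * r0 = 6^-1 by rewrite /r0; field; rewrite !gt_eqF.
transitivity (3 * (K * M * r0) * t); first by move: r0 => r; ring.
by rewrite e; field.
Qed.

Let expand_loc (x y : V) : `|y - x| <= r0 -> `|y - x| <= 2 * M * `|f y - f x|.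
Proof.
move=> h; have h1 := @lin x y x r0 h; rewrite subrr normr0 in h1; have {}h1 := h1 (ltW r00).
have h2 := Jinv (y - x) x.
have h3 : `|(y - x) *m J x| <= `|f y - f x| + K * (3 * r0) * `|y - x|.
  have -> : (y - x) *m J x = (f y - f x) - (f y - f x - (y - x) *m J x) by rewrite subKr.
  by rewrite (le_trans (ler_normB _ _))// lerD2l.
have h4 := le_trans h2 (ler_wpM2l (ltW M0) h3).
by move: h4; rewrite mulrDr half; lra.
Qed.

(** Newton iteration with the Jacobian frozen at [x]: by [half] the map [N] is a contraction of
    ratio one half of the closed ball of radius [r0], and its fixed point solves the equation. *)
Let solve (x y : V) : `|y - f x| <= r0 / (2 * M) ->
  exists2 x', f x' = y & `|x' - x| <= r0.
Proof.
move=> hy.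
have uJ : J x \in unitmx.
  rewrite unitmxE unitfE -normr_gt0; exact: lt_le_trans d0 (gd x).
pose N (t : V) : V := t + (y - f t) *m invmx (J x).
pose U : set V := [set t | `|t - x| <= r0].
have Ninv (v : V) : `|v *m invmx (J x)| <= M * `|v|.
  by have := Jinv (v *m invmx (J x)) x; rewrite mulmxKV.
have Nc (t t' : V) : U t -> U t' -> `|N t - N t'| <= 2^-1 * `|t - t'|.
  move=> Ut Ut'.
  have -> : N t - N t' = - ((f t - f t' - (t - t') *m J x) *m invmx (J x)).
    rewrite mulmxBl mulmxK// opprB /N opprD addrACA -mulmxBl; congr (_ + _).
    by rewrite -mulNmx; congr (_ *m _); apply/rowP => j; rewrite !mxE; ring.
  rewrite normrN (le_trans (Ninv _))// (le_trans (ler_wpM2l (ltW M0) (lin Ut Ut')))//.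
  by rewrite half mulrC.
have Ux : U x by rewrite /U /= subrr normr0 ltW.
have NU : {homo N : t / U t >-> U t}.
  move=> t Ut; rewrite /U /=.
  have -> : N t - x = (N t - N x) + (N x - x) by rewrite addrA subrK.
  have h1 := Nc _ _ Ut Ux.
  have h2 : `|N x - x| <= r0 / 2.
    rewrite /N addrC addKr (le_trans (Ninv _))// (le_trans (ler_wpM2l (ltW M0) hy))//.
    rewrite le_eqVlt; apply/orP; left; apply/eqP; move: r0 => r.
    by field; rewrite gt_eqF.
  rewrite (le_trans (ler_normD _ _))//; move: h1 h2; move: Ut; rewrite /U /=; lra.
have [p Up pE] : exists2 p, U p & p = N p.
  have half1 : (2^-1 : R) < 1 by rewrite invf_lt1// ltr1n.
  have ctr : is_contraction (mkfun_fun NU).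
    exists (@NngNum R 2^-1 ltac:(by rewrite invr_ge0)); split => //.
    by move=> [t t'] [/= Ut Ut']; exact: Nc.
  have [||p Up pE] := banach_fixed_point ctr.
  - rewrite (_ : U = closed_ball x r0); first exact: closed_ball_closed.
    by rewrite closed_ballE// predeqE => t; rewrite /U /closed_ball_ /= distrC.
  - by exists x.
  by exists p.
exists p => //.
have : (y - f p) *m invmx (J x) = 0.
  by apply: (addrI p); rewrite addr0 -[LHS]/(N p).
move=> /(congr1 (fun v => v *m J x)); rewrite mulmxKV// mul0mx => /eqP.
by rewrite subr_eq0 => /eqP.
Qed.

Lemma hadamard (a b : V) : `|b - a| <= 2 * M * `|f b - f a|.
Proof.
pose D := `|b - a|; pose c (s : R) : V := a + s *: (b - a).
(* Homotopy with fixed endpoints from the image of the segment [[a, b]], at [t = 0], to the segment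
   [[f a, f b]], at [t = 1]. *)
pose H (t s : R) : V := (1 - t) *: f (c s) + t *: (f a + s *: (f b - f a)).
have c0 : c 0 = a by rewrite /c scale0r addr0.
have c1 : c 1 = b by rewrite /c scale1r addrC subrK.
have H0 s : H 0 s = f (c s) by rewrite /H subr0 scale1r scale0r addr0.
have Ha t : H t 0 = f a by rewrite /H c0 scale0r addr0 -scalerDl subrK scale1r.
have Hb t : H t 1 = f b.
  by rewrite /H c1 scale1r [f a + _]addrC subrK -scalerDl subrK scale1r.
have cB s s' : c s - c s' = (s - s') *: (b - a).
  by rewrite /c opprD addrACA subrr add0r scalerBl.
have D0 : 0 <= D by exact: normr_ge0.
have fab : `|f b - f a| <= K * D by exact: flip.
have Hs t s s' : 0 <= t <= 1 -> `|H t s - H t s'| <= K * D * `|s - s'|.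
  move=> /andP[t0 t1].
  have -> : H t s - H t s' = (1 - t) *: (f (c s) - f (c s')) + t *: ((s - s') *: (f b - f a)).
    rewrite /H opprD addrACA -scalerBr -scalerBr; congr (_ + t *: _).
    by rewrite opprD addrACA subrr add0r scalerBl.
  rewrite (le_trans (ler_normD _ _))// !normrZ (ger0_norm t0) ger0_norm ?subr_ge0//.
  have h1 : `|f (c s) - f (c s')| <= K * D * `|s - s'|.
    by rewrite (le_trans (flip _ _))// cB normrZ -mulrA ler_wpM2l ?(ltW K0)// mulrC.
  have h2 : `|s - s'| * `|f b - f a| <= K * D * `|s - s'| by rewrite mulrC ler_wpM2r.
  rewrite (le_trans (lerD (ler_wpM2l _ h1) (ler_wpM2l t0 h2)))// ?subr_ge0//.
  by rewrite -mulrDl subrK mul1r.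
have Ht t t' s : 0 <= s <= 1 -> `|H t s - H t' s| <= 2 * K * D * `|t - t'|.
  move=> /andP[s0 s1].
  have -> : H t s - H t' s = (t - t') *: ((f a + s *: (f b - f a)) - f (c s)).
    apply/rowP => j; rewrite !mxE; ring.
  rewrite normrZ mulrC ler_wpM2r//.
  have -> : f a + s *: (f b - f a) - f (c s) = s *: (f b - f a) - (f (c s) - f (c 0)).
    by apply/rowP => j; rewrite !mxE c0; ring.
  rewrite (le_trans (ler_normB _ _))// normrZ ger0_norm//.
  have h1 : `|f (c s) - f (c 0)| <= K * D.
    rewrite (le_trans (flip _ _))// ler_wpM2l ?(ltW K0)// cB subr0 normrZ ger0_norm// ler_piMl//.
  have h2 : s * `|f b - f a| <= K * D by rewrite (le_trans _ fab)// ler_piMl.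
  by lra.
(* Below the first threshold [solve] applies; below the second every displacement is at most
   [r0 / 5], so three of them together stay within [r0]. *)
pose e := Num.min (r0 / (2 * M)) (r0 / (10 * M)).
have e0 : 0 < e by rewrite lt_min !divr_gt0// mulr_gt0.
(* The mesh [1 / N.+1] is fine enough for one step of the homotopy, in [t] or in [s], to move by at
   most [e], and for consecutive points of the segment to lie within [r0]. *)
have [N hN] : exists N : nat, (2 * K * D + 1 + D / r0 * e) / e <= N.+1%:R.
  exists (Num.truncn ((2 * K * D + 1 + D / r0 * e) / e)); rewrite ltW//; exact: truncnS_gt.
have KD0 : 0 <= K * D by rewrite mulr_ge0 ?(ltW K0).
pose h : R := N.+1%:R^-1; have h0 : 0 < h by rewrite invr_gt0.
have Nh : N.+1%:R * h = 1 by rewrite mulfV.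
have hx x : 0 <= x -> x <= 2 * K * D + 1 + D / r0 * e -> x * h <= e.
  move=> x0 xle; rewrite -(@ler_pM2l _ N.+1%:R)// mulrCA Nh mulr1.
  rewrite (le_trans xle)// -ler_pdivrMr//.
have De0 : 0 <= D / r0 * e by apply: mulr_ge0 (ltW e0); rewrite mulr_ge0// invr_ge0 ltW.
have h2KD : 2 * K * D * h <= e by apply: hx; [rewrite -mulrA mulr_ge0|rewrite -addrA lerDl addr_ge0].
have hKD : K * D * h <= e.
  apply: hx => //; rewrite -addrA (_ : 2 * K * D = K * D + K * D); last by ring.
  by rewrite -addrA lerDl !addr_ge0.
have hD : D * h <= r0.
  have : D / r0 * e * h <= e.
    by apply: hx => //; rewrite lerDr addr_ge0// -mulrA mulr_ge0.
  rewrite mulrAC -[leRHS]mul1r ler_pM2r// mulrAC ler_pdivrMr// mul1r//.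
have eM : 2 * M * e <= r0.
  rewrite -ler_pdivlMl ?mulr_gt0// mulrC; by rewrite ge_min lexx.
have eM' : 2 * M * e <= r0 / 5.
  rewrite -ler_pdivlMl ?mulr_gt0//.
  rewrite ge_min; apply/orP; right; rewrite le_eqVlt; apply/orP; left; apply/eqP.
  by field; rewrite gt_eqF.
pose s (i : nat) : R := i%:R * h.
have s01 i : (i <= N.+1)%N -> 0 <= s i <= 1.
  move=> iN; rewrite mulr_ge0 ?(ltW h0)//= /s [leRHS](esym Nh) ler_wpM2r ?(ltW h0)// ler_nat; exact: iN.
have sS i : s i.+1 - s i = h by rewrite /s -mulrBl -natr1 addrAC subrr add0r mul1r.
have sN : s N.+1 = 1 by rewrite /s Nh.
have s0 : s 0%N = 0 by rewrite /s mul0r.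
(* Discrete lifting of the homotopy up to time [s k]: neighbours stay within [r0], which keeps
   [expand_loc] available along the chain. *)
have chain k : (k <= N.+1)%N -> exists X : nat -> V,
    [/\ forall i, (i <= N.+1)%N -> f (X i) = H (s k) (s i),
        forall i, (i < N.+1)%N -> `|X i.+1 - X i| <= r0, X 0%N = a & X N.+1 = b].
  elim: k => [_|k IH kN].
    exists (fun i => c (s i)); split => [i _|i _||]; rewrite ?s0 ?sN ?H0 ?c0 ?c1//.
    by rewrite cB sS normrZ gtr0_norm// mulrC.
  have [X [fX dX X0 XN]] := IH (ltnW kN).
  have sk01 := s01 _ (ltnW kN); have sk101 := s01 _ kN.
  have P i : exists x', (i <= N.+1)%N -> f x' = H (s k.+1) (s i) /\ `|x' - X i| <= r0.
    have [iN|] := leqP i N.+1; last by exists 0.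
    have [|x' fx' hx'] := @solve (X i) (H (s k.+1) (s i)); last by exists x'.
    rewrite fX// (le_trans (Ht _ _ _ (s01 _ iN)))// sS gtr0_norm// (le_trans h2KD)//.
    by rewrite ge_min lexx.
  have [Y hY] := boolp.choice P.
  have YX i : (i <= N.+1)%N -> `|Y i - X i| <= r0 / 5.
    move=> iN; have [fY rY] := hY i iN.
    rewrite (le_trans (expand_loc rY))// fY fX// (le_trans _ eM')// ler_wpM2l ?mulr_ge0 ?(ltW M0)//.
    by rewrite (le_trans (Ht _ _ _ (s01 _ iN)))// sS gtr0_norm.
  exists Y; split.
  - by move=> i iN; exact: (hY i iN).1.
  - move=> i iN.
    have h1 := YX _ iN; have h2 := YX _ (ltnW iN).
    have h3 : `|X i.+1 - X i| <= r0 / 5.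
      rewrite (le_trans (expand_loc (dX i iN)))// !fX ?(ltnW iN)// (le_trans _ eM')//.
      rewrite ler_wpM2l ?mulr_ge0 ?(ltW M0)// (le_trans (Hs _ _ _ sk01))// sS gtr0_norm//.
    have -> : Y i.+1 - Y i = (Y i.+1 - X i.+1) + (X i.+1 - X i) - (Y i - X i).
      by apply/rowP => j; rewrite !mxE; ring.
    rewrite (le_trans (ler_normB _ _))// (le_trans (lerD (ler_normD _ _) (lexx _)))//.
    have := r00; lra.
  (* The endpoints do not move: old and new point have the same image and lie within [r0], where
     [expand_loc] makes [f] injective. *)
  - have [fY rY] := hY 0%N isT; rewrite X0 in rY.
    have := expand_loc rY; rewrite fY s0 Ha subrr normr0 mulr0 normr_le0 subr_eq0.
    by move=> /eqP.
  - have [fY rY] := hY N.+1 (leqnn _); rewrite XN in rY.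
    have := expand_loc rY; rewrite fY sN Hb subrr normr0 mulr0 normr_le0 subr_eq0.
    by move=> /eqP.
have [X [fX dX X0 XN]] := chain N.+1 (leqnn _).
have H1 i : H (s N.+1) (s i) = f a + s i *: (f b - f a).
  by rewrite sN /H subrr scale0r add0r scale1r.
(* At the final time the images are equally spaced on the segment [[f a, f b]], so the local
   expansion bounds add up to the global one. *)
have dXi i : (i < N.+1)%N -> `|X i.+1 - X i| <= 2 * M * `|f b - f a| * h.
  move=> iN; rewrite (le_trans (expand_loc (dX i iN)))// !fX ?(ltnW iN)// !H1.
  rewrite opprD addrACA subrr add0r -scalerBl sS normrZ gtr0_norm//.
  by rewrite [h * _]mulrC mulrA.
have tel i : (i <= N.+1)%N -> `|X i - X 0%N| <= 2 * M * `|f b - f a| * s i.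
  elim: i => [_|i IH iN]; first by rewrite subrr normr0 s0 mulr0.
  have -> : X i.+1 - X 0%N = (X i.+1 - X i) + (X i - X 0%N) by rewrite addrA subrK.
  rewrite (le_trans (ler_normD _ _))// (le_trans (lerD (dXi i iN) (IH (ltnW iN))))//.
  by rewrite -mulrDr -(sS i) subrK.
by have := tel N.+1 (leqnn _); rewrite X0 XN sN mulr1.
Qed.

End Hadamard.

(** * The phase map *)

Section Expansive.
Variables (R : realType) (m : nat).
Local Notation W := 'rV[R]_m.

(** The larger of [A] and [B] is at least [D / (2 c)], so its negative power supplies the factor in
    [D]; the other one is kept. *)
Lemma powRN_split (s A B D c : R) : 0 <= s -> 1 <= A -> 1 <= B -> 0 < D -> 0 < c -> D <= c * (A + B) ->
  A `^ (- s) * B `^ (- s) <= (2 * c) `^ s * D `^ (- s) * (A `^ (- s) + B `^ (- s)).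
Proof.
move=> s0 A1 B1 D0 c0 DAB.
have A0 : 0 < A by rewrite (lt_le_trans ltr01). have B0 : 0 < B by rewrite (lt_le_trans ltr01).
have key (E : R) : 0 < E -> D <= 2 * c * E -> E `^ (- s) <= (2 * c) `^ s * D `^ (- s).
  move=> E0 DE; rewrite !powRN -ler_pdivrMr ?invr_gt0 ?powR_gt0// invrK mulrC.
  rewrite ler_pdivrMr ?powR_gt0// -powRM ?(ltW E0) ?mulr_ge0 ?(ltW c0)//.
  by rewrite ge0_ler_powR ?nnegrE ?mulr_ge0 ?(ltW E0) ?(ltW c0) ?(ltW D0).
have nn E : 0 <= E `^ (- s) by exact: powR_ge0.
rewrite mulrDr; have [AB|BA] := leP A B.
  rewrite mulrC; apply: ler_wpDr; first by rewrite !mulr_ge0 ?powR_ge0.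
  rewrite ler_wpM2r// key// (le_trans DAB)//; nra.
apply: ler_wpDl; first by rewrite !mulr_ge0 ?powR_ge0.
by rewrite ler_wpM2r// key// (le_trans DAB)//; nra.
Qed.

(* A near-minimizer of [|E|] serves as the centre. *)
Lemma expansive_center (c : R) (E : W -> W) : 0 < c ->
  (forall z w, `|z - w| <= c * `|E z - E w|) ->
  exists z0, forall z, jw (z - z0) <= (1 + 2 * c) * jw (E z).
Proof.
move=> c0 hE.
pose A := [set `|E z| | z in [set: W]].
have hA : has_inf A.
  split; first by exists `|E 0|; exists 0.
  by exists 0 => _ [z _ <-].
have [_ [z0 _ <-] hz0] := inf_adherent ltr01 hA.
exists z0 => z; rewrite /jw.
have h1 : `|E z0| <= `|E z| + 1.
  rewrite (le_trans (ltW hz0))// lerD2r; apply: ge_inf; last by exists z.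
  exact: hA.2.
have h2 := hE z z0; have h3 := ler_normB (E z) (E z0).
have h4 : 0 <= `|E z| by exact: normr_ge0.
have : `|z - z0| <= c * (2 * `|E z| + 1).
  by rewrite (le_trans h2)// ler_wpM2l ?(ltW c0)//; lra.
nra.
Qed.

(** Up to a constant depending only on [c], the weight is dominated by a translate of the standard
    one; the centre disappears after integration. *)
Lemma expansive_rint (c s : R) (E : W -> W) : 0 < c -> m%:R < s -> measurable_fun setT E ->
  (forall z w, `|z - w| <= c * `|E z - E w|) ->
  rint (leb R m) (fun z => jw (E z) `^ (- s)) /\
  \int[leb R m]_z (jw (E z) `^ (- s)) <= (1 + 2 * c) `^ s * jint m s.
Proof.
move=> c0 ms mE hE; have s0 : 0 <= s by rewrite (le_trans _ (ltW ms)).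
have [z0 hz0] := expansive_center c0 hE.
have c1 : 0 < 1 + 2 * c by rewrite addr_gt0// mulr_gt0.
have le z : jw (E z) `^ (- s) <= (1 + 2 * c) `^ s * jw (z - z0) `^ (- s).
  exact: jw_powR_mono.
have i0 : rint (leb R m) (fun z => jw (z - z0) `^ (- s)).
  exact: (@rint_shift _ _ (- z0) (fun z => jw z `^ (- s)) (rint_decay ms)).
have i1 : rint (leb R m) (fun z => (1 + 2 * c) `^ s * jw (z - z0) `^ (- s)) by exact: rintZ.
have i2 : rint (leb R m) (fun z => jw (E z) `^ (- s)).
  apply: (rint_dom _ _ i1) => [|z]; first exact: mf_jw.
  by rewrite ger0_norm ?powR_ge0.
split; first exact: i2.
apply: (le_trans (rIle i2 i1 le)); rewrite (rIZ _ i0).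
by rewrite (@rI_shift R m (- z0) (fun z => jw z `^ (- s)))//; exact: measurable_jw_powR.
Qed.

End Expansive.

Section Phase.
Variables (R : realType) (d : nat).
Local Notation V := 'rV[R]_d.
Local Notation W := 'rV[R]_(d + d).
Variable Phi : W -> R.
Hypothesis tPhi : tame_phase Phi.

Lemma phase_isD a i z : is_derive z (ee i) (pderiv a Phi) (pderiv (i :: a) Phi z).
Proof. by have [sm _ _] := tPhi; have [_ h] := sm a; exact/derivableP/h. Qed.

Lemma phase_bound a : (2 <= size a)%N -> exists2 K, 0 < K & forall z, `|pderiv a Phi z| <= K.
Proof.
have [_ h _] := tPhi; move=> /h[K hK]; exists (`|K| + 1); first by rewrite ltr_wpDl.
by move=> z; rewrite (le_trans (hK z))// (le_trans (ler_norm K))// lerDl.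
Qed.

Lemma phase_bound2 : exists2 K, 0 < K & forall i j z, `|pderiv [:: i; j] Phi z| <= K.
Proof.
have [|i c c' cc' h z|c c0 hc] := @fin_bound R ('I_(d + d) * 'I_(d + d))%type
    (fun ij c => forall z, `|pderiv [:: ij.1; ij.2] Phi z| <= c).
- by move=> ij; have [|K K0 hK] := @phase_bound [:: ij.1; ij.2]; [|exists K => //; exact: ltW].
- exact: le_trans (h z) cc'.
exists (c + 1); first by rewrite ltr_wpDl.
by move=> i j z; rewrite (le_trans (hc (i, j) z))// lerDl.
Qed.

Lemma phase_lip2 : exists2 K, 0 < K & forall i j z w,
  `|pderiv [:: i; j] Phi z - pderiv [:: i; j] Phi w| <= K * `|z - w|.
Proof.
have [|i c c' cc' h z|c c0 hc] := @fin_bound R ('I_(d + d) * 'I_(d + d) * 'I_(d + d))%type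
    (fun ij c => forall z, `|pderiv [:: ij.2; ij.1.1; ij.1.2] Phi z| <= c).
- by move=> ij; have [|K K0 hK] := @phase_bound [:: ij.2; ij.1.1; ij.1.2]; [|exists K => //; exact: ltW].
- exact: le_trans (h z) cc'.
exists ((d + d)%:R * (c + 1)  + 1); first by rewrite ltr_wpDl// mulr_ge0// addr_ge0.
move=> i j z w.
have := @lipschitz_coord R _ (pderiv [:: i; j] Phi) (fun k => pderiv [:: k; i; j] Phi) (c + 1) w z
  (fun k x => phase_isD [:: i; j] k x).
move=> h; rewrite (le_trans (h _))//; last by rewrite ler_wpM2r// lerDl.
by move=> k x _; rewrite (le_trans (hc (i, j, k) x))// lerDl.
Qed.

Lemma mvt_dir (p : W -> R) (q : 'I_(d + d) -> W -> R) (i : 'I_(d + d)) (x : W) (h : R) :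
  (forall k z, is_derive z (ee k) p (q k z)) ->
  exists2 xi : W, `|xi - x| <= `|h| & p (x + h *: ee i) - p x = h * q i xi.
Proof.
move=> dp; have [xi [hxi e]] := mvt_coord x (x + h *: ee i) dp; exists (xi i).
  rewrite (le_trans (hxi i))// addrC addKr normrZ ler_piMr//; exact: ee_norm_le.
rewrite e (bigD1 i)//= big1 => [|k ki]; rewrite !mxE.
  by rewrite !eqxx mulr1 addr0 (addrC (x _ _)) addrK mulrC.
by rewrite (negPf ki) mulr0 addr0 subrr mulr0.
Qed.

(* Schwarz's theorem, from the second difference quotient. *)
Lemma phase_sym i j z : pderiv [:: i; j] Phi z = pderiv [:: j; i] Phi z.
Proof.
have [K K0 hK] := phase_lip2.
have key a b (h : R) : 0 < h -> exists2 xi : W, `|xi - z| <= 2 * h &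
    (Phi (z + h *: ee a + h *: ee b) - Phi (z + h *: ee a)) - (Phi (z + h *: ee b) - Phi z) =
    h * (h * pderiv [:: b; a] Phi xi).
  move=> h0; pose p (y : W) := Phi (y + h *: ee b) - Phi y.
  have dp k y : is_derive y (ee k) p (pderiv [:: k] Phi (y + h *: ee b) - pderiv [:: k] Phi y).
    apply: is_derive_subR; last exact: (phase_isD [::]).
    have := (isD_shift (isD_real (phase_isD [::] k (y + h *: ee b)))).1 => /=.
    exact.
  have [x1 hx1 e1] := mvt_dir a z h dp.
  have [x2 hx2 e2] := mvt_dir b x1 h (phase_isD [:: a]).
  exists x2; last by rewrite -e2 -e1 /p.
  have -> : x2 - z = (x2 - x1) + (x1 - z) by rewrite addrA subrK.
  rewrite (le_trans (ler_normD _ _))//; rewrite gtr0_norm// in hx1 hx2; lra.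
apply/eqP; rewrite -subr_eq0 -normr_le0; apply/ler_addgt0Pr => e e0; rewrite add0r.
pose h := e / (4 * K); have h0 : 0 < h by rewrite divr_gt0// mulr_gt0.
have [x1 hx1 e1] := key i j h h0; have [x2 hx2 e2] := key j i h h0.
have : pderiv [:: j; i] Phi x1 = pderiv [:: i; j] Phi x2.
  have hn : h != 0 by rewrite gt_eqF.
  apply: (mulfI hn); apply: (mulfI hn); refine (etrans (esym e1) (etrans _ e2)).
  by rewrite (addrAC z (h *: ee j)); move: (Phi _) (Phi _) (Phi _) (Phi _) => A B D E; ring.
move=> E.
have -> : pderiv [:: i; j] Phi z - pderiv [:: j; i] Phi z =
    (pderiv [:: j; i] Phi x1 - pderiv [:: j; i] Phi z) - (pderiv [:: i; j] Phi x2 - pderiv [:: i; j] Phi z).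
  by rewrite E; move: (pderiv _ _ _) (pderiv _ _ _) (pderiv _ _ _) => A B D; ring.
have h1 := hK j i x1 z; have h2 := hK i j x2 z.
apply: (le_trans (ler_normB _ _)); apply: (le_trans (lerD h1 h2)).
rewrite -mulrDr; apply: (le_trans (ler_wpM2l (ltW K0) (lerD hx1 hx2))).
by rewrite /h le_eqVlt; apply/orP; left; apply/eqP; field; rewrite gt_eqF.
Qed.

Definition dPhi (z : W) : W := \row_i pderiv [:: i] Phi z.

(* For [u = (x', eta')] and [z = (x, eta)], [phF u z = dPhi (x', eta) - (eta', x)]. *)
Definition phP (u z : W) : W := row_mx (lsubmx u) (rsubmx z).
Definition phQ (u z : W) : W := row_mx (rsubmx u) (lsubmx z).
Definition phF (u z : W) : W := dPhi (phP u z) - phQ u z.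

Lemma dPhi_lip : exists2 K, 0 < K & forall z w, `|dPhi z - dPhi w| <= K * `|z - w|.
Proof.
have [K K0 hK] := phase_bound2.
exists ((d + d)%:R * K + 1); first by rewrite ltr_wpDl// mulr_ge0// ltW.
move=> z w; apply: rV_norm_le => [|i]; first by rewrite mulr_ge0// addr_ge0// mulr_ge0// ltW.
rewrite !mxE (le_trans (@lipschitz_coord R _ (pderiv [:: i] Phi) (fun k => pderiv [:: k; i] Phi) K w z
  (fun k x => phase_isD [:: i] k x) _))//.
by rewrite ler_wpM2r// lerDl.
Qed.

Lemma norm_lsub_le n1 n2 (a : 'rV[R]_(n1 + n2)) : `|lsubmx a| <= `|a|.
Proof. by have := jw_lsub a; rewrite lerD2l. Qed.

Lemma norm_rsub_le n1 n2 (a : 'rV[R]_(n1 + n2)) : `|rsubmx a| <= `|a|.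
Proof. by have := jw_rsub a; rewrite lerD2l. Qed.

Lemma norm_row_mx n1 n2 (x : 'rV[R]_n1) (y : 'rV[R]_n2) : `|row_mx x y| <= `|x| + `|y|.
Proof.
apply: rV_norm_le => [|i]; first by rewrite addr_ge0.
case: (split_ordP i) => k ->; rewrite ?row_mxEl ?row_mxEr.
  by rewrite (le_trans (rV_coord_le _ _))// lerDl.
by rewrite (le_trans (rV_coord_le _ _))// lerDr.
Qed.

Lemma lsub_diff (a b : W) : lsubmx (a - b) = lsubmx a - lsubmx b :> V.
Proof. by apply/rowP => i; rewrite !mxE. Qed.

Lemma rsub_diff (a b : W) : rsubmx (a - b) = rsubmx a - rsubmx b :> V.
Proof. by apply/rowP => i; rewrite !mxE. Qed.

Lemma phP_diff_z u z w : phP u z - phP u w = row_mx 0 (rsubmx z - rsubmx w).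
Proof. by rewrite /phP opp_row_mx add_row_mx subrr. Qed.

Lemma phP_diff_u u v z : phP u z - phP v z = row_mx (lsubmx u - lsubmx v) 0.
Proof. by rewrite /phP opp_row_mx add_row_mx subrr. Qed.

Lemma phF_lip_z : exists2 K, 0 < K & forall u z w, `|phF u z - phF u w| <= K * `|z - w|.
Proof.
have [K K0 hK] := dPhi_lip; exists (K + 1); first by rewrite addr_gt0.
move=> u z w.
have -> : phF u z - phF u w = (dPhi (phP u z) - dPhi (phP u w)) - (phQ u z - phQ u w).
  by rewrite /phF opprD opprK addrACA opprB addrC [- phQ u z + _]addrC addrC.
rewrite (le_trans (ler_normB _ _))// mulrDl mul1r; apply: lerD.
  rewrite (le_trans (hK _ _))// ler_wpM2l ?(ltW K0)// phP_diff_z.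
  by rewrite (le_trans (norm_row_mx _ _))// normr0 add0r -rsub_diff norm_rsub_le.
rewrite /phQ opp_row_mx add_row_mx subrr (le_trans (norm_row_mx _ _))// normr0 add0r.
by rewrite -lsub_diff norm_lsub_le.
Qed.

Lemma is_derive_row (p : W -> R) (k : 'I_(d + d)) (v : V) (w : W) (dp : W -> R) (aff : V -> W) (y : V) :
  (forall t : R, aff (t *: v + y) = t *: ee k + aff y) ->
  is_derive (aff y) (ee k) p (dp (aff y)) -> is_derive y v (fun y => p (aff y)) (dp (aff y)).
Proof.
move=> haff /is_derive_line h; apply/is_derive_line; move: h; congr is_derive.
by apply/funext => t; rewrite haff.
Qed.

Lemma row_mx_eer (x y : V) (i : 'I_d) (t : R) :
  row_mx x (t *: ee i + y) = t *: ee (rshift d i) + row_mx x y :> W.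
Proof.
apply/rowP => k; case: (split_ordP k) => j ->; rewrite [RHS]mxE ?row_mxEl ?row_mxEr !mxE/=.
  rewrite (_ : (lshift d j == rshift d i) = false) ?mulr0 ?add0r//.
  by apply/negP => /eqP/(congr1 val)/= h; have := ltn_ord j; rewrite h -ltn_subRL subnn.
by rewrite (inj_eq (@rshift_inj d d)).
Qed.

Lemma row_mx_eel (x y : V) (i : 'I_d) (t : R) :
  row_mx (t *: ee i + x) y = t *: ee (lshift d i) + row_mx x y :> W.
Proof.
apply/rowP => k; case: (split_ordP k) => j ->; rewrite [RHS]mxE ?row_mxEl ?row_mxEr !mxE/=.
  by rewrite (inj_eq (@lshift_inj d d)).
rewrite (_ : (rshift d j == lshift d i) = false) ?mulr0 ?add0r//.
by apply/negP => /eqP/(congr1 val)/= h; have := ltn_ord i; rewrite -h -ltn_subRL subnn.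
Qed.

(** Hadamard's theorem with one half of the variables frozen. The Jacobian of [x] to the
    eta-gradient is the mixed Hessian, that of [eta] to the x-gradient is its transpose by
    [phase_sym], and (A3) bounds both determinants below. *)
Lemma phase_hadamard : exists2 c, 0 < c &
  (forall x e e' : V, `|e - e'| <= c * `|lsubmx (dPhi (row_mx x e)) - lsubmx (dPhi (row_mx x e'))|) /\
  (forall e x x' : V, `|x - x'| <= c * `|rsubmx (dPhi (row_mx x e)) - rsubmx (dPhi (row_mx x' e))|).
Proof.
have [_ _ [delta d0 hdet]] := tPhi.
have [K1 K10 h1] := phase_bound2; have [K2 K20 h2] := phase_lip2.
pose L := K1 + K2; have L0 : 0 < L by rewrite addr_gt0.
have b1 i j z : `|pderiv [:: i; j] Phi z| <= L by rewrite (le_trans (h1 _ _ _))// lerDl ltW.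
have b2 i j z w : `|pderiv [:: i; j] Phi z - pderiv [:: i; j] Phi w| <= L * `|z - w|.
  by rewrite (le_trans (h2 _ _ _ _))// ler_wpM2r// lerDr ltW.
have c0 : 0 < 2 * hadc d L delta.
  by rewrite mulr_gt0// ltr_wpDl// divr_ge0 ?(ltW d0)// !mulr_ge0// exprn_ge0// ltW.
exists (2 * hadc d L delta) => //; split.
  move=> x e e'.
  apply: (@hadamard R d L delta L0 d0 (fun e => lsubmx (dPhi (row_mx x e)))
    (fun i j e => pderiv [:: rshift d i; lshift d j] Phi (row_mx x e))) => //.
  - move=> i j y; under eq_fun do rewrite !mxE.
    apply: (@is_derive_row (pderiv [:: lshift d j] Phi) (rshift d i) (ee i) 0
      (pderiv [:: rshift d i; lshift d j] Phi) (fun e => row_mx x e) y) => [t|].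
      exact: row_mx_eer.
    exact: phase_isD.
  - move=> i j z w; rewrite (le_trans (b2 _ _ _ _))// ler_wpM2l ?(ltW L0)//.
    by rewrite opp_row_mx add_row_mx subrr (le_trans (norm_row_mx _ _))// normr0 add0r.
  - move=> y; rewrite -det_tr (le_trans (hdet (row_mx x y)))//.
    rewrite (_ : mixed_hessian Phi _ = (\matrix_(i, j) pderiv [:: rshift d i; lshift d j] Phi (row_mx x y))^T)//.
    by apply/matrixP => i j; rewrite !mxE phase_sym.
move=> e x x'.
apply: (@hadamard R d L delta L0 d0 (fun x => rsubmx (dPhi (row_mx x e)))
  (fun i j x => pderiv [:: lshift d i; rshift d j] Phi (row_mx x e))) => //.
- move=> i j y; under eq_fun do rewrite !mxE.
  apply: (@is_derive_row (pderiv [:: rshift d j] Phi) (lshift d i) (ee i) 0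
    (pderiv [:: lshift d i; rshift d j] Phi) (fun x => row_mx x e) y) => [t|].
    exact: row_mx_eel.
  exact: phase_isD.
- move=> i j z w; rewrite (le_trans (b2 _ _ _ _))// ler_wpM2l ?(ltW L0)//.
  by rewrite opp_row_mx add_row_mx subrr (le_trans (norm_row_mx _ _))// normr0 addr0.
- by move=> y; exact: hdet.
Qed.

Lemma norm_le_lr (a : W) : `|a| <= `|lsubmx a| + `|rsubmx a|.
Proof. by rewrite -{1}[a]hsubmxK; exact: norm_row_mx. Qed.

(** [phF] is block triangular. As a function of [z = (x, eta)], its first block involves only [eta]
    and determines it by [phase_hadamard]; the second block then yields [x], which enters as a
    translation, by the Lipschitz bound on the gradient. In [u] the blocks exchange roles. *)
Lemma phF_expansive : exists2 c, 0 < c &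
  (forall u z w, `|z - w| <= c * `|phF u z - phF u w|) /\
  (forall z u v, `|u - v| <= c * `|phF u z - phF v z|).
Proof.
have [c c0 [hz hu]] := phase_hadamard; have [K K0 hK] := dPhi_lip.
exists (1 + c * (1 + K)); first by rewrite ltr_wpDr// mulr_ge0 ?addr_ge0 ?ltW.
split.
  move=> u z w; pose e := phF u z - phF u w.
  pose g := dPhi (phP u z) - dPhi (phP u w).
  have eE : e = g - row_mx 0 (lsubmx z - lsubmx w).
    rewrite /e /g /phF /phQ opprD opprK addrACA; congr (_ + _).
    by rewrite opp_row_mx add_row_mx opp_row_mx oppr0 (addrC (- _)) subrr opprB (addrC (- _)).
  have lE : lsubmx e = lsubmx g.
    by rewrite eE lsub_diff row_mxKl subr0.
  have rE : rsubmx g = rsubmx e + (lsubmx z - lsubmx w).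
    by rewrite eE [rsubmx (g - _)]rsub_diff row_mxKr subrK.
  have h1 : `|rsubmx z - rsubmx w| <= c * `|e|.
    rewrite (le_trans (hz (lsubmx u) _ _))// ler_wpM2l ?(ltW c0)//.
    by rewrite -/(phP u z) -/(phP u w) -lsub_diff -lE norm_lsub_le.
  have h2 : `|lsubmx z - lsubmx w| <= `|e| + K * (c * `|e|).
    have -> : lsubmx z - lsubmx w = rsubmx g - rsubmx e by rewrite rE (addrC (rsubmx e)) addrK.
    rewrite (addrC `|e|) (le_trans (ler_normB _ _))//; apply: lerD; last exact: norm_rsub_le.
    rewrite (le_trans (norm_rsub_le _))// (le_trans (hK _ _))// ler_wpM2l ?(ltW K0)//.
    by rewrite phP_diff_z (le_trans (norm_row_mx _ _))// normr0 add0r.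
  rewrite (le_trans (norm_le_lr _))// lsub_diff rsub_diff (le_trans (lerD h2 h1))// -/e.
  by rewrite le_eqVlt; apply/orP; left; apply/eqP; ring.
move=> z u v; pose e := phF u z - phF v z.
pose g := dPhi (phP u z) - dPhi (phP v z).
have eE : e = g - row_mx (rsubmx u - rsubmx v) 0.
  rewrite /e /g /phF /phQ opprD opprK addrACA; congr (_ + _).
  by rewrite opp_row_mx add_row_mx opp_row_mx oppr0 [X in row_mx _ X](addrC (- _)) subrr opprB (addrC (- _)).
have rE : rsubmx e = rsubmx g.
  by rewrite eE rsub_diff row_mxKr subr0.
have lE : lsubmx g = lsubmx e + (rsubmx u - rsubmx v).
  by rewrite eE [lsubmx (g - _)]lsub_diff row_mxKl subrK.
have h1 : `|lsubmx u - lsubmx v| <= c * `|e|.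
  rewrite (le_trans (hu (rsubmx z) _ _))// ler_wpM2l ?(ltW c0)//.
  by rewrite -/(phP u z) -/(phP v z) -rsub_diff -rE norm_rsub_le.
have h2 : `|rsubmx u - rsubmx v| <= `|e| + K * (c * `|e|).
  have -> : rsubmx u - rsubmx v = lsubmx g - lsubmx e by rewrite lE (addrC (lsubmx e)) addrK.
  rewrite (addrC `|e|) (le_trans (ler_normB _ _))//; apply: lerD; last exact: norm_lsub_le.
  rewrite (le_trans (norm_lsub_le _))// (le_trans (hK _ _))// ler_wpM2l ?(ltW K0)//.
  by rewrite phP_diff_u (le_trans (norm_row_mx _ _))// normr0 addr0.
rewrite (le_trans (norm_le_lr _))// lsub_diff rsub_diff (le_trans (lerD h1 h2))// -/e.
by rewrite le_eqVlt; apply/orP; left; apply/eqP; ring.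
Qed.

Lemma measurable_dPhi : measurable_fun setT dPhi.
Proof.
apply: measurable_fun_rVP => i; rewrite (_ : _ \o _ = pderiv [:: i] Phi).
  by apply: continuous_mf; have [sm _ _] := tPhi; have [] := sm [:: i].
by apply/funext => z; rewrite /= /rV_coord mxE.
Qed.

Lemma mf_row_mx (dT : measure_display) (T : measurableType dT) (f g : T -> V) :
  measurable_fun setT f -> measurable_fun setT g -> measurable_fun setT (fun x => row_mx (f x) (g x)).
Proof.
move=> mf mg; apply: measurable_fun_rVP => i; case: (split_ordP i) => j ->.
  rewrite (_ : _ \o _ = rV_coord j \o f); first exact: measurableT_comp (measurable_rV_coord j) mf.
  by apply/funext => x; rewrite /= /rV_coord row_mxEl.
rewrite (_ : _ \o _ = rV_coord j \o g); first exact: measurableT_comp (measurable_rV_coord j) mg.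
by apply/funext => x; rewrite /= /rV_coord row_mxEr.
Qed.

Lemma measurable_phF (dT : measure_display) (T : measurableType dT) (u z : T -> W) :
  measurable_fun setT u -> measurable_fun setT z -> measurable_fun setT (fun x => phF (u x) (z x)).
Proof.
move=> mu mz; apply: mf_rVB.
  apply: (measurableT_comp measurable_dPhi).
  by apply: mf_row_mx; [exact: mf_lsub|exact: mf_rsub].
by apply: mf_row_mx; [exact: mf_rsub|exact: mf_lsub].
Qed.

End Phase.

(** * Inversion of operators localized in phase space *)

Section Convolution.
Variables (R : realType) (n : nat).
Local Notation V := 'rV[R]_n.
Local Notation W := 'rV[R]_(n + n).
Local Notation C := R[i].
Local Notation mV := (leb R n).
Local Notation mW := (leb R (n + n)).

Definition convc (s c1 c : R) : R := (2 * c) `^ s * (2 * ((1 + 2 * c1) `^ s * jint (n + n) s)).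

Lemma convc_ge0 s c1 c : 0 <= convc s c1 c.
Proof.
apply: mulr_ge0; first exact: powR_ge0.
by apply: mulr_ge0 => //; apply: mulr_ge0; [exact: powR_ge0|exact: jint_ge0]. Qed.

(** Where [D] is large, [E1] and [E2] are not small together; [powRN_split] extracts the decay in
    [D] and leaves a single weight, integrable over phase space because [s > 2 n]. *)
Lemma conv_bound (s c1 c D : R) (E1 E2 : W -> W) : (n + n)%:R < s -> 0 < c1 -> 0 < c -> 0 < D ->
  measurable_fun setT E1 -> measurable_fun setT E2 ->
  (forall z w, `|z - w| <= c1 * `|E1 z - E1 w|) -> (forall z w, `|z - w| <= c1 * `|E2 z - E2 w|) ->
  (forall a, D <= c * (jw (E1 a) + jw (E2 a))) ->
  rint mW (fun a => jw (E1 a) `^ (- s) * jw (E2 a) `^ (- s)) /\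
  \int[mW]_a (jw (E1 a) `^ (- s) * jw (E2 a) `^ (- s)) <= convc s c1 c * D `^ (- s).
Proof.
move=> hs c10 c0 D0 mE1 mE2 h1 h2 hD.
have s0 : 0 <= s by rewrite (le_trans _ (ltW hs)).
have [i1 b1] := expansive_rint c10 hs mE1 h1.
have [i2 b2] := expansive_rint c10 hs mE2 h2.
have i12 := rintD i1 i2; set k := (2 * c) `^ s * D `^ (- s).
have k0 : 0 <= k by rewrite mulr_ge0 ?powR_ge0.
have le a : jw (E1 a) `^ (- s) * jw (E2 a) `^ (- s) <= k * (jw (E1 a) `^ (- s) + jw (E2 a) `^ (- s)).
  by apply: powRN_split => //; exact: jw_ge1.
have i : rint mW (fun a => jw (E1 a) `^ (- s) * jw (E2 a) `^ (- s)).
  apply: (rint_dom _ _ (rintZ k i12)) => [|a]; last by rewrite ger0_norm ?le// mulr_ge0 ?powR_ge0.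
  by apply: measurable_funM; exact: mf_jw.
split=> //; apply: (le_trans (rIle i (rintZ k i12) le)).
rewrite (rIZ _ i12) (rID i1 i2) (_ : convc _ _ _ * _ = k * (2 * ((1 + 2 * c1) `^ s * jint (n + n) s))).
  by rewrite ler_wpM2l// mulr_natl mulr2n lerD.
by rewrite /convc /k mulrAC.
Qed.

(** The resolution of the identity is inserted between [B] and [f], and the resulting integral is a
    convolution of weights. The transfers of decay through [T] in the Wiener argument are instances
    with [B] the identity or [T]. *)
Lemma stft_conv (B : (V -> C) -> V -> C) (KB : R) (g f h : V -> C) (s c1 c D N1 N2 : R) (E1 E2 : W -> W) :
  bounded_op B KB -> schwartz g -> (exists x, g x <> 0) -> l2 f -> l2 h ->
  (n + n)%:R < s -> 0 < c1 -> 0 < c -> 0 < D ->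
  measurable_fun setT E1 -> measurable_fun setT E2 ->
  (forall z w, `|z - w| <= c1 * `|E1 z - E1 w|) -> (forall z w, `|z - w| <= c1 * `|E2 z - E2 w|) ->
  (forall a, D <= c * (jw (E1 a) + jw (E2 a))) -> 0 <= N1 -> 0 <= N2 ->
  (forall a, cabs (inner f (tfa a g)) <= N1 * jw (E1 a) `^ (- s)) ->
  (forall a, cabs (inner (B (tfa a g)) h) <= N2 * jw (E2 a) `^ (- s)) ->
  cabs (inner (B f) h) <= (kap g)^-1 * convc s c1 c * (N1 * N2) * D `^ (- s).
Proof.
move=> bB sg g0 lf lh hs c10 c0 D0 mE1 mE2 h1 h2 hD N10 N20 b1 b2.
have [i le] := conv_bound hs c10 c0 D0 mE1 mE2 h1 h2 hD.
have [i2 _] := expansive_rint c10 hs mE2 h2.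
have k0 := kap_gt0 sg g0.
have e := stft_synthesis bB sg lf lh (rintZ N2 i2) b2.
have : cabs (((kap g)%:C)%C * inner (B f) h) <= N1 * N2 * (convc s c1 c * D `^ (- s)).
  rewrite e; apply: (@le_trans _ _ (\int[mW]_a (N1 * N2 * (jw (E1 a) `^ (- s) * jw (E2 a) `^ (- s))))).
    apply: cI_le_dom; last exact: rintZ.
      apply: cmf_mul; first by apply: cmf_stft; [exact: lf.1|exact: schwartz_cmf].
      exact: (cmf_tempered (u := fun f => inner (B f) h) (tempered_inner bB lh) sg).
    move=> a; rewrite cabsM mulrACA; apply: ler_pM; rewrite ?cabs_ge0//.
  by rewrite (rIZ _ i) ler_wpM2l// mulr_ge0.
rewrite cabsM cabs_real gtr0_norm// mulrC -ler_pdivlMr// => /le_trans; apply.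
by rewrite le_eqVlt; apply/orP; left; apply/eqP; ring.
Qed.

Section Synthesis.
Variables (c : W -> C) (g : V -> C).
Hypotheses (ic : cint mW c) (sg : schwartz g).

Definition synth (t : V) : C := cI mW (fun w => c w * tfa w g t).

Let mcg : cmf (fun p : W * V => c p.1 * tfa p.1 g p.2).
Proof.
apply: cmf_mul; last by apply: cmf_tfa; exact: schwartz_cmf.
exact: (@cmf_comp _ _ _ _ _ c fst _ (cint_cmf ic)).
Qed.

Let mcg' : cmf (fun p : V * W => c p.2 * tfa p.2 g p.1).
Proof. exact: (cmf_comp (measurable_fun_pair (@measurable_snd _ _ _ _) (@measurable_fst _ _ _ _)) mcg). Qed.

(** With integrable coefficients [synth] is bounded by [I * G] and integrable by Fubini, so its
    square is dominated by [I * G] times an integrable function. *)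
Lemma synth_l2 : l2 synth.
Proof.
have mS : cmf synth := cmf_cI_param mW mcg'; split=> //.
have [G G0 hG] := schwartz_decay 0 sg.
have {}hG x : cabs (g x) <= G by rewrite (le_trans (hG x))// oppr0 powRr0 mulr1.
have iac := cint_cabs ic.
have iag := cint_cabs (schwartz_cint sg).
pose I := \int[mW]_w cabs (c w).
have mf : measurable_fun setT (fun p : W * V => cabs (c p.1 * tfa p.1 g p.2)) by exact: cmf_cabs.
have i2 : rint (@pint R (n + n) n) (fun p : W * V => cabs (c p.1 * tfa p.1 g p.2)).
  apply: (@rint_prod R _ _ _ _ mW mV _ (fun w t => cabs (c w) * cabs (g (t - lsubmx w)))
    (fun w => (\int[mV]_t cabs (g t)) * cabs (c w))) => //.
  - by move=> w t; rewrite ger0_norm ?cabs_ge0// cabsM cabs_tfa.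
  - by move=> w; apply: rintZ; exact: (rint_shift (- lsubmx w) iag).
  - move=> w; rewrite rIZ; last exact: (rint_shift (- lsubmx w) iag).
    rewrite (@rI_shift _ _ (- lsubmx w) (fun t => cabs (g t))) 1?mulrC//.
    exact: rint_mf iag.
  - exact: rintZ.
have [i3 _] := rI_prod2 i2.
apply: (rint_dom _ _ (rintZ (I * G) i3)) => [|t]; first exact: measurable_funX (cmf_cabs mS).
rewrite ger0_norm ?exprn_ge0 ?cabs_ge0//=.
have itg : cint mW (fun w => c w * tfa w g t).
  apply: (cint_dom (b := fun w => G * cabs (c w))); last exact: rintZ.
    exact: (cmf_comp (measurable_fun_pair (@measurable_id _ _ _) (measurable_cst t)) mcg).
  by move=> w; rewrite cabsM mulrC ler_wpM2r ?cabs_ge0// cabs_tfa.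
have h1 : cabs (synth t) <= I * G.
  rewrite mulrC -rIZ//; apply: cI_le_dom; last exact: rintZ.
    exact: cint_cmf itg.
  by move=> w; rewrite cabsM mulrC ler_wpM2r ?cabs_ge0// cabs_tfa.
have h2 := cI_le itg.
by rewrite expr2 ler_pM ?cabs_ge0.
Qed.

Lemma synth_inner (h : V -> C) : l2 h ->
  inner synth h = cI mW (fun w => c w * inner (tfa w g) h).
Proof.
move=> lh; have lg := schwartz_l2 sg.
have mch : cmf (fun p : W * V => c p.1 * tfa p.1 g p.2 * conjc (h p.2)).
  apply: cmf_mul => //; apply: cmf_conj.
  exact: (@cmf_comp _ _ _ _ _ h snd _ lh.1).
have icg : cint (@pint R (n + n) n) (fun p : W * V => c p.1 * tfa p.1 g p.2 * conjc (h p.2)).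
  apply: (@cint_prod R _ _ _ _ mW mV _
    (fun w t => cabs (c w) * (cabs (tfa w g t) ^+ 2 + cabs (h t) ^+ 2))
    (fun w => (nrm g ^+ 2 + nrm h ^+ 2) * cabs (c w))) => //.
  - move=> w t; rewrite !cabsM cabsJ -mulrA ler_wpM2l ?cabs_ge0//=.
    by have := sqr_ge0 (cabs (tfa w g t) - cabs (h t)); have := cabs_ge0 (tfa w g t);
      have := cabs_ge0 (h t); nra.
  - by move=> w; apply: rintZ; apply: rintD; [exact: (tf_l2 w lg).2|exact: lh.2].
  - move=> w; rewrite rIZ; last by apply: rintD; [exact: (tf_l2 w lg).2|exact: lh.2].
    rewrite rID; [|exact: (tf_l2 w lg).2|exact: lh.2].
    by rewrite -!nrm_sq (nrm_tf w lg) mulrC.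
  - by apply: rintZ; exact: cint_cabs.
rewrite innerE; transitivity (cI mV (fun t => cI mW (fun w => c w * tfa w g t * conjc (h t)))).
  apply: cI_ext => t; rewrite mulrC -cIZ; first by apply: cI_ext => w; rewrite mulrC.
  have [G G0 hG] := schwartz_decay 0 sg.
  apply: (cint_dom (b := fun w => G * cabs (c w))).
  - exact: (cmf_comp (measurable_fun_pair (@measurable_id _ _ _) (measurable_cst t)) mcg).
  - move=> w; rewrite cabsM mulrC ler_wpM2r ?cabs_ge0// cabs_tfa.
    by rewrite (le_trans (hG _))// oppr0 powRr0 mulr1.
  - by apply: rintZ; exact: cint_cabs.
rewrite -(@cI_swap _ _ _ _ _ mW mV (fun w t => c w * tfa w g t * conjc (h t)) icg).
apply: cI_ext => w; rewrite innerE -cIZ; first by apply: cI_ext => t; rewrite mulrA.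
by apply: cint_inner => //; exact: tf_l2.
Qed.

End Synthesis.
End Convolution.

Section Covariance.
Variables (R : realType) (n : nat).
Local Notation V := 'rV[R]_n.
Local Notation C := R[i].

(** Covariance: time-frequency shifts compose up to a unimodular factor, which the modulus
    removes. *)
Lemma cabs_inner_tfa (f g : V -> C) a b : l2 f -> l2 g ->
  cabs (inner (tfa a f) (tfa b g)) = cabs (inner f (tfa (b - a) g)).
Proof.
move=> lf lg.
have mm : cmf (fun x => tfa a f x * conjc (tfa b g x)).
  by apply: cmf_mul; [exact: (tf_l2 a lf).1|apply: cmf_conj; exact: (tf_l2 b lg).1].
rewrite !innerE -(cI_shift (lsubmx a) mm).
rewrite (_ : (fun x => _) = fun x => expi2pi (dot (lsubmx a) (rsubmx a - rsubmx b)) *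
    (f x * conjc (tfa (b - a) g x))).
  by rewrite cIZ ?cabsM ?cabs_expi2pi ?mul1r//; apply: cint_inner => //; exact: tf_l2.
have lB : lsubmx (b - a) = lsubmx b - lsubmx a by rewrite linearB.
have rB : rsubmx (b - a) = rsubmx b - rsubmx a by rewrite linearB.
apply/funext => x; rewrite /tfa /tf_shift addrK lB rB !conjcM !expi2piJ.
rewrite [x + _ - _](_ : _ = x - (lsubmx b - lsubmx a)); last by rewrite opprB addrA addrAC.
have -> : expi2pi (dot (x + lsubmx a) (rsubmx a)) = expi2pi (dot (lsubmx a) (rsubmx a - rsubmx b)) *
    (expi2pi (- dot x (rsubmx b - rsubmx a)) * expi2pi (dot (x + lsubmx a) (rsubmx b))) :> C.
  by rewrite -!expi2piD; congr expi2pi; rewrite !dotDl !dotDr !dotNr; ring.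
have := expi2piNl (dot (x + lsubmx a) (rsubmx b)).
move: (expi2pi _) (expi2pi _) (expi2pi _) (expi2pi _) (f x) (conjc _) => A1 A2 A3 A4 A5 A6 h.
transitivity (A1 * (A5 * (A2 * A6)) * (A4 * A3)); first by ring.
rewrite h mulr1; ring.
Qed.

End Covariance.

Lemma powR_interp (R : realType) (x a q t : R) : 0 <= x -> x <= a -> x <= q -> 0 <= t <= 1 ->
  x <= a `^ (1 - t) * q `^ t.
Proof.
move=> x0 xa xq /andP[t0 t1]; have [->|xn] := eqVneq x 0; first by rewrite mulr_ge0 ?powR_ge0.
have -> : x = x `^ (1 - t) * x `^ t by rewrite -powRD ?subrK ?powRr1 ?xn ?implybT.
by rewrite ler_pM ?powR_ge0// ge0_ler_powR ?nnegrE ?subr_ge0// (le_trans x0).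
Qed.

(** In logarithms the recursion is affine, with solution [(1 + mu)^k X - D 2^k - c]. Since
    [1 + mu < 2], the term [- D 2^k] prevails for every initial value and every [C]. *)
Lemma superexp_decay (R : realType) (C q mu e : R) (a : nat -> R) : 0 < C -> 0 < q < 1 -> 0 < mu < 1 -> 0 < e ->
  (forall k, 0 < a k) -> (forall k, a k.+1 = C * a k `^ (1 + mu) * q ^+ (2 ^ k)) ->
  exists k, a k <= e.
Proof.
move=> C0 /andP[q0 q1] /andP[mu0 mu1] e0 a0 ha.
(* [D] and [c] are the coefficients of the particular solution [- D 2^k - c]; [X] is then fixed by
   [a 0]. *)
pose D := - ln q / (1 - mu); pose c := ln C / mu.
have D0 : 0 < D by rewrite divr_gt0 ?subr_gt0// oppr_gt0 ln_lt0 ?q0.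
pose X := ln (a 0%N) + D + c.
have hl k : ln (a k) = (1 + mu) ^+ k * X - D * 2 ^+ k - c.
  elim: k => [|k IH]; first by rewrite !expr0 /X; ring.
  have ap : 0 < a k `^ (1 + mu) by exact: powR_gt0.
  have qp : 0 < q ^+ (2 ^ k) by exact: exprn_gt0.
  rewrite ha lnM ?posrE ?mulr_gt0// lnM ?posrE// ln_powR lnXn// IH -[ln q *+ _]mulr_natr natrX !exprS.
  have -> : ln q = - D * (1 - mu) by rewrite /D mulNr divfK ?opprK// gt_eqF// subr_gt0.
  have -> : ln C = c * mu by rewrite /c divfK// gt_eqF.
  by ring.
have h1 : ((1 + mu) / 2) ^+ k * X @[k --> \oo] --> (0 : R).
  rewrite -[X in _ --> X](mul0r X); apply: cvgM; last exact: cvg_cst.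
  by apply: cvg_expr; rewrite ger0_norm; lra.
have h2 : (2^-1 : R) ^+ k * (- c - ln e) @[k --> \oo] --> (0 : R).
  rewrite -[X in _ --> X](mul0r (- c - ln e)); apply: cvgM; last exact: cvg_cst.
  by apply: cvg_expr; rewrite ger0_norm; lra.
have h3 : ((1 + mu) / 2) ^+ k * X + (2^-1 : R) ^+ k * (- c - ln e) @[k --> \oo] --> (0 : R).
  by rewrite -[X in _ --> X](addr0 0); exact: cvgD.
have [k _ /(_ k (leqnn k))hk] : \forall k \near \oo,
    ((1 + mu) / 2) ^+ k * X + (2^-1 : R) ^+ k * (- c - ln e) < D.
  exact: (cvgr_lt _ h3).
exists k; rewrite -ler_ln ?posrE// hl -subr_ge0.
have p : 0 < (2 : R) ^+ k by exact: exprn_gt0.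
have := hk; rewrite -(ltr_pM2r p) expr_div_n exprVn mulrDl mulrAC divfK ?gt_eqF// mulrAC mulVf ?gt_eqF//.
by rewrite mul1r; lra.
Qed.

(** * Decay of the matrix coefficients of the inverse *)

Section Wiener.
Variables (R : realType) (d : nat).
Local Notation V := 'rV[R]_d.
Local Notation W := 'rV[R]_(d + d).
Local Notation C := R[i].
Local Notation mV := (leb R d).
Local Notation mW := (leb R (d + d)).
Variables (g : V -> C) (T S : (V -> C) -> V -> C) (K K' : R).
Hypotheses (sg : schwartz g) (g0 : exists x, g x <> 0).
Hypotheses (bT : bounded_op T K) (bS : bounded_op S K').
Hypothesis ST : forall f, l2 f -> ae_equal (S (T f)) f.
Hypothesis TS : forall f, l2 f -> ae_equal (T (S f)) f.
Variables (F : W -> W -> W) (c L s B : R).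
Hypotheses (c0 : 0 < c) (L0 : 0 < L) (hs : (d + d)%:R < s) (B0 : 0 <= B).
Hypothesis mF1 : forall z, measurable_fun setT (F ^~ z).
Hypothesis mF2 : forall u, measurable_fun setT (F u).
Hypothesis Fz : forall u z w, `|z - w| <= c * `|F u z - F u w|.
Hypothesis Fu : forall z u v, `|u - v| <= c * `|F u z - F v z|.
Hypothesis FL : forall u z w, `|F u z - F u w| <= L * `|z - w|.
Hypothesis HT : forall u z, cabs (inner (T (tfa z g)) (tfa u g)) <= B * jw (F u z) `^ (- s).

Let conjcB (z w : C) : conjc (z - w) = conjc z - conjc w.
Proof. by rewrite conjcD conjcN. Qed.
Let s0 : 0 <= s. Proof. by rewrite (le_trans _ (ltW hs)). Qed.
Let lg : l2 g. Proof. exact: schwartz_l2. Qed.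
Let lga a : l2 (tfa a g). Proof. exact: tf_l2. Qed.
Let lT f : l2 f -> l2 (T f). Proof. exact: bop_l2 bT _. Qed.
Let kg0 : 0 < kap g. Proof. exact: kap_gt0. Qed.
Let mshift (z : W) : measurable_fun setT (fun a : W => a - z).
Proof. exact: measurable_rV_shift. Qed.
Let eshift (z v w : W) : `|v - w| <= 1 * `|(v - z) - (w - z)|.
Proof. by rewrite mul1r opprB addrA subrK. Qed.

Let jw_split (E1 E2 : W) (k : R) (z w : W) : 1 <= k -> `|z - w| <= k * (`|E1| + `|E2|) ->
  jw (z - w) <= k * (jw E1 + jw E2).
Proof.
by move=> k1 h; rewrite /jw; have := normr_ge0 E1; have := normr_ge0 E2; nra.
Qed.

Let kT : R := (kap g)^-1 * convc d s c (1 + c) * (B * B).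

(** Both vectors are analysed at the same point [a]. As [F a] is expansive, [F a z] and [F a w] are
    not both small when [z] and [w] are far apart, and the convolution bound converts this into
    decay in [w - z]. *)
Let kTT z w : cabs (inner (T (tfa z g)) (T (tfa w g))) <= kT * jw (w - z) `^ (- s).
Proof.
rewrite /kT.
apply: (@stft_conv R d (fun f => f) 1 g (T (tfa z g)) (T (tfa w g)) s c (1 + c) (jw (w - z)) B B
  (fun a => F a z) (fun a => F a w)) => //.
- exact: bounded_op_id.
- exact: lT.
- exact: lT.
- by rewrite addr_gt0.
- exact: jw_gt0.
- move=> a; apply: jw_split; first by rewrite lerDl ltW.
  have h1 : 0 <= `|F a z| + `|F a w| by rewrite addr_ge0.
  have h : `|w - z| <= c * (`|F a z| + `|F a w|).
    by rewrite (le_trans (Fz a _ _))// ler_wpM2l ?(ltW c0)// (addrC `|F a z|) ler_normB.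
  by rewrite (le_trans h)// ler_wpM2r// lerDr.
- by move=> a; rewrite inner_conj ?cabsJ ?HT//; exact: lT.
Qed.

(** Localization at the phase-space point [z]. The constant [N] plays the role of a weighted norm,
    and the estimates on iterates of [A] are bounds on it. *)
Let loc (z : W) (N : R) (f : V -> C) := l2 f /\
  forall w, cabs (inner f (tfa w g)) <= N * jw (w - z) `^ (- s).

Let kC : R := (kap g)^-1 * convc d s 1 1.

Let kC0 : 0 <= kC.
Proof. by apply: mulr_ge0; [rewrite invr_ge0 ltW|exact: convc_ge0]. Qed.

Let kT0 : 0 <= kT.
Proof.
by apply: mulr_ge0; [apply: mulr_ge0; [rewrite invr_ge0 ltW|exact: convc_ge0]|exact: mulr_ge0].
Qed.

Let jw_tri (a z w : W) : jw (w - z) <= 1 * (jw (a - z) + jw (a - w)).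
Proof.
apply: jw_split => //; rewrite mul1r (distrC a w) (addrC `|a - z|).
by have -> : w - z = (w - a) + (a - z); [rewrite addrA subrK|exact: ler_normD].
Qed.

Let loc_conv (D : (V -> C) -> V -> C) (KD : R) z w N1 N2 f h :
  bounded_op D KD -> 0 <= N1 -> 0 <= N2 -> loc z N1 f -> l2 h ->
  (forall a, cabs (inner (D (tfa a g)) h) <= N2 * jw (a - w) `^ (- s)) ->
  cabs (inner (D f) h) <= kC * (N1 * N2) * jw (w - z) `^ (- s).
Proof.
move=> bD N10 N20 [lf hf] lh hh.
rewrite /kC.
apply: (@stft_conv R d D KD g f h s 1 1 (jw (w - z)) N1 N2 (fun a => a - z) (fun a => a - w)) => //.
exact: jw_gt0.
Qed.

Let loc_T z N f w : 0 <= N -> loc z N f ->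
  cabs (inner (T f) (T (tfa w g))) <= kC * (N * kT) * jw (w - z) `^ (- s).
Proof.
move=> N0 lf; apply: (loc_conv bT) => //; first exact: lT.
by move=> a; rewrite jw_distC kTT.
Qed.

Let loc_int z N f : 0 <= N -> loc z N f -> cint mW (fun w => inner (T f) (T (tfa w g))).
Proof.
move=> N0 lf; have h w := loc_T w N0 lf.
apply: (cint_dom (b := fun w : W => kC * (N * kT) * jw (w - z) `^ (- s))) => //.
  rewrite (_ : (fun w => _) = fun w : W => conjc (inner (T (tfa w g)) (T f))).
    exact: (cmf_conj (cmf_tempered (u := fun h => inner (T h) (T f)) (tempered_inner bT (lT lf.1)) sg)).
  by apply/funext => w; exact: (inner_conj (lT (lga w)) (lT lf.1)).
apply: rintZ; exact: (@rint_shift R _ (- z) (fun w => jw w `^ (- s)) (rint_decay hs)).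
Qed.

(* On localized functions [TT] is [T^* T]. *)
Let TT (f : V -> C) : V -> C := fun t =>
  (((kap g)^-1)%:C)%C * synth (fun w => inner (T f) (T (tfa w g))) g t.

Let TT_l2 z N f : 0 <= N -> loc z N f -> l2 (TT f).
Proof. by move=> N0 lf; apply: l2Z; apply: synth_l2 => //; exact: loc_int lf. Qed.

(** Expanding [h] in [inner (T h) (T f)] by [stft_synthesis] and conjugating gives exactly the
    integral that defines [TT f]. *)
Let TT_inner z N f h : 0 <= N -> loc z N f -> l2 h -> inner (TT f) h = inner (T f) (T h).
Proof.
move=> N0 lf lh; have ic := loc_int N0 lf; have lTf := lT lf.1.
have ib : rint mW (fun w => kC * (N * kT) * jw (w - z) `^ (- s)).
  apply: rintZ; exact: (@rint_shift R _ (- z) (fun w => jw w `^ (- s)) (rint_decay hs)).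
have hb a : cabs (inner (T (tfa a g)) (T f)) <= kC * (N * kT) * jw (a - z) `^ (- s).
  by rewrite inner_conj ?cabsJ ?loc_T//; exact: lT.
have e := stft_synthesis bT sg lh lTf ib hb.
have kn : ((kap g)%:C)%C != 0 :> C by exact: kap_neq0.
have e2 : ((kap g)%:C)%C * inner (T f) (T h) =
    cI mW (fun w => inner (T f) (T (tfa w g)) * inner (tfa w g) h).
  have := congr1 conjc e; rewrite conjcM conjc_real -(inner_conj (lT lh) lTf) => ->.
  rewrite -cI_conj; last first.
    apply: (cint_dom (b := fun a : W => nrm h * nrm g * (kC * (N * kT) * jw (a - z) `^ (- s)))); last exact: rintZ.
      apply: cmf_mul; first by apply: cmf_stft; [exact: lh.1|exact: schwartz_cmf].
      exact: (cmf_tempered (u := fun f' => inner (T f') (T f)) (tempered_inner bT lTf) sg).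
    move=> a; rewrite cabsM ler_pM ?cabs_ge0//.
    by rewrite -(nrm_tf a lg); exact: inner_le.
  apply: cI_ext => a; rewrite conjcM mulrC.
  by rewrite -(inner_conj lh (lga a)) -(inner_conj (lT (lga a)) lTf).
have e3 : inner (TT f) h = (((kap g)^-1)%:C)%C * (((kap g)%:C)%C * inner (T f) (T h)).
  by rewrite e2 -(synth_inner ic sg lh); exact: (innerZl _ (synth_l2 ic sg) lh).
rewrite e3 [LHS]mulrA -rmorphM/= mulVf; last by rewrite gt_eqF.
exact: mul1r.
Qed.

(** Since [c1 K^2 <= 1], the quadratic term [c1^2 |TT f|^2] in the norm of [A f] is absorbed by half
    of the linear term [2 c1 |T f|^2]. *)
Let c1 : R := (K ^+ 2 + 1)^-1.
Let A (f : V -> C) : V -> C := fun t => f t - (c1%:C)%C * TT f t.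

Let c10 : 0 < c1. Proof. by rewrite invr_gt0 ltr_wpDl// sqr_ge0. Qed.

Let A_inner z N f h : 0 <= N -> loc z N f -> l2 h ->
  inner (A f) h = inner f h - (c1%:C)%C * inner (T f) (T h).
Proof.
move=> N0 lf lh; have lt := TT_l2 N0 lf.
by rewrite (innerBl lf.1 (l2Z _ lt) lh) innerZl// (TT_inner N0 lf lh).
Qed.

Let A_l2 z N f : 0 <= N -> loc z N f -> l2 (A f).
Proof. by move=> N0 lf; exact: (l2B lf.1 (l2Z _ (TT_l2 N0 lf))). Qed.

Let kA : R := 1 + c1 * (kC * kT).

Let kA_ge0 : 0 <= kA.
Proof. by rewrite addr_ge0// mulr_ge0 ?(ltW c10)// mulr_ge0. Qed.

Let A_loc z N f : 0 <= N -> loc z N f -> loc z (kA * N) (A f).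
Proof.
move=> N0 lf; split=> [|w]; first exact: A_l2 lf.
rewrite (A_inner N0 lf (lga w)) (le_trans (cabsB _ _))//.
have h1 := lf.2 w; have h2 := ler_wpM2l (ltW c10) (loc_T w N0 lf).
rewrite cabsM cabs_real gtr0_norm// (le_trans (lerD h1 h2))// /kA.
by rewrite le_eqVlt; apply/orP; left; apply/eqP; ring.
Qed.

Let A_herm z w N M f h : 0 <= N -> 0 <= M -> loc z N f -> loc w M h ->
  inner (A f) h = inner f (A h).
Proof.
move=> N0 M0 lf lh; rewrite (A_inner N0 lf lh.1) (inner_conj (A_l2 M0 lh) lf.1).
rewrite (A_inner M0 lh lf.1) conjcB conjcM conjc_real.
by rewrite -(inner_conj lh.1 lf.1) -(inner_conj (lT lh.1) (lT lf.1)).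
Qed.

(** The gain comes from the lower bound [|f| <= K' |T f|] given by the inverse; the summand 2 keeps
    the fraction strictly between 0 and 1 for every [K']. *)
Let rho2 : R := 1 - c1 / (K' ^+ 2 + 2).

Let TT_nrm z N f : 0 <= N -> loc z N f -> nrm (TT f) <= K * nrm (T f).
Proof.
move=> N0 lf; have lt := TT_l2 N0 lf.
have := inner_le (lT lf.1) (lT lt); rewrite -(TT_inner N0 lf lt) inner_self cabs_real.
rewrite ger0_norm ?sqr_ge0// => /le_trans h.
have {}h : nrm (TT f) ^+ 2 <= nrm (T f) * (K * nrm (TT f)).
  by apply: h; rewrite ler_wpM2l ?nrm_ge0//; exact: bop_nrm bT _ lt.
have [z0|nz] := eqVneq (nrm (TT f)) 0; first by rewrite z0 mulr_ge0 ?nrm_ge0//; exact: bop_ge0 bT.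
have p : 0 < nrm (TT f) by rewrite lt_neqAle eq_sym nz nrm_ge0.
rewrite -(ler_pM2r p) -expr2 (le_trans h)//.
by rewrite le_eqVlt; apply/orP; left; apply/eqP; ring.
Qed.

(** Expanding the square gives [|f|^2 - 2 c1 |T f|^2 + c1^2 |TT f|^2], at most [|f|^2 - c1 |T f|^2]
    by the choice of [c1]; the lower bound on [T] concludes. *)
Let A_nrm z N f : 0 <= N -> loc z N f -> nrm (A f) ^+ 2 <= rho2 * nrm f ^+ 2.
Proof.
move=> N0 lf; have lt := TT_l2 N0 lf; have lA := A_l2 N0 lf.
have e : nrm (A f) ^+ 2 = nrm f ^+ 2 - 2 * c1 * nrm (T f) ^+ 2 + c1 ^+ 2 * nrm (TT f) ^+ 2.
  apply: (@complexI R); rewrite -inner_self (A_inner N0 lf lA) (inner_conj lA lf.1).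
  rewrite (A_inner N0 lf lf.1) conjcB conjcM conjc_real.
  have -> : inner (T f) (T (A f)) = inner (TT f) (A f) by rewrite (TT_inner N0 lf lA).
  rewrite (inner_conj lA lt) (A_inner N0 lf lt) -(TT_inner N0 lf lt) conjcB conjcM conjc_real.
  rewrite -(inner_conj lf.1 lt) (TT_inner N0 lf lf.1) !inner_self !conjc_real.
  by apply: complex_ext; rewrite !ReImE/=; ring.
have h1 := TT_nrm N0 lf.
have h2 : nrm (TT f) ^+ 2 <= K ^+ 2 * nrm (T f) ^+ 2.
  by rewrite -exprMn ler_pXn2r ?nnegrE ?mulr_ge0 ?nrm_ge0//; exact: bop_ge0 bT.
have h3 : nrm f <= K' * nrm (T f).
  have := bop_nrm bS (lT lf.1); rewrite (_ : nrm (S (T f)) = nrm f)//.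
  have sf := bop_l2 bS (lT lf.1).
  apply/eqP; rewrite -(@eqrXn2 _ 2)// ?nrm_ge0//; apply/eqP/(@complexI R).
  rewrite -!inner_self (inner_ae sf.1 lf.1.1 sf.1 (ST lf.1)) (inner_conj sf lf.1).
  by rewrite (inner_ae sf.1 lf.1.1 lf.1.1 (ST lf.1)) inner_self conjc_real.
have h4 : nrm f ^+ 2 <= K' ^+ 2 * nrm (T f) ^+ 2.
  by rewrite -exprMn ler_pXn2r ?nnegrE ?mulr_ge0 ?nrm_ge0//; exact: bop_ge0 bS.
have q0 : 0 < K' ^+ 2 + 2 by rewrite ltr_wpDl// sqr_ge0.
have h5 : nrm f ^+ 2 / (K' ^+ 2 + 2) <= nrm (T f) ^+ 2.
  rewrite ler_pdivrMr// (le_trans h4)// mulrC ler_wpM2l ?sqr_ge0// lerDl//.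
have h6 : c1 ^+ 2 * K ^+ 2 <= c1.
  rewrite expr2 -mulrA ler_piMr ?(ltW c10)// mulrC /c1 ler_pdivrMr ?ltr_wpDl ?sqr_ge0//.
  by rewrite mul1r lerDl.
have h7 : c1 ^+ 2 * nrm (TT f) ^+ 2 <= c1 * nrm (T f) ^+ 2.
  apply: (le_trans (ler_wpM2l (sqr_ge0 c1) h2)); rewrite mulrA ler_wpM2r ?sqr_ge0//.
have h8 := ler_wpM2l (ltW c10) h5.
rewrite e /rho2 mulrBl mul1r.
have -> : c1 / (K' ^+ 2 + 2) * nrm f ^+ 2 = c1 * (nrm f ^+ 2 / (K' ^+ 2 + 2)) by ring.
by lra.
Qed.

Let rho : R := Num.sqrt rho2.

Let c1_frac : 0 < c1 / (K' ^+ 2 + 2) < 1.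
Proof.
have q0 : 0 < K' ^+ 2 + 2 by rewrite ltr_wpDl// sqr_ge0.
rewrite divr_gt0//= ltr_pdivrMr// mul1r.
have h1 : c1 <= 1 by rewrite invf_le1 ?lerDr ?sqr_ge0// ltr_wpDl// sqr_ge0.
by rewrite (le_lt_trans h1)// ltr_wpDl ?sqr_ge0// ltr1n.
Qed.

Let rho01 : 0 < rho < 1.
Proof.
have /andP[h1 h2] := c1_frac.
by rewrite sqrtr_gt0 subr_gt0 h2/= -sqrtr1 ltr_sqrt// ltrBlDr ltrDl.
Qed.

Let rhoE : rho ^+ 2 = rho2.
Proof. by rewrite sqr_sqrtr// subr_ge0; have /andP[_ /ltW] := c1_frac. Qed.

(** The columns of [A^n] in phase space; [Bd n N] asks for one localization constant for all of
    them. *)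
Let e n z := iter n A (tfa z g).
Let Bd n N := forall z, loc z N (e n z).

Let Bd0 : exists2 N, 0 <= N & Bd 0 N.
Proof.
have [M M0 hM] := stft_decay s0 sg sg; exists M => // z; split=> [|w]; first exact: lga.
by have := hM (w - z); rewrite -(cabs_inner_tfa z w lg lg).
Qed.

Let loc_le z N M f : N <= M -> loc z N f -> loc z M f.
Proof.
move=> NM [lf hf]; split=> // w; apply: (le_trans (hf w)).
by rewrite ler_wpM2r// powR_ge0.
Qed.

Section Iteration.
Variable N0 : R.
Hypotheses (N00 : 0 <= N0) (hN0 : Bd 0 N0).

(** The crude constants, possibly growing geometrically; they are used only within one block of the
    Neumann series. *)
Let Nr r := kA ^+ r * N0.

Let Nr_ge0 r : 0 <= Nr r. Proof. by rewrite mulr_ge0// exprn_ge0. Qed.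

Let Bd_Nr r : Bd r (Nr r).
Proof.
elim: r => [|r IH] z; first by rewrite /Nr expr0 mul1r; exact: hN0.
by rewrite /Nr exprS -mulrA; exact: (A_loc (Nr_ge0 r) (IH z)).
Qed.

Let le2 n z : l2 (e n z). Proof. exact: (Bd_Nr n z).1. Qed.

(** Moving copies of [A] to the right one at a time splits a coefficient of [A^(m+n)] into a pairing
    of two localized vectors, to which the convolution bound applies. *)
Let e_herm m n z w : inner (e (m + n) z) (tfa w g) = inner (e n z) (e m w).
Proof.
elim: m n => [//|m IH] n; rewrite addSnnS IH.
exact: (A_herm (Nr_ge0 n) (Nr_ge0 m) (Bd_Nr n z) (Bd_Nr m w)).
Qed.

Let e_nrm n z : nrm (e n z) <= rho ^+ n * nrm g.
Proof.
have /andP[r0 r1] := rho01.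
elim: n => [|n IH]; first by rewrite expr0 mul1r nrm_tf.
have := A_nrm (Nr_ge0 n) (Bd_Nr n z); rewrite -rhoE -exprMn.
rewrite ler_pXn2r ?nnegrE ?nrm_ge0 ?mulr_ge0 ?nrm_ge0 ?(ltW r0)// => /le_trans; apply.
by rewrite exprS -mulrA ler_wpM2l// ltW.
Qed.

Let Bd_mul m n N1 N2 : 0 <= N1 -> 0 <= N2 -> Bd m N1 -> Bd n N2 -> Bd (m + n) (kC * (N2 * N1)).
Proof.
move=> N10 N20 h1 h2 z; split=> [|w]; first exact: le2.
rewrite e_herm; apply: (@loc_conv id 1 z w N2 N1 (e n z) (e m w) (bounded_op_id _ _)) => //.
by move=> a; rewrite (inner_conj (le2 m w) (lga a)) cabsJ; exact: (h1 w).2.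
Qed.

(** The midpoint of [2d] and [s]: large enough for an integrable weight, and strictly below [s], so
    that interpolation retains a positive power [th] of the exponential bound. *)
Let s' := (s + (d + d)%:R) / 2.
Let th := 1 - s' / s.

Let sp : 0 < s. Proof. by rewrite (le_lt_trans _ hs). Qed.
Let hs' : (d + d)%:R < s'. Proof. by rewrite /s'; move: hs; lra. Qed.
Let s'_lt : s' < s. Proof. by rewrite /s'; move: hs; lra. Qed.
Let s'_gt0 : 0 < s'. Proof. by rewrite (le_lt_trans _ hs'). Qed.

Let th01 : 0 < th < 1.
Proof. by rewrite subr_gt0 ltr_pdivrMr// mul1r s'_lt/= ltrBlDr ltrDl divr_gt0. Qed.

Let e_le n z w : cabs (inner (e n z) (tfa w g)) <= rho ^+ n * nrm g ^+ 2.
Proof.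
rewrite (le_trans (inner_le (le2 n z) (lga w)))// nrm_tf// expr2 mulrA.
by rewrite ler_wpM2r ?nrm_ge0.
Qed.

Let e_interp n N z w : 0 <= N -> Bd n N ->
  cabs (inner (e n z) (tfa w g)) <= N `^ (1 - th) * (rho ^+ n * nrm g ^+ 2) `^ th * jw (w - z) `^ (- s').
Proof.
move=> N0' hN; have /andP[t0 t1] := th01.
have tt : 0 <= th <= 1 by rewrite !ltW.
have := @powR_interp R _ _ _ th (cabs_ge0 _) ((hN z).2 w) (e_le n z w) tt.
rewrite powRM ?powR_ge0// -powRrM (_ : - s * (1 - th) = - s'); first by rewrite mulrAC.
by rewrite /th opprB addrCA subrr addr0 mulNr mulrC divfK// gt_eqF.
Qed.

Let kB := (kap g)^-1 * (2 `^ s * (2 * jint (d + d) s')).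

(* In [<e n z, e n w> = kap^-1 int <e n z, pi(a) g> <pi(a) g, e n w> da] one factor carries
   the decay in [w - z], the other is interpolated with its exponentially small bound. *)
Let Bd_double n N : 0 <= N -> Bd n N ->
  Bd (n + n) (kB * (N * (N `^ (1 - th) * (rho ^+ n * nrm g ^+ 2) `^ th))).
Proof.
move=> N0' hN z; split=> [|w]; first exact: le2.
set Q := N `^ (1 - th) * _; set X := fun v a => cabs (inner (e n v) (tfa a g)).
have Q0 : 0 <= Q by rewrite mulr_ge0 ?powR_ge0.
have ish v : rint mW (fun a => jw (a - v) `^ (- s')).
  exact: (@rint_shift R _ (- v) (fun w => jw w `^ (- s')) (rint_decay hs')).
have Ish v : \int[mW]_a (jw (a - v) `^ (- s')) = jint (d + d) s'.
  by rewrite (@rI_shift R _ (- v) (fun z => jw z `^ (- s')))//; exact: measurable_jw_powR.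
pose D := 2 `^ s * jw (w - z) `^ (- s).
have D0 : 0 <= D by rewrite mulr_ge0 ?powR_ge0.
have hX v a : X v a <= N * jw (a - v) `^ (- s) by exact: (hN v).2.
have hX' v a : X v a <= Q * jw (a - v) `^ (- s') by exact: e_interp.
have hD (a v : W) : jw (w - z) <= 2 * jw (a - v) -> jw (a - v) `^ (- s) <= D.
  by move=> h; exact: jw_powR_mono.
have le a : X z a * X w a <= N * Q * D * (jw (a - z) `^ (- s') + jw (a - w) `^ (- s')).
  have h := jw_tri a z w; rewrite mulrDr.
  have nn v : 0 <= N * Q * D * jw (a - v) `^ (- s') by rewrite mulr_ge0 ?powR_ge0// mulr_ge0// mulr_ge0.
  have [ab|ba] := leP (jw (a - z)) (jw (a - w)).
    apply: (ler_wpDr (nn w)).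
    rewrite [leRHS](_ : _ = (Q * jw (a - z) `^ (- s')) * (N * D)); last by ring.
    apply: (ler_pM (cabs_ge0 _) (cabs_ge0 _) (hX' z a)).
    apply: (le_trans (hX w a)); apply: (ler_wpM2l N0'); apply: hD.
    by apply: (le_trans h); lra.
  apply: (ler_wpDl (nn z)).
  rewrite [leRHS](_ : _ = N * D * (Q * jw (a - w) `^ (- s'))); last by ring.
  apply: (ler_pM (cabs_ge0 _) (cabs_ge0 _) _ (hX' w a)).
  apply: (le_trans (hX z a)); apply: (ler_wpM2l N0'); apply: hD.
  by apply: (le_trans h); lra.
have ib : rint mW (fun a => N * Q * D * (jw (a - z) `^ (- s') + jw (a - w) `^ (- s'))).
  by apply: rintZ; exact: rintD.
have i1 : rint mW (fun a => N * jw (a - w) `^ (- s)).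
  by apply: rintZ; exact: (@rint_shift R _ (- w) (fun w => jw w `^ (- s)) (rint_decay hs)).
have hb a : cabs (inner (id (tfa a g)) (e n w)) <= N * jw (a - w) `^ (- s).
  by rewrite (inner_conj (le2 n w) (lga a)) cabsJ; exact: hX.
have E := stft_synthesis (bounded_op_id _ _) sg (le2 n z) (le2 n w) i1 hb.
have : cabs (((kap g)%:C)%C * inner (id (e n z)) (e n w)) <= N * Q * D * (2 * jint (d + d) s').
  have -> : N * Q * D * (2 * jint (d + d) s') =
      \int[mW]_a (N * Q * D * (jw (a - z) `^ (- s') + jw (a - w) `^ (- s'))).
    rewrite (rIZ _ (rintD (ish z) (ish w))) (rID (ish z) (ish w)) !Ish.
    by congr (_ * _); rewrite mulr_natl mulr2n.
  rewrite E; apply: cI_le_dom => //.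
    apply: cmf_mul; first by apply: cmf_stft; [exact: (le2 n z).1|exact: schwartz_cmf].
    exact: (cmf_tempered (u := fun f' => inner f' (e n w)) (tempered_inner (bounded_op_id _ _) (le2 n w)) sg).
  move=> a; rewrite cabsM [X in _ * X](_ : _ = X w a) ?le//.
  by rewrite /X (inner_conj (le2 n w) (lga a)) cabsJ.
rewrite cabsM cabs_real gtr0_norm// mulrC -ler_pdivlMr// e_herm => /le_trans; apply.
by rewrite le_eqVlt; apply/orP; left; apply/eqP; rewrite /kB /D; ring.
Qed.

(** Iterating [Bd_double] along [n = 2^k] gives the recursion of [superexp_decay], with exponent
    [1 + (1 - th)]. Its smallness makes composition with [A^m] halve localization constants through
    [Bd_mul]. *)
Let Bd_small : exists m : nat, (0 < m)%N /\ exists2 N, 0 <= N & Bd m N /\ kC * N <= 2^-1.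
Proof.
have /andP[t0 t1] := th01; have /andP[r0 r1] := rho01.
have kB0 : 0 <= kB.
  by apply: mulr_ge0; [rewrite invr_ge0 ltW|apply: mulr_ge0; [exact: powR_ge0|apply: mulr_ge0 => //; exact: jint_ge0]].
pose CC := kB * (nrm g ^+ 2) `^ th + 1; pose q := rho `^ th.
have CC0 : 0 < CC by apply: ltr_wpDl => //; apply: mulr_ge0 => //; exact: powR_ge0.
(* The summands 1 in [CC] and in the initial value make the sequence positive, as the logarithms in
   [superexp_decay] require. *)
pose a k := iteri k (fun j x => CC * x `^ (1 + (1 - th)) * q ^+ (2 ^ j)) (Nr 1 + 1).
have q0 : 0 < q by exact: powR_gt0.
have one : (1 : R) `^ th = 1 by rewrite powR1.
have q1 : q < 1 by rewrite -one /q gt0_ltr_powR ?nnegrE ?(ltW r0).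
have a0 k : 0 < a k.
  elim: k => [|k IH]; first by apply: ltr_wpDl.
  by apply: mulr_gt0; [apply: mulr_gt0 => //; exact: powR_gt0|exact: exprn_gt0].
have hB k : Bd (2 ^ k) (a k).
  elim: k => [|k IH] z; first by apply: (loc_le _ (Bd_Nr 1 z)); rewrite lerDl.
  rewrite expnS mul2n -addnn; apply: (loc_le _ (Bd_double (ltW (a0 k)) IH z)).
  have -> : (rho ^+ (2 ^ k) * nrm g ^+ 2) `^ th = q ^+ (2 ^ k) * (nrm g ^+ 2) `^ th.
    rewrite powRM ?exprn_ge0 ?nrm_ge0 ?(ltW r0)//; congr (_ * _).
    by rewrite -powR_mulrn ?(ltW r0)// -powRrM mulrC powRrM powR_mulrn ?powR_ge0.
  have -> : a k.+1 = CC * (a k * a k `^ (1 - th)) * q ^+ (2 ^ k).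
    rewrite /a/= -/(a k); congr (_ * _ * _).
    rewrite powRD; first by rewrite powRr1// ltW.
    by rewrite (gt_eqF (a0 k)) implybT.
  have h : 0 <= a k * a k `^ (1 - th) * q ^+ (2 ^ k).
    by apply: mulr_ge0; [apply: mulr_ge0; [exact: ltW|exact: powR_ge0]|exact: exprn_ge0 (ltW q0)].
  rewrite [leRHS](_ : _ = kB * (a k * (a k `^ (1 - th) * (q ^+ (2 ^ k) * (nrm g ^+ 2) `^ th))) +
    a k * a k `^ (1 - th) * q ^+ (2 ^ k)); first by rewrite lerDl.
  by rewrite /CC; ring.
pose eps := (2 * (kC + 1))^-1.
have k10 : 0 < kC + 1 by rewrite ltr_wpDl.
have q01 : 0 < q < 1 by rewrite q0 q1.
have m01 : 0 < 1 - th < 1 by rewrite subr_gt0 t1 ltrBlDr ltrDl.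
have e0 : 0 < eps by rewrite invr_gt0 mulr_gt0.
have [k hk] := superexp_decay CC0 q01 m01 e0 a0 (fun=> erefl).
exists (2 ^ k)%N; split; first by rewrite expn_gt0.
exists (a k); first exact: ltW.
split=> //; apply: (le_trans (ler_wpM2l kC0 hk)); rewrite /eps invfM mulrCA ler_piMr ?invr_ge0//.
by rewrite ler_pdivrMr// mul1r lerDl.
Qed.

Let kL := (kap g)^-1 * convc d s (1 + c) (1 + L) * B.

Let kL0 : 0 <= kL.
Proof. by apply: mulr_ge0 => //; apply: mulr_ge0; [rewrite invr_ge0 ltW|exact: convc_ge0]. Qed.

Let jw_lip (x y t : R) : x <= y + L * t -> 0 <= y -> 0 <= t ->
  1 + x <= (1 + L) * ((1 + t) + (1 + y)).
Proof.
move=> h1 h2 h3; rewrite -subr_ge0.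
have -> : (1 + L) * ((1 + t) + (1 + y)) - (1 + x) = (y + L * t - x) + (1 + t + (L + L) + L * y) by ring.
have h4 : 0 <= L * y := mulr_ge0 (ltW L0) h2.
by move: L0 h1 h2 h3 h4; move: (L * t) (L * y) => p q *; lra.
Qed.

(** [T] sends a vector localized at [z] to one whose coefficient at [u] decays in [F u z]; by the
    Lipschitz bound, [F u z] is controlled by [F u a] and [a - z] together. *)
Let cross u z k N : 0 <= N -> Bd k N ->
  cabs (inner (tfa u g) (T (e k z))) <= kL * N * jw (F u z) `^ (- s).
Proof.
move=> N0' hN; rewrite (inner_conj (lT (le2 k z)) (lga u)) cabsJ.
rewrite (_ : kL * N = (kap g)^-1 * convc d s (1 + c) (1 + L) * (N * B)); last by rewrite /kL; ring.
apply: (@stft_conv R d T K g (e k z) (tfa u g) s (1 + c) (1 + L) (jw (F u z)) N B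
  (fun a => a - z) (F u)) => //.
- by rewrite addr_gt0.
- by rewrite addr_gt0.
- exact: jw_gt0.
- by move=> v w; rewrite opprB addrA subrK ler_peMl// lerDl ltW.
- by move=> v w; rewrite (le_trans (Fz u v w))// ler_wpM2r// lerDr.
- move=> a; have h1 : `|F u z| <= `|F u a| + L * `|a - z|.
    have := ler_normD (F u z - F u a) (F u a); rewrite subrK => /le_trans; apply.
    by rewrite addrC lerD2l (distrC a) FL.
  have h2 := normr_ge0 (F u a); have h3 := normr_ge0 (a - z); rewrite /jw.
  exact: jw_lip.
- by move=> a; exact: (hN z).2.
Qed.

(** [e n] differs from [e n.+1] by [c1] times [TT (e n)], and in the pairing with [S (tfa u g)] the
    composite [T S] is the identity, so [S] leaves this term. *)
Let step u z n : inner (S (tfa u g)) (e n z) =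
  inner (S (tfa u g)) (e n.+1 z) + (c1%:C)%C * inner (tfa u g) (T (e n z)).
Proof.
have lf := bop_l2 bS (lga u); have lA : l2 (A (e n z)) := le2 n.+1 z.
have -> : inner (S (tfa u g)) (e n.+1 z) = conjc (inner (A (e n z)) (S (tfa u g))).
  exact: inner_conj.
rewrite (A_inner (Nr_ge0 n) (Bd_Nr n z) lf) conjcB conjcM conjc_real.
rewrite -(inner_conj (le2 n z) lf) -(inner_conj (lT (le2 n z)) (lT lf)).
rewrite (inner_ae (lT lf).1 (lga u).1 (lT (le2 n z)).1 (TS (lga u))).
by rewrite subrK.
Qed.

Let steps u z n (M : nat -> R) r : (forall i, 0 <= M i) -> (forall i, (i < r)%N -> Bd (n + i) (M i)) ->
  cabs (inner (S (tfa u g)) (e n z)) <= cabs (inner (S (tfa u g)) (e (n + r) z)) +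
    c1 * kL * jw (F u z) `^ (- s) * \sum_(i < r) M i.
Proof.
move=> M0; elim: r => [_|r IH hM]; first by rewrite addn0 big_ord0 mulr0 addr0.
apply: (le_trans (IH (fun i ir => hM i (ltnW ir)))).
have -> : \sum_(i < r.+1) M i = \sum_(i < r) M i + M r by rewrite big_ord_recr.
rewrite mulrDr addrA [leRHS]addrAC lerD2r (step u z (n + r)) addnS.
apply: (le_trans (cabsD _ _)); rewrite lerD2l cabsM cabs_real gtr0_norm//.
have := ler_wpM2l (ltW c10) (cross u z (M0 r) (hM r (ltnSn r))).
by move=> /le_trans; apply; rewrite le_eqVlt; apply/orP; left; apply/eqP; ring.
Qed.

(** Telescoping [step] sums the Neumann series for a coefficient of [S]. Grouped in blocks of length
    [m], its decay constants are summable, and the remainder is sent to 0 by the operator bound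
    [rho]. *)
Lemma wiener_iter : exists2 B', 0 <= B' &
  forall u z, cabs (inner (S (tfa u g)) (tfa z g)) <= B' * jw (F u z) `^ (- s).
Proof.
have [m [m0 [N N0' [hN kN]]]] := Bd_small; have /andP[r0 r1] := rho01.
pose Sg := \sum_(i < m) Nr i.
have Sg0 : 0 <= Sg by apply: sumr_ge0.
exists (c1 * kL * (2 * Sg)); first by apply: mulr_ge0; [apply: mulr_ge0 => //; exact: ltW|exact: mulr_ge0].
(* Every exponent is [m * j + r]: the crude constant accounts for [r], and each of the [j] blocks
   contributes a factor one half. *)
have hB j r : Bd (m * j + r) (Nr r * 2^-1 ^+ j).
  elim: j => [|j IH] z; first by rewrite muln0 expr0 mulr1; exact: Bd_Nr.
  rewrite mulnS -addnA; have p : 0 <= Nr r * 2^-1 ^+ j :> R by rewrite mulr_ge0// exprn_ge0.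
  apply: (loc_le _ (Bd_mul N0' p hN IH z)).
  by rewrite [leLHS]mulrCA exprSr [leRHS]mulrA ler_wpM2l.
move=> u z; set J := jw (F u z) `^ (- s); set f0 := S (tfa u g).
have J0 : 0 <= J by exact: powR_ge0.
(* [2 - 2 * 2^-1 ^+ q] is the sum of the first [q] terms of the geometric series of ratio one
   half. *)
have claim q : cabs (inner f0 (tfa z g)) <= cabs (inner f0 (e (m * q) z)) +
    c1 * kL * J * Sg * (2 - 2 * 2^-1 ^+ q).
  elim: q => [|q IH]; first by rewrite muln0 expr0 mulr1 subrr mulr0 addr0.
  apply: (le_trans IH).
  have := @steps u z (m * q) (fun i => Nr i * 2^-1 ^+ q) m (fun i => mulr_ge0 (Nr_ge0 i) (exprn_ge0 _ (ltW _))) (fun i _ => hB q i).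
  rewrite -mulr_suml -/Sg -/f0 -/J addnC -mulnS => h.
  have : cabs (inner f0 (e (m * q) z)) <= cabs (inner f0 (e (m * q.+1) z)) + c1 * kL * J * (Sg * 2^-1 ^+ q).
    by apply: h; rewrite ?invr_gt0.
  rewrite -(lerD2r (c1 * kL * J * Sg * (2 - 2 * 2^-1 ^+ q))) => /le_trans; apply.
  rewrite -addrA lerD2l exprS.
  by rewrite le_eqVlt; apply/orP; left; apply/eqP; field.
have lf0 := bop_l2 bS (lga u).
(* The remainder is estimated in norm, not in the weight: its coefficient needs to vanish only for
   fixed [u] and [z]. *)
have bnd q : cabs (inner f0 (tfa z g)) <= nrm f0 * nrm g * rho ^+ q + c1 * kL * (2 * Sg) * J.
  apply: (le_trans (claim q)); apply: lerD.
    rewrite (le_trans (inner_le lf0 (le2 _ z)))// -mulrA ler_wpM2l ?nrm_ge0//.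
    rewrite (le_trans (e_nrm _ z))// mulrC ler_wpM2l ?nrm_ge0//.
    by rewrite ler_wiXn2l ?(ltW r0) ?(ltW r1)// leq_pmull.
  rewrite [leRHS](_ : _ = c1 * kL * J * Sg * 2); last by ring.
  apply: ler_wpM2l; last by rewrite gerBl mulr_ge0// exprn_ge0.
  by apply: mulr_ge0 => //; apply: mulr_ge0 => //; apply: mulr_ge0 => //; exact: ltW.
have lim : nrm f0 * nrm g * rho ^+ q + c1 * kL * (2 * Sg) * J @[q --> \oo] -->
    nrm f0 * nrm g * 0 + c1 * kL * (2 * Sg) * J.
  apply: cvgD; last exact: cvg_cst.
  by apply: cvgM; [exact: cvg_cst|apply: cvg_expr; rewrite ger0_norm ?(ltW r0)].
rewrite -[leRHS]add0r -[X in X + _](mulr0 (nrm f0 * nrm g)).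
by apply: (cvgr_to_ge lim); near=> q; exact: bnd.
Unshelve. all: by end_near. Qed.

End Iteration.

Theorem wiener : exists2 B', 0 <= B' &
  forall u z, cabs (inner (S (tfa u g)) (tfa z g)) <= B' * jw (F u z) `^ (- s).
Proof. by have [N N0' hN] := Bd0; exact: (wiener_iter N0' hN). Qed.

End Wiener.

(** * Wave packets *)

Section Packets.
Variables (R : realType) (d : nat).
Local Notation V := 'rV[R]_d.
Local Notation W := 'rV[R]_(d + d).
Local Notation C := R[i].
Local Notation mV := (leb R d).
Local Notation mW := (leb R (d + d)).
Local Notation G := (@gau R d 1).
Variable Phi : W -> R.
Hypothesis tPhi : tame_phase Phi.

Lemma phase_cont a : continuous (pderiv a Phi).
Proof. by have [sm _ _] := tPhi; have [] := sm a. Qed.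

Lemma phase_SB N a : (2 <= size a)%N ->
  exists2 K, 0 <= K & SB N (fun x => ((pderiv a Phi x)%:C)%C : C) (fun=> K).
Proof.
elim: N a => [|N IH] a a2; have [K K0 hK] := phase_bound tPhi a2.
  exists K; first exact: ltW.
  by split=> //; [apply: ccont_real; exact: phase_cont|move=> x; rewrite cabs_real].
have [|i c c' cc' h|c c0 hc] := @fin_bound R ('I_(d + d))
    (fun i c => SB N (fun x => ((pderiv (i :: a) Phi x)%:C)%C : C) (fun=> c)).
- by move=> i; have [K' K'0 h] := IH (i :: a) (ltnW a2); exists K'.
- by apply: (SB_le _ h) => x.
exists (K + c); first by rewrite addr_ge0// ltW.
split; first by apply: ccont_real; exact: phase_cont.
  by move=> x; rewrite cabs_real (le_trans (hK x))// lerDl.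
move=> i; exists (fun x => ((pderiv (i :: a) Phi x)%:C)%C); split.
  by move=> x; apply: isD_real; exact: phase_isD.
by apply: (SB_le _ (hc i)) => x; rewrite lerDr ltW.
Qed.

Lemma phase_shift_cont a (p : W) : ccont (fun x => ((pderiv a Phi (x + p))%:C)%C : C).
Proof.
apply: (ccont_shift p (f := fun y => ((pderiv a Phi y)%:C)%C)).
by apply: ccont_real; exact: phase_cont.
Qed.

Lemma phase_grad_SB N i : exists2 K, 0 <= K & forall p : W,
  SB N (fun x => ((pderiv [:: i] Phi (x + p) - pderiv [:: i] Phi p)%:C)%C : C) (fun x => K * jw x).
Proof.
have [K K0 hK] := phase_bound2 tPhi.
have [|k c c' cc' h|c c0 hc] := @fin_bound R ('I_(d + d))
    (fun k c => SB N (fun x => ((pderiv [:: k; i] Phi x)%:C)%C : C) (fun=> c)).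
- by move=> k; have [K' K'0 h] := @phase_SB N [:: k; i] isT; exists K'.
- by apply: (SB_le _ h) => x.
have n0 : 0 <= (d + d)%:R * K by rewrite mulr_ge0// ltW.
exists ((d + d)%:R * K + c) => [|p]; first exact: addr_ge0.
have cf : ccont (fun x => ((pderiv [:: i] Phi (x + p) - pderiv [:: i] Phi p)%:C)%C : C).
  rewrite (_ : (fun x => _) = fun x => ((pderiv [:: i] Phi (x + p))%:C)%C + (- pderiv [:: i] Phi p)%:C%C).
    by apply: ccontD; [exact: phase_shift_cont|exact: ccont_cst].
  by apply/funext => x; rewrite -rmorphD.
have bf x : cabs ((pderiv [:: i] Phi (x + p) - pderiv [:: i] Phi p)%:C)%C <= ((d + d)%:R * K + c) * jw x.
  rewrite cabs_real (le_trans (@lipschitz_coord R _ (pderiv [:: i] Phi) (fun k => pderiv [:: k; i] Phi) K p (x + p)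
    (fun k x => phase_isD tPhi [:: i] k x) _))//.
  rewrite addrK; apply: ler_pM => //; first by rewrite lerDl.
  by rewrite /jw lerDr.
case: N hc => [hc|N hc]; first by split.
split=> // k; exists (fun x => ((pderiv [:: k; i] Phi (x + p))%:C)%C); split.
  move=> x; have := isD_shift (isD_real (phase_isD tPhi [:: i] k (x + p))).
  move=> /isDB/(_ (isD_cst (((pderiv [:: i] Phi p)%:C)%C) x (ee k))); rewrite subr0.
  by under eq_fun do rewrite -rmorphB/=.
have := SB_shift p (SB_pred (hc k)); apply: SB_le => x.
by rewrite -[leLHS]mulr1; apply: ler_pM => //; [rewrite lerDr|exact: jw_ge1].
Qed.

(** The second-order Taylor remainder of [Phi] at [p], as a function of the displacement. *)
Definition remainder (p x : W) : R := Phi (x + p) - Phi p - dot x (dPhi Phi p).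

Definition theta (p x : W) : C := expi2pi (remainder p x) * gau 1 x.

(** The gradient of the remainder is the increment of [dPhi]; by (A2) it grows at most linearly,
    with bounded higher derivatives, uniformly in [p]. The Gaussian absorbs this growth. *)
Lemma theta_rapid N r : exists2 M, 0 <= M & forall p, rapid N r M (theta p).
Proof.
have [|i c c' cc' h p|c c0 hc] := @fin_bound R ('I_(d + d)) (fun i c => forall p : W,
    SB N (fun x => ((pderiv [:: i] Phi (x + p) - pderiv [:: i] Phi p)%:C)%C : C) (fun x => c * jw x)).
- by move=> i; have [K' K'0 h] := phase_grad_SB N i; exists K'.
- by apply: (SB_le _ (h p)) => x; rewrite ler_wpM2r ?jw_ge0.
pose K := 1 + 2 * pi * c + (2 * pi + 1) : R.
have pi0 : 0 <= (pi : R) := pi_ge0 R.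
have pc0 : 0 <= 2 * pi * c by apply: mulr_ge0; [exact: mulr_ge0|].
have K1 : 1 <= K by rewrite /K -addrA lerDl; lra.
have [M hM] := @rapid_cexp R (d + d) 1 K N 1 r ltr01 K1.
have key p : rapid N r M (theta p).
  pose Q (x : W) : C := I2pi R * ((remainder p x)%:C)%C + ((- (pi * 1 * dot x x))%:C)%C.
  pose Q' i (x : W) : C := I2pi R * ((pderiv [:: i] Phi (x + p) - pderiv [:: i] Phi p)%:C)%C +
    ((- (2 * pi * 1) * dot (ee i) x)%:C)%C.
  have -> : theta p = fun x => cexp (Q x).
    by apply/funext => x; rewrite /theta gauE expi2piE -cexpD.
  apply: (hM Q Q').
  - apply: ccontD; last exact: ccont_gauQ.
    apply: ccontM; first exact: ccont_cst.
    rewrite (_ : (fun x => _) = fun x => ((Phi (x + p))%:C)%C + (- Phi p)%:C%C + (dot x (- dPhi Phi p))%:C%C).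
      apply: ccontD; last by apply: ccont_real; exact: continuous_dot.
      by apply: ccontD; [exact: (phase_shift_cont [::])|exact: ccont_cst].
    by apply/funext => x; rewrite -!rmorphD dotNr.
  - move=> i x; apply: isDD; last exact: isD_gauQ.
    apply: isDZ; apply: isD_real.
    have -> : pderiv [:: i] Phi p = (dPhi Phi p) ord0 i by rewrite mxE.
    apply: is_derive_subR; last exact: is_derive_dot.
    have := is_derive_subR (isD_shift (isD_real (phase_isD tPhi [::] i (x + p)))).1 (is_derive_cst (Phi p) x (ee i)).
    by rewrite subr0.
  - move=> i; have h1 := SB_scale (I2pi R) (hc i p).
    have h2 := @SB_linear R (d + d) N (- (2 * pi * 1)) i.
    have -> : Q' i = fun x => I2pi R * ((pderiv [:: i] Phi (x + p) - pderiv [:: i] Phi p)%:C)%C +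
        ((- (2 * pi * 1) * x ord0 i)%:C)%C.
      by apply/funext => x; rewrite /Q' dot_ee.
    apply: (SB_le _ (SB_add h1 h2)) => x.
    rewrite cabs_I2pi normrN mulr1 ger0_norm ?mulr_ge0// expr1 mulrA -mulrDl ler_wpM2r ?jw_ge0//.
    by rewrite /K; lra.
  - by move=> x; rewrite ReD/= !mul0r mulr0 subrr add0r.
by exists M => //; exact: rapid_ge0 (key 0).
Qed.

Lemma theta_schwartz p : schwartz (theta p).
Proof. by apply: schwartz_of_rapid => N r; have [M _ h] := theta_rapid N r; exists M. Qed.

(* The symbol paired with [sigma] in [<T pi(z) g, pi(u) g>], for the Gaussian [g]. *)
Definition packet (u z t : W) : C :=
  ((mass d 1)%:C)%C * expi2pi (dot (lsubmx z) (rsubmx z)) *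
  (expi2pi (Phi t - dot t (phQ u z)) * gau 1 (t - phP u z)).

Lemma gau_row (x y : V) : gau 1 (row_mx x y) = G x * G y.
Proof.
rewrite /gau /gr -rmorphM -expRD; congr (expR _)%:C%C.
rewrite -opprD -mulrDr; congr (- (_ * _)); rewrite /dot big_split_ord/=.
by congr (_ + _); apply: eq_bigr => i _; rewrite ?row_mxEl ?row_mxEr.
Qed.

Lemma dot_row (t : W) (x y : V) : dot t (row_mx x y) = dot (lsubmx t) x + dot (rsubmx t) y.
Proof.
rewrite /dot big_split_ord/=.
by congr (_ + _); apply: eq_bigr => i _; rewrite ?row_mxEl ?row_mxEr mxE.
Qed.

Lemma fourier_tfa (z : W) (eta : V) : fourier (tfa z G) eta =
  ((mass d 1)%:C)%C * expi2pi (dot (lsubmx z) (rsubmx z - eta)) * G (eta - rsubmx z).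
Proof.
have sG : schwartz G by exact: schwartz_gau.
have mG := schwartz_cmf sG.
have m1 : cmf (fun t => tfa z G t * expi2pi (- dot t eta)).
  by apply: cmf_mul; [exact: cmf_tf|exact: cmf_chi].
rewrite fourierE -(cI_shift (lsubmx z) m1).
rewrite (_ : (fun x => _) = fun x => expi2pi (dot (lsubmx z) (rsubmx z - eta)) *
   (G x * expi2pi (- dot x (eta - rsubmx z)))).
  rewrite cIZ -?fourierE; first rewrite fourier_gau// invr1.
    by move: (expi2pi _) (G _) (_%:C)%C => x y k; ring.
  apply: (cint_dom (b := fun t => cabs (G t))); last by apply: cint_cabs; exact: schwartz_cint.
    by apply: cmf_mul => //; exact: cmf_chi.
  by move=> t; rewrite cabsM cabs_expi2pi mulr1.
apply/funext => x; rewrite /tfa /tf_shift addrK.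
have -> : expi2pi (dot (x + lsubmx z) (rsubmx z)) = expi2pi (dot (lsubmx z) (rsubmx z - eta)) *
    (expi2pi (- dot x (eta - rsubmx z)) * expi2pi (dot (x + lsubmx z) eta)) :> C.
  by rewrite -!expi2piD; congr expi2pi; rewrite !dotDl !dotDr !dotNr; ring.
have := expi2piNl (dot (x + lsubmx z) eta).
move: (expi2pi _) (expi2pi _) (expi2pi _) (G x) (expi2pi _) => A1 A2 A3 A4 A5 h.
transitivity (A1 * (A4 * A2) * (A5 * A3)); first by ring.
rewrite h mulr1; ring.
Qed.

Lemma packetE u z t : expi2pi (Phi t) * conjc (tfa u G (lsubmx t)) * fourier (tfa z G) (rsubmx t) =
  packet u z t.
Proof.
rewrite fourier_tfa /packet /tfa /tf_shift conjcM expi2piJ.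
have -> : conjc (G (lsubmx t - lsubmx u)) = G (lsubmx t - lsubmx u) by exact: conjc_real.
have -> : t - phP u z = row_mx (lsubmx t - lsubmx u) (rsubmx t - rsubmx z).
  by rewrite -{1}[t]hsubmxK /phP opp_row_mx add_row_mx.
rewrite gau_row /phQ dot_row.
have -> : expi2pi (Phi t - (dot (lsubmx t) (rsubmx u) + dot (rsubmx t) (lsubmx z))) =
    expi2pi (Phi t) * expi2pi (- dot (lsubmx t) (rsubmx u)) * expi2pi (- dot (rsubmx t) (lsubmx z)) :> C.
  by rewrite -!expi2piD; congr expi2pi; ring.
have -> : expi2pi (dot (lsubmx z) (rsubmx z - rsubmx t)) =
    expi2pi (dot (lsubmx z) (rsubmx z)) * expi2pi (- dot (rsubmx t) (lsubmx z)) :> C.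
  by rewrite -!expi2piD dotDr dotNr (dotC (rsubmx t)).
move: (expi2pi _) (expi2pi _) (expi2pi _) (expi2pi _) (G _) (G _) (_%:C)%C => a b c e f k l.
by ring.
Qed.

(** Taylor expansion of the phase at the centre [phP u z]: the linear part, minus [phQ u z], is the
    frequency [phF Phi u z], the rest is [theta], and the constants are unimodular up to [mass]. *)
Lemma packet_theta u z t : packet u z t =
  ((mass d 1)%:C)%C * expi2pi (dot (lsubmx z) (rsubmx z) + (Phi (phP u z) - dot (phP u z) (phQ u z))) *
  (expi2pi (dot (t - phP u z) (phF Phi u z)) * theta (phP u z) (t - phP u z)).
Proof.
have e : expi2pi (dot (lsubmx z) (rsubmx z)) * expi2pi (Phi t - dot t (phQ u z)) =
    expi2pi (dot (lsubmx z) (rsubmx z) + (Phi (phP u z) - dot (phP u z) (phQ u z))) *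
    expi2pi (dot (t - phP u z) (phF Phi u z)) * expi2pi (remainder (phP u z) (t - phP u z)) :> C.
  rewrite -!expi2piD; congr expi2pi; rewrite /phF /remainder subrK.
  move: (phP u z) (phQ u z) => p q.
  by rewrite !dotDl !dotDr !dotNr !dotNl; ring.
rewrite /packet /theta; move: e; set a1 := expi2pi _; set a2 := expi2pi _; set a3 := expi2pi _.
set a4 := expi2pi _; set a5 := expi2pi _; move: (gau _ _) (_%:C)%C => y k e.
transitivity (k * (a1 * a2) * y); first by ring.
by rewrite e; ring.
Qed.

Lemma packet_schwartz u z : schwartz (packet u z).
Proof.
rewrite (funext (packet_theta u z)).
apply: schwartzZ.
exact: (schwartz_shift (- phP u z) (schwartz_chi (phF Phi u z) (theta_schwartz (phP u z)))).
Qed.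

(** Once the packet is moved to the origin, the integral is a Fourier transform at
    [zeta - phF Phi u z] of [theta] times a translate of [X]. Their overlap gives the decay in
    position, smoothness the decay in frequency, and [theta_rapid] makes [K] uniform in [u] and
    [z]. *)
Lemma packet_bound N (q : R) : 0 <= q -> exists2 K, 0 <= K &
  forall X M (w zeta : W), rapid N q M X -> cmf X -> forall u z,
  cabs (cI mW (fun t => packet u z t * (expi2pi (- dot t zeta) * X (t - w)))) <=
  K * M * (jw (phP u z - w) `^ (- q) * jw (phF Phi u z - zeta) `^ (- N%:R)).
Proof.
move=> q0; pose r : R := (d + d)%:R + 1.
have hr : (d + d)%:R < r by rewrite ltrDl.
have [M0 M00 hM0] := theta_rapid N (r + q).
have m0 : 0 <= mass d (1 : R) by rewrite ltW// mass_gt0.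
exists (mass d 1 * (2 ^+ N.+1 * jint (d + d) r * (2 ^+ N * M0))).
  by apply: mulr_ge0 => //; apply: mulr_ge0; apply: mulr_ge0; rewrite ?exprn_ge0 ?jint_ge0.
move=> X M w zeta hX mX u z; set p := phP u z; set F := phF Phi u z.
have h1 := rapid_mul_shift (p - w) q0 (hM0 p) hX.
set f := fun t => _ in h1.
have h2 := fourier_decay (zeta - F) hr h1.
have mP := schwartz_cmf (packet_schwartz u z).
have mf : cmf (fun t => packet u z t * (expi2pi (- dot t zeta) * X (t - w))).
  apply: cmf_mul => //; apply: cmf_mul; first exact: cmf_chi.
  exact: (cmf_comp (measurable_rV_shift (- w)) mX).
rewrite -(cI_shift p mf).
pose k : C := ((mass d 1)%:C)%C * expi2pi (dot (lsubmx z) (rsubmx z) + (Phi p - dot p (phQ u z)) + - dot p zeta).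
have -> : (fun t => packet u z (t + p) * (expi2pi (- dot (t + p) zeta) * X (t + p - w))) =
    fun t => k * (f t * expi2pi (- dot t (zeta - F))).
  apply/funext => t; rewrite packet_theta -/p -/F addrK /k /f -[t + p - w]addrA.
  have -> : - dot (t + p) zeta = - dot t zeta - dot p zeta by rewrite dotDl opprD.
  have -> : - dot t (zeta - F) = - dot t zeta + dot t F by rewrite dotDr dotNr opprD opprK.
  rewrite !expi2piD; move: (expi2pi _) (expi2pi _) (expi2pi _) (expi2pi _) (expi2pi _) (theta _ _) (X _) (_%:C)%C => *.
  by ring.
have icf : cint mW (fun t => f t * expi2pi (- dot t (zeta - F))).
  apply: (cint_dom (b := fun t => cabs (f t))).
  - by apply: cmf_mul; [exact: ccont_cmf (SB_cont h1)|exact: cmf_chi].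
  - by move=> t; rewrite cabsM cabs_expi2pi mulr1.
  - apply: cint_cabs; apply: (rapid_cint hr) => [|t]; first exact: ccont_cmf (SB_cont h1).
    exact: SB_bound h1.
rewrite cIZ// cabsM -fourierE /k cabsM cabs_real cabs_expi2pi mulr1 (ger0_norm m0).
rewrite (jw_distC F zeta).
apply: (le_trans (ler_wpM2l m0 h2)).
move: (jw _ `^ _) (jw _ `^ _) (jint _ _) (mass _ _) (2 ^+ _) (2 ^+ _) => a1 a2 a3 a4 a5 a6.
by rewrite le_eqVlt; apply/orP; left; apply/eqP; ring.
Qed.

End Packets.

Section SymbolClass.
Variables (R : realType) (n : nat).
Local Notation V := 'rV[R]_n.
Local Notation C := R[i].

Lemma japanese_powR (x : V) (s : R) : 0 <= s ->
  japanese x `^ s <= n.+1%:R `^ s * jw x `^ s /\ jw x `^ s <= 2 `^ s * japanese x `^ s.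
Proof.
have j0 := ltW (japanese_gt0 x); move=> s0; split.
  rewrite -powRM ?jw_ge0//; apply: ge0_ler_powR => //; rewrite ?nnegrE//.
    by rewrite mulr_ge0 ?jw_ge0.
  exact: japanese_le.
rewrite -powRM//; apply: ge0_ler_powR => //; rewrite ?nnegrE ?jw_ge0//.
  by rewrite mulr_ge0.
exact: jw_le_japanese.
Qed.

Lemma modulation_jwP (Psi : V -> C) (s : R) (u : (V -> C) -> C) : 0 <= s ->
  modulation_class Psi s u <-> tempered u /\
  exists2 K, 0 <= K & forall z zeta, cabs (stft Psi u z zeta) <= K * jw zeta `^ (- s).
Proof.
move=> s0; have jp (x : V) : 0 < jw x `^ s by exact: jw_powR_gt0.
split; last first.
  move=> [tu [K K0 b]]; split=> //; exists (K * n.+1%:R `^ s) => z zeta.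
  have [h _] := japanese_powR zeta s0; have := b z zeta; rewrite powRN ler_pdivlMr// => h'.
  rewrite (le_trans (ler_wpM2l (cabs_ge0 _) h))// mulrCA mulrC ler_wpM2r ?powR_ge0//.
move=> [tu [K b]]; split=> //.
have K0 : 0 <= K by apply: le_trans (b 0 0); rewrite mulr_ge0 ?cabs_ge0 ?powR_ge0.
exists (2 `^ s * K) => [|z zeta]; first by rewrite mulr_ge0 ?powR_ge0.
rewrite powRN ler_pdivlMr//; have [_ h] := japanese_powR zeta s0.
rewrite (le_trans (ler_wpM2l (cabs_ge0 _) h))// mulrCA ler_wpM2l ?powR_ge0//.
Qed.

Lemma fourier_cint (f : V -> C) : schwartz f -> cint (leb R n) (fourier f).
Proof.
move=> sf; have [M hM] := schwartz_rapid n.+1 n.+1%:R sf.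
have hr : n%:R < n.+1%:R :> R by rewrite ltr_nat.
apply: (rapid_cint hr); first exact: cmf_fourier (schwartz_cmf sf).
by move=> x; exact: fourier_decay hr hM.
Qed.

Lemma parseval (f h : V -> C) : schwartz f -> schwartz h ->
  inner (fourier f) (fourier h) = ((mass n 1 ^+ 2)%:C)%C * inner f h.
Proof.
move=> sf sh; have mf := cmf_fourier (schwartz_cmf sf); have mh := schwartz_cmf sh.
have ich := schwartz_cint sh; have icf := fourier_cint sf.
have m2 : cmf (fun p : V * V => fourier f p.1 * (conjc (h p.2) * expi2pi (dot p.2 p.1))).
  apply: cmf_mul; first exact: (cmf_comp (@measurable_fst _ _ _ _) mf).
  apply: cmf_mul; first exact: (cmf_comp (@measurable_snd _ _ _ _) (cmf_conj mh)).
  by apply: cmf_expi; apply: mf_dot; [exact: measurable_snd|exact: measurable_fst].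
rewrite innerE; transitivity (cI (leb R n) (fun eta => cI (leb R n) (fun t =>
    fourier f eta * (conjc (h t) * expi2pi (dot t eta))))).
  apply: cI_ext => eta; rewrite cIZ.
    congr (_ * _); rewrite fourierE -cI_conj.
      by apply: cI_ext => t; rewrite conjcM expi2piJ opprK.
    apply: (cint_dom (b := fun t => cabs (h t))); last exact: cint_cabs.
      by apply: cmf_mul => //; exact: cmf_chi.
    by move=> t; rewrite cabsM cabs_expi2pi mulr1.
  apply: (cint_dom (b := fun t => cabs (h t))); last exact: cint_cabs.
    apply: cmf_mul; first exact: cmf_conj.
    by apply: cmf_expi; apply: mf_dot => //; exact: measurable_cst.
  by move=> t; rewrite cabsM cabs_expi2pi mulr1 cabsJ.
rewrite (@cI_swap R _ _ _ _ (leb R n) (leb R n)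
  (fun eta t => fourier f eta * (conjc (h t) * expi2pi (dot t eta)))); last first.
  apply: (@cint_prod R _ _ _ _ (leb R n) (leb R n) _ (fun eta t => cabs (fourier f eta) * cabs (h t))
    (fun eta => (\int[leb R n]_t cabs (h t)) * cabs (fourier f eta))) => //.
  - by move=> eta t; rewrite !cabsM cabs_expi2pi mulr1 cabsJ.
  - by move=> eta; apply: rintZ; exact: cint_cabs.
  - by move=> eta; rewrite rIZ 1?mulrC//; exact: cint_cabs.
  - by apply: rintZ; exact: cint_cabs.
rewrite innerE -cIZ; last by apply: cint_inner; exact: schwartz_l2.
apply: cI_ext => t; rewrite mulrA -(fourier_inv sf (schwartz_shift t sf)) mulrC -cIZ.
  by apply: cI_ext => eta; rewrite mulrCA.
apply: (cint_dom (b := fun eta => cabs (fourier f eta))); last exact: cint_cabs.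
  by apply: cmf_mul => //; apply: cmf_expi; apply: mf_dot => //; exact: measurable_cst.
by move=> eta; rewrite cabsM cabs_expi2pi mulr1.
Qed.

Lemma jw_lr_powRN n1 n2 (b : 'rV[R]_(n1 + n2)) (q : R) : 0 <= q ->
  jw (lsubmx b) `^ (- q) * jw (rsubmx b) `^ (- q) <= jw b `^ (- q).
Proof.
move=> q0; rewrite -powRM ?jw_ge0// !powRN lef_pV2 ?posrE ?powR_gt0 ?mulr_gt0 ?jw_gt0//.
by rewrite ge0_ler_powR ?nnegrE ?mulr_ge0 ?jw_ge0// jw_le_lrsub.
Qed.

End SymbolClass.

Section MeasurableKernel.
Context (R : realType) (dx dz : measure_display) (X : measurableType dx) (Z : measurableType dz).

Lemma measurable_fin_family (I : finType) (k : X -> I) (v : I -> Z -> R) :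
  (forall i, measurable [set x | k x = i]) -> (forall i, measurable_fun setT (v i)) ->
  measurable_fun setT (fun p : X * Z => v (k p.1) p.2).
Proof.
move=> mk mv _ Y mY; rewrite setTI.
rewrite (_ : _ @^-1` _ = \big[setU/set0]_(i : I) ([set x | k x = i] `*` (v i @^-1` Y))).
  apply: bigsetU_measurable => i _; apply: measurableX => //.
  by rewrite -[X in measurable X]setTI; exact: mv.
rewrite predeqE => -[x z] /=; rewrite -bigcup_seq; split.
  by move=> Yx; exists (k x) => //=; rewrite mem_index_enum.
by move=> [i _ /= [-> ]].
Qed.

Lemma cmf_fin_family (I : finType) (k : X -> I) (v : I -> Z -> R[i]) :
  (forall i, measurable [set x | k x = i]) -> (forall i, cmf (v i)) ->
  cmf (fun p : X * Z => v (k p.1) p.2).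
Proof.
move=> mk mv; split.
  exact: (measurable_fin_family (v := fun i z => complex.Re (v i z)) mk (fun i => (mv i).1)).
exact: (measurable_fin_family (v := fun i z => complex.Im (v i z)) mk (fun i => (mv i).2)).
Qed.

End MeasurableKernel.

Section Kernel.
Variables (R : realType) (d : nat).
Local Notation V := 'rV[R]_d.
Local Notation W := 'rV[R]_(d + d).
Local Notation C := R[i].
Local Notation mV := (leb R d).
Local Notation mW := (leb R (d + d)).
Local Notation WW := (@pint R (d + d) (d + d)).
Local Notation G := (@gau R d 1).

(** Joint measurability: with the first argument replaced by its grid value, the kernel becomes a
    finite family of functions measurable in the second, and continuity in the first argument gives
    the limit. *)
Lemma cmf_kernel (S : (V -> C) -> V -> C) K g : bounded_op S K -> schwartz g ->
  cmf (fun p : W * W => inner (S (tfa p.1 g)) (tfa p.2 g)).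
Proof.
move=> bS sg; have lga a : l2 (tfa a g) by apply: tf_l2; exact: schwartz_l2.
apply: (cmf_cto (u := fun N (p : W * W) => inner (S (tfa (cval (cell N p.1)) g)) (tfa p.2 g))) => [N|p].
  apply: (cmf_fin_family (k := fun x => cell N x) (v := fun c z => inner (S (tfa (cval c) g)) (tfa z g))).
    exact: measurable_cell.
  by move=> c; apply: cmf_stft; [exact: (bop_l2 bS (lga _)).1|exact: schwartz_cmf].
exact: (cto_tempered_cval (tempered_inner bS (lga p.2)) p.1 sg).
Qed.

Variable Phi : W -> R.
Hypothesis tPhi : tame_phase Phi.

Lemma cmf_packet : cmf (fun p : (W * W) * W => packet Phi p.1.1 p.1.2 p.2).
Proof.
have mPhi : measurable_fun setT Phi by apply: continuous_mf; have [sm _ _] := tPhi; have [] := sm [::].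
have m11 : measurable_fun setT (fun p : (W * W) * W => p.1.1) by exact: (measurableT_comp (@measurable_fst _ _ _ _) (@measurable_fst _ _ _ _)).
have m12 : measurable_fun setT (fun p : (W * W) * W => p.1.2) by exact: (measurableT_comp (@measurable_snd _ _ _ _) (@measurable_fst _ _ _ _)).
have m2 : measurable_fun setT (fun p : (W * W) * W => p.2) by exact: measurable_snd.
apply: cmf_mul.
  apply: cmf_mul; first exact: cmf_cst.
  by apply: cmf_expi; apply: mf_dot; [exact: mf_lsub|exact: mf_rsub].
apply: cmf_mul.
  apply: cmf_expi; apply: measurable_funB.
    by apply: (measurableT_comp mPhi).
  by apply: mf_dot => //; apply: mf_row_mx; [exact: mf_rsub|exact: mf_lsub].
apply: (cmf_comp (f := gau 1)); last exact: schwartz_cmf (schwartz_gau _ ltr01).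
by apply: mf_rVB => //; apply: mf_row_mx; [exact: mf_lsub|exact: mf_rsub].
Qed.

Lemma cmf_packet_int (X : W -> C) : cmf X ->
  cmf (fun p : W * W => cI mW (fun t => packet Phi p.1 p.2 t * X t)).
Proof.
move=> mX; apply: (@cmf_cI_param R _ _ _ _ mW (fun p : (W * W) * W => packet Phi p.1.1 p.1.2 p.2 * X p.2)).
by apply: cmf_mul; [exact: cmf_packet|exact: (cmf_comp (@measurable_snd _ _ _ _) mX)].
Qed.

(** [phP u z] and [phQ u z] together list the coordinates of [u] and [z], and
    [phQ = dPhi (phP) - phF]. Confining [phP] near [w] and [phF] near [zeta] thus confines [u] and
    [z]; the exponents come from squaring [jw a * jw c], where [jw c <= (1 + K) * jw a * jw b]. *)
Lemma packet_center : exists2 c, 0 < c & forall w zeta : W, exists uc zc : W, forall u z,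
  jw (u - uc) * jw (z - zc) <= c * (jw (phP u z - w) ^+ 4 * jw (phF Phi u z - zeta) ^+ 2).
Proof.
have [K K0 hK] := dPhi_lip tPhi.
exists ((1 + K) ^+ 2); first by rewrite exprn_gt0// addr_gt0.
move=> w zeta; pose qw := dPhi Phi w - zeta.
exists (row_mx (lsubmx w) (lsubmx qw)), (row_mx (rsubmx qw) (rsubmx w)) => u z.
pose a := phP u z - w; pose b := phF Phi u z - zeta; pose c := phQ u z - qw.
have lP : lsubmx (phP u z) = lsubmx u by rewrite row_mxKl.
have rP : rsubmx (phP u z) = rsubmx z by rewrite row_mxKr.
have lQ : lsubmx (phQ u z) = rsubmx u by rewrite row_mxKl.
have rQ : rsubmx (phQ u z) = lsubmx z by rewrite row_mxKr.
have hc : jw c <= (1 + K) * jw a * jw b.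
  have -> : c = (dPhi Phi (phP u z) - dPhi Phi w) - b.
    by rewrite /c /qw /b /phF opprB opprD !opprK addrACA [RHS]addrC !addrA; apply/rowP => i; rewrite !mxE; ring.
  rewrite -(jwN b); apply: (le_trans (jwD _ _)); rewrite ler_wpM2r ?jw_ge0//.
  rewrite /jw; have := hK (phP u z) w; rewrite -/a; have := normr_ge0 a; nra.
have hu : jw (u - row_mx (lsubmx w) (lsubmx qw)) <= jw a * jw c.
  apply: (le_trans (jw_le_lrsub _)); rewrite lsub_diff rsub_diff row_mxKl row_mxKr -lP -lQ -lsub_diff -lsub_diff.
  by apply: ler_pM; rewrite ?jw_ge0// jw_lsub.
have hz : jw (z - row_mx (rsubmx qw) (rsubmx w)) <= jw c * jw a.
  apply: (le_trans (jw_le_lrsub _)); rewrite lsub_diff [rsubmx (z - _)]rsub_diff row_mxKl row_mxKr -rP -rQ -rsub_diff -rsub_diff.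
  by apply: ler_pM; rewrite ?jw_ge0// jw_rsub.
apply: (le_trans (ler_pM (jw_ge0 _) (jw_ge0 _) hu hz)).
rewrite -/a -/b; have ja := jw_ge0 a; have jb := jw_ge0 b; have jc := jw_ge0 c.
have h : (jw a * jw c) ^+ 2 <= (jw a * ((1 + K) * jw a * jw b)) ^+ 2.
  have h1 : jw a * jw c <= jw a * ((1 + K) * jw a * jw b) by exact: ler_wpM2l.
  have h0 : 0 <= jw a * jw c by exact: mulr_ge0.
  by rewrite ler_pXn2r ?nnegrE// (le_trans h0).
rewrite [leLHS](_ : _ = (jw a * jw c) ^+ 2); last by ring.
by apply: (le_trans h); rewrite le_eqVlt; apply/orP; left; apply/eqP; ring.
Qed.

Let k : R := (d + d)%:R + 1.

(** The exponents are those of [packet_center] multiplied by [k > 2d]. The family is dominated by a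
    product of integrable weights centred at [uc] and [zc], whose integral does not depend on these
    centres. *)
Lemma packet_family_int : exists2 D, 0 <= D & forall (Y : W * W -> C) (A : R) (w zeta : W), cmf Y -> 0 <= A ->
  (forall u z, cabs (Y (u, z)) <= A * (jw (phP u z - w) `^ (- (4 * k)) * jw (phF Phi u z - zeta) `^ (- (2 * k)))) ->
  cint WW Y /\ cabs (cI WW Y) <= D * A.
Proof.
have [c c0 hc] := packet_center.
have k0 : 0 <= k by rewrite addr_ge0.
have hk : (d + d)%:R < k by rewrite ltrDl.
have J0 := @jint_ge0 R (d + d) k.
exists (c `^ k * jint (d + d) k ^+ 2); first by rewrite mulr_ge0 ?powR_ge0 ?exprn_ge0.
move=> Y A w zeta mY A0 hY; have [uc [zc h]] := hc w zeta.
pose B u := c `^ k * A * jw (u - uc) `^ (- k).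
have B0 u : 0 <= B u by rewrite mulr_ge0 ?powR_ge0// mulr_ge0 ?powR_ge0.
have ish (v : W) : rint mW (fun a => jw (a - v) `^ (- k)).
  exact: (@rint_shift R _ (- v) (fun w => jw w `^ (- k)) (rint_decay hk)).
have Ish (v : W) : \int[mW]_a (jw (a - v) `^ (- k)) = jint (d + d) k.
  by rewrite (@rI_shift R _ (- v) (fun z => jw z `^ (- k)))//; exact: measurable_jw_powR.
have le u z : cabs (Y (u, z)) <= B u * jw (z - zc) `^ (- k).
  apply: (le_trans (hY u z)); rewrite /B -[leRHS]mulrA [c `^ k * A]mulrC -[leRHS]mulrA ler_wpM2l//.
  have pw (x : W) (j : nat) : jw x `^ (- (j%:R * k)) = (jw x ^+ j) `^ (- k).
    by rewrite -powR_mulrn ?jw_ge0// -powRrM mulrN.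
  rewrite !pw -!powRM ?mulr_ge0 ?exprn_ge0 ?jw_ge0// !powRN.
  rewrite ler_pdivlMr ?powR_gt0 ?mulr_gt0 ?jw_gt0// mulrC ler_pdivrMr ?powR_gt0 ?mulr_gt0 ?exprn_gt0 ?jw_gt0//.
  rewrite -powRM ?(ltW c0) ?mulr_ge0 ?exprn_ge0 ?jw_ge0//.
  by rewrite ge0_ler_powR ?nnegrE ?mulr_ge0 ?exprn_ge0 ?jw_ge0 ?(ltW c0).
have iz u : rint mW (fun z => B u * jw (z - zc) `^ (- k)) by exact: rintZ.
have iB : rint mW (fun u => jint (d + d) k * B u) by apply: rintZ; exact: rintZ.
have icY : cint WW Y.
  apply: (@cint_prod R _ _ _ _ mW mW Y (fun u z => B u * jw (z - zc) `^ (- k)) (fun u => jint (d + d) k * B u)) => //.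
  by move=> u; rewrite (rIZ _ (ish zc)) Ish mulrC.
split=> //; have [i1 <-] := cI_prod1 icY.
apply: (le_trans (cI_le_dom (b := fun u => jint (d + d) k * B u) (cint_cmf i1) _ iB)).
  move=> u; rewrite mulrC -[X in _ <= _ * X](Ish zc) -(rIZ _ (ish zc)).
  have mYu : cmf (fun z => Y (u, z)).
    exact: (cmf_comp (measurable_fun_pair (measurable_cst u) (@measurable_id _ _ _)) mY).
  exact: (cI_le_dom mYu (le u) (iz u)).
rewrite (rIZ _ (rintZ _ (ish uc))) (rIZ _ (ish uc)) Ish.
by rewrite le_eqVlt; apply/orP; left; apply/eqP; ring.
Qed.

End Kernel.

(** * Symbols *)

Section SymbolKernel.
Variables (R : realType) (d : nat).
Local Notation V := 'rV[R]_d.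
Local Notation W := 'rV[R]_(d + d).
Local Notation C := R[i].
Local Notation mW := (leb R (d + d)).
Local Notation G := (@gau R d 1).
Variables (Phi : W -> R) (Psi : W -> C) (s : R).
Hypotheses (tPhi : tame_phase Phi) (sPsi : schwartz Psi) (s0 : 0 <= s).

Lemma FIO_I_packet (sigma : (W -> C) -> C) u z :
  FIO_I Phi sigma (tfa z G) (tfa u G) = sigma (packet Phi u z).
Proof.
rewrite /FIO_I /pairing; congr sigma; apply/funext => t.
by rewrite conjcM conjcM conjcK expi2piJ opprK packetE.
Qed.

Lemma ex_nat_ge (r : R) : exists N : nat, r <= N%:R.
Proof.
by exists (Num.truncn `|r|).+1; rewrite (le_trans (ler_norm r))// ltW// truncnS_gt.
Qed.

(** [stft_exchange] expands [sigma (packet Phi u z)] over the window. The transform of the packet is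
    concentrated at the position [phP u z] and the frequency [phF Phi u z], that of [sigma] decays
    in frequency, and Peetre's inequality evaluates this decay at the packet's frequency. *)
Lemma symbol_kernel (sigma : (W -> C) -> C) : (exists z, Psi z <> 0) ->
  modulation_class Psi s sigma ->
  exists2 B, 0 <= B & forall u z, cabs (sigma (packet Phi u z)) <= B * jw (phF Phi u z) `^ (- s).
Proof.
move=> Psi0 /(modulation_jwP _ _ s0)[ts [K K0 hK]].
(* [stft] conjugates the shifted window before applying [sigma], whereas [stft_exchange] applies the
   functional to the shift itself: hence the conjugate window, and the opposite frequency in
   [h2]. *)
pose Pc x := conjc (Psi x); have sPc : schwartz Pc by exact: schwartz_conj.
have Pc0 : exists z, Pc z <> 0.
  have [z hz] := Psi0; exists z => h; apply: hz.
  by rewrite -[Psi z]conjcK -/(Pc z) h conjc0.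
have kP := kap_gt0 sPc Pc0.
pose q : R := ((d + d) + (d + d))%:R + 1.
have q0 : 0 <= q by rewrite addr_ge0.
have hq : ((d + d) + (d + d))%:R < q by rewrite ltrDl.
(* Of the [N] orders of decay in frequency, [q] serve integrability and [s] are spent on moving the
   weight of [sigma] to [phF Phi u z]. *)
have [N hN] := ex_nat_ge (q + s).
have [D D0 hD] := packet_bound tPhi N q0.
have [M hM] := schwartz_rapid N q sPsi; have M0 := rapid_ge0 hM.
pose A := D * M * K; have A0 : 0 <= A by do 2 apply: mulr_ge0 => //.
exists ((kap Pc)^-1 * (A * jint ((d + d) + (d + d)) q)).
  by apply: mulr_ge0; [rewrite invr_ge0 ltW|apply: mulr_ge0 => //; exact: jint_ge0].
move=> u z; have [ic e] := stft_exchange ts (packet_schwartz tPhi u z) sPc.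
set p := phP u z in hD *; set F := phF Phi u z.
have ib : rint (leb R ((d + d) + (d + d))) (fun a => A * jw F `^ (- s) * jw (a - row_mx p F) `^ (- q)).
  apply: rintZ; exact: (@rint_shift R _ (- row_mx p F) (fun w => jw w `^ (- q)) (rint_decay hq)).
have : cabs (((kap Pc)%:C)%C * sigma (packet Phi u z)) <= A * jw F `^ (- s) * jint ((d + d) + (d + d)) q.
  have -> : A * jw F `^ (- s) * jint ((d + d) + (d + d)) q =
      \int[leb R ((d + d) + (d + d))]_a (A * jw F `^ (- s) * jw (a - row_mx p F) `^ (- q)).
    rewrite rIZ; last exact: (@rint_shift R _ (- row_mx p F) (fun w => jw w `^ (- q)) (rint_decay hq)).
    by rewrite (@rI_shift R _ (- row_mx p F) (fun z => jw z `^ (- q)))//; exact: measurable_jw_powR.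
  rewrite e; apply: (cI_le_dom (cint_cmf ic) _ ib) => a; rewrite cabsM.
  have h1 : cabs (inner (packet Phi u z) (tfa a Pc)) <=
      D * M * (jw (p - lsubmx a) `^ (- q) * jw (F - rsubmx a) `^ (- N%:R)).
    apply: (le_trans _ (hD Psi M (lsubmx a) (rsubmx a) hM (schwartz_cmf sPsi) u z)).
    rewrite innerE le_eqVlt; apply/orP; left; apply/eqP; congr cabs; apply: cI_ext => t.
    by rewrite /tfa /tf_shift /Pc conjcM conjcK expi2piJ.
  have h2 : cabs (sigma (tfa a Pc)) <= K * jw (rsubmx a) `^ (- s).
    rewrite -jwN; apply: (le_trans _ (hK (lsubmx a) (- rsubmx a))).
    rewrite le_eqVlt; apply/orP; left; apply/eqP; congr cabs; congr sigma.
    by apply/funext => t; rewrite /tfa /tf_shift /Pc conjcM expi2piJ dotNr opprK.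
  apply: (le_trans (ler_pM (cabs_ge0 _) (cabs_ge0 _) h1 h2)).
  have h3 : jw (F - rsubmx a) `^ (- N%:R) * jw (rsubmx a) `^ (- s) <=
      jw F `^ (- s) * jw (rsubmx a - F) `^ (- q).
    have p1 : jw (F - rsubmx a) `^ (- N%:R) <= jw (F - rsubmx a) `^ (- (q + s)).
      by apply: jw_powR_le; rewrite lerN2.
    have p2 : jw (rsubmx a) `^ (- s) <= jw F `^ (- s) * jw (rsubmx a - F) `^ s.
      by have := peetreN F (rsubmx a - F) s0; rewrite [F + _]addrC subrK.
    apply: (le_trans (ler_pM (powR_ge0 _ _) (powR_ge0 _ _) p1 p2)).
    have p3 : jw (rsubmx a - F) `^ (- (q + s)) * jw (rsubmx a - F) `^ s = jw (rsubmx a - F) `^ (- q).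
      have e0 : - (q + s) + s = - q by ring.
      by rewrite -jw_powRD e0.
    rewrite (jw_distC F (rsubmx a)) -p3.
    by move: (jw _ `^ _) (jw _ `^ _) (jw _ `^ _) => x y v; rewrite mulrCA.
  have h4 : jw (p - lsubmx a) `^ (- q) * jw (rsubmx a - F) `^ (- q) <= jw (a - row_mx p F) `^ (- q).
    rewrite jw_distC; have := @jw_lr_powRN R _ _ (a - row_mx p F) q q0.
    have -> : lsubmx (a - row_mx p F) = lsubmx a - p by rewrite linearB/= row_mxKl.
    by have -> : rsubmx (a - row_mx p F) = rsubmx a - F by rewrite linearB/= row_mxKr.
  have h5 := ler_wpM2l (powR_ge0 (jw (p - lsubmx a)) (- q)) h3.
  have h6 := ler_wpM2l (powR_ge0 (jw F) (- s)) h4.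
  move: (jw (p - lsubmx a) `^ _) (jw (F - rsubmx a) `^ _) (jw (rsubmx a) `^ _) (jw F `^ _)
    (jw (rsubmx a - F) `^ _) (jw (a - row_mx p F) `^ _) h5 h6 => x1 x2 x3 x4 x5 x6 h5 h6.
  have h7 : x1 * (x2 * x3) <= x4 * x6 by rewrite (le_trans h5)// mulrCA.
  have := ler_wpM2l A0 h7; rewrite (mulrA A x4) => h8; apply: le_trans h8.
  by rewrite le_eqVlt; apply/orP; left; apply/eqP; rewrite /A; ring.
rewrite cabsM cabs_real gtr0_norm// mulrC -ler_pdivlMr// => /le_trans; apply.
by rewrite le_eqVlt; apply/orP; left; apply/eqP; ring.
Qed.

End SymbolKernel.

Lemma cI_tensor (R : realType) (n m : nat) (A : 'rV[R]_n -> R[i]) (B : 'rV[R]_m -> R[i]) :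
  cint (leb R n) A -> cint (leb R m) B ->
  cI (leb R (n + m)) (fun t => A (lsubmx t) * B (rsubmx t)) = cI (leb R n) A * cI (leb R m) B.
Proof.
move=> iA iB; have [mA mB] := (cint_cmf iA, cint_cmf iB).
have mAB : cmf (fun t : 'rV[R]_(n + m) => A (lsubmx t) * B (rsubmx t)).
  apply: cmf_mul.
    exact: (cmf_comp (mf_lsub (@measurable_id _ _ _)) mA).
  exact: (cmf_comp (mf_rsub (@measurable_id _ _ _)) mB).
rewrite (cI_app mAB).
have -> : (fun p => A (lsubmx (rV_app p)) * B (rsubmx (rV_app p))) = fun p : 'rV[R]_n * 'rV[R]_m => A p.1 * B p.2.
  by apply/funext => p; rewrite /rV_app row_mxKl row_mxKr.
have ic : cint (@pint R n m) (fun p => A p.1 * B p.2).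
  apply: (@cint_prod R _ _ _ _ (leb R n) (leb R m) _ (fun x y => cabs (A x) * cabs (B y))
    (fun x => (\int[leb R m]_y cabs (B y)) * cabs (A x))).
  - apply: cmf_mul; first exact: (cmf_comp (@measurable_fst _ _ _ _) mA).
    exact: (cmf_comp (@measurable_snd _ _ _ _) mB).
  - by move=> x y; rewrite cabsM.
  - by move=> x; apply: rintZ; exact: cint_cabs.
  - by move=> x; rewrite rIZ 1?mulrC//; exact: cint_cabs.
  - by apply: rintZ; exact: cint_cabs.
have [_ <-] := cI_prod1 ic.
rewrite [RHS]mulrC -cIZ//; apply: cI_ext => x /=; rewrite cIZ//.
exact: mulrC.
Qed.

Lemma fourier_l2 (R : realType) (n : nat) (f : 'rV[R]_n -> R[i]) : schwartz f -> l2 (fourier f).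
Proof.
move=> sf; have [M hM] := schwartz_rapid n.+1 n.+1%:R sf.
have hr : n%:R < n.+1%:R :> R by rewrite ltr_nat.
apply: (decay_l2 hr (cmf_fourier (schwartz_cmf sf)) _ (fun x => fourier_decay x hr hM)).1.
apply: mulr_ge0; last exact: rapid_ge0 hM.
by apply: mulr_ge0; [exact: exprn_ge0|exact: jint_ge0].
Qed.

(** * The symbol of the inverse operator *)

Section InverseSymbol.
Variables (R : realType) (d : nat).
Local Notation V := 'rV[R]_d.
Local Notation W := 'rV[R]_(d + d).
Local Notation C := R[i].
Local Notation mV := (leb R d).
Local Notation mW := (leb R (d + d)).
Local Notation WW := (@pint R (d + d) (d + d)).
Local Notation G := (@gau R d 1).
Variables (Phi : W -> R) (s : R) (S : (V -> C) -> V -> C) (K B : R).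
Hypotheses (tPhi : tame_phase Phi) (s0 : 0 <= s) (B0 : 0 <= B).
Hypothesis bS : bounded_op S K.
Hypothesis hS : forall u z, cabs (inner (S (tfa u G)) (tfa z G)) <= B * jw (phF Phi u z) `^ (- s).

Let sG : schwartz G. Proof. exact: schwartz_gau. Qed.
Let lGa a : l2 (tfa a G). Proof. by apply: tf_l2; exact: schwartz_l2. Qed.
Let G0 : exists x, G x <> 0.
Proof. by exists 0; apply/eqP; rewrite /gau gr0; exact: oner_neq0. Qed.
Let kG : 0 < kap G. Proof. exact: kap_gt0. Qed.
Let mass0 : 0 < mass d (1 : R). Proof. exact: mass_gt0. Qed.

Let kernel (X : W -> C) (p : W * W) : C :=
  inner (S (tfa p.1 G)) (tfa p.2 G) * cI mW (fun t => packet Phi p.1 p.2 t * X t).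

(** The normalization undoes two resolutions of the identity, over [u] and over [z], each with
    constant [kap G], and the factor [mass d 1 ^+ 2] of Parseval's identity. *)
Definition inverse_symbol (X : W -> C) : C :=
  (((mass d 1 ^+ 2 * kap G ^+ 2)^-1)%:C)%C * cI WW (kernel X).

Let cmf_kern X : cmf X -> cmf (kernel X).
Proof. by move=> mX; apply: cmf_mul; [exact: cmf_kernel bS sG|exact: cmf_packet_int]. Qed.

(** One estimate for both properties of the symbol: [w = zeta = 0] gives temperedness, and the
    conjugate window as [X] gives the modulation bound. [packet_family_int] consumes [4 k] orders in
    position and [2 k] in frequency; a further [s] orders move the weight of the coefficients from
    [phF Phi u z] to [zeta]. *)
Let shifted_int : exists N : nat, exists2 q : R, 0 <= q & exists2 D, 0 <= D &
  forall X M (w zeta : W), rapid N q M X -> cmf X ->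
    cint WW (kernel (fun t => expi2pi (- dot t zeta) * X (t - w))) /\
    cabs (cI WW (kernel (fun t => expi2pi (- dot t zeta) * X (t - w)))) <= D * M * jw zeta `^ (- s).
Proof.
pose k : R := (d + d)%:R + 1; have k0 : 0 <= k by rewrite addr_ge0.
have [N hN] := ex_nat_ge (2 * k + s); exists N; exists (4 * k); first by rewrite mulr_ge0.
have [L L0 hL] := packet_bound tPhi N (mulr_ge0 (ler0n R 4) k0).
have [D D0 hD] := packet_family_int tPhi.
exists (D * (B * L)); first by apply: mulr_ge0 => //; exact: mulr_ge0.
move=> X M w zeta hX mX; have M0 := rapid_ge0 hX.
set Xw := fun t => expi2pi _ * _.
have mXw : cmf Xw.
  by apply: cmf_mul; [exact: cmf_chi|exact: (cmf_comp (measurable_rV_shift (- w)) mX)].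
pose A := B * L * M * jw zeta `^ (- s).
have A0 : 0 <= A by rewrite mulr_ge0 ?powR_ge0//; apply: mulr_ge0 => //; exact: mulr_ge0.
have [|ic le] := hD (kernel Xw) A w zeta (cmf_kern mXw) A0; last first.
  by split=> //; apply: (le_trans le); rewrite le_eqVlt; apply/orP; left; apply/eqP; rewrite /A; ring.
move=> u z; rewrite /kernel cabsM.
apply: (le_trans (ler_pM (cabs_ge0 _) (cabs_ge0 _) (hS u z) (hL X M w zeta hX mX u z))).
set p := phP u z; set F := phF Phi u z.
have p1 : jw (F - zeta) `^ (- N%:R) <= jw (F - zeta) `^ (- (2 * k + s)).
  by apply: jw_powR_le; rewrite lerN2.
have p2 : jw F `^ (- s) <= jw zeta `^ (- s) * jw (F - zeta) `^ s.
  by have := peetreN zeta (F - zeta) s0; rewrite [zeta + _]addrC subrK.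
have h : jw F `^ (- s) * jw (F - zeta) `^ (- N%:R) <= jw zeta `^ (- s) * jw (F - zeta) `^ (- (2 * k)).
  apply: (le_trans (ler_pM (powR_ge0 _ _) (powR_ge0 _ _) p2 p1)).
  rewrite -mulrA -jw_powRD (_ : s + - (2 * k + s) = - (2 * k))//; ring.
have c0 : 0 <= B * L * M * jw (p - w) `^ (- (4 * k)).
  by rewrite mulr_ge0 ?powR_ge0//; apply: mulr_ge0 => //; exact: mulr_ge0.
have := ler_wpM2l c0 h; rewrite /A.
move: (jw F `^ _) (jw (F - zeta) `^ _) (jw (F - zeta) `^ _) (jw zeta `^ _) (jw (p - w) `^ _) => a1 a2 a3 a4 a5 h'.
rewrite [leLHS](_ : _ = B * L * M * a5 * (a1 * a3)); last by ring.
by apply: (le_trans h'); rewrite le_eqVlt; apply/orP; left; apply/eqP; ring.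
Qed.

Let kernel_schwartz : exists N : nat, exists2 q : R, 0 <= q & exists2 D, 0 <= D &
  forall X M, rapid N q M X -> cmf X -> cint WW (kernel X) /\ cabs (cI WW (kernel X)) <= D * M.
Proof.
have [N [q q0 [D D0 h]]] := shifted_int; exists N; exists q => //; exists D => // X M hX mX.
have [i le] := h X M 0 0 hX mX.
have e : (fun t : W => expi2pi (- dot t 0) * X (t - 0)) = X.
  apply/funext => t; rewrite subr0.
  have -> : dot t 0 = 0 by rewrite /dot big1// => j _; rewrite mxE mulr0.
  rewrite oppr0 expi2pi0; exact: mul1r.
rewrite e in i le; split=> //; apply: (le_trans le).
by rewrite ler_piMr ?jw_powRN_le1// mulr_ge0// (rapid_ge0 hX).
Qed.

Lemma inverse_symbol_tempered : tempered inverse_symbol.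
Proof.
have [N [q q0 [D D0 h]]] := kernel_schwartz.
have int X : schwartz X -> cint WW (kernel X).
  by move=> sX; have [M hM] := schwartz_rapid N q sX; have [] := h X M hM (schwartz_cmf sX).
set c0 := ((mass d 1 ^+ 2 * kap G ^+ 2)^-1); split.
  move=> a f g sf sg; rewrite /inverse_symbol -/c0.
  have ip X u z : schwartz X -> cint mW (fun t => packet Phi u z t * X t).
    by move=> sX; apply: schwartz_cint; apply: schwartzM => //; exact: packet_schwartz.
  have -> : kernel (fun x => a * f x + g x) = fun p => a * kernel f p + kernel g p.
    apply/funext => -[u z]; rewrite /kernel/=.
    rewrite (_ : (fun t => packet Phi u z t * (a * f t + g t)) =
      fun t => a * (packet Phi u z t * f t) + packet Phi u z t * g t).
      rewrite (cID (cintZ a (ip f u z sf)) (ip g u z sg)) (cIZ a (ip f u z sf)).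
      by move: (inner _ _) (cI _ _) (cI _ _) => x y v; ring.
    by apply/funext => t; move: (packet _ _ _ _) (f t) (g t) => x y v; ring.
  rewrite (cID (cintZ a (int f sf)) (int g sg)) (cIZ a (int f sf)).
  by move: (c0%:C)%C (cI _ _) (cI _ _) => x y v; ring.
have [N2 hN2] := ex_nat_ge q; pose N' := maxn N N2.
exists (`|c0| * D * 2 ^+ N'), N' => f M sf /(schwartz_le_rapid_of sf)[M0 hM].
have hM' : rapid N q (2 ^+ N' * M) f.
  apply: (rapid_sub _ _ (lexx _) hM); first exact: leq_maxl.
  by rewrite (le_trans hN2)// ler_nat leq_maxr.
have [_ le] := h f _ hM' (schwartz_cmf sf).
rewrite /inverse_symbol cabsM cabs_real -/c0 -!mulrA ler_wpM2l//.
Qed.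

Lemma inverse_symbol_modulation (Psi : W -> C) : schwartz Psi -> modulation_class Psi s inverse_symbol.
Proof.
move=> sPsi; apply/(modulation_jwP _ _ s0); split; first exact: inverse_symbol_tempered.
have [N [q q0 [D D0 h]]] := shifted_int.
have sPc := schwartz_conj sPsi; have [M hM] := schwartz_rapid N q sPc.
set c0 := ((mass d 1 ^+ 2 * kap G ^+ 2)^-1).
exists (`|c0| * (D * M)) => [|w zeta].
  by apply: mulr_ge0 => //; apply: mulr_ge0 => //; exact: rapid_ge0 hM.
have [_ le] := h _ _ w zeta hM (schwartz_cmf sPc).
have -> : stft Psi inverse_symbol w zeta =
    inverse_symbol (fun t => expi2pi (- dot t zeta) * conjc (Psi (t - w))).
  rewrite /stft /pairing; congr inverse_symbol; apply/funext => t.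
  by rewrite /tf_shift conjcM expi2piJ.
by rewrite /inverse_symbol cabsM cabs_real -/c0 -mulrA ler_wpM2l.
Qed.

(** On the test function of a type II operator the factor [expi2pi (- Phi t)] cancels the phase of
    the packet. The integral over [t] then factorizes into a coefficient of [f] at [u] and, by
    Parseval, one of [h] at [z]; [stft_synthesis] resums over [z] and [stft_exchange] over [u]. *)
Lemma inverse_symbol_FIO_II (f h : V -> C) : schwartz f -> schwartz h ->
  inner (S f) h = FIO_II Phi inverse_symbol f h.
Proof.
move=> sf sh; have lh := schwartz_l2 sh.
pose k : R := (d + d)%:R + 1; have k0 : 0 <= k by rewrite addr_ge0.
have hk : (d + d)%:R < k by rewrite ltrDl.
have [Mf Mf0 hf] := stft_decay k0 sf sG; have [Mh Mh0 hh] := stft_decay k0 sh sG.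
have hh' z : cabs (inner (tfa z G) h) <= Mh * jw z `^ (- k).
  by rewrite (inner_conj lh (lGa z)) cabsJ.
have iMh : rint mW (fun z => Mh * jw z `^ (- k)) by apply: rintZ; exact: rint_decay.
have iMf : rint mW (fun z => Mf * jw z `^ (- k)) by apply: rintZ; exact: rint_decay.
have hB u z : cabs (inner (S (tfa u G)) (tfa z G)) <= B.
  by apply: (le_trans (hS u z)); rewrite ler_piMr// jw_powRN_le1.
set m2 : C := ((mass d 1 ^+ 2)%:C)%C.
rewrite /FIO_II /pairing.
have -> : (fun x : W => conjc (expi2pi (Phi x) * conjc (f (lsubmx x)) * fourier h (rsubmx x))) =
    fun t => expi2pi (- Phi t) * f (lsubmx t) * conjc (fourier h (rsubmx t)).
  by apply/funext => t; rewrite !conjcM conjcK expi2piJ.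
rewrite /inverse_symbol; set X := fun t => _ * conjc _.
have -> : kernel X = fun p => inner (S (tfa p.1 G)) (tfa p.2 G) *
    (inner f (tfa p.1 G) * (m2 * inner (tfa p.2 G) h)).
  apply/funext => -[u z]; rewrite /kernel/=; congr (_ * _).
  have st : schwartz (tfa z G) by exact: schwartz_tf.
  rewrite -(parseval st sh) [inner f _]innerE [inner (fourier _) _]innerE -cI_tensor.
  - apply: cI_ext => t; rewrite -packetE /X.
    have := expi2piNl (Phi t).
    move: (expi2pi _) (expi2pi _) (conjc (tfa _ _ _)) (conjc (fourier _ _)) (fourier _ _) (f _) => a b x y v w e.
    transitivity (b * a * (w * x * (v * y))); last by rewrite e mul1r.
    by ring.
  - by apply: cint_inner => //; exact: schwartz_l2.
  - by apply: cint_inner; exact: fourier_l2.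
have mK : cmf (fun p : W * W => inner (S (tfa p.1 G)) (tfa p.2 G)) by exact: cmf_kernel bS sG.
have mf : cmf (fun a => inner f (tfa a G)) by apply: cmf_stft; exact: schwartz_cmf.
have mh : cmf (fun a => inner (tfa a G) h) by exact: (cmf_tempered (tempered_inner (bounded_op_id _ _) lh) sG).
have ic : cint WW (fun p => inner (S (tfa p.1 G)) (tfa p.2 G) * (inner f (tfa p.1 G) * (m2 * inner (tfa p.2 G) h))).
  apply: (@cint_prod R _ _ _ _ mW mW _ (fun u z => B * cabs m2 * (Mf * jw u `^ (- k)) * (Mh * jw z `^ (- k)))
    (fun u => B * cabs m2 * (\int[mW]_z (Mh * jw z `^ (- k))) * (Mf * jw u `^ (- k)))).
  - apply: cmf_mul => //; apply: cmf_mul; first exact: (cmf_comp (@measurable_fst _ _ _ _) mf).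
    by apply: cmf_mul; [exact: cmf_cst|exact: (cmf_comp (@measurable_snd _ _ _ _) mh)].
  - move=> u z; rewrite !cabsM.
    rewrite [leRHS](_ : _ = B * (Mf * jw u `^ (- k) * (cabs m2 * (Mh * jw z `^ (- k))))); last by ring.
    apply: ler_pM; rewrite ?cabs_ge0 ?mulr_ge0 ?cabs_ge0//.
    by apply: ler_pM; rewrite ?cabs_ge0 ?mulr_ge0 ?cabs_ge0// ler_wpM2l ?cabs_ge0.
  - by move=> u; apply: rintZ.
  - by move=> u; rewrite (rIZ _ iMh) le_eqVlt; apply/orP; left; apply/eqP; ring.
  - exact: rintZ.
have [_ <-] := cI_prod1 ic.
have inn u : cI mW (fun z => inner (S (tfa u G)) (tfa z G) * (inner f (tfa u G) * (m2 * inner (tfa z G) h))) =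
    (m2 * ((kap G)%:C)%C) * (inner f (tfa u G) * inner (S (tfa u G)) h).
  have lS := bop_l2 bS (lGa u).
  have e := stft_synthesis (bounded_op_id _ _) sG lS lh iMh hh'.
  have i1 : cint mW (fun z => inner (S (tfa u G)) (tfa z G) * inner (tfa z G) h).
    apply: (cint_dom (b := fun z => B * (Mh * jw z `^ (- k)))); last exact: rintZ.
      by apply: cmf_mul => //; apply: cmf_stft; [exact: lS.1|exact: schwartz_cmf].
    by move=> z; rewrite cabsM ler_pM ?cabs_ge0.
  transitivity ((inner f (tfa u G) * m2) * cI mW (fun z => inner (S (tfa u G)) (tfa z G) * inner (tfa z G) h)).
    rewrite -cIZ//; apply: cI_ext => z.
    by move: (inner _ _) (inner _ _) (inner _ _) => a b e'; ring.
  by rewrite -e; move: (inner _ _) (inner _ _) => a b; ring.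
rewrite (cI_ext _ inn).
have [i1 e1] := stft_exchange (tempered_inner bS lh) sf sG.
rewrite (cIZ _ i1) -e1 /m2 -!rmorphM mulrA -rmorphM mulrA -rmorphM/=.
have m1 : mass d (1 : R) != 0 by rewrite gt_eqF.
have k1 : kap G != 0 by rewrite gt_eqF.
have c1 : (mass d 1 ^+ 2 * kap G ^+ 2)^-1 * (mass d 1 ^+ 2 * kap G) * kap G = 1 by field; rewrite m1 k1.
by rewrite c1; exact: esym (mul1r _).
Qed.

End InverseSymbol.

Theorem theorem4p6 (R : realType) (d : nat)
    (Psi : 'rV[R]_(d + d) -> R[i])
    (hPsi : schwartz Psi) (hPsi0 : exists z, Psi z <> 0)
    (s : R) (hs : (2 * d)%:R < s)
    (Phi : 'rV[R]_(d + d) -> R) (hPhi : tame_phase Phi)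
    (sigma : ('rV[R]_(d + d) -> R[i]) -> R[i])
    (hsigma : modulation_class Psi s sigma)
    (T : ('rV[R]_d -> R[i]) -> ('rV[R]_d -> R[i]))
    (hT : L2_extension (FIO_I Phi sigma) T)
    (Tinv : ('rV[R]_d -> R[i]) -> ('rV[R]_d -> R[i]))
    (hTinv : L2_inverse T Tinv) :
  exists tau : ('rV[R]_(d + d) -> R[i]) -> R[i],
    modulation_class Psi s tau /\ L2_extension (FIO_II Phi tau) Tinv.
Proof.
have hs' : (d + d)%:R < s by rewrite addnn -mul2n.
have s0 : 0 <= s by rewrite (le_trans _ (ltW hs')).
have [bT0 hT'] := hT; have [bS0 inv] := hTinv.
have [K bT] := L2_bounded_op bT0; have [K' bS] := L2_bounded_op bS0.
have [B B0 hB] := symbol_kernel hPhi hPsi s0 hPsi0 hsigma.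
pose G := @gau R d 1; have sG : schwartz G by exact: schwartz_gau.
have G0 : exists x, G x <> 0.
  by exists 0; apply/eqP; rewrite /G /gau gr0; exact: oner_neq0.
have kT u z : cabs (inner (T (tfa z G)) (tfa u G)) <= B * jw (phF Phi u z) `^ (- s).
  by rewrite hT' ?FIO_I_packet//; exact: schwartz_tf.
have [c c0 [Fz Fu]] := phF_expansive hPhi; have [L L0 FL] := phF_lip_z hPhi.
have ST f : l2 f -> ae_equal (Tinv (T f)) f by move=> /L2P /inv[].
have TS f : l2 f -> ae_equal (T (Tinv f)) f by move=> /L2P /inv[].
have mF1 z : measurable_fun setT (fun u => phF Phi u z).
  by apply: measurable_phF => //; exact: measurable_cst.
have mF2 u : measurable_fun setT (phF Phi u).
  by apply: measurable_phF => //; exact: measurable_cst.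
have [B' B'0 hB'] := wiener sG G0 bT bS ST TS c0 L0 hs' B0 mF1 mF2 Fz Fu FL kT.
exists (inverse_symbol Phi Tinv); split.
  exact: (inverse_symbol_modulation hPhi s0 B'0 bS hB' hPsi).
by split=> // f h sf sh; exact: (inverse_symbol_FIO_II s0 B'0 bS hB' sf sh).
Qed.
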